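(* Consider a linear electromagnetic-gravitational perturbation of the Kerr-Newman spacetime $\mathbf g_{M,a,Q}$ (as defined in the context). Then its associated complex tensors and gauge-invariant quantities $A,\mathfrak F,\mathfrak B,\mathfrak X$ satisfy the coupled system $$\mathcal T_1(\mathfrak B)=\mathbf M_1[\mathfrak F,\mathfrak X],\qquad \mathcal T_2(\mathfrak F)=\mathbf M_2[A,\mathfrak X,\mathfrak B],\qquad \mathcal T_3(A)=\mathbf M_3[\mathfrak F,\mathfrak X],$$ where $$\begin{aligned}\mathcal T_1(\mathfrak B)=&-{}^c\nabla_3{}^c\nabla_4\mathfrak B+\tfrac12\overline{{}^c\mathcal D}\cdot({}^c\mathcal D\widehat\otimes\mathfrak B)-3\,\overline{\mathrm{tr}X}\,{}^c\nabla_3\mathfrak B-\big(\tfrac32\mathrm{tr}\underline X+\tfrac12\overline{\mathrm{tr}\underline X}\big){}^c\nabla_4\mathfrak B\\&+\big(6H+\overline H+3\overline{\underline H}\big)\cdot{}^c\nabla\mathfrak B+\big(-\tfrac92\mathrm{tr}\underline X\,\overline{\mathrm{tr}X}-4P_{\mathbf F}\overline{P_{\mathbf F}}+9\,\overline{\underline H}\cdot H\big)\mathfrak B,\end{aligned}$$ $$\begin{aligned}\mathcal T_2(\mathfrak F)=&-{}^c\nabla_3{}^c\nabla_4\mathfrak F+\tfrac12{}^c\mathcal D\widehat\otimes(\overline{{}^c\mathcal D}\cdot\mathfrak F)-\big(\tfrac32\overline{\mathrm{tr}X}+\tfrac12\mathrm{tr}X\big){}^c\nabla_3\mathfrak F-\tfrac12\big(\mathrm{tr}\underline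 X+\overline{\mathrm{tr}\underline X}\big){}^c\nabla_4\mathfrak F\\&+\big(4H+\overline H+\underline H\big)\cdot{}^c\nabla\mathfrak F+\big(-\tfrac34\mathrm{tr}\underline X\,\overline{\mathrm{tr}X}-\tfrac14\overline{\mathrm{tr}\underline X}\,\mathrm{tr}X+3\overline P-P+4P_{\mathbf F}\overline{P_{\mathbf F}}-\tfrac32\overline{{}^c\mathcal D}\cdot H\big)\mathfrak F\\&+\tfrac12\underline H\widehat\otimes(\overline H\cdot\mathfrak F),\end{aligned}$$ $$\begin{aligned}\mathcal T_3(A)=&-{}^c\nabla_4{}^c\nabla_3A+\tfrac12{}^c\mathcal D\widehat\otimes(\overline{{}^c\mathcal D}\cdot A)-\big(\tfrac12\mathrm{tr}X+2\overline{\mathrm{tr}X}\big){}^c\nabla_3A-\tfrac12\mathrm{tr}\underline X\,{}^c\nabla_4A\\&+\big(4H+\underline H+\overline{\underline H}\big)\cdot\nabla A+\big(-\overline{\mathrm{tr}X}\,\mathrm{tr}\underline X+2\overline P-2P_{\mathbf F}\overline{P_{\mathbf F}}\big)A+2H\widehat\otimes(\overline{\underline H}\cdot A),\end{aligned}$$ in which in $\mathcal T_3$ the first order horizontal derivative is the conformal one ${}^c\nabla A$, and $$\mathbf M_1[\mathfrak F,\mathfrak X]=2P_{\mathbf F}\overline{P_{\mathbf F}}\Big(2\,\overline{{}^c\mathcal D}\cdot\mathfrak F+4\,\overline{\underline H}\cdot\mathfrak F-\big(2\mathrm{tr}\underline X-\overline{\mathrm{tr}\underline X}\big)\mathfrak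 X\Big),$$ $$\mathbf M_2[A,\mathfrak X,\mathfrak B]=-P_{\mathbf F}\Big({}^c\nabla_3A+\tfrac12\big(3\mathrm{tr}\underline X-\overline{\mathrm{tr}\underline X}\big)A\Big)+\big(\tfrac32{}^c\nabla_3H\big)\widehat\otimes\mathfrak X+\big(2H-\underline H\big)\widehat\otimes\mathfrak B,$$ $$\mathbf M_3[\mathfrak F,\mathfrak X]=2\overline{P_{\mathbf F}}\Big(2\,{}^c\nabla_4\mathfrak F+2\,\overline{\mathrm{tr}X}\,\mathfrak F+(\underline H+H)\widehat\otimes\mathfrak X\Big).$$
   Context: **Formalism.** $(\mathcal M,\mathbf g)$ is a 4-dimensional Lorentzian manifold with Levi-Civita connection $\mathbf D$, a null pair $(e_3,e_4)$ with $\mathbf g(e_3,e_4)=-2$, and an antisymmetric 2-tensor $\mathbf F$. A vector is horizontal if orthogonal to $e_3,e_4$; $(e_a)_{a=1,2}$ is a local orthonormal frame of horizontal vectors, $\in_{ab}$ the horizontal volume form ($\in_{12}=1$, orientation fixed); repeated horizontal indices are summed. $\nabla_a,\nabla_3,\nabla_4$ are the horizontal projections of $\mathbf D_{e_a},\mathbf D_{e_3},\mathbf D_{e_4}$ acting on horizontal tensors. Connection coefficients: $\chi_{ab}=\mathbf g(\mathbf D_ae_4,e_b)$, $\underline\chi_{ab}=\mathbf g(\mathbf D_ae_3,e_b)$, $\eta_a=\frac12\mathbf g(\mathbf D_3e_4,e_a)$, $\underline\eta_a=\frac12\mathbf g(\mathbf D_4e_3,e_a)$, $\xi_a=\frac12\mathbf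 g(\mathbf D_4e_4,e_a)$, $\underline\xi_a=\frac12\mathbf g(\mathbf D_3e_3,e_a)$, $\zeta_a=\frac12\mathbf g(\mathbf D_ae_4,e_3)$, $\omega=\frac14\mathbf g(\mathbf D_4e_4,e_3)$, $\underline\omega=\frac14\mathbf g(\mathbf D_3e_3,e_4)$; $\mathrm{tr}\chi=\delta^{ab}\chi_{ab}$, ${}^{(a)}\mathrm{tr}\chi=\in^{ab}\chi_{ab}$, $\hat\chi$ is the symmetric traceless part of $\chi$; similarly for $\underline\chi$. Electromagnetic components: $(\beta_{\mathbf F})_a=\mathbf F(e_a,e_4)$, $(\underline\beta_{\mathbf F})_a=\mathbf F(e_a,e_3)$, $\rho_{\mathbf F}=\frac12\mathbf F(e_3,e_4)$, $\mathbf F(e_a,e_b)=-\in_{ab}{}^*\rho_{\mathbf F}$. Curvature: $[\mathbf D_\mu,\mathbf D_\nu]f_\gamma=\mathbf R_{\gamma\delta\mu\nu}f^\delta$, $\mathbf W$ is the Weyl tensor, $\alpha_{ab}=\mathbf W(e_4,e_a,e_4,e_b)$, $\underline\alpha_{ab}=\mathbf W(e_3,e_a,e_3,e_b)$, $\beta_a=\frac12\mathbf W(e_a,e_4,e_3,e_4)$, $\underline\beta_a=\frac12\mathbf W(e_a,e_3,e_3,e_4)$, $\rho=\frac14\mathbf W(e_4,e_3,e_4,e_3)$, $\mathbf W(e_a,e_b,e_3,e_4)=2\in_{ab}{}^*\rho$. **Complex notation.** ${}^*f_a=\in_{ab}f_b$, ${}^*u_{ab}=\in_{ac}u_{cb}$.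 $\mathfrak s_1(\mathbb C)$ (resp. $\mathfrak s_2(\mathbb C)$) is the set of $f+i{}^*f$ (resp. $u+i{}^*u$) with $f$ a real horizontal 1-form (resp. $u$ a real horizontal symmetric traceless 2-tensor). $X=\chi+i{}^*\chi$, so $\mathrm{tr}X=\mathrm{tr}\chi-i\,{}^{(a)}\mathrm{tr}\chi$, $\widehat X=\hat\chi+i{}^*\hat\chi$, likewise $\underline X$; $H=\eta+i{}^*\eta$, $\underline H=\underline\eta+i{}^*\underline\eta$, $\Xi=\xi+i{}^*\xi$, $\underline\Xi=\underline\xi+i{}^*\underline\xi$, $Z=\zeta+i{}^*\zeta$, $A=\alpha+i{}^*\alpha$, $B=\beta+i{}^*\beta$, $P=\rho+i{}^*\rho$ (and $\underline A,\underline B$ similarly), $B_{\mathbf F}=\beta_{\mathbf F}+i{}^*\beta_{\mathbf F}$, $\underline B_{\mathbf F}=\underline\beta_{\mathbf F}+i{}^*\underline\beta_{\mathbf F}$, $P_{\mathbf F}=\rho_{\mathbf F}+i{}^*\rho_{\mathbf F}$. Products are complex bilinear: $F\cdot G=F_aG_a$, $(F\widehat\otimes G)_{ab}=\frac12(F_aG_b+F_bG_a-\delta_{ab}F\cdot G)$, $(F\cdot U)_a=F_bU_{ab}$, $F\cdot\nabla\Psi=F_a\nabla_a\Psi$. $\mathcal D=\nabla+i{}^*\nabla$, $\overline{\mathcal D}=\nabla-i{}^*\nabla$ with ${}^*\nabla_a=\in_{ab}\nabla_b$; $(\mathcal D\widehat\otimes F)_{ab}=\frac12(\mathcal D_aF_b+\mathcal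 D_bF_a-\delta_{ab}\mathcal D\cdot F)$, $\overline{\mathcal D}\cdot F=\overline{\mathcal D}_aF_a$, $(\overline{\mathcal D}\cdot U)_a=\overline{\mathcal D}_bU_{ab}$. **Conformal derivatives.** A horizontal tensor has conformal type $s$ if it is multiplied by $\lambda^s$ under $e_4\to\lambda e_4$, $e_3\to\lambda^{-1}e_3$. On type $s$: ${}^c\nabla_3=\nabla_3-2s\underline\omega$, ${}^c\nabla_4=\nabla_4+2s\omega$, ${}^c\nabla_a=\nabla_a+s\zeta_a$, ${}^c\mathcal D=\mathcal D+sZ$, $\overline{{}^c\mathcal D}=\overline{\mathcal D}+s\overline Z$; results of ${}^c\nabla_3,{}^c\nabla_4,{}^c\nabla_a$ have types $s-1,s+1,s$. Types: $A,\Xi$: 2; $\mathrm{tr}X,\widehat X,B,B_{\mathbf F}$: 1; $H,\underline H,P,P_{\mathbf F}$: 0; $\underline X,\underline B,\underline B_{\mathbf F}$: $-1$; $\underline A,\underline\Xi$: $-2$. **Kerr-Newman.** For $\sqrt{a^2+Q^2}<M$, in coordinates $(t,r,\theta,\varphi)$, with $\Delta=r^2-2Mr+a^2+Q^2$, $q=r+ia\cos\theta$, $|q|^2=r^2+a^2\cos^2\theta$, $$\mathbf g_{M,a,Q}=-\tfrac{\Delta}{|q|^2}(dt-a\sin^2\theta d\varphi)^2+\tfrac{|q|^2}{\Delta}dr^2+|q|^2d\theta^2+\tfrac{\sin^2\theta}{|q|^2}(a\,dt-(r^2+a^2)d\varphi)^2.$$ Principal null frame: $e_4=\frac{r^2+a^2}{\Delta}\partial_t+\partial_r+\frac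 a\Delta\partial_\varphi$, $e_3=\frac{r^2+a^2}{|q|^2}\partial_t-\frac{\Delta}{|q|^2}\partial_r+\frac{a}{|q|^2}\partial_\varphi$, $e_1=\frac1{|q|}\partial_\theta$, $e_2=\frac{a\sin\theta}{|q|}\partial_t+\frac{1}{|q|\sin\theta}\partial_\varphi$. In it $\widehat X,\underline{\widehat X},\Xi,\underline\Xi,A,B,\underline B,\underline A,B_{\mathbf F},\underline B_{\mathbf F}$ vanish, and $\mathrm{tr}X=\frac2q$, $\mathrm{tr}\underline X=-\frac{2\Delta}{q\overline q^2}$, $H_1=\frac{ai\sin\theta\,q}{|q|^3}$, $\underline H=-Z$, $Z_1=\frac{ai\sin\theta\,\overline q}{|q|^3}$, $P_{\mathbf F}=\frac{Q}{\overline q^2}$, $P=-\frac{2M}{q^3}+\frac{2Q^2}{q^3\overline q}$, $\omega=0$. **Linear perturbations.** A linear electromagnetic-gravitational perturbation of Kerr-Newman is a solution, with a null frame, of the Einstein-Maxwell equations $\mathbf R_{\mu\nu}=2\mathbf F_{\mu\lambda}\mathbf F_\nu{}^\lambda-\frac12\mathbf g_{\mu\nu}\mathbf F^{\alpha\beta}\mathbf F_{\alpha\beta}$, $\mathbf D_{[\mu}\mathbf F_{\nu\lambda]}=0$, $\mathbf D^\mu\mathbf F_{\mu\nu}=0$, in which expressions quadratic in the quantities vanishing in Kerr-Newman ($\widehat X,\underline{\widehat X},\Xi,\underline\Xi,A,B,\underline B,\underline A,B_{\mathbf F},\underline B_{\mathbf F}$, and their derivatives) are neglected: all equalities are modulo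 such quadratic expressions; coefficients multiplying one of these quantities may thus be evaluated in the Kerr-Newman background. **Gauge-invariant quantities.** $A$ (type 2), $\mathfrak F=-\frac12{}^c\mathcal D\widehat\otimes B_{\mathbf F}-\frac32H\widehat\otimes B_{\mathbf F}+P_{\mathbf F}\widehat X\in\mathfrak s_2(\mathbb C)$ (type 1), $\mathfrak B=2P_{\mathbf F}B-3\overline PB_{\mathbf F}\in\mathfrak s_1(\mathbb C)$ (type 1), $\mathfrak X={}^c\nabla_4B_{\mathbf F}+\frac32\overline{\mathrm{tr}X}B_{\mathbf F}-2P_{\mathbf F}\Xi\in\mathfrak s_1(\mathbb C)$ (type 2). *)

(* Defs.v *)
From HB Require Import structures.
From mathcomp Require Import all_boot all_order all_algebra.
From mathcomp Require Import all_classical all_reals all_analysis.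
From mathcomp Require Import complex.

Set Implicit Arguments.
Unset Strict Implicit.
Unset Printing Implicit Defensive.

Import Order.TTheory GRing.Theory Num.Theory.
Import numFieldNormedType.Exports.
Local Open Scope classical_set_scope.
Local Open Scope ring_scope.
Local Open Scope complex_scope.

Section Smoothness.
Context {R : realType} {V : normedModType R}.

Fixpoint iter_derive (vs : seq V) (f : V -> R) : V -> R :=
  if vs is v :: vs' then 'D_v (iter_derive vs' f) else f.

(* On a finite-dimensional V and an open O this is C^infinity on O. *)
Definition smooth_on (O : set V) (f : V -> R) : Prop :=
  forall (vs : seq V) (x : V), O x ->
    {for x, continuous (iter_derive vs f)} /\
    forall v : V, derivable (iter_derive vs f) x v.

End Smoothness.

(* Everything takes place in one coordinate chart: points and vectors are rows
   of R^4, the coordinates being (t, r, theta, phi). *)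
Notation pt R := 'rV[R]_4.
Notation vfield R := (pt R -> 'rV[R]_4).

Section Riemannian.
Context {R : realType}.
Implicit Types (g F : pt R -> 'M[R]_4) (X Y : vfield R) (x : pt R).
Implicit Types (i j k l m : 'I_4).

Definition partial i (f : pt R -> R) : pt R -> R := 'D_(delta_mx 0 i) f.

(* Gamma^k_{ij} *)
Definition christoffel g k i j x : R :=
  2^-1 * \sum_l invmx (g x) k l *
    (partial i (fun y => g y j l) x + partial j (fun y => g y i l) x
     - partial l (fun y => g y i j) x).

Definition covD g X Y : vfield R := fun x =>
  \row_k \sum_i X x 0 i *
    (partial i (fun y => Y y 0 k) x + \sum_j christoffel g k i j x * Y x 0 j).

(* R^k_{l i j}, normalised by [D_i, D_j] f^k = R^k_{l i j} f^l *)
Definition riemann_up g k l i j x : R :=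
  partial i (christoffel g k j l) x - partial j (christoffel g k i l) x
  + \sum_m (christoffel g k i m x * christoffel g m j l x
            - christoffel g k j m x * christoffel g m i l x).

Definition riemann g k l i j x : R :=
  \sum_m g x k m * riemann_up g m l i j x.

Definition ricci g i j x : R := \sum_k riemann_up g k i k j x.

Definition scalar_curvature g x : R :=
  \sum_i \sum_j invmx (g x) i j * ricci g i j x.

Definition weyl g k l i j x : R :=
  riemann g k l i j x
  - 2^-1 * (g x k i * ricci g l j x - g x k j * ricci g l i x
            + g x l j * ricci g k i x - g x l i * ricci g k j x)
  + 6^-1 * scalar_curvature g x * (g x k i * g x l j - g x k j * g x l i).

Definition bilin (b : 'M[R]_4) (u v : 'rV[R]_4) : R :=
  \sum_i \sum_j b i j * u 0 i * v 0 j.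

Definition weyl_on g (X Y Z T : vfield R) x : R :=
  \sum_k \sum_l \sum_i \sum_j
    weyl g k l i j x * X x 0 k * Y x 0 l * Z x 0 i * T x 0 j.

(* D_k F_{ij} *)
Definition covD_form g F k i j x : R :=
  partial k (fun y => F y i j) x
  - \sum_m christoffel g m k i x * F x m j
  - \sum_m christoffel g m k j x * F x i m.

(* Both sides of the Einstein-Maxwell equations, subtracted; for an
   antisymmetric F the cyclic sum is 3 D_[k F_ij]. *)
Definition einstein_defect g F i j x : R :=
  ricci g i j x
  - (2 * (\sum_k \sum_l invmx (g x) k l * F x i k * F x j l)
     - 2^-1 * g x i j *
       (\sum_k \sum_l \sum_m \sum_n
          invmx (g x) k m * invmx (g x) l n * F x k l * F x m n)).

Definition bianchi_defect g F k i j x : R :=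
  covD_form g F k i j x + covD_form g F i j k x + covD_form g F j k i x.

Definition divergence_defect g F j x : R :=
  \sum_i \sum_k invmx (g x) i k * covD_form g F k i j x.

End Riemannian.

(* [eh] is the oriented orthonormal horizontal frame (e_1, e_2), indexed
   from 0; [Fem] is the electromagnetic tensor. *)
Record spacetime (R : realType) := Spacetime {
  metric : pt R -> 'M[R]_4;
  e3 : vfield R;
  e4 : vfield R;
  eh : 'I_2 -> vfield R;
  Fem : pt R -> 'M[R]_4
}.

Section Formalism.
Context {R : realType}.
Implicit Types (S : spacetime R) (X : vfield R) (x : pt R) (a b c : 'I_2).

Local Notation C := R[i].

Definition gdot S X Y x : R := bilin (metric S x) (X x) (Y x).

Definition null_frame S x : Prop :=
  [/\ gdot S (e3 S) (e4 S) x = -2,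
      gdot S (e3 S) (e3 S) x = 0 /\ gdot S (e4 S) (e4 S) x = 0,
      forall a, gdot S (eh S a) (e3 S) x = 0 /\ gdot S (eh S a) (e4 S) x = 0 &
      forall a b, gdot S (eh S a) (eh S b) x = (a == b)%:R].

Definition hvol a b : R := (a < b)%N%:R - (b < a)%N%:R.

Definition chi S x : 'M[R]_2 :=
  \matrix_(a, b) gdot S (covD (metric S) (eh S a) (e4 S)) (eh S b) x.
Definition chib S x : 'M[R]_2 :=
  \matrix_(a, b) gdot S (covD (metric S) (eh S a) (e3 S)) (eh S b) x.
Definition eta S x : 'rV[R]_2 :=
  \row_a (2^-1 * gdot S (covD (metric S) (e3 S) (e4 S)) (eh S a) x).
Definition etab S x : 'rV[R]_2 :=
  \row_a (2^-1 * gdot S (covD (metric S) (e4 S) (e3 S)) (eh S a) x).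
Definition xi S x : 'rV[R]_2 :=
  \row_a (2^-1 * gdot S (covD (metric S) (e4 S) (e4 S)) (eh S a) x).
Definition zeta S x : 'rV[R]_2 :=
  \row_a (2^-1 * gdot S (covD (metric S) (eh S a) (e4 S)) (e3 S) x).
Definition omega S x : R :=
  4^-1 * gdot S (covD (metric S) (e4 S) (e4 S)) (e3 S) x.
Definition omegab S x : R :=
  4^-1 * gdot S (covD (metric S) (e3 S) (e3 S)) (e4 S) x.

Definition atr (u : 'M[R]_2) : R := \sum_a \sum_b hvol a b * u a b.
Definition symtraceless (u : 'M[R]_2) : 'M[R]_2 :=
  2^-1 *: (u + u^T - (\tr u)%:M).

Definition Fdot S X Y x : R := bilin (Fem S x) (X x) (Y x).
Definition beta_F S x : 'rV[R]_2 := \row_a Fdot S (eh S a) (e4 S) x.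
Definition betab_F S x : 'rV[R]_2 := \row_a Fdot S (eh S a) (e3 S) x.
Definition rho_F S x : R := 2^-1 * Fdot S (e3 S) (e4 S) x.
Definition rhod_F S x : R := - Fdot S (eh S 0) (eh S 1) x.

Definition alpha S x : 'M[R]_2 :=
  \matrix_(a, b) weyl_on (metric S) (e4 S) (eh S a) (e4 S) (eh S b) x.
Definition beta S x : 'rV[R]_2 :=
  \row_a (2^-1 * weyl_on (metric S) (eh S a) (e4 S) (e3 S) (e4 S) x).
Definition rho S x : R :=
  4^-1 * weyl_on (metric S) (e4 S) (e3 S) (e4 S) (e3 S) x.
Definition rhod S x : R :=
  2^-1 * weyl_on (metric S) (eh S 0) (eh S 1) (e3 S) (e4 S) x.

(* Horizontal one-forms are rows and horizontal two-tensors are matrices,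
   both given by their components in the frame (e_1, e_2). [cplx1 f] is
   f + i *f and [cplx2 u] is u + i *u. *)

Definition cplx1 (f : 'rV[R]_2) : 'rV[C]_2 :=
  \row_a (f 0 a +i* \sum_b hvol a b * f 0 b).
Definition cplx2 (u : 'M[R]_2) : 'M[C]_2 :=
  \matrix_(a, b) (u a b +i* \sum_c hvol a c * u c b).

Definition trX S x : C := \tr (chi S x) -i* atr (chi S x).
Definition trXb S x : C := \tr (chib S x) -i* atr (chib S x).
Definition Xhat S x := cplx2 (symtraceless (chi S x)).
Definition H S x := cplx1 (eta S x).
Definition Hb S x := cplx1 (etab S x).
Definition Xi S x := cplx1 (xi S x).
Definition A S x := cplx2 (alpha S x).
Definition B S x := cplx1 (beta S x).
Definition P S x : C := rho S x +i* rhod S x.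
Definition B_F S x := cplx1 (beta_F S x).
Definition P_F S x : C := rho_F S x +i* rhod_F S x.

Definition cj1 (f : 'rV[C]_2) : 'rV[C]_2 := map_mx (@conjc R) f.

Definition dot (f h : 'rV[C]_2) : C := \sum_a f 0 a * h 0 a.
Definition hotimes (f h : 'rV[C]_2) : 'M[C]_2 :=
  \matrix_(a, b)
    (2^-1 * (f 0 a * h 0 b + f 0 b * h 0 a - (a == b)%:R * dot f h)).
Definition dot2 (f : 'rV[C]_2) (u : 'M[C]_2) : 'rV[C]_2 :=
  \row_a \sum_b f 0 b * u a b.

Definition dirC X (f : pt R -> C) x : C :=
  (\sum_i X x 0 i * partial i (fun y => complex.Re (f y)) x) +i*
  (\sum_i X x 0 i * partial i (fun y => complex.Im (f y)) x).

(* g(D_X e_a, e_b): the horizontal part of D_X e_a is its sum over b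
   against e_b *)
Definition hconn S X a b x : C :=
  (gdot S (covD (metric S) X (eh S a)) (eh S b) x)%:C.

Definition nabla1 S X (f : pt R -> 'rV[C]_2) x : 'rV[C]_2 :=
  \row_a (dirC X (fun y => f y 0 a) x - \sum_b hconn S X a b x * f x 0 b).
Definition nabla2 S X (u : pt R -> 'M[C]_2) x : 'M[C]_2 :=
  \matrix_(a, b) (dirC X (fun y => u y a b) x
    - \sum_c hconn S X a c x * u x c b - \sum_c hconn S X b c x * u x a c).

(* The integer s is the conformal type of the differentiated tensor. *)
Definition cnabla3_1 S (s : int) (f : pt R -> 'rV[C]_2) x :=
  nabla1 S (e3 S) f x - (2 * s%:~R * omegab S x)%:C *: f x.
Definition cnabla3_2 S (s : int) (u : pt R -> 'M[C]_2) x :=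
  nabla2 S (e3 S) u x - (2 * s%:~R * omegab S x)%:C *: u x.
Definition cnabla4_1 S (s : int) (f : pt R -> 'rV[C]_2) x :=
  nabla1 S (e4 S) f x + (2 * s%:~R * omega S x)%:C *: f x.
Definition cnabla4_2 S (s : int) (u : pt R -> 'M[C]_2) x :=
  nabla2 S (e4 S) u x + (2 * s%:~R * omega S x)%:C *: u x.
Definition cnablah_1 S (s : int) (f : pt R -> 'rV[C]_2) x a :=
  nabla1 S (eh S a) f x + (s%:~R * zeta S x 0 a)%:C *: f x.
Definition cnablah_2 S (s : int) (u : pt R -> 'M[C]_2) x a :=
  nabla2 S (eh S a) u x + (s%:~R * zeta S x 0 a)%:C *: u x.

(* From (nabla_a Psi)_a to ((nabla + i *nabla)_a Psi)_a and its conjugate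
   operator. Applied to the conformal nabla on type s, the zeta terms add up
   to s Z_a and to s times the conjugate of Z_a. *)
Definition calD (V : lmodType C) (n : 'I_2 -> V) a : V :=
  n a + 'i *: \sum_b (hvol a b)%:C *: n b.
Definition calDbar (V : lmodType C) (n : 'I_2 -> V) a : V :=
  n a - 'i *: \sum_b (hvol a b)%:C *: n b.

Definition cD_hotimes S s (f : pt R -> 'rV[C]_2) x : 'M[C]_2 :=
  let D := calD (cnablah_1 S s f x) in
  \matrix_(a, b)
    (2^-1 * (D a 0 b + D b 0 a - (a == b)%:R * \sum_c D c 0 c)).
Definition cDbar_dot1 S s (f : pt R -> 'rV[C]_2) x : C :=
  \sum_a calDbar (cnablah_1 S s f x) a 0 a.
Definition cDbar_dot2 S s (u : pt R -> 'M[C]_2) x : 'rV[C]_2 :=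
  \row_a \sum_b calDbar (cnablah_2 S s u x) b a b.
Definition dot_cnabla1 S s (h : 'rV[C]_2) (f : pt R -> 'rV[C]_2) x :=
  \sum_a h 0 a *: cnablah_1 S s f x a.
Definition dot_cnabla2 S s (h : 'rV[C]_2) (u : pt R -> 'M[C]_2) x :=
  \sum_a h 0 a *: cnablah_2 S s u x a.

(* These have conformal types 1, 1 and 2, in this order. *)
Definition frakF S x : 'M[C]_2 :=
  - 2^-1 *: cD_hotimes S 1 (B_F S) x - (3 / 2) *: hotimes (H S x) (B_F S x)
  + P_F S x *: Xhat S x.
Definition frakB S x : 'rV[C]_2 :=
  (2 * P_F S x) *: B S x - (3 * (P S x)^*) *: B_F S x.
Definition frakX S x : 'rV[C]_2 :=
  cnabla4_1 S 1 (B_F S) x + (3 / 2 * (trX S x)^*) *: B_F S x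
  - (2 * P_F S x) *: Xi S x.

Definition T1 S (f : pt R -> 'rV[C]_2) x : 'rV[C]_2 :=
  - cnabla3_1 S 2 (cnabla4_1 S 1 f) x
  + 2^-1 *: cDbar_dot2 S 1 (cD_hotimes S 1 f) x
  - (3 * (trX S x)^*) *: cnabla3_1 S 1 f x
  - (3 / 2 * trXb S x + 1 / 2 * (trXb S x)^*) *: cnabla4_1 S 1 f x
  + dot_cnabla1 S 1 (6 *: H S x + cj1 (H S x) + 3 *: cj1 (Hb S x)) f x
  + (- (9 / 2) * trXb S x * (trX S x)^* - 4 * P_F S x * (P_F S x)^*
     + 9 * dot (cj1 (Hb S x)) (H S x)) *: f x.

Definition T2 S (u : pt R -> 'M[C]_2) x : 'M[C]_2 :=
  - cnabla3_2 S 2 (cnabla4_2 S 1 u) x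
  + 2^-1 *: cD_hotimes S 1 (cDbar_dot2 S 1 u) x
  - (3 / 2 * (trX S x)^* + 1 / 2 * trX S x) *: cnabla3_2 S 1 u x
  - (1 / 2 * (trXb S x + (trXb S x)^*)) *: cnabla4_2 S 1 u x
  + dot_cnabla2 S 1 (4 *: H S x + cj1 (H S x) + Hb S x) u x
  + (- (3 / 4) * trXb S x * (trX S x)^* - 1 / 4 * (trXb S x)^* * trX S x
     + 3 * (P S x)^* - P S x + 4 * P_F S x * (P_F S x)^*
     - 3 / 2 * cDbar_dot1 S 0 (H S) x) *: u x
  + 2^-1 *: hotimes (Hb S x) (dot2 (cj1 (H S x)) (u x)).

Definition T3 S (u : pt R -> 'M[C]_2) x : 'M[C]_2 :=
  - cnabla4_2 S 1 (cnabla3_2 S 2 u) x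
  + 2^-1 *: cD_hotimes S 2 (cDbar_dot2 S 2 u) x
  - (1 / 2 * trX S x + 2 * (trX S x)^*) *: cnabla3_2 S 2 u x
  - (1 / 2 * trXb S x) *: cnabla4_2 S 2 u x
  + dot_cnabla2 S 2 (4 *: H S x + Hb S x + cj1 (Hb S x)) u x
  + (- (trX S x)^* * trXb S x + 2 * (P S x)^*
     - 2 * P_F S x * (P_F S x)^*) *: u x
  + 2 *: hotimes (H S x) (dot2 (cj1 (Hb S x)) (u x)).

Definition M1 S (u : pt R -> 'M[C]_2) (f : pt R -> 'rV[C]_2) x : 'rV[C]_2 :=
  (2 * P_F S x * (P_F S x)^*) *:
    (2 *: cDbar_dot2 S 1 u x + 4 *: dot2 (cj1 (Hb S x)) (u x)
     - (2 * trXb S x - (trXb S x)^*) *: f x).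

Definition M2 S (u : pt R -> 'M[C]_2) (f h : pt R -> 'rV[C]_2) x : 'M[C]_2 :=
  - P_F S x *: (cnabla3_2 S 2 u x
                + (1 / 2 * (3 * trXb S x - (trXb S x)^*)) *: u x)
  + hotimes ((3 / 2) *: cnabla3_1 S 0 (H S) x) (f x)
  + hotimes (2 *: H S x - Hb S x) (h x).

Definition M3 S (u : pt R -> 'M[C]_2) (f : pt R -> 'rV[C]_2) x : 'M[C]_2 :=
  (2 * (P_F S x)^*) *:
    (2 *: cnabla4_2 S 1 u x + (2 * (trX S x)^*) *: u x
     + hotimes (Hb S x + H S x) (f x)).

End Formalism.

Section KerrNewman.
Context {R : realType}.
Context (M a Q : R).
Implicit Types x : pt R.

Local Notation r x := (x 0 1).
Local Notation theta x := (x 0 2).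

Definition row4 (c0 c1 c2 c3 : R) : 'rV[R]_4 :=
  \row_j nth 0 [:: c0; c1; c2; c3] j.

Definition kn_Delta x : R := r x ^+ 2 - 2 * M * r x + a ^+ 2 + Q ^+ 2.
Definition kn_q x : R[i] := r x +i* (a * cos (theta x)).
Definition kn_q2 x : R := r x ^+ 2 + a ^+ 2 * cos (theta x) ^+ 2.
Definition kn_absq x : R := Num.sqrt (kn_q2 x).

(* The points at which the coordinates and the principal null frame are
   regular; this contains the exterior region. *)
Definition kn_domain : set (pt R) :=
  [set x : pt R | [/\ 0 < theta x < pi, kn_Delta x != 0 & kn_q2 x != 0]].

Definition kn_metric x : 'M[R]_4 :=
  let s1 := row4 1 0 0 (- (a * sin (theta x) ^+ 2)) in
  let dr := row4 0 1 0 0 in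
  let dtheta := row4 0 0 1 0 in
  let s2 := row4 a 0 0 (- (r x ^+ 2 + a ^+ 2)) in
  - (kn_Delta x / kn_q2 x) *: (s1^T *m s1)
  + (kn_q2 x / kn_Delta x) *: (dr^T *m dr)
  + kn_q2 x *: (dtheta^T *m dtheta)
  + (sin (theta x) ^+ 2 / kn_q2 x) *: (s2^T *m s2).

Definition kn_e4 x : 'rV[R]_4 :=
  row4 ((r x ^+ 2 + a ^+ 2) / kn_Delta x) 1 0 (a / kn_Delta x).
Definition kn_e3 x : 'rV[R]_4 :=
  row4 ((r x ^+ 2 + a ^+ 2) / kn_q2 x) (- (kn_Delta x / kn_q2 x)) 0
       (a / kn_q2 x).
Definition kn_e1 x : 'rV[R]_4 := row4 0 0 (kn_absq x)^-1 0.
Definition kn_e2 x : 'rV[R]_4 :=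
  row4 (a * sin (theta x) / kn_absq x) 0 0
       (kn_absq x * sin (theta x))^-1.

(* The electromagnetic tensor is given by its null components. *)
Definition is_kerr_newman (S : spacetime R) x : Prop :=
  [/\ metric S x = kn_metric x,
      e3 S x = kn_e3 x /\ e4 S x = kn_e4 x,
      eh S 0 x = kn_e1 x /\ eh S 1 x = kn_e2 x,
      beta_F S x = 0 /\ betab_F S x = 0 &
      P_F S x = Q%:C / (kn_q x)^* ^+ 2].

End KerrNewman.

Section Perturbation.
Context {R : realType}.

Definition neglected (f : R -> R) : Prop :=
  f =O_ (nbhs (0 : R)) (fun eps : R => eps ^+ 2).

Definition eq_mod_quadratic m n (f h : R -> 'M[R[i]]_(m, n)) : Prop :=
  forall i j,
    neglected (fun eps => complex.Re (f eps i j - h eps i j)) /\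
    neglected (fun eps => complex.Im (f eps i j - h eps i j)).

Definition smooth_family (O : set (R * pt R)) (S : R -> spacetime R) : Prop :=
  [/\ forall i j, smooth_on O (fun p => metric (S p.1) p.2 i j),
      forall i, smooth_on O (fun p => e3 (S p.1) p.2 0 i),
      forall i, smooth_on O (fun p => e4 (S p.1) p.2 0 i),
      forall b i, smooth_on O (fun p => eh (S p.1) b p.2 0 i) &
      forall i j, smooth_on O (fun p => Fem (S p.1) p.2 i j)].

(* A one-parameter family through the Kerr-Newman spacetime which solves the
   Einstein-Maxwell equations modulo O(eps^2). The quantities vanishing in
   Kerr-Newman are O(eps) along it, so their products are O(eps^2). *)
Definition linear_perturbation (M a Q : R) (U : set (pt R)) (eps0 : R)
    (S : R -> spacetime R) : Prop :=
  [/\ smooth_family [set p | `|p.1| < eps0 /\ U p.2] S,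
      forall x, U x -> is_kerr_newman M a Q (S 0) x,
      forall eps x, `|eps| < eps0 -> U x ->
        [/\ (metric (S eps) x)^T = metric (S eps) x,
            (Fem (S eps) x)^T = - Fem (S eps) x &
            null_frame (S eps) x],
      forall x i j, U x ->
        neglected (fun eps =>
          einstein_defect (metric (S eps)) (Fem (S eps)) i j x) &
      forall x, U x ->
        (forall k i j, neglected (fun eps =>
           bianchi_defect (metric (S eps)) (Fem (S eps)) k i j x)) /\
        (forall j, neglected (fun eps =>
           divergence_defect (metric (S eps)) (Fem (S eps)) j x))].

End Perturbation.

(* Main.v *)
Require Import Defs.
From HB Require Import structures.
From mathcomp Require Import all_boot all_order all_algebra.
From mathcomp Require Import all_classical all_reals all_analysis.
From mathcomp Require Import complex ring lra.

Set Implicit Arguments.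
Unset Strict Implicit.
Unset Printing Implicit Defensive.

Import Order.TTheory GRing.Theory Num.Theory.
Import numFieldNormedType.Exports.
Local Open Scope classical_set_scope.
Local Open Scope ring_scope.

(** The claim is an equality of first-order jets in the perturbation parameter, so it is moved into
    commutative algebra. One ring consists of the smooth complex functions of the parameter and the
    point, another of those of the point alone; [ev] restricts to parameter 0, and [delta] takes the
    parameter derivative there. A smooth function is O(eps^2) exactly when both maps kill it
    ([neglected_ev_delta], [ev_delta_neglected]). Such elements form an ideal that contains every
    product of two elements killed by [ev]; this is the precise form of neglecting quadratic
    expressions.

    Geometry is done in the complex null frame (e_3, e_4, m, mb) with m = e_1 + i e_2. An element of
    s_1(C) or s_2(C) has one independent component; on it D-hat-otimes acts as the derivative along
    m, and Dbar-dot as twice the derivative along mb. Tensor equations thus become scalar equations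
    in Newman-Penrose style spin coefficients. The structure, Bianchi and Maxwell equations are
    proved over any commutative ring with commuting derivations ([curv_spin], [bianchi_4mb],
    [bianchi_34m], [max4E], [maxmE]).

    Linearised at Kerr-Newman they yield four equations: two Bianchi identities giving the e_4
    derivative of B and D-hat-otimes B ([lin_D4B], [lin_DmB]), the transport equation of Xhat
    ([lin_D4X]), and, from commuting two Maxwell equations so that the variation of P_F drops out,
    the relation nabla_3 frakX + Dbar.frakF + (1/2) conj(trXb) frakX + conj(H).frakF + 2 frakB = 0
    ([lin_D3X]). Consequently nabla_4 frakB and D-hat-otimes frakB are first order expressions in A
    plus terms in frakB and in frakX or frakF ([eq_D4W], [eq_DmW]), and nabla_4 frakF is a first
    order expression in frakX plus terms in frakF and A ([eq_D4F]).

    Decoupling is then a matter of commuting derivatives. In T1 the second derivatives of A cancel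
    and a multiple of the displayed relation remains ([T1_knE]). In T2 the second derivatives of
    frakX cancel and [eq_DmW] supplies the rest ([T2_knE]). T3 is Teukolsky's argument, which
    commutes the e_4 and m derivatives of B ([T3_knE]). What is left are polynomial identities in
    1/(2q), its conjugate, i a sin(theta)/|q| and cot(theta)/|q|, whose derivatives are known
    ([kn_table]). The background connection comes from the brackets of the principal frame by the
    Koszul formula ([ev_spinE]).

    [nul_T1], [nul_T2] and [nul_T3] assemble this in the ring; the predicates [rep], [rep1] and
    [rep2] carry it back to the functions and tensors of the statement. *)

Section SmoothFunctions.

(** * Closure properties of smooth functions *)

Context {R : realType} {V : normedModType R}.
Implicit Types (O : set V) (f g : V -> R) (v w x : V).

Lemma open_near_eq O f g x : open O -> O x -> {in O, f =1 g} ->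
  {near x, f =1 g}.
Proof.
move=> Oo Ox fg; near=> y; apply: fg; rewrite inE; near: y.
exact: open_nbhs_nbhs.
Unshelve. all: by end_near. Qed.

Lemma iter_derive_eq O f g vs : open O -> {in O, f =1 g} ->
  {in O, iter_derive vs f =1 iter_derive vs g}.
Proof.
move=> Oo fg; elim: vs => //= v vs IH x /[!inE] Ox.
by apply: near_eq_derive; exact: open_near_eq IH.
Qed.

Lemma iter_derive_rcons vs v f :
  iter_derive (rcons vs v) f = iter_derive vs ('D_v f).
Proof. by elim: vs => //= w vs ->. Qed.

Lemma near_eq_continuous f g x : {near x, f =1 g} ->
  {for x, continuous f} -> {for x, continuous g}.
Proof.
move=> fg cf; have e : f x = g x by exact: nbhs_singleton fg.
rewrite /prop_for /continuous_at -e; apply: cvg_trans cf; exact: near_eq_cvg fg.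
Qed.

Definition once_diff O f := forall x, O x ->
  {for x, continuous f} /\ forall v, derivable f x v.

Lemma smooth_onP O f : smooth_on O f <->
  forall vs, once_diff O (iter_derive vs f).
Proof. by split=> H vs x Ox; exact: H. Qed.

Lemma once_diff_eq O f g : open O -> {in O, f =1 g} ->
  once_diff O f -> once_diff O g.
Proof.
move=> Oo fg df x Ox; have n := open_near_eq Oo Ox fg.
have [cf dfx] := df x Ox; split; first exact: near_eq_continuous cf.
by move=> v; exact: near_eq_derivable (dfx v).
Qed.

Lemma smooth_on_eq O f g : open O -> {in O, f =1 g} ->
  smooth_on O f -> smooth_on O g.
Proof.
move=> Oo fg /smooth_onP df; apply/smooth_onP => vs.
by apply: once_diff_eq (df vs) => //; exact: iter_derive_eq.
Qed.

Lemma smooth_on_derive O f v : smooth_on O f -> smooth_on O ('D_v f).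
Proof. by move=> sf vs; rewrite -iter_derive_rcons; exact: sf. Qed.

(** Smoothness concerns all iterated derivatives at once, so it is proved by exhibiting a class of
    functions that are differentiable once and whose derivatives lie again in the class, up to
    equality on [O]. Sums, products and coordinate functions are all treated this way. *)
Lemma smooth_on_class O (P : (V -> R) -> Prop) f : open O ->
  (forall h, P h -> once_diff O h /\
     forall v, exists2 h', P h' & {in O, 'D_v h =1 h'}) ->
  P f -> smooth_on O f.
Proof.
move=> Oo HP Pf; apply/smooth_onP => vs.
suff [h Ph e] : exists2 h, P h & {in O, iter_derive vs f =1 h}.
  apply: once_diff_eq (HP h Ph).1 => // x Ox.
  by rewrite e.
elim: vs => [|v vs [h Ph e]] /=; first by exists f.
have [_ /(_ v)[h' Ph' e']] := HP h Ph.
exists h' => // x /[dup] Ox /[!inE] Ox'; rewrite -e' //.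
by apply: near_eq_derive; exact: open_near_eq e.
Qed.

Lemma once_diff_cst O (c : R) : once_diff O (cst c).
Proof. by move=> x _; split; [exact: cst_continuous | move=> v; exact: derivable_cst]. Qed.

Lemma once_diffD O f g : once_diff O f -> once_diff O g -> once_diff O (f \+ g).
Proof.
move=> df dg x Ox; have [cf dfx] := df x Ox; have [cg dgx] := dg x Ox.
by split; [exact: continuousD | move=> v; exact: derivableD].
Qed.

Lemma once_diffN O f : once_diff O f -> once_diff O (\- f).
Proof.
move=> df x Ox; have [cf dfx] := df x Ox.
by split; [exact: continuousN | move=> v; exact: derivableN].
Qed.

Lemma once_diffM O f g : once_diff O f -> once_diff O g -> once_diff O (f \* g).
Proof.
move=> df dg x Ox; have [cf dfx] := df x Ox; have [cg dgx] := dg x Ox.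
by split; [exact: continuousM | move=> v; exact: derivableM].
Qed.

Lemma smooth_on_once O f : smooth_on O f -> once_diff O f.
Proof. by move=> sf; exact: (sf [::]). Qed.

Lemma smooth_on_cst O (c : R) : open O -> smooth_on O (cst c).
Proof.
move=> Oo; apply: (@smooth_on_class O (fun h => exists c, h = cst c)) => //; last by exists c.
move=> _ [d ->]; split; first exact: once_diff_cst.
by move=> v; exists (cst 0); [exists 0 | move=> x _; exact: derive_cst].
Qed.

Lemma smooth_onD O f g : open O ->
  smooth_on O f -> smooth_on O g -> smooth_on O (f \+ g).
Proof.
move=> Oo sf sg.
apply: (@smooth_on_class O (fun h => exists a b,
  [/\ smooth_on O a, smooth_on O b & h = a \+ b])) => //; last by exists f, g.
move=> _ [a [b [sa sb ->]]]; split.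
  by apply: once_diffD; exact: smooth_on_once.
move=> v; exists ('D_v a \+ 'D_v b).
  exists ('D_v a), ('D_v b); split; [exact: smooth_on_derive | exact: smooth_on_derive | reflexivity].
move=> x /[!inE] Ox; apply: deriveD.
  by have [_] := smooth_on_once sa Ox; exact.
by have [_] := smooth_on_once sb Ox; exact.
Qed.

Lemma smooth_onN O f : open O -> smooth_on O f -> smooth_on O (\- f).
Proof.
move=> Oo sf.
apply: (@smooth_on_class O (fun h => exists2 a, smooth_on O a & h = \- a)) => //;
  last by exists f.
move=> _ [a sa ->]; split; first by apply: once_diffN; exact: smooth_on_once.
move=> v; exists (\- 'D_v a); first by exists ('D_v a); [exact: smooth_on_derive | reflexivity].
move=> x /[!inE] Ox; apply: deriveN.
by have [_] := smooth_on_once sa Ox; exact.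
Qed.

Lemma deriveM' O f g v x : O x -> smooth_on O f -> smooth_on O g ->
  'D_v (f \* g) x = f x * 'D_v g x + g x * 'D_v f x.
Proof.
move=> Ox sf sg; apply: deriveM.
  by have [_] := smooth_on_once sf Ox; exact.
by have [_] := smooth_on_once sg Ox; exact.
Qed.

(** A derivative does not send a product to a product, so the class for [smooth_onM] has to consist
    of finite sums of products. *)
Inductive prod_class O : (V -> R) -> Prop :=
| prod_class1 f g : smooth_on O f -> smooth_on O g -> prod_class O (f \* g)
| prod_classD f g : prod_class O f -> prod_class O g -> prod_class O (f \+ g).

Lemma smooth_onM O f g : open O ->
  smooth_on O f -> smooth_on O g -> smooth_on O (f \* g).
Proof.
move=> Oo sf sg; apply: (@smooth_on_class O (prod_class O)) => //; last exact: prod_class1.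
move=> h; elim=> {f g sf sg h} [f g sf sg|f g _ [df hf] _ [dg hg]]; split.
- by apply: once_diffM; exact: smooth_on_once.
- move=> v; exists ((f \* 'D_v g) \+ (g \* 'D_v f)).
    by refine (prod_classD (prod_class1 sf _) (prod_class1 sg _)); exact: smooth_on_derive.
  by move=> x /[!inE] Ox; rewrite (deriveM' v Ox).
- exact: once_diffD.
- move=> v; have [f' Pf ef] := hf v; have [g' Pg eg] := hg v.
  exists (f' \+ g'); first exact: prod_classD.
  move=> x /[dup] Ox' /[!inE] Ox; rewrite /= -ef // -eg //; apply: deriveD.
    by have [_] := df x Ox; exact.
  by have [_] := dg x Ox; exact.
Qed.

End SmoothFunctions.

(** * Symmetry of second derivatives *)

Section Schwarz.
Context {R : realType} {V : normedModType R}.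
Implicit Types (O : set V) (f g : V -> R) (v w x y : V).

Lemma is_derive_line f y v (s : R) : derivable f (y + s *: v) v ->
  is_derive s 1 (fun s => f (y + s *: v)) ('D_v f (y + s *: v)).
Proof.
have e : (fun h : R => h^-1 *: (((fun s => f (y + s *: v)) \o shift s) (h *: 1)
             - f (y + s *: v)))
  = (fun h => h^-1 *: ((f \o shift (y + s *: v)) (h *: v) - f (y + s *: v))).
  apply/funext => h /=; congr (_ *: (f _ - _)).
  by rewrite /shift /= [h *: 1]mulr1 scalerDl addrCA.
by move=> df; split; rewrite /derivable /derive e.
Qed.

Lemma nbhs_parallelogram x v w (P : set V) : nbhs x P ->
  exists2 d : R, 0 < d & forall s t : R, 0 <= s <= d -> 0 <= t <= d ->
    P (x + s *: v + t *: w).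
Proof.
move=> /nbhs_ballP[r /= r0 rP].
have k0 : 0 < `|v| + `|w| + 1 by rewrite ltr_wpDl// addr_ge0.
(* The added 1 keeps the denominator positive when both vectors vanish; halving [r] makes the final
   bound strict. *)
exists (r / 2 / (`|v| + `|w| + 1)); first by rewrite !divr_gt0.
move=> s t /andP[s0 sd] /andP[t0 td]; apply: rP.
rewrite -ball_normE /ball_ /= -addrA opprD addrA subrr sub0r normrN.
apply: le_lt_trans (ler_normD _ _) _; rewrite !normrZ !ger0_norm //.
apply: (@le_lt_trans _ _ (r / 2)); last by rewrite ltr_pdivrMr // ltr_pMr // ltr1n.
apply: (@le_trans _ _ (r / 2 / (`|v| + `|w| + 1) * (`|v| + `|w| + 1))); last first.
  by rewrite divfK // gt_eqF.
rewrite mulrDr mulrDr -[leLHS]addr0 lerD //; first by rewrite lerD // ler_wpM2r.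
by rewrite mulr1 !divr_ge0 // ltW.
Qed.

Lemma MVT_line f y v (h : R) : 0 < h ->
  (forall s, 0 <= s <= h -> derivable f (y + s *: v) v) ->
  exists2 s, 0 <= s <= h & f (y + h *: v) - f y = h * 'D_v f (y + s *: v).
Proof.
move=> h0 df.
have D s : 0 <= s <= h ->
    is_derive s 1 (fun s => f (y + s *: v)) ('D_v f (y + s *: v)).
  by move=> sh; apply: is_derive_line; exact: df.
have [||s] := @MVT _ (fun s => f (y + s *: v)) (fun s => 'D_v f (y + s *: v)) 0 h h0.
- move=> s; rewrite in_itv /= => /andP[s0 sh]; apply: D.
  by rewrite !ltW.
- apply: derivable_within_continuous => s; rewrite in_itv /= => sh.
  by have [] := D s sh.
rewrite in_itv /= => /andP[s0 sh]; rewrite subr0 scale0r addr0 => ->.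
by exists s; [rewrite !ltW | rewrite mulrC].
Qed.

(** The mean value theorem is used twice: along [v] for the increment of f in the direction [w],
    then along [w] for the derivative of f along [v]. The second difference is symmetric in [v] and
    [w] while the right side prescribes an order of differentiation. *)
Lemma second_difference O f x v w (h : R) : open O -> smooth_on O f -> 0 < h ->
  (forall s t, 0 <= s <= h -> 0 <= t <= h -> O (x + s *: v + t *: w)) ->
  exists s, exists2 t, 0 <= s <= h /\ 0 <= t <= h &
    f (x + h *: v + h *: w) - f (x + h *: w) - f (x + h *: v) + f x =
    h * h * 'D_w ('D_v f) (x + s *: v + t *: w).
Proof.
move=> Oo sf h0 Ohh.
have h0h : 0 <= h <= h by rewrite lexx ltW.
have h00 : 0 <= (0 : R) <= h by rewrite lexx ltW.
have df g : smooth_on O g -> forall y u, O y -> derivable g y u.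
  by move=> sg y u Oy; have [_] := smooth_on_once sg Oy; exact.
pose g := (fun y => f (y + h *: w)) \- f.
have dgs s : 0 <= s <= h -> is_derive (x + s *: v) v (fun y => f (y + h *: w))
    ('D_v f (x + s *: v + h *: w)).
  move=> sh; have := df _ sf (x + s *: v + h *: w) v (Ohh _ _ sh h0h).
  have e : (fun k : R => k^-1 *: (((fun y => f (y + h *: w)) \o shift (x + s *: v))
              (k *: v) - f (x + s *: v + h *: w)))
    = (fun k => k^-1 *: ((f \o shift (x + s *: v + h *: w)) (k *: v)
                - f (x + s *: v + h *: w))).
    by apply/funext => k /=; congr (_ *: (f _ - _)); rewrite /shift /= !addrA.
  by move=> d; split; rewrite /derivable /derive e.
have dfs s : 0 <= s <= h -> is_derive (x + s *: v) v f ('D_v f (x + s *: v)).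
  move=> sh; split => //; apply: df => //.
  by have := Ohh s 0 sh h00; rewrite scale0r addr0.
have dg s : 0 <= s <= h -> is_derive (x + s *: v) v g
    ('D_v f (x + s *: v + h *: w) - 'D_v f (x + s *: v)).
  by move=> sh; apply: is_deriveB; [exact: dgs | exact: dfs].
have [s sh es] : exists2 s, 0 <= s <= h &
    g (x + h *: v) - g x = h * 'D_v g (x + s *: v).
  by apply: MVT_line => // s sh; have [] := dg s sh.
have [t th et] : exists2 t, 0 <= t <= h &
  'D_v f (x + s *: v + h *: w) - 'D_v f (x + s *: v) =
  h * 'D_w ('D_v f) (x + s *: v + t *: w).
  apply: MVT_line => // t th; apply: df; first exact: smooth_on_derive.
  exact: Ohh.
exists s, t => //; rewrite -mulrA -et.
have [_ <-] := dg s sh; rewrite -es /g /=; ring.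
Qed.

Lemma dist_half (a b c e : R) :
  `|a - c| <= e / 2 -> `|b - c| <= e / 2 -> `|b - a| <= e.
Proof.
rewrite !ler_norml => /andP[? ?] /andP[? ?]; apply/andP; split; lra.
Qed.

(** One second difference over a small parallelogram at [x] is [d1 * d1] times either mixed
    derivative at a nearby point; continuity of both at [x] then makes them equal up to any [e]. *)
Lemma derive_comm O f x v w : open O -> smooth_on O f -> O x ->
  'D_v ('D_w f) x = 'D_w ('D_v f) x.
Proof.
move=> Oo sf Ox.
have cont g : smooth_on O g -> {for x, continuous g}.
  by move=> sg; have [] := smooth_on_once sg Ox.
have c1 := cont _ (smooth_on_derive v (smooth_on_derive w sf)).
have c2 := cont _ (smooth_on_derive w (smooth_on_derive v sf)).
apply/eqP; rewrite -subr_eq0 -normr_le0; apply/ler_addgt0Pr => e e0; rewrite add0r.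
have e20 : 0 < e / 2 by rewrite divr_gt0.
move/cvgrPdist_le : c1 => /(_ _ e20) n1.
move/cvgrPdist_le : c2 => /(_ _ e20) n2.
have n3 : nbhs x O by exact: open_nbhs_nbhs.
have [d1 d10 p1] := nbhs_parallelogram v w (filterI n3 (filterI n1 n2)).
have [|s1 [t1 [s1d t1d] E1]] := second_difference Oo sf d10 (x := x) (v := v) (w := w).
  by move=> s t sd td; have [] := p1 s t sd td.
have [|s2 [t2 [s2d t2d] E2]] := second_difference Oo sf d10 (x := x) (v := w) (w := v).
  by move=> s t sd td; have := p1 t s td sd; rewrite addrAC => -[].
have [_ [_ q1]] := p1 _ _ s1d t1d.
have [_ [q2 _]] := p1 _ _ t2d s2d.
(* After reordering the increments the two second differences coincide, and cancelling [d1 * d1]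
   equates the mixed derivatives at their two intermediate points. *)
move: E1 E2 q1 q2; rewrite [x + d1 *: w + _]addrAC.
rewrite [x + s2 *: w + _]addrAC.
set D1 := 'D_w _ (_ + _); set D2 := 'D_v _ (_ + _).
rewrite [X in X + f x = _ -> _]addrAC => ->.
have dd0 : d1 * d1 != 0 by rewrite mulf_neq0 // gt_eqF.
move=> /(mulfI dd0) <-; exact: dist_half.
Qed.
End Schwarz.

Local Open Scope complex_scope.

(** * The commutative ring of smooth complex functions on an open set *)

Section SmoothRing.
Context {R : realType} {V : normedModType R} {O : set V} (Oo : open O).
Local Notation C := R[i].
Local Notation Re := (@complex.Re R).
Local Notation Im := (@complex.Im R).
Implicit Types (f g : V -> C).

Definition smooth_C f := smooth_on O (Re \o f) /\ smooth_on O (Im \o f).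

Lemma smooth_C_eq f g : {in O, f =1 g} -> smooth_C f -> smooth_C g.
Proof.
by move=> fg [a b]; split; [refine (smooth_on_eq Oo _ a)|refine (smooth_on_eq Oo _ b)];
  move=> x Ox /=; rewrite fg.
Qed.

Lemma smooth_C_cst (c : C) : smooth_C (cst c).
Proof. by split; exact: smooth_on_cst. Qed.

Lemma smooth_CD f g : smooth_C f -> smooth_C g -> smooth_C (fun x => f x + g x).
Proof.
move=> [a b] [a' b']; split.
  refine (smooth_on_eq Oo _ (smooth_onD Oo a a')).
  by move=> x _ /=; case: (f x) (g x) => ? ? [].
refine (smooth_on_eq Oo _ (smooth_onD Oo b b')).
by move=> x _ /=; case: (f x) (g x) => ? ? [].
Qed.

Lemma smooth_CN f : smooth_C f -> smooth_C (fun x => - f x).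
Proof.
move=> [a b]; split.
  by refine (smooth_on_eq Oo _ (smooth_onN Oo a)) => x _ /=; case: (f x).
by refine (smooth_on_eq Oo _ (smooth_onN Oo b)) => x _ /=; case: (f x).
Qed.

Lemma smooth_CM f g : smooth_C f -> smooth_C g -> smooth_C (fun x => f x * g x).
Proof.
move=> [a b] [a' b']; split.
  refine (smooth_on_eq Oo _ (smooth_onD Oo (smooth_onM Oo a a')
    (smooth_onN Oo (smooth_onM Oo b b')))).
  by move=> x _ /=; case: (f x) (g x) => ? ? [].
refine (smooth_on_eq Oo _ (smooth_onD Oo (smooth_onM Oo a b')
    (smooth_onM Oo b a'))).
by move=> x _ /=; case: (f x) (g x) => ? ? [].
Qed.

Lemma smooth_CJ f : smooth_C f -> smooth_C (fun x => (f x)^*).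
Proof.
move=> [a b]; split.
  by refine (smooth_on_eq Oo _ a) => x _ /=; case: (f x).
by refine (smooth_on_eq Oo _ (smooth_onN Oo b)) => x _ /=; case: (f x).
Qed.

(* Functions are cut off to 0 outside [O], where nothing is known about
   their derivatives; this makes pointwise equality on [O] an equality. *)
Record cutoff_fun := CutoffFun {
  cutoff_val : V -> C;
  cutoff_smooth : smooth_C cutoff_val /\ forall x, ~ O x -> cutoff_val x = 0 }.

(* The ring structures need the openness of [O]; recording it in the type lets
   them be inferred. *)
Definition sfun_of of open O := cutoff_fun.
Local Notation sfun := (sfun_of Oo).

Definition sfun_fun (a : sfun) : V -> C := cutoff_val a.
Coercion sfun_fun : sfun_of >-> Funclass.

Lemma sfun_smooth (a : sfun) : smooth_C a /\ forall x, ~ O x -> a x = 0.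
Proof. exact: cutoff_smooth. Qed.

HB.instance Definition _ := gen_eqMixin sfun.
HB.instance Definition _ := gen_choiceMixin sfun.

Lemma sfunP (a b : sfun) : (forall x, O x -> a x = b x) -> a = b.
Proof.
rewrite /sfun_fun; case: a b => [f [sf f0]] [g [sg g0]] /= fg.
have e : f = g.
  by apply/funext => x; have [/fg //|Ox] := pselect (O x); rewrite f0 // g0.
by move: sf f0; rewrite e => sf f0; congr CutoffFun; exact: Prop_irrelevance.
Qed.

Definition cut f : V -> C := fun x => if pselect (O x) then f x else 0.

Lemma cutE f x : O x -> cut f x = f x.
Proof. by rewrite /cut; case: pselect. Qed.

Lemma cut_smooth f : smooth_C f ->
  smooth_C (cut f) /\ forall x, ~ O x -> cut f x = 0.
Proof.
move=> sf; split; last by move=> x; rewrite /cut; case: pselect.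
by apply: smooth_C_eq sf => x /[!inE] Ox; rewrite cutE.
Qed.

Definition mk_sfun f (sf : smooth_C f) : sfun := CutoffFun (cut_smooth sf).

Lemma mk_sfunE f (sf : smooth_C f) x : O x -> mk_sfun sf x = f x.
Proof. exact: cutE. Qed.

Definition sfun_add (a b : sfun) :=
  mk_sfun (smooth_CD (sfun_smooth a).1 (sfun_smooth b).1).
Definition sfun_opp (a : sfun) := mk_sfun (smooth_CN (sfun_smooth a).1).
Definition sfun_mul (a b : sfun) :=
  mk_sfun (smooth_CM (sfun_smooth a).1 (sfun_smooth b).1).
Definition sfun_cst (c : C) := mk_sfun (smooth_C_cst c).

Let addE (a b : sfun) x : O x -> sfun_add a b x = a x + b x.
Proof. exact: mk_sfunE. Qed.
Let oppE (a : sfun) x : O x -> sfun_opp a x = - a x.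
Proof. exact: mk_sfunE. Qed.
Let mulE (a b : sfun) x : O x -> sfun_mul a b x = a x * b x.
Proof. exact: mk_sfunE. Qed.
Let cstE c x : O x -> sfun_cst c x = c.
Proof. exact: mk_sfunE. Qed.

Fact sfun_addA : associative sfun_add.
Proof. by move=> a b c; apply: sfunP => x Ox; rewrite !addE // addrA. Qed.
Fact sfun_addC : commutative sfun_add.
Proof. by move=> a b; apply: sfunP => x Ox; rewrite !addE // addrC. Qed.
Fact sfun_add0 : left_id (sfun_cst 0) sfun_add.
Proof. by move=> a; apply: sfunP => x Ox; rewrite !addE // cstE // add0r. Qed.
Fact sfun_addN : left_inverse (sfun_cst 0) sfun_opp sfun_add.
Proof. by move=> a; apply: sfunP => x Ox; rewrite addE // oppE // cstE // addNr. Qed.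

HB.instance Definition _ :=
  GRing.isZmodule.Build sfun sfun_addA sfun_addC sfun_add0 sfun_addN.

Fact sfun_mulA : associative sfun_mul.
Proof. by move=> a b c; apply: sfunP => x Ox; rewrite !mulE // mulrA. Qed.
Fact sfun_mulC : commutative sfun_mul.
Proof. by move=> a b; apply: sfunP => x Ox; rewrite !mulE // mulrC. Qed.
Fact sfun_mul1 : left_id (sfun_cst 1) sfun_mul.
Proof. by move=> a; apply: sfunP => x Ox; rewrite !mulE // cstE // mul1r. Qed.
Fact sfun_mulDl : left_distributive sfun_mul +%R.
Proof.
by move=> a b c; apply: sfunP => x Ox; rewrite !(mulE, addE) // mulrDl.
Qed.

HB.instance Definition _ := GRing.Zmodule_isComPzRing.Build sfun
  sfun_mulA sfun_mulC sfun_mul1 sfun_mulDl.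

Section Evaluation.
Context {x : V} (Ox : O x).

(** Evaluation preserves 1 only at points of [O], the unit being cut off to 0 elsewhere; hence the
    proof of [O x] among the arguments. *)
Definition sev of O x := fun a : sfun => a x : C.
Local Notation sevx := (sev Ox).

Fact sev_is_additive : additive sevx.
Proof. by move=> a b; rewrite /sev addE // oppE. Qed.
Fact sev_is_mult : multiplicative sevx.
Proof. by split=> [a b|]; rewrite /sev; [rewrite mulE | rewrite cstE]. Qed.

HB.instance Definition _ := GRing.isAdditive.Build sfun C sevx sev_is_additive.
HB.instance Definition _ := GRing.isMultiplicative.Build sfun C sevx sev_is_mult.

Lemma sev_cst c : sevx (sfun_cst c) = c.
Proof. by rewrite /sev cstE. Qed.
End Evaluation.

End SmoothRing.

(** * Directional derivatives, conjugation and constants on this ring *)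

Section SmoothDerivation.
Context {R : realType} {V : normedModType R} {O : set V} (Oo : open O).
Local Notation C := R[i].
Local Notation Re := (@complex.Re R).
Local Notation Im := (@complex.Im R).
Implicit Types (f : V -> C) (a b : sfun_of Oo) (v w x : V).

Definition derC v f : V -> C := fun x => 'D_v (Re \o f) x +i* 'D_v (Im \o f) x.

Lemma derC_smooth v f : smooth_C (O := O) f -> smooth_C (O := O) (derC v f).
Proof. by move=> [sr si]; split; exact: smooth_on_derive. Qed.

Lemma derC_eq v f g x : O x -> {in O, f =1 g} -> derC v f x = derC v g x.
Proof.
move=> Ox fg; rewrite /derC.
congr (_ +i* _); apply: near_eq_derive; apply: (open_near_eq Oo Ox) => y Oy /=;
  by rewrite fg.
Qed.

Definition sder v a : sfun_of Oo := mk_sfun Oo (derC_smooth v (sfun_smooth a).1).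

Lemma sderE v a x : O x -> sder v a x = derC v a x.
Proof. exact: mk_sfunE. Qed.

Lemma sfun_addE a b x : O x -> sfun_fun (a + b) x = a x + b x.
Proof. exact: mk_sfunE. Qed.
Lemma sfun_oppE a x : O x -> sfun_fun (- a) x = - a x.
Proof. exact: mk_sfunE. Qed.
Lemma sfun_mulE a b x : O x -> sfun_fun (a * b) x = a x * b x.
Proof. exact: mk_sfunE. Qed.
Lemma sfun_cstE c x : O x -> sfun_cst Oo c x = c.
Proof. exact: mk_sfunE. Qed.

Let dr a v x : O x -> derivable (Re \o a) x v.
Proof.
by move=> Ox; have [_] := smooth_on_once (sfun_smooth a).1.1 Ox; exact.
Qed.
Let di a v x : O x -> derivable (Im \o a) x v.
Proof.
by move=> Ox; have [_] := smooth_on_once (sfun_smooth a).1.2 Ox; exact.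
Qed.

Fact sder_additive v : additive (sder v).
Proof.
move=> a b; apply: sfunP => x Ox; rewrite sfun_addE // sfun_oppE // !sderE //.
have e : {in O, sfun_fun (a - b) =1 fun y => sfun_fun a y - sfun_fun b y}.
  by move=> y /[!inE] Oy; rewrite sfun_addE // sfun_oppE.
rewrite (derC_eq v Ox e) /derC.
have -> : Re \o (fun y => sfun_fun a y - sfun_fun b y) = (Re \o sfun_fun a) - (Re \o sfun_fun b).
  by apply/funext => y; rewrite !fctE /=; case: (sfun_fun a y) (sfun_fun b y) => ? ? [].
have -> : Im \o (fun y => sfun_fun a y - sfun_fun b y) = (Im \o sfun_fun a) - (Im \o sfun_fun b).
  by apply/funext => y; rewrite !fctE /=; case: (sfun_fun a y) (sfun_fun b y) => ? ? [].
by rewrite (deriveB (@dr a v _ Ox) (@dr b v _ Ox)) (deriveB (@di a v _ Ox) (@di b v _ Ox)).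
Qed.

HB.instance Definition _ v :=
  GRing.isAdditive.Build (sfun_of Oo) (sfun_of Oo) (sder v) (sder_additive v).

Lemma sderM v a b : sder v (a * b) = sder v a * b + a * sder v b.
Proof.
apply: sfunP => x Ox; rewrite sfun_addE // !sfun_mulE // !sderE //.
have e : {in O, sfun_fun (a * b) =1 fun y => sfun_fun a y * sfun_fun b y}.
  by move=> y /[!inE] Oy; rewrite sfun_mulE.
rewrite (derC_eq v Ox e) /derC.
have -> : Re \o (fun y => sfun_fun a y * sfun_fun b y) =
    (Re \o sfun_fun a) * (Re \o sfun_fun b) - (Im \o sfun_fun a) * (Im \o sfun_fun b).
  by apply/funext => y; rewrite !fctE /=; case: (sfun_fun a y) (sfun_fun b y) => ? ? [].
have -> : Im \o (fun y => sfun_fun a y * sfun_fun b y) =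
    (Re \o sfun_fun a) * (Im \o sfun_fun b) + (Im \o sfun_fun a) * (Re \o sfun_fun b).
  by apply/funext => y; rewrite !fctE /=; case: (sfun_fun a y) (sfun_fun b y) => ? ? [].
have [[[ra rb] ia] ib] := (@dr a v _ Ox, @dr b v _ Ox, @di a v _ Ox, @di b v _ Ox).
have dM (f g : V -> R) : derivable f x v -> derivable g x v -> derivable (f * g) x v.
  exact: derivableM.
have := (dM _ _ ra rb, dM _ _ ia ib, dM _ _ ra ib, dM _ _ ia rb).
move=> [[[rr ii] ri] ir].
rewrite (deriveB rr ii) (deriveD ri ir).
rewrite (deriveM ra rb) (deriveM ia ib) (deriveM ra ib) (deriveM ia rb).
move: ('D_v _ _) ('D_v _ _) ('D_v _ _) ('D_v _ _) => dra drb dia dib.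
rewrite /GRing.scale /=; case: (sfun_fun a x) (sfun_fun b x) => [ar ai] [br bi] /=.
by apply/eqP; rewrite eq_complex /=; apply/andP; split; apply/eqP; ring.
Qed.

Lemma sder_comm v w a : sder v (sder w a) = sder w (sder v a).
Proof.
have [sr si] := (sfun_smooth a).1.
apply: sfunP => x Ox; rewrite (sderE _ _ Ox) (sderE w (sder v a) Ox).
have e u : {in O, sfun_fun (sder u a) =1 derC u a} by move=> y /[!inE] Oy; exact: sderE.
rewrite (derC_eq v Ox (e w)) (derC_eq w Ox (e v)).
have er u : Re \o derC u a = 'D_u (Re \o a) by apply/funext.
have ei u : Im \o derC u a = 'D_u (Im \o a) by apply/funext.
rewrite /derC -!/(derC _ _) !er !ei.
by rewrite (derive_comm v w Oo sr Ox) (derive_comm v w Oo si Ox).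
Qed.

Definition sconj a : sfun_of Oo := mk_sfun Oo (smooth_CJ Oo (sfun_smooth a).1).

Lemma sconjE a x : O x -> sconj a x = (sfun_fun a x)^*.
Proof. exact: mk_sfunE. Qed.

Fact sconj_additive : additive sconj.
Proof.
move=> a b; apply: sfunP => x Ox.
by rewrite !(sfun_addE, sfun_oppE, sconjE) // rmorphB.
Qed.
Fact sconj_multiplicative : multiplicative sconj.
Proof.
split=> [a b|]; apply: sfunP => x Ox.
  by rewrite !(sfun_mulE, sconjE) // rmorphM.
by rewrite !(sfun_cstE, sconjE) // rmorph1.
Qed.
HB.instance Definition _ :=
  GRing.isAdditive.Build (sfun_of Oo) (sfun_of Oo) sconj sconj_additive.
HB.instance Definition _ :=
  GRing.isMultiplicative.Build (sfun_of Oo) (sfun_of Oo) sconj sconj_multiplicative.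

Lemma sconjK : involutive sconj.
Proof. by move=> a; apply: sfunP => x Ox; rewrite !sconjE // conjcK. Qed.

Lemma sder_conj v a : sder v (sconj a) = sconj (sder v a).
Proof.
apply: sfunP => x Ox; rewrite sconjE // !sderE //.
have e : {in O, sfun_fun (sconj a) =1 fun y => (sfun_fun a y)^*}.
  by move=> y /[!inE] Oy; rewrite sconjE.
rewrite (derC_eq v Ox e) /derC /=.
have -> : Re \o (fun y => (sfun_fun a y)^*) = Re \o sfun_fun a.
  by apply/funext => y /=; case: (sfun_fun a y).
have -> : Im \o (fun y => (sfun_fun a y)^*) = - (Im \o sfun_fun a).
  by apply/funext => y; rewrite !fctE /=; case: (sfun_fun a y).
by rewrite (deriveN (@di a v _ Ox)).
Qed.

Lemma sder_cst v c : sder v (sfun_cst Oo c) = 0.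
Proof.
apply: sfunP => x Ox; rewrite sderE // sfun_cstE //.
have e : {in O, sfun_cst Oo c =1 cst c} by move=> y /[!inE] Oy; rewrite sfun_cstE.
rewrite (derC_eq v Ox e) /derC.
have -> : Re \o cst c = cst (Re c) :> (V -> R) by [].
have -> : Im \o cst c = cst (Im c) :> (V -> R) by [].
by rewrite !derive_cst.
Qed.

Fact sfun_cst_additive : additive (sfun_cst Oo).
Proof.
by move=> c d; apply: sfunP => x Ox; rewrite !(sfun_addE, sfun_oppE, sfun_cstE).
Qed.
Fact sfun_cst_multiplicative : multiplicative (sfun_cst Oo).
Proof.
by split=> // c d; apply: sfunP => x Ox; rewrite !(sfun_mulE, sfun_cstE).
Qed.
HB.instance Definition _ :=
  GRing.isAdditive.Build C (sfun_of Oo) (sfun_cst Oo) sfun_cst_additive.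
HB.instance Definition _ :=
  GRing.isMultiplicative.Build C (sfun_of Oo) (sfun_cst Oo) sfun_cst_multiplicative.

Lemma sconj_cst c : sconj (sfun_cst Oo c) = sfun_cst Oo c^*.
Proof. by apply: sfunP => x Ox; rewrite sconjE // !sfun_cstE. Qed.

End SmoothDerivation.

(** * Restriction to parameter 0 and the first variation *)

Section Slice.
Context {R : realType} {V : normedModType R} {e0 : R} {U : set V}.
Hypotheses (e00 : 0 < e0) (Uo : open U).
Local Notation C := R[i].

Definition slab : set (R * V) := [set p | `|p.1| < e0 /\ U p.2].

Lemma slab_open : open slab.
Proof.
have -> : slab = (fst @^-1` ball (0 : R) e0) `&` (snd @^-1` U).
  by apply/seteqP; split=> -[s x] /=; rewrite -ball_normE /= sub0r normrN.
apply: openI; apply: open_comp.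
- by move=> p _; exact: cvg_fst.
- exact: (@ball_open R R^o).
- by move=> p _; exact: cvg_snd.
- exact: Uo.
Qed.

Lemma slab0 x : U x -> slab (0, x).
Proof. by move=> Ux; split; rewrite //= normr0. Qed.

Lemma derive_slice (f : R * V -> R) (s : R) (v x : V) :
  'D_v (fun y => f (s, y)) x = 'D_((0, v) : R * V) f (s, x).
Proof.
have e : (fun h : R => h^-1 *: (((fun y => f (s, y)) \o shift x) (h *: v) - f (s, x)))
  = (fun h : R => h^-1 *: ((f \o shift (s, x)) (h *: ((0, v) : R * V)) - f (s, x))).
  apply/funext => h /=; congr (_ *: (f (_, _) - _)).
  by rewrite -[s in LHS]add0r -[0 in LHS](scaler0 R h).
by rewrite /derive e.
Qed.

Lemma derivable_slice (f : R * V -> R) (s : R) (v x : V) :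
  derivable f (s, x) ((0, v) : R * V) -> derivable (fun y => f (s, y)) x v.
Proof.
have e : (fun h : R => h^-1 *: (((fun y => f (s, y)) \o shift x) (h *: v) - f (s, x)))
  = (fun h : R => h^-1 *: ((f \o shift (s, x)) (h *: ((0, v) : R * V)) - f (s, x))).
  apply/funext => h /=; congr (_ *: (f (_, _) - _)).
  by rewrite -[s in LHS]add0r -[0 in LHS](scaler0 R h).
by rewrite /derivable e.
Qed.

Lemma iter_derive_slice (f : R * V -> R) (s : R) vs :
  iter_derive vs (fun y => f (s, y)) =
  fun y => iter_derive [seq ((0, v) : R * V) | v <- vs] f (s, y).
Proof.
by elim: vs => //= v vs ->; apply/funext => x; rewrite -derive_slice.
Qed.

Lemma smooth_on_slice (f : R * V -> R) : smooth_on slab f ->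
  smooth_on U (fun y => f (0, y)).
Proof.
move=> sf vs x Ux; rewrite iter_derive_slice.
have [cf df] := sf [seq (0, v) | v <- vs] (0, x) (slab0 Ux).
split; last by move=> v; apply: derivable_slice; exact: df.
have c0 : {for x, continuous (fun y => ((0, y) : R * V))}.
  exact: (cvg_pair (F := nbhs x) (G := nbhs (0 : R)) (H := nbhs x)
    (@cvg_cst _ _ _ _ _) cvg_id).
exact: (continuous_comp c0 cf).
Qed.

Local Notation KO := (sfun_of slab_open).
Local Notation KU := (sfun_of Uo).
Implicit Types (a b : KO).

Fact smooth_C_slice a : smooth_C (O := U) (fun y => sfun_fun a (0, y)).
Proof. by have [[sr si] _] := sfun_smooth a; split; [exact: (smooth_on_slice sr)|exact: (smooth_on_slice si)]. Qed.

Definition ev a : KU := mk_sfun Uo (smooth_C_slice a).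

Lemma evE a x : U x -> ev a x = sfun_fun a (0, x).
Proof. exact: mk_sfunE. Qed.

Fact ev_additive : additive ev.
Proof.
move=> a b; apply: sfunP => x Ux; have Ox := slab0 Ux.
by rewrite !(sfun_addE, sfun_oppE, evE).
Qed.
Fact ev_multiplicative : multiplicative ev.
Proof.
split=> [a b|]; apply: sfunP => x Ux; have Ox := slab0 Ux.
  by rewrite !(sfun_mulE, evE).
by rewrite !(sfun_cstE, evE).
Qed.
HB.instance Definition _ := GRing.isAdditive.Build KO KU ev ev_additive.
HB.instance Definition _ := GRing.isMultiplicative.Build KO KU ev ev_multiplicative.

Lemma ev_cst c : ev (sfun_cst slab_open c) = sfun_cst Uo c.
Proof.
by apply: sfunP => x Ux; have Ox := slab0 Ux; rewrite evE // !sfun_cstE.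
Qed.

Lemma ev_conj a : ev (sconj a) = sconj (ev a).
Proof.
by apply: sfunP => x Ux; have Ox := slab0 Ux; rewrite !(evE, sconjE).
Qed.

Lemma ev_der v a : ev (sder ((0, v) : R * V) a) = sder v (ev a).
Proof.
apply: sfunP => x Ux; have Ox := slab0 Ux.
rewrite evE // !sderE //.
have e : {in U, sfun_fun (ev a) =1 fun y => sfun_fun a (0, y)} by move=> y /[!inE] Uy; rewrite evE.
by rewrite (derC_eq Uo v Ux e) /derC -!derive_slice.
Qed.

(** The first variation of a one-parameter family. It is a derivation over [ev] ([deltaM]), and it
    commutes with spatial derivatives because second derivatives are symmetric ([delta_der]). *)
Definition delta a : KU := ev (sder ((1, 0) : R * V) a).

HB.instance Definition _ := GRing.isAdditive.Build KO KU delta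
  (fun a b => etrans (congr1 ev (raddfB (sder ((1, 0) : R * V)) a b)) (raddfB ev _ _)).

Lemma deltaM a b : delta (a * b) = delta a * ev b + ev a * delta b.
Proof. by rewrite /delta sderM rmorphD !rmorphM. Qed.

Lemma delta_der v a : delta (sder ((0, v) : R * V) a) = sder v (delta a).
Proof. by rewrite /delta sder_comm ev_der. Qed.

Lemma delta_conj a : delta (sconj a) = sconj (delta a).
Proof. by rewrite /delta sder_conj ev_conj. Qed.

Lemma delta_cst c : delta (sfun_cst slab_open c) = 0.
Proof. by rewrite /delta sder_cst rmorph0. Qed.

End Slice.

(** The device behind most computations below: a goal follows from hypotheses as soon as its defect
    is an explicit linear combination of theirs. Each application subtracts [k] times one
    hypothesis, and [ring] checks the remaining identity, so the multipliers form a certificate. *)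
Lemma eq_of_diff (K : comPzRingType) (k a b c d : K) :
  c = d -> a - b = k * (c - d) -> a = b.
Proof. by move=> -> /eqP; rewrite subrr mulr0 subr_eq0 => /eqP. Qed.
Arguments eq_of_diff {K} k {a b c d}.

(** The classical octahedron argument: of the four cyclic identities on the index set a, b, c, d,
    two are added and two subtracted; everything cancels except twice the defect of the pair
    symmetry. *)
Lemma pair_symmetry (K : comPzRingType) (half : K) (I : Type)
    (T : I -> I -> I -> I -> K) :
  half + half = 1 ->
  (forall a b c d, T b a c d = - T a b c d) ->
  (forall a b c d, T a b d c = - T a b c d) ->
  (forall a b c d, T a b c d + T a c d b + T a d b c = 0) ->
  forall a b c d, T c d a b = T a b c d.
Proof.
move=> hh t12 t34 cyc a b c d.
have := cyc a b c d; have := cyc b c d a; have := cyc c d a b; have := cyc d a b c.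
rewrite (t34 a c b d) (t34 b c a d) (t12 a b c d) (t12 a c b d) (t12 b c d a).
rewrite (t34 b c a d) (t12 a d b c) (t12 b d c a) (t34 b d a c) (t12 c d a b).
set x1 := T a b c d; set x2 := T c d a b.
set y1 := T a c b d; set y2 := T b d a c; set z1 := T a d b c; set z2 := T b c a d.
move=> h4 h3 h2 h1.
have h := congr2 (fun u v => u - v) (congr2 (fun u v => u - v) h1 h2)
  (congr2 (fun u v => u - v) h3 h4).
have e : (half + half) * (x1 - x2) = 0 by apply: (eq_of_diff half h) => /=; ring.
by move/eqP: e; rewrite hh mul1r subr_eq0 => /eqP.
Qed.

(** * Riemannian geometry in a frame, over a ring with commuting derivations *)

Section FrameGeometry.
Context {K : comPzRingType} {n : nat}.
Variable D : 'I_n -> {additive K -> K}.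
Hypothesis DM : forall i a b, D i (a * b) = D i a * b + a * D i b.
Hypothesis DC : forall i j a, D i (D j a) = D j (D i a).
Variable half : K.
Hypothesis half2 : half + half = 1.
Variables (g E eta etai : 'M[K]_n).
Hypothesis gT : g^T = g.
Hypothesis etaD : forall i a b, D i (eta a b) = 0.
Hypothesis etaiT : etai^T = etai.
Hypothesis etaiK : eta *m etai = 1%:M.
Hypothesis EgE : E *m g *m E^T = eta.

(** In a general ring the inverse metric has to be supplied: the frame provides it, since [E] brings
    [g] to the constant matrix [eta] with inverse [etai]. *)
Definition ginv : 'M[K]_n := E^T *m etai *m E.

Definition christ k i j : K :=
  half * \sum_l ginv k l * (D i (g j l) + D j (g i l) - D l (g i j)).

Definition riemup k l i j : K :=
  D i (christ k j l) - D j (christ k i l)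
  + \sum_m (christ k i m * christ m j l - christ k j m * christ m i l).

Definition riem k l i j : K := \sum_m g k m * riemup m l i j.

Lemma addmxE p q (A B : 'M[K]_(p, q)) a b : (A + B) a b = A a b + B a b.
Proof. exact: mxE. Qed.

Lemma oppmxE p q (A : 'M[K]_(p, q)) a b : (- A) a b = - A a b.
Proof. exact: mxE. Qed.

Definition mxD p q i (A : 'M[K]_(p, q)) : 'M[K]_(p, q) := map_mx (D i) A.

Lemma mxDM p q r i (A : 'M[K]_(p, q)) (B : 'M[K]_(q, r)) :
  mxD i (A *m B) = mxD i A *m B + A *m mxD i B.
Proof.
apply/matrixP => a b; rewrite !mxE raddf_sum -big_split /=.
by apply: eq_bigr => c _; rewrite DM !mxE.
Qed.

Lemma mxDD p q i (A B : 'M[K]_(p, q)) : mxD i (A + B) = mxD i A + mxD i B.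
Proof. exact: map_mxD. Qed.

Lemma mxDN p q i (A : 'M[K]_(p, q)) : mxD i (- A) = - mxD i A.
Proof. exact: map_mxN. Qed.

Lemma mxDT p q i (A : 'M[K]_(p, q)) : mxD i A^T = (mxD i A)^T.
Proof. by apply/matrixP => a b; rewrite !mxE. Qed.

Lemma mxDC p q i j (A : 'M[K]_(p, q)) : mxD i (mxD j A) = mxD j (mxD i A).
Proof. by apply/matrixP => a b; rewrite !mxE DC. Qed.

Lemma E_inv : (g *m E^T *m etai) *m E = 1%:M.
Proof.
apply: mulmx1C.
by rewrite mulmxA mulmxA EgE etaiK.
Qed.

Lemma etaiK' : etai *m eta = 1%:M.
Proof. exact: mulmx1C etaiK. Qed.

Lemma ginvP : g *m ginv = 1%:M.
Proof. by rewrite /ginv !mulmxA E_inv. Qed.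

Lemma etaT : eta^T = eta.
Proof. by rewrite -EgE !trmx_mul trmxK gT mulmxA. Qed.

Lemma christC k i j : christ k i j = christ k j i.
Proof.
congr (half * _); apply: eq_bigr => l _; congr (_ * _).
have -> : g i j = g j i by rewrite -[in LHS]gT mxE.
by rewrite [D i _ + _]addrC.
Qed.

(* The matrix of the covariant derivative along the i-th coordinate, acting on
   components from the right. *)
Definition cmx i : 'M[K]_n := \matrix_(j, k) christ k i j.

(** Metric compatibility: lowering an index of the Christoffel symbols leaves the first-kind symbols
    ([low]), and adding the transpose cancels all but the derivative of the metric along [i]. *)
Lemma cmx_metric i : mxD i g = cmx i *m g + (cmx i *m g)^T.
Proof.
have ginvT : ginv^T = ginv.
  by rewrite /ginv !trmx_mul trmxK etaiT mulmxA.
have low j l : (cmx i *m g) j l = half * (D i (g j l) + D j (g i l) - D l (g i j)).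
  rewrite mxE (eq_bigr (fun k => half * \sum_m
      (D i (g j m) + D j (g i m) - D m (g i j)) * (ginv m k * g k l))).
    rewrite -mulr_sumr exchange_big /=; congr (_ * _).
    under eq_bigr do rewrite -mulr_sumr.
    have gg : ginv *m g = 1%:M by exact: mulmx1C ginvP.
    have ggE m : \sum_k ginv m k * g k l = (m == l)%:R.
      by have := congr1 (fun A : 'M[K]_n => A m l) gg; rewrite !mxE.
    under eq_bigr do rewrite ggE.
    rewrite (bigD1 l) //= eqxx mulr1 big1 ?addr0 // => m /negbTE ->.
    by rewrite mulr0.
  move=> k _; rewrite mxE /christ -mulrA; congr (_ * _).
  rewrite mulr_suml; apply: eq_bigr => m _.
  by rewrite -[in LHS]ginvT mxE mulrAC mulrC.
apply/matrixP => j l; rewrite mxE [RHS]mxE [X in _ + X]mxE !low.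
have -> : g i l = g l i by rewrite -[in LHS]gT mxE.
have -> : g i j = g j i by rewrite -[in LHS]gT mxE.
have -> : g l j = g j l by rewrite -[in LHS]gT mxE.
set a := D i _; set b := D j _; set c := D l _.
have -> : half * (a + b - c) + half * (a + c - b) = (half + half) * a by ring.
by rewrite half2 mul1r.
Qed.

(** The connection matrix of the frame: the covariant derivative of e_a along the i-th coordinate is
    the sum of [theta i a b] times e_b. The factor g E^T etai is the inverse of [E]. *)
Definition theta i : 'M[K]_n := (mxD i E + E *m cmx i) *m g *m E^T *m etai.

Lemma theta_def i : mxD i E = theta i *m E - E *m cmx i.
Proof.
have e := E_inv; rewrite -!mulmxA in e.
by rewrite /theta -!mulmxA e mulmx1 addrK.
Qed.

Definition frame_conn i : 'M[K]_n := theta i *m eta.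

Lemma frame_connE i : frame_conn i = (mxD i E + E *m cmx i) *m g *m E^T.
Proof. by rewrite /frame_conn /theta -mulmxA etaiK' mulmx1. Qed.

(** The derivative of the constant matrix E g E^T vanishes, and by metric compatibility it is the
    symmetric part of [frame_conn]. *)
Lemma frame_conn_anti i : (frame_conn i)^T = - frame_conn i.
Proof.
have eta0 : mxD i eta = 0 by apply/matrixP => a b; rewrite !mxE etaD.
apply/eqP; rewrite -subr_eq0 opprK addrC; apply/eqP.
rewrite -eta0 -EgE !mxDM mxDT cmx_metric frame_connE !trmx_mul trmxK gT.
rewrite !linearD /= !trmx_mul.
by rewrite !mulmxDl !mulmxA; apply/matrixP => a b; rewrite !addmxE; ring.
Qed.

Definition rmx i j : 'M[K]_n :=
  mxD i (cmx j) - mxD j (cmx i) + cmx j *m cmx i - cmx i *m cmx j.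

(** Curvature of the connection [theta]. As for [rmx], components are acted on from the right, so
    the two quadratic terms appear in reversed order. *)
Definition omx i j : 'M[K]_n :=
  mxD i (theta j) - mxD j (theta i) + theta j *m theta i - theta i *m theta j.

Lemma rmxE i j l k : rmx i j l k = riemup k l i j.
Proof.
rewrite /rmx /riemup !mxE sumrB -!addrA; congr (_ + (_ + (_ - _))).
  by apply: eq_bigr => m _; rewrite !mxE mulrC.
by apply: eq_bigr => m _; rewrite !mxE mulrC.
Qed.

(** Both curvatures come from commuting two coordinate derivatives of [E], expanded by [theta_def];
    the first order cross terms are symmetric in i and j and drop out. *)
Lemma frame_curv i j : E *m rmx i j = omx i j *m E.
Proof.
have e a b : mxD a (mxD b E) = mxD a (theta b) *m E
    + theta b *m theta a *m E - theta b *m E *m cmx a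
    - theta a *m E *m cmx b + E *m cmx a *m cmx b - E *m mxD a (cmx b).
  rewrite [mxD b E]theta_def mxDD mxDN (mxDM a (theta b)) (mxDM a E) (theta_def a).
  rewrite !(mulmxBl, mulmxBr) !mulmxA.
  by apply/matrixP => p q; rewrite !(addmxE, oppmxE); ring.
have := mxDC i j E; rewrite !e /rmx /omx.
rewrite !(mulmxBl, mulmxBr, mulmxDl, mulmxDr) !mulmxA.
move/matrixP => H; apply/matrixP => p q; move: (H p q).
rewrite !(addmxE, oppmxE) => h; apply: (eq_of_diff (-1) h); ring.
Qed.

(** A formal identity: it holds for arbitrary matrices in place of [theta], because coordinate
    derivatives commute. *)
Lemma bianchi_coord i j k :
  (mxD k (omx i j) + omx i j *m theta k - theta k *m omx i j) +
  (mxD i (omx j k) + omx j k *m theta i - theta i *m omx j k) +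
  (mxD j (omx k i) + omx k i *m theta j - theta j *m omx k i) = 0.
Proof.
rewrite /omx; move: (theta i) (theta j) (theta k) => x y z.
rewrite !(mxDD, mxDN) !mxDM (mxDC j i) (mxDC k i) (mxDC k j).
rewrite !(mulmxBl, mulmxBr, mulmxDl, mulmxDr) !mulmxA.
by apply/matrixP => p q; rewrite !(addmxE, oppmxE) [RHS]mxE; ring.
Qed.

Definition frd l (f : K) : K := \sum_i E l i * D i f.

Fact frd_additive l : additive (frd l).
Proof.
by move=> a b; rewrite /frd -sumrB; apply: eq_bigr => i _; rewrite raddfB mulrBr.
Qed.
HB.instance Definition _ l := GRing.isAdditive.Build K K (frd l) (frd_additive l).

Lemma frdM l a b : frd l (a * b) = frd l a * b + a * frd l b.
Proof.
rewrite /frd mulr_suml mulr_sumr -big_split /=; apply: eq_bigr => i _.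
rewrite DM; ring.
Qed.

Definition conn l a b : K := \sum_i E l i * frame_conn i a b.
Definition up l a b : K := \sum_i E l i * theta i a b.

Lemma conn_anti l a b : conn l a b = - conn l b a.
Proof.
rewrite /conn -sumrN; apply: eq_bigr => i _.
have /matrixP/(_ b a) := frame_conn_anti i; rewrite mxE => ->.
by rewrite oppmxE mulrN.
Qed.

Lemma upE l a b : up l a b = \sum_s conn l a s * etai s b.
Proof.
rewrite /up /conn; under [RHS]eq_bigr do rewrite mulr_suml.
rewrite exchange_big; apply: eq_bigr => i _ /=.
under eq_bigr do rewrite -mulrA; rewrite -mulr_sumr; congr (_ * _).
by rewrite -[theta i]mulmx1 -etaiK mulmxA mxE.
Qed.

Lemma frd_E l k j :
  frd l (E k j) - frd k (E l j) = \sum_s (up l k s - up k l s) * E s j.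
Proof.
have e a b : frd a (E b j) = \sum_s up a b s * E s j
    - \sum_i \sum_m E a i * E b m * christ j i m.
  transitivity (\sum_i E a i * (mxD i E) b j).
    by apply: eq_bigr => i _; rewrite mxE.
  under eq_bigr do rewrite theta_def addmxE oppmxE mulrBr.
  rewrite sumrB; congr (_ - _).
    under [RHS]eq_bigr do rewrite mulr_suml.
    rewrite exchange_big; apply: eq_bigr => i _ /=.
    by rewrite mxE mulr_sumr; apply: eq_bigr => s _; rewrite mulrA.
  apply: eq_bigr => i _; rewrite mxE mulr_sumr; apply: eq_bigr => m _.
  by rewrite mxE mulrA.
rewrite !e [X in _ - (_ - X)]exchange_big /=.
have -> : \sum_i \sum_m E k m * E l i * christ j m i =
    \sum_i \sum_m E l i * E k m * christ j i m.
  apply: eq_bigr => i _; apply: eq_bigr => m _.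
  by rewrite christC [E k m * _]mulrC.
under [RHS]eq_bigr do rewrite mulrBl.
rewrite sumrB; ring.
Qed.

Lemma frd_comm_coord l k f :
  frd l (frd k f) - frd k (frd l f) = \sum_j (frd l (E k j) - frd k (E l j)) * D j f.
Proof.
have e a b : frd a (frd b f) = \sum_j frd a (E b j) * D j f
    + \sum_i \sum_j E a i * E b j * D i (D j f).
  rewrite {2}/frd raddf_sum /=; under eq_bigr do rewrite frdM.
  rewrite big_split /=; congr (_ + _); rewrite exchange_big /=.
  apply: eq_bigr => j _; rewrite /frd mulr_sumr.
  by apply: eq_bigr => i _; ring.
rewrite !e [X in _ - (_ + X)]exchange_big /=.
have -> : \sum_i \sum_m E k m * E l i * D m (D i f) =
    \sum_i \sum_m E l i * E k m * D i (D m f).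
  apply: eq_bigr => i _; apply: eq_bigr => m _.
  by rewrite DC [E k m * _]mulrC.
under [RHS]eq_bigr do rewrite mulrBl.
rewrite sumrB; ring.
Qed.

(** Absence of torsion: the bracket of e_l and e_k is D_l e_k - D_k e_l, since the Christoffel
    symbols are symmetric ([frd_E]). *)
Lemma frd_comm l k f :
  frd l (frd k f) - frd k (frd l f) = \sum_s (up l k s - up k l s) * frd s f.
Proof.
rewrite frd_comm_coord.
rewrite (eq_bigr (fun j => \sum_s (up l k s - up k l s) * E s j * D j f)); last first.
  by move=> j _; rewrite frd_E mulr_suml.
rewrite exchange_big; apply: eq_bigr => s _ /=.
by rewrite /frd mulr_sumr; apply: eq_bigr => j _; rewrite mulrA.
Qed.

Definition con2 (T : 'I_n -> 'I_n -> K) l m : K :=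
  \sum_i \sum_j E l i * E m j * T i j.

Lemma frd_con2 T l m k : frd l (con2 T m k) =
  \sum_i \sum_j frd l (E m i) * E k j * T i j +
  \sum_i \sum_j E m i * frd l (E k j) * T i j +
  \sum_i \sum_j E m i * E k j * frd l (T i j).
Proof.
rewrite /con2 raddf_sum -!big_split; apply: eq_bigr => i _ /=.
rewrite raddf_sum -!big_split; apply: eq_bigr => j _ /=.
by rewrite !frdM mulrDl.
Qed.

(** The Riemann tensor in the frame, normalised as the pairing with e_a of the curvature operator of
    e_l and e_k applied to e_b. *)
Definition curv a b l k : K := con2 (fun i j => (omx i j *m eta) b a) l k.

Lemma curvE a b l k : curv a b l k = frd l (conn k b a) - frd k (conn l b a)
  - \sum_s (up l k s - up k l s) * conn s b a
  + \sum_s (up k b s * conn l s a - up l b s * conn k s a).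
Proof.
have eta0 i : mxD i eta = 0 by apply/matrixP => p q; rewrite !mxE etaD.
have oE i j : omx i j *m eta = mxD i (frame_conn j) - mxD j (frame_conn i)
    + theta j *m frame_conn i - theta i *m frame_conn j.
  rewrite /omx /frame_conn (mxDM i (theta j)) (mxDM j (theta i)).
  rewrite !eta0 !mulmx0 !addr0 !(mulmxBl, mulmxDl) -!mulmxA.
done.
have frd_conn p q : frd p (conn q b a) = \sum_j frd p (E q j) * frame_conn j b a
    + \sum_i \sum_j E p i * E q j * D i (frame_conn j b a).
  rewrite /conn raddf_sum /=; under eq_bigr do rewrite frdM.
  rewrite big_split /=; congr (_ + _); rewrite exchange_big /=.
  apply: eq_bigr => j _; rewrite /frd mulr_sumr.
  by apply: eq_bigr => i _; ring.
have tc p q : \sum_i \sum_j E p i * E q j * (theta j *m frame_conn i) b a =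
    \sum_s up q b s * conn p s a.
  rewrite /up /conn.
  under [RHS]eq_bigr do rewrite mulr_suml.
  under [RHS]eq_bigr => s _ do under eq_bigr do rewrite mulr_sumr.
  rewrite [RHS]exchange_big /= [LHS]exchange_big /=; apply: eq_bigr => j _.
  rewrite [RHS]exchange_big /=; apply: eq_bigr => i _.
  by rewrite mxE mulr_sumr; apply: eq_bigr => s _; ring.
rewrite /curv /con2; under eq_bigr => i _ do under eq_bigr => j _
  do rewrite oE !(addmxE, oppmxE) !(mulrBr, mulrDr).
under eq_bigr do rewrite sumrB big_split sumrB /=.
rewrite sumrB big_split sumrB /= tc.
have -> : \sum_i \sum_j E l i * E k j * (theta i *m frame_conn j) b a =
    \sum_s up l b s * conn k s a.
  rewrite -tc [RHS]exchange_big; apply: eq_bigr => i _; apply: eq_bigr => j _ /=.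
  by rewrite [E k j * _]mulrC.
rewrite !frd_conn sumrB.
have -> : \sum_s (up l k s - up k l s) * conn s b a =
    \sum_j frd l (E k j) * frame_conn j b a
    - \sum_j frd k (E l j) * frame_conn j b a.
  rewrite -sumrB; under [RHS]eq_bigr do rewrite -mulrBl frd_E mulr_suml.
  rewrite [RHS]exchange_big; apply: eq_bigr => s _ /=.
  by rewrite /conn mulr_sumr; apply: eq_bigr => j _; rewrite mulrA.
have -> : \sum_i \sum_j E l i * E k j * (mxD i (frame_conn j)) b a =
    \sum_i \sum_j E l i * E k j * D i (frame_conn j b a).
  by apply: eq_bigr => i _; apply: eq_bigr => j _; rewrite mxE.
have -> : \sum_i \sum_j E l i * E k j * (mxD j (frame_conn i)) b a =
    \sum_i \sum_j E k i * E l j * D i (frame_conn j b a).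
  rewrite [RHS]exchange_big; apply: eq_bigr => i _; apply: eq_bigr => j _ /=.
  by rewrite mxE [E k j * _]mulrC.
ring.
Qed.

Definition con4 (T : 'I_n -> 'I_n -> 'I_n -> 'I_n -> K) a b l m : K :=
  \sum_k \sum_p \sum_i \sum_j T k p i j * E a k * E b p * E l i * E m j.

Lemma eq_con4 T T' a b l m : (forall k p i j, T k p i j = T' k p i j) ->
  con4 T a b l m = con4 T' a b l m.
Proof.
move=> e; apply: eq_bigr => k _; apply: eq_bigr => p _; apply: eq_bigr => i _.
by apply: eq_bigr => j _; rewrite e.
Qed.

Lemma con4D T T' a b l m :
  con4 (fun k p i j => T k p i j + T' k p i j) a b l m =
  con4 T a b l m + con4 T' a b l m.
Proof.
rewrite /con4 -big_split; apply: eq_bigr => k _ /=.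
rewrite -big_split; apply: eq_bigr => p _ /=.
rewrite -big_split; apply: eq_bigr => i _ /=.
by rewrite -big_split; apply: eq_bigr => j _ /=; rewrite !mulrDl.
Qed.

Lemma con4Z c T a b l m :
  con4 (fun k p i j => c * T k p i j) a b l m = c * con4 T a b l m.
Proof.
rewrite /con4 mulr_sumr; apply: eq_bigr => k _.
rewrite mulr_sumr; apply: eq_bigr => p _; rewrite mulr_sumr; apply: eq_bigr => i _.
by rewrite mulr_sumr; apply: eq_bigr => j _; rewrite !mulrA.
Qed.

Lemma con4N T a b l m :
  con4 (fun k p i j => - T k p i j) a b l m = - con4 T a b l m.
Proof.
rewrite -mulN1r -con4Z; apply: eq_con4 => *; exact/esym/mulN1r.
Qed.

Lemma con4_34 T a b l m :
  con4 (fun k p i j => T k p j i) a b l m = con4 T a b m l.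
Proof.
apply: eq_bigr => k _; apply: eq_bigr => p _; rewrite exchange_big.
by apply: eq_bigr => j _; apply: eq_bigr => i _ /=; rewrite mulrAC.
Qed.

Lemma con4_12 T a b l m :
  con4 (fun k p i j => T p k i j) a b l m = con4 T b a l m.
Proof.
rewrite /con4 exchange_big; apply: eq_bigr => p _; apply: eq_bigr => k _ /=.
apply: eq_bigr => i _; apply: eq_bigr => j _; ring.
Qed.

Lemma con4_cyc T a b l m :
  con4 (fun k p i j => T k i j p) a b l m = con4 T a l m b.
Proof.
apply: eq_bigr => k _; rewrite exchange_big; apply: eq_bigr => i _ /=.
rewrite exchange_big; apply: eq_bigr => j _ /=; apply: eq_bigr => p _; ring.
Qed.

Lemma con4_prod T T' a b l m :
  con4 (fun k p i j => T k i * T' p j) a b l m = con2 T a l * con2 T' b m.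
Proof.
rewrite /con2 mulr_suml; apply: eq_bigr => k _.
rewrite exchange_big mulr_suml; apply: eq_bigr => i _ /=.
rewrite mulr_sumr; apply: eq_bigr => p _; rewrite mulr_sumr.
by apply: eq_bigr => j _; ring.
Qed.

(** Bridge between the Cartan form of the curvature, from which the structure equations are read,
    and the coordinate form, in which the cyclic symmetry and the Ricci and Weyl tensors are
    expressed. *)
Lemma curv_riem a b l m : curv a b l m = con4 riem a b l m.
Proof.
have e i j : (omx i j *m eta) b a =
    \sum_k \sum_p riem k p i j * E a k * E b p.
  rewrite -EgE !mulmxA -frame_curv mxE; apply: eq_bigr => k _.
  rewrite -mulmxA mxE mulr_suml; apply: eq_bigr => p _.
  have -> : (rmx i j *m g) p k = riem k p i j.
    rewrite mxE; apply: eq_bigr => q _.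
    by rewrite rmxE -[in LHS]gT mxE mulrC.
  rewrite mxE; ring.
rewrite /curv /con2; under eq_bigr => i _ do under eq_bigr => j _ do rewrite e mulr_sumr.
rewrite /con4.
transitivity (\sum_i \sum_k \sum_j \sum_p
    E l i * E m j * (riem k p i j * E a k * E b p)).
  apply: eq_bigr => i _; rewrite exchange_big; apply: eq_bigr => k _ /=.
  by apply: eq_bigr => j _; rewrite mulr_sumr.
rewrite exchange_big; apply: eq_bigr => k _ /=.
under eq_bigr do rewrite exchange_big; rewrite exchange_big.
apply: eq_bigr => p _ /=; apply: eq_bigr => i _; apply: eq_bigr => j _ /=; ring.
Qed.

Lemma curv_anti34 a b l m : curv a b m l = - curv a b l m.
Proof.
rewrite !curv_riem -con4_34 -con4N; apply: eq_con4 => k p i j.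
rewrite /riem -sumrN; apply: eq_bigr => q _; rewrite /riemup -mulrN; congr (_ * _).
by rewrite opprD opprB; congr (_ + _); rewrite -sumrN; apply: eq_bigr => r _; rewrite opprB.
Qed.

Lemma frame_curv_anti i j : (omx i j *m eta)^T = - (omx i j *m eta).
Proof.
have eta0 k : mxD k eta = 0 by apply/matrixP => p q; rewrite !mxE etaD.
have oE : omx i j *m eta = mxD i (frame_conn j) - mxD j (frame_conn i)
    + frame_conn j *m etai *m frame_conn i - frame_conn i *m etai *m frame_conn j.
  rewrite /omx /frame_conn (mxDM i (theta j)) (mxDM j (theta i)).
  rewrite !eta0 !mulmx0 !addr0 !(mulmxBl, mulmxDl) -!mulmxA.
  by rewrite ![eta *m (etai *m _)]mulmxA etaiK !mul1mx.
rewrite oE; move: (frame_conn_anti i) (frame_conn_anti j).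
move: (frame_conn i) (frame_conn j) => x y ex ey.
have tr (A B : 'M[K]_n) : A^T = - A -> B^T = - B -> forall p q,
    (A *m etai *m B) q p = (B *m etai *m A) p q.
  move=> eA eB p q; have -> : (A *m etai *m B) q p = (A *m etai *m B)^T p q.
    by rewrite [RHS]mxE.
  by rewrite !trmx_mul etaiT eA eB !(mulNmx, mulmxN, opprK) mulmxA.
have trD k (A : 'M[K]_n) : A^T = - A -> forall p q, mxD k A q p = - mxD k A p q.
  by move=> eA p q; rewrite !mxE -raddfN -[in RHS]oppmxE -eA mxE.
apply/matrixP => p q; rewrite mxE !(addmxE, oppmxE).
rewrite (tr _ _ ex ey p q) (tr _ _ ey ex p q) (trD i y ey p q) (trD j x ex p q); ring.
Qed.

Lemma curv_anti12 a b l m : curv b a l m = - curv a b l m.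
Proof.
rewrite /curv /con2 -sumrN; apply: eq_bigr => i _; rewrite -sumrN.
apply: eq_bigr => j _; rewrite -mulrN; congr (_ * _).
by have /matrixP/(_ b a) := frame_curv_anti i j; rewrite mxE oppmxE.
Qed.

(** First Bianchi identity, proved in coordinates, where it reduces to the symmetry of the
    Christoffel symbols in their lower indices. *)
Lemma curv_cyc a b l m : curv a b l m + curv a l m b + curv a m b l = 0.
Proof.
rewrite !curv_riem -(con4_cyc riem a b) -(con4_cyc riem a l m b).
rewrite -(con4_cyc (fun k p i j => riem k i j p) a b l m) -!con4D -[RHS](mul0r (con4 riem a b l m)) -con4Z; apply: eq_con4 => k p i j.
rewrite mul0r /riem -!big_split big1 //= => q _; rewrite -!mulrDr.
suff -> : riemup q p i j + riemup q i j p + riemup q j p i = 0 by rewrite mulr0.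
rewrite /riemup !sumrB (christC q j i) (christC q j p) (christC q i p).
have e x y z : \sum_(m0 < n) christ q x m0 * christ m0 y z =
    \sum_(m0 < n) christ q x m0 * christ m0 z y.
  by apply: eq_bigr => r _; rewrite (christC r y z).
rewrite (e i p j) (e j p i) (e p j i); ring.
Qed.

Lemma curv_sym a b l m : curv l m a b = curv a b l m.
Proof.
apply: (pair_symmetry half2 (T := curv)).
- by move=> *; exact: curv_anti12.
- by move=> *; exact: curv_anti34.
- exact: curv_cyc.
Qed.

Definition con3 (T : 'I_n -> 'I_n -> 'I_n -> K) l m k : K :=
  \sum_a \sum_i \sum_j E l a * E m i * E k j * T a i j.

Lemma eq_con3 T T' l m k : (forall a i j, T a i j = T' a i j) ->
  con3 T l m k = con3 T' l m k.
Proof.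
move=> e; apply: eq_bigr => a _; apply: eq_bigr => i _.
by apply: eq_bigr => j _; rewrite e.
Qed.

Lemma con3D T T' l m k :
  con3 (fun a i j => T a i j + T' a i j) l m k = con3 T l m k + con3 T' l m k.
Proof.
rewrite /con3 -big_split; apply: eq_bigr => a _ /=.
rewrite -big_split; apply: eq_bigr => i _ /=.
by rewrite -big_split; apply: eq_bigr => j _ /=; rewrite mulrDr.
Qed.

Lemma con3_cyc T l m k : con3 (fun a i j => T i j a) l m k = con3 T m k l.
Proof.
rewrite /con3 exchange_big; apply: eq_bigr => i _ /=.
rewrite exchange_big; apply: eq_bigr => j _ /=; apply: eq_bigr => a _; ring.
Qed.

Lemma con3_cyc_sum T l m k : con3 T l m k + con3 T m k l + con3 T k l m =
  con3 (fun a i j => T a i j + T i j a + T j a i) l m k.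
Proof.
rewrite -(con3_cyc T l m k) -(con3_cyc T m k l).
by rewrite -(con3_cyc (fun a i j => T i j a) l m k) -!con3D.
Qed.

Lemma con3_frd T l m k : con3 (fun a i j => D a (T i j)) l m k =
  \sum_i \sum_j E m i * E k j * frd l (T i j).
Proof.
rewrite /con3 exchange_big; apply: eq_bigr => i _ /=.
rewrite exchange_big; apply: eq_bigr => j _ /=.
by rewrite /frd mulr_sumr; apply: eq_bigr => a _; ring.
Qed.

Lemma con3_lin (T : 'I_n -> 'I_n -> 'I_n -> K) (X : 'I_n -> 'I_n -> K) l m k :
  con3 (fun a i j => \sum_s X a s * T s i j) l m k =
  \sum_s (\sum_a E l a * X a s) * con2 (T s) m k.
Proof.
under [RHS]eq_bigr do rewrite mulr_suml.
rewrite [RHS]exchange_big; apply: eq_bigr => a _ /=.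
transitivity (\sum_s \sum_i \sum_j E l a * X a s * (E m i * E k j * T s i j)).
  rewrite [RHS]exchange_big; apply: eq_bigr => i _ /=.
  rewrite [RHS]exchange_big; apply: eq_bigr => j _ /=.
  rewrite mulr_sumr; apply: eq_bigr => s _; ring.
apply: eq_bigr => s _; rewrite /con2 mulr_sumr; apply: eq_bigr => i _.
by rewrite mulr_sumr.
Qed.

(** Not the full covariant derivative: the last two slots are corrected only through the bracket of
    e_l and e_m. In a cyclic sum over l, m, k this amounts to the same, the connection being
    torsion-free and the curvature antisymmetric in those slots. *)
Definition curv_cov a b l m k : K := frd l (curv a b m k)
  - \sum_s up l a s * curv s b m k - \sum_s up l b s * curv a s m k
  - \sum_s (up l m s - up m l s) * curv a b s k.

(** The matrix identity [bianchi_coord], with one index lowered by [eta] and contracted with three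
    frame vectors. *)
Lemma bianchi_frame a b l m k :
  curv_cov a b l m k + curv_cov a b m k l + curv_cov a b k l m = 0.
Proof.
pose T i j := (omx i j *m eta) b a.
have eta0 c : mxD c eta = 0 by apply/matrixP => p q; rewrite !mxE etaD.
have Tanti i j : T i j = - T j i.
  rewrite /T -oppmxE -mulNmx; congr ((_ *m _) _ _); rewrite /omx.
  by apply/matrixP => p q; rewrite !(addmxE, oppmxE); ring.
have low c s : (etai *m frame_conn c) s a = - theta c a s.
  have -> : etai *m frame_conn c = - (theta c)^T.
    rewrite -[frame_conn c]opprK -frame_conn_anti /frame_conn trmx_mul etaT.
    by rewrite mulmxN mulmxA etaiK' mul1mx.
  by rewrite oppmxE mxE.
pose Z c i j := D c (T i j) + \sum_s - theta c a s * (omx i j *m eta) b s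
  + \sum_s - theta c b s * (omx i j *m eta) s a.
have ZE c i j : (((mxD c (omx i j) + omx i j *m theta c - theta c *m omx i j)
     *m eta) b a) = Z c i j.
  have dE : mxD c (omx i j) *m eta = mxD c (omx i j *m eta).
    by rewrite (mxDM c (omx i j) eta) eta0 mulmx0 addr0.
  rewrite mulmxBl mulmxDl dE !(addmxE, oppmxE); congr (_ + _ + _).
  - by rewrite mxE.
  - have -> : omx i j *m theta c *m eta = omx i j *m eta *m (etai *m frame_conn c).
      by rewrite /frame_conn -!mulmxA [eta *m (etai *m _)]mulmxA etaiK mul1mx.
    by rewrite mxE; apply: eq_bigr => s _; rewrite low mulrC.
  - by rewrite -mulmxA mxE -sumrN; apply: eq_bigr => s _; rewrite mulNr.
have H : con3 Z l m k + con3 Z m k l + con3 Z k l m = 0.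
  rewrite con3_cyc_sum /con3 big1 // => c _; rewrite big1 // => i _; rewrite big1 // => j _.
  rewrite -!ZE -!addmxE -!mulmxDl bianchi_coord mul0mx mxE mulr0 //.
(* Differentiating a frame component also differentiates the frame vectors in its last two slots.
   These unwanted terms are isolated here; [com] pairs them over the cyclic sum into bracket
   coefficients. *)
have con3Z u v w : con3 Z u v w = frd u (curv a b v w)
    - \sum_s up u a s * curv s b v w - \sum_s up u b s * curv a s v w
    - (\sum_i \sum_j frd u (E v i) * E w j * T i j
       - \sum_i \sum_j frd u (E w i) * E v j * T i j).
  rewrite /Z !con3D con3_frd (con3_lin (fun s i j => (omx i j *m eta) b s)).
  rewrite (con3_lin (fun s i j => (omx i j *m eta) s a)).
  have upN c : forall s, \sum_a0 E u a0 * - theta a0 c s = - up u c s.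
    by move=> s; rewrite /up -sumrN; apply: eq_bigr => ? _; rewrite mulrN.
  have -> : \sum_s (\sum_a0 E u a0 * - theta a0 a s)
      * con2 (fun i j => (omx i j *m eta) b s) v w = - \sum_s up u a s * curv s b v w.
    by rewrite -sumrN; apply: eq_bigr => s _; rewrite upN mulNr.
  have -> : \sum_s (\sum_a0 E u a0 * - theta a0 b s)
      * con2 (fun i j => (omx i j *m eta) s a) v w = - \sum_s up u b s * curv a s v w.
    by rewrite -sumrN; apply: eq_bigr => s _; rewrite upN mulNr.
  have -> : \sum_i \sum_j frd u (E w i) * E v j * T i j =
      - \sum_i \sum_j E v i * frd u (E w j) * T i j.
    rewrite exchange_big -sumrN; apply: eq_bigr => i _ /=.
    by rewrite -sumrN; apply: eq_bigr => j _; rewrite Tanti; ring.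
  rewrite /curv frd_con2 -/T; ring.
have com u v w : \sum_i \sum_j frd u (E v i) * E w j * T i j
    - \sum_i \sum_j frd v (E u i) * E w j * T i j =
    \sum_s (up u v s - up v u s) * curv a b s w.
  rewrite -sumrB; under eq_bigr do rewrite -sumrB.
  transitivity (\sum_i \sum_s \sum_j (up u v s - up v u s) * (E s i * E w j * T i j)).
    apply: eq_bigr => i _; rewrite exchange_big; apply: eq_bigr => j _ /=.
    rewrite -!mulrBl frd_E !mulr_suml; apply: eq_bigr => s _; ring.
  rewrite exchange_big; apply: eq_bigr => s _ /=.
  rewrite /curv /con2 mulr_sumr; apply: eq_bigr => i _.
  by rewrite mulr_sumr.
move: H; rewrite !con3Z /curv_cov -!com => h; apply: (eq_of_diff 1 h); ring.
Qed.

Definition ric i j : K := \sum_k riemup k i k j.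
Definition scal : K := \sum_i \sum_j ginv i j * ric i j.

Lemma ginvT : ginv^T = ginv.
Proof. by rewrite /ginv !trmx_mul trmxK etaiT mulmxA. Qed.

Lemma con2_g a b : con2 (fun i j => g i j) a b = eta a b.
Proof.
rewrite -EgE /con2 -mulmxA mxE; apply: eq_bigr => i _.
rewrite mxE mulr_sumr; apply: eq_bigr => j _; rewrite mxE; ring.
Qed.

Lemma riemupE k l i j : riemup k l i j = \sum_m ginv k m * riem m l i j.
Proof.
under eq_bigr do rewrite mulr_sumr; rewrite exchange_big /=.
have gg : ginv *m g = 1%:M by exact: mulmx1C ginvP.
have ggE m : \sum_p ginv k p * g p m = (k == m)%:R.
  by have := congr1 (fun A : 'M[K]_n => A k m) gg; rewrite !mxE.
rewrite (eq_bigr (fun m => (k == m)%:R * riemup m l i j)); last first.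
  by move=> m _; rewrite -ggE mulr_suml; apply: eq_bigr => p _; rewrite mulrA.
rewrite (bigD1 k) //= eqxx mul1r big1 ?addr0 // => m /negbTE.
by rewrite eq_sym => ->; rewrite mul0r.
Qed.

Lemma ricE b k : con2 ric b k = \sum_a \sum_l etai a l * curv a b l k.
Proof.
have e i j : ric i j = \sum_a \sum_l etai a l *
    (\sum_p \sum_q riem p i q j * E a p * E l q).
  rewrite /ric; under eq_bigr do rewrite riemupE.
  have gE q p : ginv q p = \sum_a \sum_l etai a l * (E a p * E l q).
    rewrite -ginvT mxE /ginv mxE exchange_big; apply: eq_bigr => l _ /=.
    rewrite mxE mulr_suml; apply: eq_bigr => a _; rewrite mxE; ring.
  transitivity (\sum_q \sum_p \sum_a \sum_l etai a l * (riem p i q j * E a p * E l q)).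
    apply: eq_bigr => q _; apply: eq_bigr => p _; rewrite gE mulr_suml.
    apply: eq_bigr => a _; rewrite mulr_suml; apply: eq_bigr => l _; ring.
  rewrite exchange_big /=.
  under eq_bigr do rewrite exchange_big /=.
  rewrite exchange_big; apply: eq_bigr => a _ /=.
  under eq_bigr do rewrite exchange_big /=.
  rewrite exchange_big; apply: eq_bigr => l _ /=; rewrite mulr_sumr.
  by apply: eq_bigr => p _; rewrite mulr_sumr.
rewrite /con2; under eq_bigr => i _ do under eq_bigr do rewrite e mulr_sumr.
under eq_bigr do rewrite exchange_big /=.
rewrite exchange_big; apply: eq_bigr => a _ /=.
under eq_bigr => i _ do under eq_bigr do rewrite mulr_sumr.
under eq_bigr do rewrite exchange_big /=.
rewrite exchange_big; apply: eq_bigr => l _ /=.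
rewrite curv_riem /con4.
transitivity (\sum_i \sum_j \sum_p \sum_q
   etai a l * (riem p i q j * E a p * E b i * E l q * E k j)).
  apply: eq_bigr => i _; apply: eq_bigr => j _; rewrite mulrCA mulr_sumr mulr_sumr.
  apply: eq_bigr => p _; rewrite !mulr_sumr; apply: eq_bigr => q _; ring.
rewrite mulr_sumr; under eq_bigr do rewrite exchange_big /=.
rewrite exchange_big; apply: eq_bigr => p _ /=.
rewrite mulr_sumr; apply: eq_bigr => i _; rewrite exchange_big mulr_sumr.
by apply: eq_bigr => q _ /=; rewrite mulr_sumr.
Qed.

Lemma con2_ginv (T : 'I_n -> 'I_n -> K) :
  \sum_i \sum_j ginv i j * T i j = \sum_a \sum_b etai a b * con2 T a b.
Proof.
transitivity (\sum_i \sum_j \sum_b \sum_a etai a b * (E a i * E b j * T i j)).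
  apply: eq_bigr => i _; apply: eq_bigr => j _.
  rewrite /ginv mxE mulr_suml; apply: eq_bigr => b _; rewrite mxE !mulr_suml.
  apply: eq_bigr => a _; rewrite mxE; ring.
under eq_bigr do rewrite exchange_big /=.
rewrite exchange_big /= [RHS]exchange_big; apply: eq_bigr => b _ /=.
under eq_bigr do rewrite exchange_big /=.
rewrite exchange_big; apply: eq_bigr => a _ /=.
by rewrite /con2 mulr_sumr; apply: eq_bigr => i _; rewrite mulr_sumr.
Qed.

Section Maxwell.
Variable F : 'M[K]_n.

Definition dF k i j : K := D k (F i j)
  - \sum_m christ m k i * F m j - \sum_m christ m k j * F i m.

Definition ff a b : K := con2 (fun i j => F i j) a b.

Lemma ffE a b : ff a b = (E *m F *m E^T) a b.
Proof.
rewrite /ff /con2 -mulmxA mxE; apply: eq_bigr => i _.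
rewrite mxE mulr_sumr; apply: eq_bigr => j _; rewrite mxE; ring.
Qed.

Definition ff_cov l a b : K := frd l (ff a b)
  - \sum_s up l a s * ff s b - \sum_s up l b s * ff a s.

Lemma dF_frame l a b : con3 dF l a b = ff_cov l a b.
Proof.
have e k i j : dF k i j = (mxD k F - cmx k *m F - F *m (cmx k)^T) i j.
  rewrite !(addmxE, oppmxE) /dF; congr (_ - _ - _); rewrite mxE //.
    by apply: eq_bigr => m _; rewrite mxE.
  by apply: eq_bigr => m _; rewrite !mxE mulrC.
have mE k : E *m (mxD k F - cmx k *m F - F *m (cmx k)^T) *m E^T =
    mxD k (E *m F *m E^T) - theta k *m (E *m F *m E^T)
    - (E *m F *m E^T) *m (theta k)^T.
  have tE : (mxD k E)^T = E^T *m (theta k)^T - (cmx k)^T *m E^T.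
    rewrite (theta_def k) -!trmx_mul; apply/matrixP => p q.
    rewrite [LHS]mxE !(addmxE, oppmxE); congr (_ - _); by rewrite [RHS]mxE.
  rewrite (mxDM k (E *m F)) (mxDM k E) mxDT tE (theta_def k).
  rewrite !(mulmxBl, mulmxBr, mulmxDl, mulmxDr) !mulmxA.
  by apply/matrixP => p q; rewrite !(addmxE, oppmxE, mulNmx, mulmxN) !mulmxA; ring.
transitivity (\sum_k E l k * (E *m (mxD k F - cmx k *m F - F *m (cmx k)^T) *m E^T) a b).
  apply: eq_bigr => k _; rewrite -mulmxA mxE mulr_sumr; apply: eq_bigr => i _.
  rewrite mxE !mulr_sumr; apply: eq_bigr => j _; rewrite e [E^T _ _]mxE; ring.
under eq_bigr do rewrite mE !(addmxE, oppmxE) !mulrBr.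
rewrite !sumrB /ff_cov; congr (_ - _ - _).
- by rewrite /frd; apply: eq_bigr => k _; rewrite mxE ffE.
- under [RHS]eq_bigr do rewrite /up mulr_suml.
  rewrite [RHS]exchange_big; apply: eq_bigr => k _ /=; rewrite mxE mulr_sumr.
  by apply: eq_bigr => s _; rewrite ffE mulrA.
- under [RHS]eq_bigr do rewrite /up mulr_suml.
  rewrite [RHS]exchange_big; apply: eq_bigr => k _ /=; rewrite mxE mulr_sumr.
  apply: eq_bigr => s _; rewrite ffE [(theta k)^T _ _]mxE; ring.
Qed.
End Maxwell.

End FrameGeometry.

Lemma derivation_nat (K : pzRingType) (d : {additive K -> K}) (n : nat) :
  (forall x y, d (x * y) = d x * y + x * d y) -> d n%:R = 0.
Proof.
move=> dM; have d1 : d 1 = 0.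
  have := dM 1 1; rewrite mulr1 mul1r mulr1 => /eqP.
  by rewrite -subr_eq subrr eq_sym => /eqP.
by rewrite raddfMn d1 mul0rn.
Qed.

(** * Decoupling the linearised equations on the Kerr-Newman background *)

Section KerrNewmanAlgebra.
Context {K : comPzRingType}.
Variables (d3 d4 dm db : {additive K -> K}).
Hypothesis d3M : forall x y, d3 (x * y) = d3 x * y + x * d3 y.
Hypothesis d4M : forall x y, d4 (x * y) = d4 x * y + x * d4 y.
Hypothesis dmM : forall x y, dm (x * y) = dm x * y + x * dm y.
Hypothesis dbM : forall x y, db (x * y) = db x * y + x * db y.
(* [a] and [b] are 1/(2q) and its conjugate, [s] is i a sin(theta)/|q| and
   [ct] is cot(theta)/|q|. *)
Variables (a b s ct M Q : K).
Let D := 1 - s * s - 2 * M * (a + b) + 4 * Q * Q * a * b.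

(** The differential algebra of Kerr-Newman: constants, derivatives of the generators, the relation
    between [s] and [ct], and three commutators. Every identity of this section is checked modulo
    this table. *)
Record kn_background : Prop := KNBackground {
  kn_d3M : d3 M = 0; kn_d4M : d4 M = 0; kn_dmM : dm M = 0; kn_dbM : db M = 0;
  kn_d3Q : d3 Q = 0; kn_d4Q : d4 Q = 0; kn_dmQ : dm Q = 0; kn_dbQ : db Q = 0;
  kn_d4a : d4 a = - (2 * a * a); kn_d4b : d4 b = - (2 * b * b);
  kn_d4s : d4 s = - (s * (a + b)); kn_d4ct : d4 ct = - (ct * (a + b));
  kn_dma : dm a = 2 * s * a * a; kn_dmb : dm b = - (2 * s * b * b);
  kn_dms : dm s = (b - a) * (1 - s * s);
  kn_dba : db a = 2 * s * a * a; kn_dbb : db b = - (2 * s * b * b);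
  kn_dbs : db s = (b - a) * (1 - s * s);
  kn_d3a : d3 a = 2 * D * a * a; kn_d3b : d3 b = 2 * D * b * b;
  kn_d3s : d3 s = D * s * (a + b); kn_d3ct : d3 ct = D * ct * (a + b);
  kn_sct : s * ct = b - a;
  kn_comm4m : forall f, d4 (dm f) - dm (d4 f) = - ((a + b) * dm f);
  kn_comm3m : forall f, d3 (dm f) - dm (d3 f) =
    2 * s * (b - a) * d3 f + D * (a + b) * dm f;
  kn_comm3b : forall f, d3 (db f) - db (d3 f) =
    2 * s * (b - a) * d3 f + D * (a + b) * db f
}.
Hypothesis kn : kn_background.

(** Background values of the conformal and rotational parts of the connection along e_3, e_4, m, mb.
    Here [nu3] is -2 omegab, the value along e_4 is 2 omega = 0, and [num] and [nub] are the
    components of Z and its conjugate. The [mu] family is i g(D e_1, e_2). *)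
Let nu3 := 2 * D * (a + b) + 8 * M * a * b - 2 * a - 2 * b.
Let num := 2 * s * a.
Let nub := - (2 * s * b).
Let mu3 := D * (b - a).
Let mu4 := b - a.
Let mum := s * (b - a) - ct.
Let mub := ct - s * (b - a).

(* Conformal derivatives on quantities of type [p] and spin [k]. *)
Definition cder3 (p k : K) f := d3 f + (p * nu3 + k * mu3) * f.
Definition cder4 (p k : K) f := d4 f + (k * mu4) * f.
Definition cderm (p k : K) f := dm f + (p * num + k * mum) * f.
Definition cderb (p k : K) f := db f + (p * nub + k * mub) * f.

Let T := 4 * b.
Let Tc := 4 * a.
Let TB := - (4 * D * b).
Let TBc := - (4 * D * a).
Let H := 2 * s * b.
Let Hb := - (2 * s * a).
Let Hc := - (2 * s * a).
Let Hbc := 2 * s * b.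
Let PF := 4 * Q * b * b.
Let PFc := 4 * Q * a * a.
Let Pc := 32 * Q * Q * a * b * b * b - 16 * M * b * b * b.
Let P := 32 * Q * Q * a * a * a * b - 16 * M * a * a * a.

Variables (half A B ph xi sg : K).
Hypothesis half2 : half + half = 1.
(* Linearised components: [ph] is half of [B_F], [sg] is [Xhat]. *)
Let F := PF * sg - cderm 1 1 ph - 3 * H * ph.
Let X := 2 * cder4 1 1 ph + 3 * T * ph - 2 * PF * xi.
Let W := 2 * PF * B - 6 * Pc * ph.

(** The inputs of the decoupling: two linearised Bianchi identities for [B], the transport of the
    shear along e_4, and a relation extracted from the Maxwell equations. They are established as
    [lin_D4B], [lin_DmB], [lin_D4X] and [lin_D3X]. *)
Hypothesis eq_D4B : cder4 1 1 B = cderb 2 2 A + Hbc * A - 2 * T * B + 3 * Pc * xi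
  + PFc * (X - 3 * T * ph).
Hypothesis eq_DmB : cderm 1 1 B = cder3 2 2 A - 2 * D * b * A - 4 * H * B + 3 * Pc * sg
  + PFc * (2 * F + 6 * H * ph).
Hypothesis eq_D4X : cder4 1 2 sg = cderm 2 1 xi - (2 * b + 2 * a) * sg + (H + Hb) * xi - A.
Hypothesis eq_D3X : cder3 2 1 X + 2 * cderb 1 2 F - 2 * D * a * X + 2 * Hc * F + 2 * W = 0.

Let d_nat (d : {additive K -> K}) (n : nat) :
  (forall x y, d (x * y) = d x * y + x * d y) -> d n%:R = 0.
Proof. exact: derivation_nat. Qed.

Let d1E := (@d_nat d3 1 d3M, @d_nat d4 1 d4M, @d_nat dm 1 dmM, @d_nat db 1 dbM).
Let d2E := (@d_nat d3 2 d3M, @d_nat d4 2 d4M, @d_nat dm 2 dmM, @d_nat db 2 dbM).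
Let d3E := (@d_nat d3 3 d3M, @d_nat d4 3 d4M, @d_nat dm 3 dmM, @d_nat db 3 dbM).
Let d4E := (@d_nat d3 4 d3M, @d_nat d4 4 d4M, @d_nat dm 4 dmM, @d_nat db 4 dbM).
Let d6E := (@d_nat d3 6 d3M, @d_nat d4 6 d4M, @d_nat dm 6 dmM, @d_nat db 6 dbM).
Let d8E := (@d_nat d3 8 d3M, @d_nat d4 8 d4M, @d_nat dm 8 dmM, @d_nat db 8 dbM).
Let d16E := (@d_nat d3 16 d3M, @d_nat d4 16 d4M, @d_nat dm 16 dmM, @d_nat db 16 dbM).
Let d32E := (@d_nat d3 32 d3M, @d_nat d4 32 d4M, @d_nat dm 32 dmM, @d_nat db 32 dbM).
Let dE := (raddfD d3, raddfD d4, raddfD dm, raddfD db,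
  raddfN d3, raddfN d4, raddfN dm, raddfN db, d3M, d4M, dmM, dbM,
  d1E, d2E, d3E, d4E, d6E, d8E, d16E, d32E,
  (kn_d3M kn, kn_d4M kn, kn_dmM kn, kn_dbM kn,
   kn_d3Q kn, kn_d4Q kn, kn_dmQ kn, kn_dbQ kn),
  (kn_d3a kn, kn_d3b kn, kn_d3s kn, kn_d3ct kn,
   kn_d4a kn, kn_d4b kn, kn_d4s kn, kn_d4ct kn),
  (kn_dma kn, kn_dmb kn, kn_dms kn, kn_dba kn, kn_dbb kn, kn_dbs kn)).

Let unfE := (cder3, cder4, cderm, cderb).

(** The weights of B and B_F in frakB are such that, with the background derivatives of P_F and of
    the conjugate of P, all loose terms in [ph] and [xi] recombine into [W] and [X]. *)
Lemma eq_D4W : cder4 1 1 W =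
  2 * PF * (cderb 2 2 A + Hbc * A) - 3 * T * W + (2 * PF * PFc - 3 * Pc) * X.
Proof.
apply: (eq_of_diff (2 * PF) eq_D4B).
rewrite /W /X /cder4 /cderb /PF /PFc /Pc /T /Hbc /mu4 !dE; ring.
Qed.

Let comm4m f : d4 (dm f) = dm (d4 f) - (a + b) * dm f.
Proof. by rewrite -[LHS](subrK (dm (d4 f))) (kn_comm4m kn) addrC. Qed.
Let comm3m f : d3 (dm f) = dm (d3 f) + 2 * s * (b - a) * d3 f + D * (a + b) * dm f.
Proof. by rewrite -[LHS](subrK (dm (d3 f))) (kn_comm3m kn) addrC addrA. Qed.
Let comm3b f : d3 (db f) = db (d3 f) + 2 * s * (b - a) * d3 f + D * (a + b) * db f.
Proof. by rewrite -[LHS](subrK (db (d3 f))) (kn_comm3b kn) addrC addrA. Qed.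

(** Same mechanism as [eq_D4W] along m, the loose terms in [ph] and [sg] recombining into [W] and
    [F]. *)
Lemma eq_DmW : cderm 1 1 W =
  2 * PF * (cder3 2 2 A - 2 * D * b * A) - 6 * H * W + 2 * (2 * PF * PFc + 3 * Pc) * F.
Proof.
apply: (eq_of_diff (2 * PF) eq_DmB).
rewrite /W /F /cderm /PF /PFc /Pc /H !dE; ring.
Qed.

Let Y := cder4 1 1 ph + 6 * b * ph - PF * xi.
Let XY : X = 2 * Y. Proof. rewrite /X /Y /T; ring. Qed.

(** [F] contains the m derivative of [ph] and [Y] its e_4 derivative, so after exchanging the two
    derivatives only the transport equation of the shear is needed, with weight [PF]. *)
Lemma eq_D4F : cder4 1 2 F =
  - cderm 2 1 Y - (6 * b + 2 * a) * F - (3 * H + Hb) * Y - PF * A.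
Proof.
apply: (eq_of_diff PF eq_D4X).
rewrite /F /Y /cder4 /cderm /PF /T /H /Hb /mum /num /mu4 !dE comm4m; ring.
Qed.

Lemma eq_D3Y : cder3 2 1 Y + cderb 1 2 F - 2 * D * a * Y + Hc * F + W = 0.
Proof.
have e x : half * (2 * x) = x by rewrite mulrA mulr_natr mulr2n half2 mul1r.
rewrite -[LHS]e; apply: etrans (mulr0 half); congr (half * _).
apply: etrans eq_D3X; rewrite XY /cder3 d3M d2E; ring.
Qed.

Definition T1_kn : K :=
  - cder3 2 1 (cder4 1 1 W) + cderb 1 2 (cderm 1 1 W) - 3 * T * cder3 1 1 W
  + (6 * D * b + 2 * D * a) * cder4 1 1 W + 6 * H * cderb 1 1 W + (Hc + 3 * Hbc) * cderm 1 1 W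
  + (72 * D * b * b - 4 * PF * PFc + 18 * Hbc * H) * W.
Definition M1_kn : K := 2 * PF * PFc *
  (4 * cderb 1 2 F + 8 * Hbc * F + (8 * D * b - 4 * D * a) * X).

(** After substitution the second order terms are the e_3 and mb derivatives of [A] in both orders
    with opposite signs. [comm3b] removes them. *)
Theorem T1_knE : T1_kn = M1_kn.
Proof.
rewrite /T1_kn eq_D4W eq_DmW /M1_kn.
(* The multiplier is minus the coefficient of [X] in [eq_D4W]: that term, differentiated along e_3,
   leaves exactly a multiple of the relation between [X], [F] and [W]. *)
apply: (eq_of_diff (3 * Pc - 2 * PF * PFc) eq_D3X).
move: W F X => W' F' X'.
rewrite /cder3 /cder4 /cderm /cderb /PF /PFc /Pc /H /Hbc /Hc /T !dE.
rewrite comm3b /nu3 /nub /mu3 /mub /D; ring: (kn_sct kn).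
Qed.

Definition T2_kn : K :=
  - cder3 2 2 (cder4 1 2 F) + cderm 1 1 (cderb 1 2 F) - (6 * b + 2 * a) * cder3 1 2 F
  + 2 * D * (a + b) * cder4 1 2 F + (4 * H + Hb) * cderb 1 2 F + Hc * cderm 1 2 F
  + (12 * D * b * b + 4 * D * a * a + 3 * Pc - P + 4 * PF * PFc - 3 * cderb 0 1 H) * F
  + Hb * Hc * F.
Definition M2_kn : K :=
  - PF * (cder3 2 2 A + (2 * D * a - 6 * D * b) * A) + 3 * cder3 0 1 (s * b) * X
  + (2 * H - Hb) * W.

Theorem T2_knE : T2_kn = M2_kn.
Proof.
have dbF : cderb 1 2 F = - cder3 2 1 Y + 2 * D * a * Y - Hc * F - W.
  (* With this and [eq_D4F], the second order part of T2 is the e_3 and m derivatives of [Y] in both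
     orders with opposite signs. *)
  by apply: (eq_of_diff 1 eq_D3Y); ring.
rewrite /T2_kn eq_D4F dbF /M2_kn XY.
(* The m derivative of [dbF] produces minus that of [W]. Its replacement brings minus twice [PF]
   times the e_3 derivative of [A], against plus once from [eq_D4F], whence the single [PF] in
   M2. *)
apply: (eq_of_diff (-1) eq_DmW).
move: W F Y => W' F' Y'.
rewrite /cder3 /cder4 /cderm /cderb /PF /PFc /Pc /P /H /Hb /Hc /T !dE.
rewrite comm3m /nu3 /nub /num /mu3 /mub /mum /mu4 /D; ring: (kn_sct kn).
Qed.

Definition T3_kn : K :=
  - cder4 1 2 (cder3 2 2 A) + cderm 2 1 (cderb 2 2 A) - (2 * a + 8 * b) * cder3 2 2 A
  + 2 * D * b * cder4 2 2 A + (4 * H + Hb) * cderb 2 2 A + Hbc * cderm 2 2 A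
  + (- T * TB + 2 * Pc - 2 * PF * PFc) * A + 4 * H * Hbc * A.
Definition M3_kn : K :=
  2 * PFc * (2 * cder4 1 2 F + 2 * T * F + (Hb + H) * X).

(** Teukolsky's derivation: the e_4 and m derivatives of [B] are expressed through [A], so the
    commutator of these two derivatives on [B] is a second order equation for [A]. *)
Theorem T3_knE : T3_kn = M3_kn.
Proof.
have e4B : cder4 1 1 B = cderb 2 2 A + Hbc * A - 2 * T * B + 3 * Pc * xi
  + PFc * (2 * Y - 3 * T * ph) by rewrite -XY.
have h : cderm 2 1 (cder4 1 1 B) - cder4 1 2 (cderm 1 1 B) =
    2 * s * a * cder4 1 1 B + 2 * a * cderm 1 1 B.
  rewrite /cderm /cder4 !dE comm4m /num /mum /mu4; ring: (kn_sct kn).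
rewrite e4B eq_DmB in h.
(* The commutator leaves first derivatives of [B] and of [sg]; the three further hypotheses
   eliminate them in favour of [A], [F] and [Y]. *)
apply: (eq_of_diff 1 h); apply: (eq_of_diff (8 * b) eq_DmB).
apply: (eq_of_diff (- (8 * s * b)) e4B).
apply: (eq_of_diff (3 * Pc - 2 * PF * PFc) eq_D4X).
rewrite /T3_kn /M3_kn XY /F /Y /cder3 /cder4 /cderm /cderb /PF /PFc /Pc /H /Hb /Hbc /T /TB !dE.
rewrite !comm4m /nu3 /nub /num /mu3 /mub /mum /mu4 /D; ring: (kn_sct kn).
Qed.

End KerrNewmanAlgebra.

(** * Linearising the exact frame equations at Kerr-Newman *)

Section Linearisation.
Context {K K0 : comPzRingType}.
Variables (ev : {rmorphism K -> K0}) (dl : {additive K -> K0}).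
Hypothesis dlM : forall x y, dl (x * y) = dl x * ev y + ev x * dl y.
Variables (d3 d4 dm db : {additive K -> K}) (e3 e4 em eb : {additive K0 -> K0}).
Hypothesis d3M : forall x y, d3 (x * y) = d3 x * y + x * d3 y.
Hypothesis d4M : forall x y, d4 (x * y) = d4 x * y + x * d4 y.
Hypothesis dmM : forall x y, dm (x * y) = dm x * y + x * dm y.
Hypothesis dbM : forall x y, db (x * y) = db x * y + x * db y.
Hypothesis e3M : forall x y, e3 (x * y) = e3 x * y + x * e3 y.
Hypothesis e4M : forall x y, e4 (x * y) = e4 x * y + x * e4 y.
Hypothesis emM : forall x y, em (x * y) = em x * y + x * em y.
Hypothesis ebM : forall x y, eb (x * y) = eb x * y + x * eb y.
Hypothesis evd3 : forall f, ev (d3 f) = e3 (ev f).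
Hypothesis evd4 : forall f, ev (d4 f) = e4 (ev f).
Hypothesis evdm : forall f, ev (dm f) = em (ev f).
Hypothesis evdb : forall f, ev (db f) = eb (ev f).
(** The frame itself varies with the parameter, so variation and frame derivative commute only on
    quantities that vanish in the background; otherwise the variation of the frame would enter. *)
Hypothesis dld3 : forall f, ev f = 0 -> dl (d3 f) = e3 (dl f).
Hypothesis dld4 : forall f, ev f = 0 -> dl (d4 f) = e4 (dl f).
Hypothesis dldm : forall f, ev f = 0 -> dl (dm f) = em (dl f).
Hypothesis dldb : forall f, ev f = 0 -> dl (db f) = eb (dl f).

Variables (a b s ct M Q : K0).
Let D := 1 - s * s - 2 * M * (a + b) + 4 * Q * Q * a * b.
Hypothesis kn : kn_background e3 e4 em eb a b s ct M Q.
Hypothesis kn_dmct : em ct = s * ct * (a - b) - ct * ct - 4 * a * b.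
Hypothesis kn_dbct : eb ct = s * ct * (a - b) - ct * ct - 4 * a * b.
Let nu3' := 2 * D * (a + b) + 8 * M * a * b - 2 * a - 2 * b.
Hypothesis kn_comm43 : forall f, e4 (e3 f) - e3 (e4 f) =
  nu3' * e4 f + 2 * s * (a + b) * em f - 2 * s * (a + b) * eb f.
Hypothesis kn_commmb : forall f, em (eb f) - eb (em f) =
  2 * (a - b) * (e3 f + D * e4 f) + (s * (b - a) - ct) * eb f
  + (ct - s * (b - a)) * em f.

(* Half of g(D_X e_4, m), g(D_X e_4, mb), g(D_X e_3, mb), g(D_X e_3, m),
   g(D_X e_4, e_3) and - g(D_X m, mb), for X = e_3, e_4, m, mb. *)
Variables (ta ka si rh tac kac rhc sic kp tp rp sp kpc tpc spc rpc : K).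
Variables (nu3 nu4 num nub mu3 mu4 mum mub : K).
Variables (BF BFc BbF BbFc PF PFc A B ric : K).
Variables (R13 R02 R03 s13 s23 s01 s02 z m1 m2 : K).

Hypothesis ev_ta : ev ta = 2 * s * b.
Hypothesis ev_tac : ev tac = - (2 * s * a).
Hypothesis ev_tp : ev tp = 2 * s * b.
Hypothesis ev_tpc : ev tpc = - (2 * s * a).
Hypothesis ev_rh : ev rh = 2 * b.
Hypothesis ev_rhc : ev rhc = 2 * a.
Hypothesis ev_rp : ev rp = - (2 * D * b).
Hypothesis ev_rpc : ev rpc = - (2 * D * a).
Hypothesis ev_ka : ev ka = 0. Hypothesis ev_kac : ev kac = 0.
Hypothesis ev_si : ev si = 0. Hypothesis ev_sic : ev sic = 0.
Hypothesis ev_kp : ev kp = 0. Hypothesis ev_kpc : ev kpc = 0.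
Hypothesis ev_sp : ev sp = 0. Hypothesis ev_spc : ev spc = 0.
Hypothesis ev_nu3 : ev nu3 = nu3'.
Hypothesis ev_nu4 : ev nu4 = 0.
Hypothesis ev_num : ev num = 2 * s * a.
Hypothesis ev_nub : ev nub = - (2 * s * b).
Hypothesis ev_mu3 : ev mu3 = D * (b - a).
Hypothesis ev_mu4 : ev mu4 = b - a.
Hypothesis ev_mum : ev mum = s * (b - a) - ct.
Hypothesis ev_mub : ev mub = ct - s * (b - a).
Hypothesis ev_PF : ev PF = 4 * Q * b * b.
Hypothesis ev_PFc : ev PFc = 4 * Q * a * a.
Hypothesis ev_BF : ev BF = 0. Hypothesis ev_BbFc : ev BbFc = 0.

Hypothesis ricci_ka_si : d4 si - dm ka - ka * mum - 2 * ka * num - ka * ta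
  - ka * tpc + 2 * mu4 * si + nu4 * si + rh * si + rhc * si = - A.
Hypothesis ricci_ka_ta : d3 ka - d4 ta + ka * mu3 + 2 * ka * nu3 - mu4 * ta
  - rh * ta + rh * tpc - si * tac + si * tp = B + ric.
Hypothesis ricci_si_rh : dm rh - db si - ka * rp + ka * rpc - 2 * mub * si
  - nub * si + num * rh + rh * ta - rhc * ta = B - ric.
Hypothesis ricci_rh_ta : d3 rh - db ta - ka * kp - mub * ta + nu3 * rh
  + rh * rpc + si * sp - ta * tac = R03.
Hypothesis comm4m : forall f, d4 (dm f) - dm (d4 f) =
  ka * d3 f + (num + tpc) * d4 f - (mu4 + rhc) * dm f - si * db f.
Hypothesis s23E : dm (nub + mub) - db (num + mum) - mub * num - mum * nub
  + (nu3 + mu3) * rh - (nu3 + mu3) * rhc - (nu4 + mu4) * rp + (nu4 + mu4) * rpc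
  - 2 * mub * mum - 2 * rh * rp + 2 * si * sp = s23.
Hypothesis s01E : d3 (mu4 + nu4) - d4 (mu3 + nu3) - 2 * ka * kp + mu3 * nu4
  + mu4 * nu3 - mub * ta + mub * tpc - mum * tac + mum * tp + 2 * nu3 * nu4
  - nub * ta + nub * tpc - num * tac + num * tp + 2 * ta * tp = s01.
Hypothesis s02E : d3 (mum + num) - dm (mu3 + nu3) - 2 * kp * si - kpc * mu4
  - kpc * nu4 + mu3 * mum + 2 * mu3 * num - mu3 * ta + mub * spc + mum * rp
  + nu3 * num - nu3 * ta + nub * spc + num * rp + 2 * rp * ta = s02.
Hypothesis s13E : d4 (mub + nub) - db (mu4 + nu4) + 2 * ka * sp - kac * mu3
  - kac * nu3 - mu4 * mub - 2 * mu4 * nub - mu4 * tp + mub * rh + mum * sic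
  - nu4 * nub - nu4 * tp + nub * rh + num * sic - 2 * rh * tp = s13.
Hypothesis bianchi4mb : d4 (B - ric) - db A - dm R13 + 2 * B * rh + s13 * si
  - s23 * ka + (B + ric) * (rh - rhc) + R02 * kac - R03 * ka
  - A * (2 * mub + 2 * nub + tp) - R13 * (2 * num + tpc)
  + (B - ric) * (mu4 + nu4 + rh + rhc) = 0.
Hypothesis bianchi34m : - d3 A - d4 R02 + dm (B + ric) - s01 * si + s02 * ka
  + 2 * B * ta + (B + ric) * (mum + num + ta + tpc) - R02 * (2 * mu4 + rhc)
  - R03 * si - A * (2 * mu3 + 2 * nu3 + rp) + R13 * spc + (B - ric) * (ta - tpc) = 0.
Hypothesis maxwell4 : d4 PF - db BF - BF * mub - BF * nub - BF * tp + BbFc * ka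
  + 2 * PF * rh = m1.
Hypothesis maxwellm : dm PF - d3 BF - BF * mu3 - BF * nu3 - BF * rp + BbFc * si
  + 2 * PF * ta = m2.
Hypothesis ricE : ric = BF * PFc + z.
Variable ph : K0.
Hypothesis dl_BF : dl BF = 2 * ph.
Hypothesis ev_z : ev z = 0. Hypothesis dl_z : dl z = 0.
Hypothesis ev_m1 : ev m1 = 0. Hypothesis dl_m1 : dl m1 = 0.
Hypothesis ev_m2 : ev m2 = 0. Hypothesis dl_m2 : dl m2 = 0.
Hypothesis ev_R13 : ev R13 = 0. Hypothesis dl_R13 : dl R13 = 0.
Hypothesis ev_R02 : ev R02 = 0. Hypothesis dl_R02 : dl R02 = 0.

Let d_nat (d : {additive K0 -> K0}) (n : nat) :
  (forall x y, d (x * y) = d x * y + x * d y) -> d n%:R = 0.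
Proof. exact: derivation_nat. Qed.

Let e1E := (@d_nat e3 1 e3M, @d_nat e4 1 e4M, @d_nat em 1 emM, @d_nat eb 1 ebM).
Let e2E := (@d_nat e3 2 e3M, @d_nat e4 2 e4M, @d_nat em 2 emM, @d_nat eb 2 ebM).
Let e4E := (@d_nat e3 4 e3M, @d_nat e4 4 e4M, @d_nat em 4 emM, @d_nat eb 4 ebM).
Let e8E := (@d_nat e3 8 e3M, @d_nat e4 8 e4M, @d_nat em 8 emM, @d_nat eb 8 ebM).
Let eE := (raddfD e3, raddfD e4, raddfD em, raddfD eb,
  raddfN e3, raddfN e4, raddfN em, raddfN eb, e3M, e4M, emM, ebM,
  raddf0 e3, raddf0 e4, raddf0 em, raddf0 eb, e1E, e2E, e4E, e8E,
  (kn_d3M kn, kn_d4M kn, kn_dmM kn, kn_dbM kn,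
   kn_d3Q kn, kn_d4Q kn, kn_dmQ kn, kn_dbQ kn),
  (kn_d3a kn, kn_d3b kn, kn_d3s kn, kn_d3ct kn,
   kn_d4a kn, kn_d4b kn, kn_d4s kn, kn_d4ct kn),
  (kn_dma kn, kn_dmb kn, kn_dms kn, kn_dba kn, kn_dbb kn, kn_dbs kn,
   kn_dmct, kn_dbct)).

Let dl1 : dl 1 = 0.
Proof.
have := dlM 1 1; rewrite mulr1 rmorph1 mulr1 mul1r => /eqP.
by rewrite -subr_eq subrr eq_sym => /eqP.
Qed.
Let dl2 : dl 2 = 0. Proof. by rewrite raddfMn dl1 mul0rn. Qed.
Let ev2 : ev 2 = 2. Proof. exact: rmorph_nat. Qed.

Let evE := (rmorphD ev, rmorphN ev, rmorphM ev, ev2, evd3, evd4, evdm, evdb,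
  (ev_ta, ev_tac, ev_tp, ev_tpc, ev_rh, ev_rhc, ev_rp, ev_rpc, ev_ka, ev_kac),
  (ev_si, ev_sic, ev_kp, ev_kpc, ev_sp, ev_spc, ev_nu3, ev_nu4, ev_num, ev_nub),
  (ev_mu3, ev_mu4, ev_mum, ev_mub, ev_PF, ev_PFc, ev_BF, ev_BbFc, ev_z, ev_m1),
  (ev_m2, ev_R13, ev_R02, raddf0 e3, raddf0 e4, raddf0 em, raddf0 eb)).

(** The structure equation writes [A] through [ka] and [si], each term of it containing one of
    these. *)
Lemma lin_ev_A : ev A = 0.
Proof.
rewrite -[A]opprK -ricci_ka_si !evE; ring.
Qed.

Lemma ev_ric : ev ric = 0.
Proof. by rewrite ricE !evE mul0r addr0. Qed.

Lemma lin_ev_B : ev B = 0.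
Proof.
rewrite -[B](addrK ric) -ricci_ka_ta rmorphB ev_ric !evE !eE; ring.
Qed.

Let T := 4 * b.
Let H := 2 * s * b.
Let Hb := - (2 * s * a).
Let Hbc := 2 * s * b.
Let Hc := - (2 * s * a).
Let PF0 := 4 * Q * b * b.
Let PFc0 := 4 * Q * a * a.
Let Pc := 32 * Q * Q * a * b * b * b - 16 * M * b * b * b.
Let A' := dl A.
Let B' := dl B.
Let xi := dl ka.
Let sg := dl si.
Notation cd3 := (cder3 e3 a b s M Q).
Notation cd4 := (cder4 e4 a b).
Notation cdm := (cderm em a b s ct).
Notation cdb := (cderb eb a b s ct).
Let F := PF0 * sg - cdm 1 1 ph - 3 * H * ph.
Let X := 2 * cd4 1 1 ph + 3 * T * ph - 2 * PF0 * xi.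
Let W := 2 * PF0 * B' - 6 * Pc * ph.

Let dlE := (raddfD dl, raddfN dl, dlM, dl1, dl2, dl_BF, dl_z,
  (dl_m1, dl_m2, dl_R13, dl_R02)).
Let dlkE := (dld3 ev_ka, dldm ev_ka, dld4 ev_si, dldb ev_si).

Lemma lin_D4X : cd4 1 2 sg = cdm 2 1 xi - (2 * b + 2 * a) * sg + (H + Hb) * xi - A'.
Proof.
have := congr1 dl ricci_ka_si; rewrite !dlE !dlkE !evE -/xi -/sg -/A' => h.
apply: (eq_of_diff 1 h).
rewrite /cder4 /cderm /H /Hb; ring.
Qed.

Let dl_ric : dl ric = 8 * Q * a * a * ph.
Proof. rewrite ricE !dlE !evE; ring. Qed.

Let evX := (lin_ev_A, lin_ev_B, ev_ric).

Lemma lin_D4B : cd4 1 1 B' = cdb 2 2 A' + Hbc * A' - 2 * T * B' + 3 * Pc * xi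
  + PFc0 * (X - 3 * T * ph).
Proof.
have evBr : ev (B - ric) = 0 by rewrite rmorphB !evX subrr.
have := congr1 dl bianchi4mb.
rewrite (raddf0 dl) !(raddfD dl, raddfN dl, dlM) (dld4 evBr) (dldb lin_ev_A) (dldm ev_R13).
(* The components [s13], [s23] and the e_3, mb component [R03] multiply [si] or [ka], so only their
   background values matter. These are obtained from the structure equations and produce the term
   with [Pc]. *)
rewrite !(raddfD dl, raddfN dl) dl_ric !dlE -s13E -s23E -ricci_rh_ta.
rewrite !(evE, evX) -/A' -/B' -/xi -/sg !eE => h.
apply: (eq_of_diff 1 h).
rewrite /cder4 /cderb /Hbc /T /Pc /PFc0 /X /PF0 /cder4 /T /nu3' /D.
ring: (kn_sct kn).
Qed.

Lemma lin_DmB : cdm 1 1 B' = cd3 2 2 A' - 2 * D * b * A' - 4 * H * B' + 3 * Pc * sg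
  + PFc0 * (2 * F + 6 * H * ph).
Proof.
have evBr : ev (B + ric) = 0 by rewrite rmorphD !evX addr0.
have := congr1 dl bianchi34m.
rewrite (raddf0 dl) !(raddfD dl, raddfN dl, dlM) (dldm evBr) (dld3 lin_ev_A) (dld4 ev_R02).
rewrite !(raddfD dl, raddfN dl) dl_ric !dlE -s01E -s02E -ricci_rh_ta.
rewrite !(evE, evX) -/A' -/B' -/xi -/sg !eE => h.
apply: (eq_of_diff 1 h).
rewrite /cderm /cder3 /H /Pc /PFc0 /F /PF0 /cderm /H /nu3' /D.
ring: (kn_sct kn).
Qed.

(** P_F does not vanish in the background, but this combination does, by its right side; frame
    derivatives of it may therefore be varied. *)
Let mw4 : d4 PF + 2 * PF * rh = db BF + BF * (mub + nub + tp) - BbFc * ka + m1.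
Proof. rewrite -maxwell4; ring. Qed.
Let mwm : dm PF + 2 * PF * ta = d3 BF + BF * (mu3 + nu3 + rp) - BbFc * si + m2.
Proof. rewrite -maxwellm; ring. Qed.

(** Varying the e_4 derivative of the Maxwell equation along m, and the m derivative of the one
    along e_4, brings in variations of second derivatives of P_F. These are not gauge-invariant, and
    the commutator of the two derivatives on P_F removes them. *)
Lemma lin_D3X : cd3 2 1 X + 2 * cdb 1 2 F - 2 * D * a * X + 2 * Hc * F + 2 * W = 0.
Proof.
have ev_mw4 : ev (db BF + BF * (mub + nub + tp) - BbFc * ka + m1) = 0.
  by rewrite !evE; ring.
have ev_mwm : ev (d3 BF + BF * (mu3 + nu3 + rp) - BbFc * si + m2) = 0.
  by rewrite !evE; ring.
have d2 (d : {additive K -> K}) : (forall x y, d (x * y) = d x * y + x * d y) ->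
  d 2 = 0 by exact: derivation_nat.
have h1 := congr1 (fun t => dl (d4 t)) mwm; rewrite /= (dld4 ev_mwm) in h1.
have h2 := congr1 (fun t => dl (dm t)) mw4; rewrite /= (dldm ev_mw4) in h2.
have h3 := congr1 dl (comm4m PF).
have h4 := congr1 dl ricci_ka_ta.
have h5 := congr1 dl ricci_si_rh.
have h6 := congr1 dl mw4.
have h7 := congr1 dl mwm.
move: h1 h2 h3 h4 h5 h6 h7.
rewrite !(raddfD d4, raddfD dm, d4M, dmM, d2 d4 d4M, d2 dm dmM).
rewrite !(dlE, dldb ev_BF, dld3 ev_BF, dld3 ev_ka, dldb ev_si) dl_ric.
rewrite -/B' -/xi -/sg !(evE, evX) !eE.
move=> h1 h2 h3 h4 h5 h6 h7.
(* The multipliers are forced: [h3] removes second derivatives of P_F, [h4] and [h5] with twice the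
   background P_F remove the variations of [d4 ta] and [dm rh], and [h6], [h7] those of [d4 PF] and
   [dm PF], whose total coefficients are [4 * s * b] and [5 * b + a] up to sign. *)
apply: (eq_of_diff (-1) h1); apply: (eq_of_diff 1 h2); apply: (eq_of_diff 1 h3).
apply: (eq_of_diff (- (8 * Q * b * b)) h4); apply: (eq_of_diff (- (8 * Q * b * b)) h5).
apply: (eq_of_diff (4 * s * b) h6); apply: (eq_of_diff (- (5 * b + a)) h7).
rewrite /X /F /W /Hc /cder3 /cderb /cderm /cder4 /PF0 /Pc /H /T.
rewrite -/D !eE.
have c43 : e4 (e3 ph) = e3 (e4 ph) + nu3' * e4 ph + 2 * s * (a + b) * em ph
    - 2 * s * (a + b) * eb ph.
  by rewrite -[LHS](subrK (e3 (e4 ph))) kn_comm43; ring.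
have cmb : em (eb ph) = eb (em ph) + 2 * (a - b) * (e3 ph + D * e4 ph)
    + (s * (b - a) - ct) * eb ph + (ct - s * (b - a)) * em ph.
  by rewrite -[LHS](subrK (eb (em ph))) kn_commmb; ring.
rewrite c43 cmb /nu3' /D.
ring: (kn_sct kn).
Qed.

End Linearisation.

Lemma sum4 (K : nmodType) (F : 'I_4 -> K) :
  \sum_(i < 4) F i = F 0 + F 1 + F 2 + F 3.
Proof.
rewrite !big_ord_recl big_ord0 addr0 !addrA.
by congr (F _ + F _ + F _ + F _); apply: val_inj.
Qed.

(** * Structure, Bianchi, Maxwell and Einstein equations in a complex null frame *)

Section Tetrad.
Context {K : comPzRingType}.
Variable D : 'I_4 -> {additive K -> K}.
Hypothesis DM : forall i a b, D i (a * b) = D i a * b + a * D i b.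
Hypothesis DC : forall i j a, D i (D j a) = D j (D i a).
Variable half : K.
Hypothesis half2 : half + half = 1.

(* The metric in the null frame (e_3, e_4, m, mb), m = e_1 + i e_2. *)
Definition nullmx (c : K) : 'M[K]_4 := \matrix_(i, j)
  (if (i + j == 1)%N then - c else if (i + j == 5)%N then c else 0).

Lemma nullmx_inv : nullmx 2 *m nullmx half = 1%:M.
Proof.
have h2 : 2 * half = 1 by rewrite mulr_natl mulr2n.
apply/matrixP => i j; rewrite !mxE sum4 !mxE.
case: i => [[|[|[|[|//]]]] ?]; case: j => [[|[|[|[|//]]]] ?];
  rewrite /= ?(mulr0, mul0r, addr0, add0r, mulrN, mulNr, opprK) ?h2 //.
Qed.

Lemma nullmxT c : (nullmx c)^T = nullmx c.
Proof. by apply/matrixP => i j; rewrite !mxE addnC. Qed.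

Lemma nullmxD i a b : D i (nullmx 2 a b) = 0.
Proof.
have d2 := @derivation_nat _ (D i) 2 (DM i).
by rewrite mxE; case: ifP => _; [rewrite raddfN d2 oppr0 | case: ifP; rewrite ?raddf0].
Qed.

Variables (g E : 'M[K]_4).
Hypothesis gT : g^T = g.
Hypothesis EgE : E *m g *m E^T = nullmx 2.

Local Notation eta := (nullmx 2).
Local Notation etai := (nullmx half).
Local Notation conn := (conn D half g E eta etai).
Local Notation up := (up D half g E etai).
Local Notation curv := (curv D half g E eta etai).
Local Notation d := (frd D E).

Lemma halfK x : half * (2 * x) = x.
Proof. by rewrite mulrA [half * 2]mulrC mulr_natl mulr2n half2 mul1r. Qed.

(** Spin coefficients in the Newman-Penrose sense. The factor [half] fits the normalisation g(m, mb)
    = 2 = - g(e_3, e_4): raising an index then costs only a sign and a permutation ([up_spin]). *)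
Definition spin l a b : K := half * conn l a b.
Local Notation w := spin.

Lemma conn_spin l a b : conn l a b = 2 * w l a b.
Proof. by rewrite -[LHS]mul1r -{1}half2 /w mulrDl mulr_natl mulr2n.  Qed.

Let canti l a b : conn l a b = - conn l b a.
Proof. exact: (conn_anti DM half2 gT nullmxD (nullmxT half) nullmx_inv EgE). Qed.

Lemma spin_anti l a b : w l a b = - w l b a.
Proof. by rewrite /w canti mulrN. Qed.

Lemma conn_diag l a : conn l a a = 0.
Proof.
have h : conn l a a + conn l a a = 0 by rewrite {2}canti subrr.
by transitivity ((half + half) * conn l a a);
  [rewrite half2 mul1r | rewrite mulrDl -mulrDr h mulr0].
Qed.

Lemma spin_diag l a : w l a a = 0.
Proof. by rewrite /w conn_diag mulr0. Qed.

Lemma up_spin l a : (up l a 0 = - w l a 1) * (up l a 1 = - w l a 0) *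
  (up l a 2 = w l a 3) * (up l a 3 = w l a 2).
Proof.
do !split; rewrite (upE D half g E nullmx_inv) sum4 !mxE /=
  ?(mulr0, addr0, add0r) /w ?mulrN mulrC //.
Qed.

Let curvK := (curvE DM half gT nullmxD nullmx_inv EgE).

Lemma curv_spin a b l k : curv a b l k =
  2 * (d l (w k b a) - d k (w l b a)
  + (w l k 1 - w k l 1) * w 0 b a + (w l k 0 - w k l 0) * w 1 b a
  - (w l k 3 - w k l 3) * w 2 b a - (w l k 2 - w k l 2) * w 3 b a
  - (w k b 1 * w l 0 a + w k b 0 * w l 1 a - w l b 1 * w k 0 a - w l b 0 * w k 1 a)
  + (w k b 3 * w l 2 a + w k b 2 * w l 3 a - w l b 3 * w k 2 a - w l b 2 * w k 3 a)).
Proof.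
rewrite curvK !sum4 !up_spin !conn_spin !frdM //.
have d2 l' : d l' 2 = 0 by apply: derivation_nat => x y; exact: frdM.
rewrite !d2; ring.
Qed.

Let antiE l := (spin_anti l 0 1, spin_anti l 2 1, spin_anti l 3 1, spin_anti l 3 0,
  spin_anti l 2 0, spin_anti l 3 2, spin_diag l).

Local Notation ta := (w 0 1 2). Local Notation ka := (w 1 1 2).
Local Notation si := (w 2 1 2). Local Notation rh := (w 3 1 2).
Local Notation tac := (w 0 1 3). Local Notation kac := (w 1 1 3).
Local Notation rhc := (w 2 1 3). Local Notation sic := (w 3 1 3).
Local Notation kp := (w 0 0 3). Local Notation tp := (w 1 0 3).
Local Notation rp := (w 2 0 3). Local Notation sp := (w 3 0 3).
Local Notation kpc := (w 0 0 2). Local Notation tpc := (w 1 0 2).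
Local Notation spc := (w 2 0 2). Local Notation rpc := (w 3 0 2).
Local Notation nu l := (w l 1 0).
Local Notation mu l := (- w l 2 3).

(** This and the next three are null structure equations: the curvature with first pair (m, e_4) is
    expressed by derivatives of the coefficients g(D e_4, m), which are Xi, H, Xhat and the
    conjugate of trX up to factors. *)
Lemma ricci_ka_si : d 1 si - d 2 ka - ka * mu 2 - 2 * ka * nu 2 - ka * ta
  - ka * tpc + 2 * mu 1 * si + nu 1 * si + rh * si + rhc * si = half * curv 2 1 1 2.
Proof.
rewrite curv_spin halfK.
rewrite !antiE ?(raddfN (d _)); ring.
Qed.

Lemma ricci_ka_ta : d 0 ka - d 1 ta + ka * mu 0 + 2 * ka * nu 0 - mu 1 * ta
  - rh * ta + rh * tpc - si * tac + si * tp = half * curv 2 1 0 1.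
Proof.
rewrite curv_spin halfK.
rewrite !antiE ?(raddfN (d _)); ring.
Qed.

Lemma ricci_si_rh : d 2 rh - d 3 si - ka * rp + ka * rpc - 2 * mu 3 * si
  - nu 3 * si + nu 2 * rh + rh * ta - rhc * ta = half * curv 2 1 2 3.
Proof. rewrite curv_spin halfK !antiE ?(raddfN (d _)); ring. Qed.

Lemma ricci_rh_ta : d 0 rh - d 3 ta - ka * kp - mu 3 * ta + nu 0 * rh
  + rh * rpc + si * sp - ta * tac = half * curv 2 1 0 3.
Proof. rewrite curv_spin halfK !antiE ?(raddfN (d _)); ring. Qed.

Lemma comm_4m f : d 1 (d 2 f) - d 2 (d 1 f) =
  ka * d 0 f + (nu 2 + tpc) * d 1 f - (mu 1 + rhc) * d 2 f - si * d 3 f.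
Proof.
rewrite (frd_comm DM DC half gT nullmx_inv EgE) sum4 !up_spin !antiE; ring.
Qed.

Lemma curv_nu_mu23 : d 2 (nu 3 + mu 3) - d 3 (nu 2 + mu 2) - mu 3 * nu 2
  - mu 2 * nu 3 + (nu 0 + mu 0) * rh - (nu 0 + mu 0) * rhc - (nu 1 + mu 1) * rp
  + (nu 1 + mu 1) * rpc - 2 * mu 3 * mu 2 - 2 * rh * rp + 2 * si * sp =
  half * (curv 0 1 2 3 + curv 2 3 2 3).
Proof.
rewrite !curv_spin -mulrDr halfK !antiE !(raddfN (d _), raddfD (d _)); ring.
Qed.

Lemma curv_nu_mu01 : d 0 (mu 1 + nu 1) - d 1 (mu 0 + nu 0) - 2 * ka * kp
  + mu 0 * nu 1 + mu 1 * nu 0 - mu 3 * ta + mu 3 * tpc - mu 2 * tac + mu 2 * tp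
  + 2 * nu 0 * nu 1 - nu 3 * ta + nu 3 * tpc - nu 2 * tac + nu 2 * tp
  + 2 * ta * tp = half * (curv 0 1 0 1 + curv 2 3 0 1).
Proof.
rewrite !curv_spin -mulrDr halfK !antiE !(raddfN (d _), raddfD (d _)); ring.
Qed.

Lemma curv_nu_mu02 : d 0 (mu 2 + nu 2) - d 2 (mu 0 + nu 0) - 2 * kp * si
  - kpc * mu 1 - kpc * nu 1 + mu 0 * mu 2 + 2 * mu 0 * nu 2 - mu 0 * ta
  + mu 3 * spc + mu 2 * rp + nu 0 * nu 2 - nu 0 * ta + nu 3 * spc + nu 2 * rp
  + 2 * rp * ta = half * (curv 0 1 0 2 + curv 2 3 0 2).
Proof.
rewrite !curv_spin -mulrDr halfK !antiE !(raddfN (d _), raddfD (d _)); ring.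
Qed.

Lemma curv_nu_mu13 : d 1 (mu 3 + nu 3) - d 3 (mu 1 + nu 1) + 2 * ka * sp
  - kac * mu 0 - kac * nu 0 - mu 1 * mu 3 - 2 * mu 1 * nu 3 - mu 1 * tp
  + mu 3 * rh + mu 2 * sic - nu 1 * nu 3 - nu 1 * tp + nu 3 * rh + nu 2 * sic
  - 2 * rh * tp = half * (curv 0 1 1 3 + curv 2 3 1 3).
Proof.
rewrite !curv_spin -mulrDr halfK !antiE !(raddfN (d _), raddfD (d _)); ring.
Qed.

Let c12 a b l m : curv b a l m = - curv a b l m.
Proof. exact: (curv_anti12 DM half2 gT nullmxD (nullmxT half) nullmx_inv EgE). Qed.
Let c34 a b l m : curv a b m l = - curv a b l m.
Proof. exact: (curv_anti34 DM DC half gT nullmx_inv EgE). Qed.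
Let csym a b l m : curv l m a b = curv a b l m.
Proof. exact: (curv_sym DM DC half2 gT nullmxD (nullmxT half) nullmx_inv EgE). Qed.

Let dbl0 (x : K) : x + x = 0 -> x = 0.
Proof. by move=> h; rewrite -[x]halfK mulr_natl mulr2n h mulr0. Qed.
Let c34d a b l : curv a b l l = 0.
Proof. by apply: dbl0; rewrite {1}c34 addNr. Qed.
Let c12d a l m : curv a a l m = 0.
Proof. by apply: dbl0; rewrite {1}c12 addNr. Qed.

Definition ricf b k : K := con2 E (ric D half g E etai) b k.

Lemma ricfE b k : ricf b k = half * (curv 2 b 3 k + curv 3 b 2 k
  - curv 0 b 1 k - curv 1 b 0 k).
Proof.
rewrite /ricf (ricE DM DC half gT (nullmxT half) nullmx_inv EgE) sum4 !sum4 !mxE /=.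
ring.
Qed.

Lemma ricf_21 : ricf 2 1 = half * (curv 2 1 0 1 - curv 2 1 2 3).
Proof.
rewrite ricfE c12d (c34d 0 2) (csym 2 1 3 2) (c34 2 1 2 3) (c12 2 1 0 1); ring.
Qed.

Lemma ricf_12 : ricf 1 2 = ricf 2 1.
Proof.
rewrite ricf_21 ricfE c12d (c34d 3 1) (csym 1 2 0 1) (c12 2 1) (c34 2 1 2 3); ring.
Qed.

Lemma ricf_11 : ricf 1 1 = - curv 2 1 1 3.
Proof.
rewrite ricfE c34d c12d (csym 2 1 3 1) (c34 2 1 1 3) -[RHS]halfK; ring.
Qed.

Lemma ricf_22 : ricf 2 2 = curv 2 1 0 2.
Proof.
rewrite ricfE !c12d c34d (csym 1 2 0 2) (c12 2 1 0 2) -[RHS]halfK; ring.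
Qed.

(** By self-duality of the Weyl tensor this combination carries no new component: once the Ricci
    part is removed it is -4 times [B_w]. *)
Lemma curv_12 : curv 0 1 1 2 + curv 2 3 1 2 = - 2 * (curv 2 1 0 1 - ricf 2 1).
Proof.
rewrite (csym 1 2 0 1) (csym 1 2 2 3) !(c12 2 1) ricf_21 mulrBr.
have -> : -2 * (half * (curv 2 1 0 1 - curv 2 1 2 3)) =
  - (half * (2 * (curv 2 1 0 1 - curv 2 1 2 3))) by ring.
rewrite halfK; ring.
Qed.

Lemma curv_23 : curv 2 1 2 3 = curv 2 1 0 1 - 2 * ricf 2 1.
Proof.
have -> : 2 * ricf 2 1 = half * (2 * (curv 2 1 0 1 - curv 2 1 2 3)).
  by rewrite ricf_21; ring.
rewrite halfK; ring.
Qed.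

Let canon := ((c12 2 1, c12 0 1, c12 2 3, c12d, c34d),
  (fun p q => c34 p q 0 1, fun p q => c34 p q 0 2, fun p q => c34 p q 0 3),
  (fun p q => c34 p q 1 2, fun p q => c34 p q 1 3, fun p q => c34 p q 2 3)).

(** Second Bianchi identity for the pair (m, e_4), cyclic over e_4, m, mb. The next lemma is the
    same pair with e_3, e_4, m. *)
Lemma bianchi_4mb : d 1 (curv 2 1 2 3) + d 3 (curv 2 1 1 2) - d 2 (curv 2 1 1 3)
  - (curv 0 1 1 2 + curv 2 3 1 2) * rh + (curv 0 1 1 3 + curv 2 3 1 3) * si
  - (curv 0 1 2 3 + curv 2 3 2 3) * ka + curv 2 1 0 1 * (rh - rhc)
  + curv 2 1 0 2 * kac - curv 2 1 0 3 * ka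
  + curv 2 1 1 2 * (2 * mu 3 + 2 * nu 3 + tp) - curv 2 1 1 3 * (2 * nu 2 + tpc)
  + curv 2 1 2 3 * (mu 1 + nu 1 + rh + rhc) = 0.
Proof.
have := bianchi_frame DM DC half2 gT nullmxD (nullmxT half) nullmx_inv EgE 2 1 1 2 3.
rewrite /curv_cov !sum4 !up_spin.
move=> h; apply: (eq_of_diff 1 h).
rewrite !canon ?(raddfN (d _)) !antiE.
ring.
Qed.

Lemma bianchi_34m : d 0 (curv 2 1 1 2) - d 1 (curv 2 1 0 2) + d 2 (curv 2 1 0 1)
  - (curv 0 1 0 1 + curv 2 3 0 1) * si + (curv 0 1 0 2 + curv 2 3 0 2) * ka
  - (curv 0 1 1 2 + curv 2 3 1 2) * ta + curv 2 1 0 1 * (mu 2 + nu 2 + ta + tpc)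
  - curv 2 1 0 2 * (2 * mu 1 + rhc) - curv 2 1 0 3 * si
  + curv 2 1 1 2 * (2 * mu 0 + 2 * nu 0 + rp) + curv 2 1 1 3 * spc
  + curv 2 1 2 3 * (ta - tpc) = 0.
Proof.
have := bianchi_frame DM DC half2 gT nullmxD (nullmxT half) nullmx_inv EgE 2 1 0 1 2.
rewrite /curv_cov !sum4 !up_spin.
move=> h; apply: (eq_of_diff 1 h).
rewrite !canon ?(raddfN (d _)) !antiE.
ring.
Qed.

Section Maxwell.
Variable F : 'M[K]_4.
Hypothesis FT : F^T = - F.
Local Notation ff := (ff E F).

Lemma ff_anti i j : ff j i = - ff i j.
Proof.
rewrite /(ff _ _) /con2 exchange_big -sumrN; apply: eq_bigr => p _ /=.
rewrite -sumrN; apply: eq_bigr => q _.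
have -> : F q p = - F p q.
  by rewrite -[in LHS](trmxK F) mxE FT [LHS]mxE.
ring.
Qed.
Lemma ff_diag i : ff i i = 0.
Proof. by apply: dbl0; rewrite {1}ff_anti addNr. Qed.

Let phi := half * (ff 0 1 + ff 2 3).
Let phic := half * (ff 0 1 - ff 2 3).

Definition max4 := d 1 phi - d 3 (ff 2 1) - ff 2 1 * mu 3 - ff 2 1 * nu 3
  - ff 2 1 * tp + ff 3 0 * ka + 2 * phi * rh.
Definition maxm := d 2 phi - d 0 (ff 2 1) - ff 2 1 * mu 0 - ff 2 1 * nu 0
  - ff 2 1 * rp + ff 3 0 * si + 2 * phi * ta.

Local Notation fc := (ff_cov D half g E etai F).

Let ff01 : ff 0 1 = phi + phic.
Proof. rewrite -[LHS]halfK /phi /phic; ring. Qed.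
Let ff23 : ff 2 3 = phi - phic.
Proof. rewrite -[LHS]halfK /phi /phic; ring. Qed.

Let ffE := (ff_anti 0 1, ff_anti 2 1, ff_anti 2 0, ff_anti 3 1, ff_anti 3 0,
  ff_anti 2 3, ff_diag, ff01, ff23).

Definition div_f p := \sum_a \sum_b etai a b * fc b a p.
Definition cyc_f l a b := fc l a b + fc a b l + fc b l a.

Lemma max4E : max4 = half * cyc_f 1 2 3 - div_f 1.
Proof.
rewrite -[max4]halfK /div_f !sum4 !mxE /=.
(* The half-sum of the closedness equation and minus the divergence equation is the self-dual one:
   the conjugate component [phic] cancels. *)
transitivity (half * (fc 1 2 3 + fc 2 3 1 + fc 3 1 2 + fc 1 0 1 + fc 0 1 1
  - fc 3 2 1 - fc 2 3 1)); last by rewrite /cyc_f; ring.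
congr (half * _); rewrite /ff_cov /max4 !sum4 !up_spin !ffE.
rewrite !(raddfN (d _), raddfD (d _), raddf0 (d _)) !antiE; ring.
Qed.

Lemma maxmE : maxm = half * cyc_f 0 1 2 - div_f 2.
Proof.
rewrite -[maxm]halfK /div_f !sum4 !mxE /=.
transitivity (half * (fc 0 1 2 + fc 1 2 0 + fc 2 0 1 + fc 1 0 2 + fc 0 1 2
  - fc 3 2 2 - fc 2 3 2)); last by rewrite /cyc_f; ring.
congr (half * _); rewrite /ff_cov /maxm !sum4 !up_spin !ffE.
rewrite !(raddfN (d _), raddfD (d _), raddf0 (d _)) !antiE; ring.
Qed.

Definition bianchi_F k i j := dF D half g E etai F k i j
  + dF D half g E etai F i j k + dF D half g E etai F j k i.
Definition div_F j := \sum_i \sum_k ginv E etai i k * dF D half g E etai F k i j.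
Definition einstein_F i j := ric D half g E etai i j -
  (2 * (\sum_k \sum_l ginv E etai k l * F i k * F j l)
   - half * g i j * (\sum_k \sum_l \sum_m \sum_n
      ginv E etai k m * ginv E etai l n * F k l * F m n)).

Let dFf l a b : fc l a b = con3 E (dF D half g E etai F) l a b.
Proof. by rewrite (dF_frame DM half nullmx_inv EgE F l a b). Qed.

Lemma cyc_fE l a b : cyc_f l a b = con3 E bianchi_F l a b.
Proof. by rewrite /cyc_f !dFf con3_cyc_sum. Qed.

Lemma div_fE p : div_f p = \sum_j E p j * div_F j.
Proof.
rewrite /div_f; transitivity (\sum_a \sum_b etai a b *
    con2 E (fun i k => \sum_j dF D half g E etai F k i j * E p j) a b).
  apply: eq_bigr => a _; apply: eq_bigr => b _; congr (_ * _).
  rewrite dFf /con3 /con2 exchange_big; apply: eq_bigr => i _ /=.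
  apply: eq_bigr => k _; rewrite mulr_sumr; apply: eq_bigr => j _; ring.
rewrite -con2_ginv /div_F.
under [RHS]eq_bigr do rewrite mulr_sumr.
rewrite [RHS]exchange_big; apply: eq_bigr => i _ /=.
under [RHS]eq_bigr do rewrite mulr_sumr.
rewrite [RHS]exchange_big; apply: eq_bigr => k _ /=.
rewrite mulr_sumr; apply: eq_bigr => j _; ring.
Qed.

Lemma einstein_f p q : con2 E einstein_F p q = ricf p q
  - 2 * (\sum_a \sum_b etai a b * (ff p a * ff q b))
  + half * eta p q * (\sum_k \sum_l \sum_m \sum_n
      ginv E etai k m * ginv E etai l n * F k l * F m n).
Proof.
set Fsq := (\sum_k \sum_l \sum_m \sum_n _).
have c2D (S1 S2 : 'I_4 -> 'I_4 -> K) :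
    con2 E (fun i j => S1 i j + S2 i j) p q = con2 E S1 p q + con2 E S2 p q.
  rewrite /con2 -big_split; apply: eq_bigr => i _; rewrite -big_split.
  by apply: eq_bigr => j _; rewrite /= mulrDr.
have c2Z c (S1 : 'I_4 -> 'I_4 -> K) :
    con2 E (fun i j => c * S1 i j) p q = c * con2 E S1 p q.
  rewrite /con2 mulr_sumr; apply: eq_bigr => i _; rewrite mulr_sumr.
  by apply: eq_bigr => j _; ring.
have e : con2 E einstein_F p q = con2 E (fun i j => ric D half g E etai i j +
   (- 2 * (\sum_k \sum_l ginv E etai k l * (F i k * F j l))
    + (half * Fsq) * g i j)) p q.
  apply: eq_bigr => i _; apply: eq_bigr => j _; congr (_ * _).
  rewrite /einstein_F -/Fsq.
  have -> : \sum_k \sum_l ginv E etai k l * (F i k * F j l) =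
     \sum_k \sum_l ginv E etai k l * F i k * F j l.
    by apply: eq_bigr => k _; apply: eq_bigr => l _; rewrite mulrA.
  ring.
rewrite e c2D c2D c2Z c2Z (con2_g EgE) -/(ricf p q).
have -> : con2 E (fun i j => \sum_k \sum_l ginv E etai k l * (F i k * F j l)) p q =
    \sum_a \sum_b etai a b * (ff p a * ff q b).
  transitivity (con2 E (fun i j => \sum_a \sum_b etai a b *
      con2 E (fun k l => F i k * F j l) a b) p q).
    by apply: eq_bigr => i _; apply: eq_bigr => j _; rewrite con2_ginv.
  rewrite {1}/con2.
  transitivity (\sum_i \sum_j \sum_a \sum_b \sum_k \sum_l
     etai a b * ((E p i * E a k * F i k) * (E q j * E b l * F j l))).
    apply: eq_bigr => i _; apply: eq_bigr => j _; rewrite mulr_sumr.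
    apply: eq_bigr => a _; rewrite mulr_sumr; apply: eq_bigr => b _.
    rewrite /con2 !mulr_sumr; apply: eq_bigr => k _; rewrite !mulr_sumr.
    by apply: eq_bigr => l _; ring.
  under eq_bigr do rewrite exchange_big /=.
  rewrite exchange_big; apply: eq_bigr => a _ /=.
  under eq_bigr do rewrite exchange_big /=.
  rewrite exchange_big; apply: eq_bigr => b _ /=.
  rewrite /(ff _ _) /con2 mulr_suml mulr_sumr; apply: eq_bigr => i _.
  rewrite mulr_suml mulr_sumr exchange_big; apply: eq_bigr => k _ /=.
  rewrite mulr_sumr mulr_sumr; apply: eq_bigr => j _.
  by rewrite mulr_sumr mulr_sumr.
ring.
Qed.

(** This Ricci component is linear in B_F with the background factor conj(P_F), so it contributes to
    the linear theory. In [einstein_11] and [einstein_22] both factors vanish in the background. *)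
Lemma einstein_21 : con2 E einstein_F 2 1 = ricf 2 1 - 2 * (ff 2 1 * phic).
Proof.
rewrite einstein_f; set z := nullmx 2 _ _; have -> : z = 0 by rewrite /z mxE.
rewrite mulr0 mul0r addr0 !sum4 !mxE /= !ffE.
have -> : 2 * (ff 2 1 * phic) = half * (2 * (2 * (ff 2 1 * phic))) by rewrite halfK.
ring.
Qed.

Lemma einstein_11 : con2 E einstein_F 1 1 = ricf 1 1 - 2 * (ff 2 1 * ff 3 1).
Proof.
rewrite einstein_f; set z := nullmx 2 _ _; have -> : z = 0 by rewrite /z mxE.
rewrite mulr0 mul0r addr0 !sum4 !mxE /= !ffE.
have -> : 2 * (ff 2 1 * ff 3 1) = half * (2 * (2 * (ff 2 1 * ff 3 1))) by rewrite halfK.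
ring.
Qed.

Lemma einstein_22 : con2 E einstein_F 2 2 = ricf 2 2 + 2 * (ff 2 1 * ff 2 0).
Proof.
rewrite einstein_f; set z := nullmx 2 _ _; have -> : z = 0 by rewrite /z mxE.
rewrite mulr0 mul0r addr0 !sum4 !mxE /= !ffE.
have -> : 2 * (ff 2 1 * ff 2 0) = half * (2 * (2 * (ff 2 1 * ff 2 0))) by rewrite halfK.
ring.
Qed.
End Maxwell.

End Tetrad.

(** * The principal null frame of Kerr-Newman: derivatives and brackets *)

Section KerrNewmanFrame.
Context {K : comPzRingType}.
Variable D : 'I_4 -> {additive K -> K}.
Hypothesis DM : forall i x y, D i (x * y) = D i x * y + x * D i y.
Hypothesis DC : forall i j x, D i (D j x) = D j (D i x).
Variables (half ii aK M Q rr cc ss iw iS iD : K).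
Hypothesis half2 : half + half = 1.
Hypothesis iiE : ii * ii = -1.
Hypothesis cstD : forall i, [/\ D i ii = 0, D i aK = 0, D i M = 0 & D i Q = 0].
Hypothesis rrD : forall i, D i rr = (i == 1)%:R.
Hypothesis ccD : forall i, D i cc = - ((i == 2)%:R * ss).
Hypothesis ssD : forall i, D i ss = (i == 2)%:R * cc.
(** 1/|q|, 1/sin(theta) and 1/Delta enter as generators [iw], [iS], [iD] fixed by polynomial
    relations, since the ring is not a field; their derivatives follow by implicit
    differentiation. *)
Hypothesis iwE : iw * iw * (rr * rr + aK * aK * cc * cc) = 1.
Hypothesis sscc : ss * ss + cc * cc = 1.
Hypothesis iSE : iS * ss = 1.
Hypothesis iDE : iD * (rr * rr - 2 * M * rr + aK * aK + Q * Q) = 1.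

Definition kn_a := half * (rr - ii * aK * cc) * (iw * iw).
Definition kn_b := half * (rr + ii * aK * cc) * (iw * iw).
Definition kn_s := ii * aK * ss * iw.
Definition kn_ct := cc * iS * iw.
Local Notation a := kn_a.
Local Notation b := kn_b.
Local Notation s := kn_s.
Local Notation ct := kn_ct.
Definition kn_D := 1 - s * s - 2 * M * (a + b) + 4 * Q * Q * a * b.
Local Notation Dl := kn_D.
Let X := rr * rr + aK * aK.

Let D2 i : D i 2 = 0. Proof. exact: (@derivation_nat _ (D i) 2 (DM i)). Qed.
Let D1' i : D i 1 = 0. Proof. exact: (@derivation_nat _ (D i) 1 (DM i)). Qed.
Let D4 i : D i 4 = 0. Proof. exact: (@derivation_nat _ (D i) 4 (DM i)). Qed.
Let halfK x : half * (2 * x) = x.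
Proof. by rewrite mulrA [half * 2]mulrC mulr_natl mulr2n half2 mul1r. Qed.
Let halfD i : D i half = 0.
Proof.
have := congr1 (D i) half2; rewrite raddfD D1' => h.
by rewrite -[LHS]halfK mulr_natl mulr2n h mulr0.
Qed.
Let half22 : half * 2 = 1. Proof. by rewrite mulr_natr mulr2n. Qed.

Lemma kn_iw2 : iw * iw = 4 * a * b.
Proof.
rewrite /kn_a /kn_b.
transitivity ((half * 2) * (half * 2) * (iw * iw) * (iw * iw * (rr * rr + aK * aK * cc * cc))).
  by rewrite iwE half22 !mul1r mulr1.
ring: iiE.
Qed.
Lemma kn_apb : a + b = iw * iw * rr.
Proof. by rewrite /kn_a /kn_b -[RHS]mul1r -half22; ring. Qed.
Lemma kn_bma : b - a = ii * aK * cc * (iw * iw).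
Proof. by rewrite /kn_a /kn_b -[RHS]mul1r -half22; ring. Qed.
Lemma kn_X : iw * iw * X = 1 - s * s.
Proof.
apply: (eq_of_diff 1 iwE); apply: (eq_of_diff (- (aK * aK * (iw * iw))) sscc).
rewrite /kn_s /X; ring: iiE.
Qed.
(** Identifies the polynomial [kn_D] in the generators with Delta/|q|^2. *)
Lemma kn_DE : iw * iw * (rr * rr - 2 * M * rr + aK * aK + Q * Q) = Dl.
Proof.
have e : 4 * Q * Q * a * b = Q * Q * (iw * iw) by rewrite kn_iw2; ring.
apply: (eq_of_diff 1 kn_X); apply: (eq_of_diff (-1) e).
rewrite /kn_D kn_apb /X; ring.
Qed.
Lemma kn_DiD : Dl * iD = iw * iw.
Proof. by apply: (eq_of_diff (iw * iw) iDE); rewrite -kn_DE; ring. Qed.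
Lemma kn_sctE : s * ct = b - a.
Proof.
rewrite kn_bma; apply: (eq_of_diff (ii * aK * cc * (iw * iw)) iSE).
rewrite /kn_s /kn_ct; ring.
Qed.
Lemma kn_s_iS : s * (ii * iw * iS) = - (aK * (iw * iw)).
Proof.
apply: (eq_of_diff (- (aK * (iw * iw))) iSE); rewrite /kn_s; ring: iiE.
Qed.

Let csE i : (D i ii = 0) * (D i aK = 0) * (D i M = 0) * (D i Q = 0).
Proof. by have [] := cstD i. Qed.

Let i12 : ((1 : 'I_4) == 2) = false. Proof. by []. Qed.
Let i21 : ((2 : 'I_4) == 1) = false. Proof. by []. Qed.
Let iE := (i12, i21, @eqxx 'I_4, (erefl : (true%:R : K) = 1), (erefl : (false%:R : K) = 0)).

Let dE i := (@raddfD _ _ (D i), @raddfN _ _ (D i), DM i, csE i, rrD i, ccD i, ssD i,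
  D1' i, D2 i, D4 i, halfD i).

Let iw_D i : D i iw = - (iw * (iw * iw) * (rr * (i == 1)%:R - aK * aK * cc * ((i == 2)%:R * ss))).
Proof.
have := congr1 (D i) iwE; rewrite !dE => h.
set y := iw * (iw * iw) * _; set x := D i iw in h *.
apply: (eq_of_diff (half * iw) h); apply: (eq_of_diff (- x) iwE).
apply: (eq_of_diff (- (iw * iw * (rr * rr + aK * aK * cc * cc) * x + y)) half22).
rewrite /y; ring.
Qed.

Lemma kn_iw0 i : i != 1 -> i != 2 -> D i iw = 0.
Proof. by move=> /negPf h1 /negPf h2; rewrite iw_D h1 h2 iE; ring. Qed.
Lemma kn_iw_r : D 1 iw = - (iw * (a + b)).
Proof. rewrite iw_D kn_apb !iE; ring. Qed.
Lemma kn_iw_th : D 2 iw = s * (a - b).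
Proof.
have -> : a - b = - (b - a) by ring.
rewrite kn_bma iw_D !iE /kn_s; ring: iiE.
Qed.
Let iS_D i : D i iS = - (iS * iS * ((i == 2)%:R * cc)).
Proof.
have := congr1 (D i) iSE; rewrite !dE => h.
have e : iS * (D i iS * ss) = D i iS by rewrite mulrCA iSE mulr1.
rewrite -[LHS]e; apply: (eq_of_diff iS h); ring.
Qed.
Let iD_D i : D i iD = - (iD * iD * (2 * (rr - M) * (i == 1)%:R)).
Proof.
have := congr1 (D i) iDE; rewrite !dE => h.
have e : D i iD = iD * (D i iD * (rr * rr - 2 * M * rr + aK * aK + Q * Q)).
  by rewrite mulrCA iDE mulr1.
rewrite e; apply: (eq_of_diff iD h); ring.
Qed.

Let zero i : i != 1 -> i != 2 -> [/\ D i rr = 0, D i cc = 0, D i ss = 0 & D i iw = 0].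
Proof.
by move=> h1 h2; rewrite rrD ccD ssD kn_iw0 // (negPf h1) (negPf h2) iE; split; ring.
Qed.

Lemma kn_0 i : i != 1 -> i != 2 -> [/\ D i a = 0, D i b = 0, D i s = 0 & D i ct = 0].
Proof.
move=> h1 h2; have [z1 z2 z3 z4] := zero h1 h2.
rewrite /kn_a /kn_b /kn_s /kn_ct !(dE i, z4, iS_D).
rewrite (negPf h1) (negPf h2) !iE; split; ring.
Qed.

Lemma kn_r : [/\ D 1 a = - (2 * a * a), D 1 b = - (2 * b * b),
  D 1 s = - (s * (a + b)) & D 1 ct = - (ct * (a + b))].
Proof.
have e := kn_iw2.
have e' : half * (iw * iw) = 2 * (a * b).
  by rewrite -[RHS]halfK e; congr (half * _); ring.
split.
- rewrite {1}/kn_a !(dE 1, kn_iw_r, iE).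
  apply: (eq_of_diff 1 e'); apply: (eq_of_diff (- (2 * (a + b))) (erefl : half * (rr - ii * aK * cc) * (iw * iw) = a)).
  ring.
- rewrite {1}/kn_b !(dE 1, kn_iw_r, iE).
  apply: (eq_of_diff 1 e'); apply: (eq_of_diff (- (2 * (a + b))) (erefl : half * (rr + ii * aK * cc) * (iw * iw) = b)).
  ring.
- rewrite {1}/kn_s !(dE 1, kn_iw_r, iE) /kn_s; ring.
- rewrite {1}/kn_ct !(dE 1, kn_iw_r, iS_D, iE) /kn_ct; ring.
Qed.

Lemma kn_th : [/\ iw * D 2 a = 2 * s * a * a, iw * D 2 b = - (2 * s * b * b),
  iw * D 2 s = (b - a) * (1 - s * s) & iw * D 2 ct = s * ct * (a - b) - ct * ct - 4 * a * b].
Proof.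
have e := kn_iw2.
have e' : half * (iw * iw) = 2 * (a * b).
  by rewrite -[RHS]halfK e; congr (half * _); ring.
have es : ii * aK * ss * iw = s by [].
split.
- rewrite {1}/kn_a !(dE 2, kn_iw_th, iE).
  apply: (eq_of_diff s e'); apply: (eq_of_diff (half * (iw * iw)) es).
  apply: (eq_of_diff (2 * s * (a - b)) (erefl : half * (rr - ii * aK * cc) * (iw * iw) = a)).
  ring.
- rewrite {1}/kn_b !(dE 2, kn_iw_th, iE).
  apply: (eq_of_diff (- s) e'); apply: (eq_of_diff (- (half * (iw * iw))) es).
  apply: (eq_of_diff (2 * s * (a - b)) (erefl : half * (rr + ii * aK * cc) * (iw * iw) = b)).
  ring.
- rewrite {1}/kn_s !(dE 2, kn_iw_th, iE).
  apply: (eq_of_diff (-1) kn_bma); apply: (eq_of_diff (s * (a - b)) es).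
  ring.
- rewrite {1}/kn_ct !(dE 2, kn_iw_th, iS_D, iE).
  apply: (eq_of_diff (- (iw * iw)) iSE); apply: (eq_of_diff (- 1) e).
  apply: (eq_of_diff (s * (a - b) - ct - cc * iS * iw) (erefl : cc * iS * iw = ct)).
  ring.
Qed.

Variable E : 'M[K]_4.
Local Notation d := (frd D E).
Hypothesis E0 : [/\ E 0 0 = X * (iw * iw), E 0 1 = - Dl, E 0 2 = 0 & E 0 3 = aK * (iw * iw)].
Hypothesis E1 : [/\ E 1 0 = X * iD, E 1 1 = 1, E 1 2 = 0 & E 1 3 = aK * iD].
Hypothesis E2 : [/\ E 2 0 = s, E 2 1 = 0, E 2 2 = iw & E 2 3 = ii * iw * iS].
Hypothesis E3 : [/\ E 3 0 = - s, E 3 1 = 0, E 3 2 = iw & E 3 3 = - (ii * iw * iS)].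

Let EE : (E 0 0 = X * (iw * iw)) * (E 0 1 = - Dl) * (E 0 2 = 0) * (E 0 3 = aK * (iw * iw))
  * ((E 1 0 = X * iD) * (E 1 1 = 1) * (E 1 2 = 0) * (E 1 3 = aK * iD))
  * ((E 2 0 = s) * (E 2 1 = 0) * (E 2 2 = iw) * (E 2 3 = ii * iw * iS))
  * ((E 3 0 = - s) * (E 3 1 = 0) * (E 3 2 = iw) * (E 3 3 = - (ii * iw * iS))).
Proof. by case: E0 E1 E2 E3 => ? ? ? ? [? ? ? ?] [? ? ? ?] [? ? ? ?]. Qed.

(** On functions of r and theta alone, e_4 acts as the r derivative, e_3 as minus Delta/|q|^2 times
    it, and m and mb both as the theta derivative over |q|. *)
Let dr f r t : D 0 f = 0 -> D 3 f = 0 -> D 1 f = r -> iw * D 2 f = t ->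
  [/\ d 0 f = - (Dl * r), d 1 f = r, d 2 f = t & d 3 f = t].
Proof.
by move=> z0 z3 <- <-; rewrite /frd !sum4 !EE z0 z3; split; ring.
Qed.

Let z0 := kn_0 (i := 0) isT isT.
Let z3 := kn_0 (i := 3) isT isT.

Let daE : [/\ d 0 a = 2 * Dl * a * a, d 1 a = - (2 * a * a), d 2 a = 2 * s * a * a
  & d 3 a = 2 * s * a * a].
Proof.
case: z0 z3 kn_r kn_th => u _ _ _ [v _ _ _] [r _ _ _] [t _ _ _].
by have [-> -> -> ->] := dr u v r t; split; ring.
Qed.
Let dbE : [/\ d 0 b = 2 * Dl * b * b, d 1 b = - (2 * b * b), d 2 b = - (2 * s * b * b)
  & d 3 b = - (2 * s * b * b)].
Proof.
case: z0 z3 kn_r kn_th => _ u _ _ [_ v _ _] [_ r _ _] [_ t _ _].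
by have [-> -> -> ->] := dr u v r t; split; ring.
Qed.
Let dsE : [/\ d 0 s = Dl * s * (a + b), d 1 s = - (s * (a + b)),
  d 2 s = (b - a) * (1 - s * s) & d 3 s = (b - a) * (1 - s * s)].
Proof.
case: z0 z3 kn_r kn_th => _ _ u _ [_ _ v _] [_ _ r _] [_ _ t _].
by have [-> -> -> ->] := dr u v r t; split; ring.
Qed.
Let dctE : [/\ d 0 ct = Dl * ct * (a + b), d 1 ct = - (ct * (a + b)),
  d 2 ct = s * ct * (a - b) - ct * ct - 4 * a * b
  & d 3 ct = s * ct * (a - b) - ct * ct - 4 * a * b].
Proof.
case: z0 z3 kn_r kn_th => _ _ _ u [_ _ _ v] [_ _ _ r] [_ _ _ t].
by have [-> -> -> ->] := dr u v r t; split; ring.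
Qed.
Let diwE : [/\ d 0 iw = Dl * iw * (a + b), d 1 iw = - (iw * (a + b)),
  d 2 iw = iw * s * (a - b) & d 3 iw = iw * s * (a - b)].
Proof.
have [-> -> -> ->] := dr (kn_iw0 (i := 0) isT isT) (kn_iw0 (i := 3) isT isT)
  kn_iw_r (congr1 ( *%R iw) kn_iw_th); split; ring.
Qed.
Let diSE : [/\ d 0 iS = 0, d 1 iS = 0, d 2 iS = - (ct * iS) & d 3 iS = - (ct * iS)].
Proof.
have h i : i != 2 -> D i iS = 0 by move=> /negPf e; rewrite iS_D e iE; ring.
have h2 : iw * D 2 iS = - (ct * iS) by rewrite iS_D iE /kn_ct; ring.
have [-> -> -> ->] := dr (h 0 isT) (h 3 isT) (h 1 isT) h2; split; ring.
Qed.
Let drrE : [/\ d 0 rr = - Dl, d 1 rr = 1, d 2 rr = 0 & d 3 rr = 0].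
Proof.
have h2 : iw * D 2 rr = 0 by rewrite rrD iE mulr0.
have h1 : D 1 rr = 1 by rewrite rrD iE.
have [-> -> -> ->] := dr (rrD 0) (rrD 3) h1 h2; split; ring.
Qed.
Let diDE : [/\ d 0 iD = iD * (iw * iw) * (2 * (rr - M)), d 1 iD = - (iD * iD * (2 * (rr - M))),
  d 2 iD = 0 & d 3 iD = 0].
Proof.
have h i : i != 1 -> D i iD = 0 by move=> /negPf e; rewrite iD_D e iE; ring.
have h1 : D 1 iD = - (iD * iD * (2 * (rr - M))) by rewrite iD_D iE; ring.
have h2 : iw * D 2 iD = 0 by rewrite h // mulr0.
have [-> -> -> ->] := dr (h 0 isT) (h 3 isT) h1 h2; rewrite -kn_DiD; split; ring.
Qed.
Let dcst l : [/\ d l ii = 0, d l aK = 0, d l M = 0 & d l Q = 0].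
Proof. by rewrite /frd !sum4 !csE; split; ring. Qed.
Let dnat l k : d l k%:R = 0.
Proof. by apply: derivation_nat => x y; exact: frdM. Qed.

Let gE : (d 0 a = 2 * Dl * a * a) * (d 1 a = - (2 * a * a)) * (d 2 a = 2 * s * a * a)
  * (d 3 a = 2 * s * a * a)
  * ((d 0 b = 2 * Dl * b * b) * (d 1 b = - (2 * b * b)) * (d 2 b = - (2 * s * b * b))
  * (d 3 b = - (2 * s * b * b)))
  * ((d 0 s = Dl * s * (a + b)) * (d 1 s = - (s * (a + b))) *
  (d 2 s = (b - a) * (1 - s * s)) * (d 3 s = (b - a) * (1 - s * s)))
  * ((d 0 ct = Dl * ct * (a + b)) * (d 1 ct = - (ct * (a + b))) *
  (d 2 ct = s * ct * (a - b) - ct * ct - 4 * a * b)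
  * (d 3 ct = s * ct * (a - b) - ct * ct - 4 * a * b))
  * ((d 0 iw = Dl * iw * (a + b)) * (d 1 iw = - (iw * (a + b))) *
  (d 2 iw = iw * s * (a - b)) * (d 3 iw = iw * s * (a - b)))
  * ((d 0 iS = 0) * (d 1 iS = 0) * (d 2 iS = - (ct * iS)) * (d 3 iS = - (ct * iS)))
  * ((d 0 rr = - Dl) * (d 1 rr = 1) * (d 2 rr = 0) * (d 3 rr = 0))
  * ((d 0 iD = iD * (iw * iw) * (2 * (rr - M))) * (d 1 iD = - (iD * iD * (2 * (rr - M))))
  * (d 2 iD = 0) * (d 3 iD = 0)).
Proof.
case: daE dbE dsE dctE => ? ? ? ? [? ? ? ?] [? ? ? ?] [? ? ? ?].
by case: diwE diSE drrE diDE => ? ? ? ? [? ? ? ?] [? ? ? ?] [? ? ? ?].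
Qed.
Let dcE l : (d l ii = 0) * (d l aK = 0) * (d l M = 0) * (d l Q = 0).
Proof. by case: (dcst l). Qed.
Let dDl l x y : d l (x + y) = d l x + d l y. Proof. exact: raddfD. Qed.
Let dNl l x : d l (- x) = - d l x. Proof. exact: raddfN. Qed.
Let d0l l : d l 0 = 0. Proof. exact: raddf0. Qed.
Let fE := (gE, dcE, fun l => dnat l 1, fun l => dnat l 2, fun l => dnat l 4,
  d0l, dDl, dNl, frdM DM E).

Definition kn_nu3 := 2 * Dl * (a + b) + 8 * M * a * b - 2 * a - 2 * b.

(* The commutators of the principal null frame. *)
Definition kn_comm (l k : 'I_4) : seq K :=
  match val l, val k return seq K with
  | 1, 2 => [:: 0; 0; - (a + b); 0] | 1, 3 => [:: 0; 0; 0; - (a + b)]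
  | 0, 2 => [:: 2 * s * (b - a); 0; Dl * (a + b); 0]
  | 0, 3 => [:: 2 * s * (b - a); 0; 0; Dl * (a + b)]
  | 1, 0 => [:: 0; kn_nu3; 2 * s * (a + b); - (2 * s * (a + b))]
  | 2, 3 => [:: 2 * (a - b); 2 * (a - b) * Dl; ct - s * (b - a); s * (b - a) - ct]
  | _, _ => [::] end.

Definition kn_pairs : seq ('I_4 * 'I_4) :=
  [:: (1, 2); (1, 3); (0, 2); (0, 3); (1, 0); (2, 3)].

Let dXE : (d 0 X = - (2 * rr * Dl)) * (d 1 X = 2 * rr) * (d 2 X = 0) * (d 3 X = 0).
Proof. by rewrite /X !fE; do !split; ring. Qed.
Let dDE : (d 0 Dl = Dl * kn_nu3) * (d 1 Dl = - kn_nu3) * (d 2 Dl = - (2 * s * (b - a) * Dl))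
  * (d 3 Dl = - (2 * s * (b - a) * Dl)).
Proof.
by do !split; rewrite {1}/kn_D !fE /kn_nu3 /kn_D; ring.
Qed.
Let fE' := (dXE, dDE, fE).

Lemma kn_frame_comm l k j : (l, k) \in kn_pairs ->
  d l (E k j) - d k (E l j) = \sum_(t < 4) (kn_comm l k)`_t * E t j.
Proof.
have jP : j \in [:: 0; 1; 2; 3] by case: j => [[|[|[|[|//]]]] ?].
have [iw2 DiD] := (kn_iw2, kn_DiD).
rewrite sum4 !inE => /or4P[|||/or3P[]] /eqP[-> ->]; move: jP; rewrite !inE => /or4P[]/eqP->;
  rewrite !EE /kn_comm /= !fE' ?oppr0; try ring.
(* Left over are the t and phi components of the brackets of e_4, e_3 and of m, mb; there [iD],
   present in e_4, must be eliminated through [kn_DiD]. *)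
- apply: (eq_of_diff (2 * rr - 2 * (a + b) * X) DiD).
  apply: (eq_of_diff (2 * X * iD - 4) kn_apb); apply: (eq_of_diff (2 * M * X * iD) iw2).
  apply: (eq_of_diff (- (4 * (a + b))) kn_X); rewrite /kn_nu3; ring.
- apply: (eq_of_diff (- (2 * (a + b) * aK)) DiD); apply: (eq_of_diff (- (4 * (a + b))) kn_s_iS).
  apply: (eq_of_diff (2 * aK * iD) kn_apb); apply: (eq_of_diff (2 * M * aK * iD) iw2).
  rewrite /kn_nu3; ring.
- apply: (eq_of_diff (- (2 * (a - b) * X)) DiD); apply: (eq_of_diff (- (4 * (a - b))) kn_X).
  apply: (eq_of_diff (- 2) kn_sctE); ring.
- apply: (eq_of_diff (- (2 * (a - b) * aK)) DiD).
  apply: (eq_of_diff (- (4 * (a - b))) kn_s_iS); ring.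
Qed.

Lemma kn_commE l k f : (l, k) \in kn_pairs ->
  d l (d k f) - d k (d l f) = \sum_(t < 4) (kn_comm l k)`_t * d t f.
Proof.
move=> lk; rewrite (frd_comm_coord DM DC); under eq_bigr do rewrite (kn_frame_comm _ lk) mulr_suml.
rewrite exchange_big; apply: eq_bigr => t _ /=.
by rewrite /frd mulr_sumr; apply: eq_bigr => j _; rewrite mulrA.
Qed.

Lemma kn_table : kn_background (d 0) (d 1) (d 2) (d 3) a b s ct M Q.
Proof.
split; rewrite /= ?gE ?dcE //; try exact: kn_sctE.
- by move=> f; rewrite kn_commE // sum4 /kn_comm /=; ring.
- by move=> f; rewrite kn_commE // sum4 /kn_comm /= -/kn_D; ring.
- by move=> f; rewrite kn_commE // sum4 /kn_comm /= -/kn_D; ring.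
Qed.

Lemma kn_ct_deriv : d 2 ct = s * ct * (a - b) - ct * ct - 4 * a * b /\
  d 3 ct = s * ct * (a - b) - ct * ct - 4 * a * b.
Proof. by rewrite !gE. Qed.

End KerrNewmanFrame.

(** * Spin coefficients and curvature of the background *)

Section KerrNewmanSpin.
Context {K K0 : comPzRingType}.
Variable ev : {rmorphism K -> K0}.
Variables (D : 'I_4 -> {additive K -> K}) (D0 : 'I_4 -> {additive K0 -> K0}).
Hypothesis DM : forall i x y, D i (x * y) = D i x * y + x * D i y.
Hypothesis DC : forall i j x, D i (D j x) = D j (D i x).
Hypothesis D0M : forall i x y, D0 i (x * y) = D0 i x * y + x * D0 i y.
Hypothesis D0C : forall i j x, D0 i (D0 j x) = D0 j (D0 i x).
Hypothesis evD : forall i x, ev (D i x) = D0 i (ev x).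
Variables (half : K) (g E : 'M[K]_4).
Hypothesis half2 : half + half = 1.
Hypothesis gT : g^T = g.
Hypothesis EgE : E *m g *m E^T = nullmx 2.
Local Notation up := (up D half g E (nullmx half)).
Local Notation w := (spin D half g E).
Local Notation d := (frd D E).
Local Notation E0 := (map_mx ev E).
Local Notation d0 := (frd D0 E0).
Local Notation curv := (curv D half g E (nullmx 2) (nullmx half)).
Local Notation ricf := (ricf D half g E).
Local Notation scal := (scal D half g E (nullmx half)).

Lemma ev_frd l x : ev (d l x) = d0 l (ev x).
Proof.
by rewrite rmorph_sum; apply: eq_bigr => i _; rewrite rmorphM evD /= !mxE.
Qed.

Lemma frame_indep (x y : 'I_4 -> K0) :
  (forall j, \sum_t x t * E0 t j = \sum_t y t * E0 t j) -> forall t, x t = y t.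
Proof.
move=> h t; have := congr1 (map_mx ev) (mulmx1C (E_inv (nullmx_inv half2) EgE)).
rewrite map_mxM map_mx1 => einv.
have e : (\row_t x t) *m E0 = (\row_t y t) *m E0.
  apply/rowP => j; rewrite !mxE.
  under eq_bigr do rewrite mxE; under [RHS]eq_bigr do rewrite mxE.
  exact: h.
have := congr1 (mulmx^~ (map_mx ev (g *m E^T *m nullmx half))) e.
by rewrite /= -[LHS]mulmxA -[RHS]mulmxA einv !mulmx1 => /rowP/(_ t); rewrite !mxE.
Qed.

Variables (ii aK M Q rr cc ss iw iS iD : K0).
Let half0 := ev half.
Local Notation a := (kn_a half0 ii aK rr cc iw).
Local Notation b := (kn_b half0 ii aK rr cc iw).
Local Notation s := (kn_s ii aK ss iw).
Local Notation ct := (kn_ct cc iw iS).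
Local Notation Dl := (kn_D half0 ii aK M Q rr cc ss iw).
Local Notation cm := (kn_comm half0 ii aK M Q rr cc ss iw iS).
Local Notation nu3' := (kn_nu3 half0 ii aK M Q rr cc ss iw).
Hypothesis comm0 : forall l k j, (l, k) \in kn_pairs ->
  d0 l (E0 k j) - d0 k (E0 l j) = \sum_(t < 4) (cm l k)`_t * E0 t j.
Hypothesis kn : kn_background (d0 0) (d0 1) (d0 2) (d0 3) a b s ct M Q.
Hypothesis kn_ct2 : d0 2 ct = s * ct * (a - b) - ct * ct - 4 * a * b.
Hypothesis kn_ct3 : d0 3 ct = s * ct * (a - b) - ct * ct - 4 * a * b.

(** Without torsion the antisymmetric part of the connection is the bracket of frame vectors, and
    the rows of the frame are independent. *)
Lemma ev_up l k t : (l, k) \in kn_pairs -> ev (up l k t - up k l t) = (cm l k)`_t.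
Proof.
move=> lk; apply: (frame_indep (x := fun t => ev (up l k t - up k l t))
  (y := fun t => (cm l k)`_t)) => j.
rewrite -(comm0 j lk) [E0 k j]mxE [E0 l j]mxE -!ev_frd -rmorphB.
rewrite (frd_E D half gT (nullmx_inv half2) EgE) rmorph_sum; apply: eq_bigr => u _.
by rewrite rmorphM [E0 u j]mxE.
Qed.

Let halfK x : half0 * (2 * x) = x.
Proof.
by rewrite mulrA mulr_natr mulr2n -rmorphD half2 rmorph1 mul1r.
Qed.
Let two_inj (x y : K0) : 2 * x = 2 * y -> x = y.
Proof. by move=> e; rewrite -[x]halfK e halfK. Qed.

Let T l k c := ev (w l k c - w k l c).

Let TE l k : (l, k) \in kn_pairs -> (T l k 1 = - (cm l k)`_0) * (T l k 0 = - (cm l k)`_1)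
  * (T l k 3 = (cm l k)`_2) * (T l k 2 = (cm l k)`_3).
Proof.
move=> lk; have e t := ev_up t lk.
have u := up_spin D half2 g E.
have := (e 0, e 1, e 2, e 3); rewrite !u => -[[[e0 e1] e2] e3].
rewrite /T; do !split.
- by rewrite -(e0 : _ = (cm l k)`_0) -rmorphN; congr (ev _); ring.
- by rewrite -(e1 : _ = (cm l k)`_1) -rmorphN; congr (ev _); ring.
- by rewrite -(e2 : _ = (cm l k)`_2).
- by rewrite -(e3 : _ = (cm l k)`_3).
Qed.

Let anti l x y : w l x y = - w l y x.
Proof. exact: (spin_anti DM half2 gT EgE). Qed.
Let Tanti l k c : T k l c = - T l k c.
Proof. by rewrite /T -rmorphN; congr (ev _); ring. Qed.
Let Td l c : T l l c = 0.
Proof. by rewrite /T subrr rmorph0. Qed.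

(** Koszul formula for a frame with constant Gram matrix: antisymmetry in the last two indices
    recovers the connection from its torsion-free antisymmetrisation. *)
Let koszul l x y : 2 * ev (w l x y) = T l x y - T x y l + T y l x.
Proof.
have -> : 2 * ev (w l x y) = ev (w l x y + w l x y).
  by rewrite rmorphD mulr_natl mulr2n.
rewrite /T -!rmorphB -rmorphD; congr (ev _).
rewrite (anti l y x) (anti y x l) (anti x y l); ring.
Qed.

Let TV : (T 1 2 0 = 0) * (T 1 2 1 = 0) * (T 1 2 2 = 0) * (T 1 2 3 = - (a + b))
  * ((T 1 3 0 = 0) * (T 1 3 1 = 0) * (T 1 3 2 = - (a + b)) * (T 1 3 3 = 0))
  * ((T 0 2 0 = 0) * (T 0 2 1 = - (2 * s * (b - a))) * (T 0 2 2 = 0)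
     * (T 0 2 3 = Dl * (a + b)))
  * ((T 0 3 0 = 0) * (T 0 3 1 = - (2 * s * (b - a))) * (T 0 3 2 = Dl * (a + b))
     * (T 0 3 3 = 0))
  * ((T 1 0 0 = - nu3') * (T 1 0 1 = 0) * (T 1 0 2 = - (2 * s * (a + b)))
     * (T 1 0 3 = 2 * s * (a + b)))
  * ((T 2 3 0 = - (2 * (a - b) * Dl)) * (T 2 3 1 = - (2 * (a - b)))
     * (T 2 3 2 = s * (b - a) - ct) * (T 2 3 3 = ct - s * (b - a))).
Proof.
have h l k := @TE l k; have o : - 0 = 0 :> K0 by exact: oppr0.
have [[[h1 h2] h3] h4] := h 1 2 isT; have [[[k1 k2] k3] k4] := h 1 3 isT.
have [[[l1 l2] l3] l4] := h 0 2 isT; have [[[m1 m2] m3] m4] := h 0 3 isT.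
have [[[n1 n2] n3] n4] := h 1 0 isT; have [[[p1 p2] p3] p4] := h 2 3 isT.
by rewrite h1 h2 h3 h4 k1 k2 k3 k4 l1 l2 l3 l4 m1 m2 m3 m4 n1 n2 n3 n4 p1 p2 p3 p4
  /kn_comm /= !o.
Qed.

Let TN : (forall c, T 2 1 c = - T 1 2 c) * (forall c, T 3 1 c = - T 1 3 c)
  * (forall c, T 2 0 c = - T 0 2 c) * (forall c, T 3 0 c = - T 0 3 c)
  * (forall c, T 0 1 c = - T 1 0 c) * (forall c, T 3 2 c = - T 2 3 c).
Proof. by do 5?split; move=> c; exact: Tanti. Qed.

Lemma ev_spinE :
  [/\ ev (w 0 1 2) = 2 * s * b, ev (w 0 1 3) = - (2 * s * a), ev (w 1 0 3) = 2 * s * b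
    & ev (w 1 0 2) = - (2 * s * a)] /\
  [/\ ev (w 3 1 2) = 2 * b, ev (w 2 1 3) = 2 * a, ev (w 2 0 3) = - (2 * Dl * b)
    & ev (w 3 0 2) = - (2 * Dl * a)] /\
  [/\ ev (w 1 1 2) = 0, ev (w 1 1 3) = 0, ev (w 2 1 2) = 0 & ev (w 3 1 3) = 0] /\
  [/\ ev (w 0 0 3) = 0, ev (w 0 0 2) = 0, ev (w 3 0 3) = 0 & ev (w 2 0 2) = 0] /\
  [/\ ev (w 0 1 0) = nu3', ev (w 1 1 0) = 0, ev (w 2 1 0) = 2 * s * a
    & ev (w 3 1 0) = - (2 * s * b)] /\
  [/\ ev (w 0 2 3) = - (Dl * (b - a)), ev (w 1 2 3) = - (b - a),
    ev (w 2 2 3) = - (s * (b - a) - ct) & ev (w 3 2 3) = - (ct - s * (b - a))].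
Proof.
by do !split; apply: two_inj; rewrite koszul ?(TN, TV, Td); ring.
Qed.

Let wD l x : w l x x = 0. Proof. exact: (spin_diag DM half2 gT EgE). Qed.
Let wN l := (anti l 0 1, anti l 2 1, anti l 3 1, anti l 2 0, anti l 3 0, anti l 3 2, wD l).

Let wE : (ev (w 0 1 2) = 2 * s * b) * (ev (w 0 1 3) = - (2 * s * a))
  * (ev (w 1 0 3) = 2 * s * b) * (ev (w 1 0 2) = - (2 * s * a))
  * ((ev (w 3 1 2) = 2 * b) * (ev (w 2 1 3) = 2 * a) * (ev (w 2 0 3) = - (2 * Dl * b))
     * (ev (w 3 0 2) = - (2 * Dl * a)))
  * ((ev (w 1 1 2) = 0) * (ev (w 1 1 3) = 0) * (ev (w 2 1 2) = 0) * (ev (w 3 1 3) = 0))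
  * ((ev (w 0 0 3) = 0) * (ev (w 0 0 2) = 0) * (ev (w 3 0 3) = 0) * (ev (w 2 0 2) = 0))
  * ((ev (w 0 1 0) = nu3') * (ev (w 1 1 0) = 0) * (ev (w 2 1 0) = 2 * s * a)
     * (ev (w 3 1 0) = - (2 * s * b)))
  * ((ev (w 0 2 3) = - (Dl * (b - a))) * (ev (w 1 2 3) = - (b - a))
     * (ev (w 2 2 3) = - (s * (b - a) - ct)) * (ev (w 3 2 3) = - (ct - s * (b - a)))).
Proof.
have [[-> -> -> ->] [[-> -> -> ->] [[-> -> -> ->] [[-> -> -> ->] [[-> -> -> ->] [-> -> -> ->]]]]]] := ev_spinE.
by [].
Qed.

Let d0n l n : d0 l n%:R = 0.
Proof. by apply: derivation_nat => x y; exact: frdM. Qed.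
Let dDl l x y : d0 l (x + y) = d0 l x + d0 l y. Proof. exact: raddfD. Qed.
Let dNl l x : d0 l (- x) = - d0 l x. Proof. exact: raddfN. Qed.
Let dE := ((kn_d3M kn, kn_d4M kn, kn_dmM kn, kn_dbM kn,
   kn_d3Q kn, kn_d4Q kn, kn_dmQ kn, kn_dbQ kn),
  (kn_d3a kn, kn_d3b kn, kn_d3s kn, kn_d3ct kn,
   kn_d4a kn, kn_d4b kn, kn_d4s kn, kn_d4ct kn),
  (kn_dma kn, kn_dmb kn, kn_dms kn, kn_dba kn, kn_dbb kn, kn_dbs kn, kn_ct2, kn_ct3),
  fun l => d0n l 0, fun l => d0n l 1, fun l => d0n l 2, fun l => d0n l 4, fun l => d0n l 8,
  dDl, dNl, frdM D0M E0).

Let curvV p q l k := (curv_spin DM half2 gT EgE p q l k).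
Let cE p q l k : ev (curv p q l k) = 2 * (d0 l (ev (w k q p)) - d0 k (ev (w l q p))
  + (ev (w l k 1) - ev (w k l 1)) * ev (w 0 q p) + (ev (w l k 0) - ev (w k l 0)) * ev (w 1 q p)
  - (ev (w l k 3) - ev (w k l 3)) * ev (w 2 q p) - (ev (w l k 2) - ev (w k l 2)) * ev (w 3 q p)
  - (ev (w k q 1) * ev (w l 0 p) + ev (w k q 0) * ev (w l 1 p)
     - ev (w l q 1) * ev (w k 0 p) - ev (w l q 0) * ev (w k 1 p))
  + (ev (w k q 3) * ev (w l 2 p) + ev (w k q 2) * ev (w l 3 p)
     - ev (w l q 3) * ev (w k 2 p) - ev (w l q 2) * ev (w k 3 p))).
Proof. by rewrite curvV !(rmorphD, rmorphN, rmorphM, rmorph_nat, ev_frd). Qed.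

(** The curvature combination behind P: four times its background value, plus a Ricci contribution
    in Q^2 that [peeling] removes. *)
Lemma ev_curv_em : ev (curv 1 0 1 0) - ev (curv 2 3 0 1) = 
  4 * (32 * Q * Q * a * a * a * b - 16 * M * a * a * a) + 64 * Q * Q * a * a * b * b.
Proof.
rewrite !cE !wN !(rmorphN ev, rmorph0 ev) !wE /kn_nu3 /kn_D !dE; ring: (kn_sct kn).
Qed.

Let ev_ricf p q x : ev (curv 2 p 3 q) + ev (curv 3 p 2 q) - ev (curv 0 p 1 q)
    - ev (curv 1 p 0 q) = 2 * x -> ev (ricf p q) = x.
Proof.
move=> e; rewrite (ricfE DM DC half2 gT EgE) !(rmorphM, rmorphD, rmorphN) e.
exact: halfK.
Qed.

Lemma ev_ricf01 : ev (ricf 0 1) = 32 * Q * Q * a * a * b * b.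
Proof.
apply: ev_ricf.
rewrite !cE !wN !(rmorphN ev, rmorph0 ev) !wE /kn_nu3 /kn_D !dE; ring: (kn_sct kn).
Qed.
Lemma ev_ricf10 : ev (ricf 1 0) = 32 * Q * Q * a * a * b * b.
Proof.
apply: ev_ricf.
rewrite !cE !wN !(rmorphN ev, rmorph0 ev) !wE /kn_nu3 /kn_D !dE; ring: (kn_sct kn).
Qed.
Lemma ev_ricf23 : ev (ricf 2 3) = 32 * Q * Q * a * a * b * b.
Proof.
apply: ev_ricf.
rewrite !cE !wN !(rmorphN ev, rmorph0 ev) !wE /kn_nu3 /kn_D !dE; ring: (kn_sct kn).
Qed.
Lemma ev_ricf32 : ev (ricf 3 2) = 32 * Q * Q * a * a * b * b.
Proof.
apply: ev_ricf.
rewrite !cE !wN !(rmorphN ev, rmorph0 ev) !wE /kn_nu3 /kn_D !dE; ring: (kn_sct kn).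
Qed.

(** The four Ricci components entering the trace have the same background value, and the two signs
    of the null metric cancel them. *)
Lemma ev_scal : ev scal = 0.
Proof.
rewrite /scal con2_ginv !sum4 !mxE /= -!/(ricf _ _).
rewrite !(mul0r, add0r, addr0) !(rmorphD, rmorphM, rmorphN).
rewrite ev_ricf01 ev_ricf10 ev_ricf23 ev_ricf32 -/half0; ring.
Qed.

End KerrNewmanSpin.

(** * Scalar form of the gauge-invariant quantities and of the operators *)

Section TetradEquations.
Context {K : comPzRingType}.
Variables (D : 'I_4 -> {additive K -> K}) (half : K) (g E F : 'M[K]_4).
Local Notation w := (spin D half g E).
Local Notation ff := (ff E F).

Definition phi_F := half * (ff 0 1 + ff 2 3).
Definition phic_F := half * (ff 0 1 - ff 2 3).

(* The conformal frame derivative on components of type [p] and spin [j]. *)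
Definition ckd l (p j k : K) : K := frd D E l k + (p * w l 1 0 + j * (- w l 2 3)) * k.

Variables (Bw Pw Pcw : K).
Local Notation ta := (w 0 1 2). Local Notation tac := (w 0 1 3).
Local Notation tp := (w 1 0 3). Local Notation tpc := (w 1 0 2).
Local Notation rh := (w 3 1 2). Local Notation rhc := (w 2 1 3).
Local Notation rp := (w 2 0 3). Local Notation rpc := (w 3 0 2).

Definition frakF_K : K := - half * ckd 2 1 1 (ff 2 1) - 3 * half * (ta * ff 2 1) + phi_F * w 2 1 2.
Definition frakX_K : K := ckd 1 1 1 (ff 2 1) + 3 * rh * ff 2 1 - 2 * phi_F * w 1 1 2.
Definition frakB_K : K := 2 * phi_F * Bw - 3 * Pcw * ff 2 1.

(** Component form of [T1]. One half of Dbar-dot after D-hat-otimes becomes the mb derivative of the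
    m derivative, and each contraction of a conjugate with an element of s_1(C) or s_2(C) yields a
    factor 2. The same rules give the definitions that follow. *)
Definition T1K k : K := - ckd 0 2 1 (ckd 1 1 1 k) + ckd 3 1 2 (ckd 2 1 1 k)
  - 6 * rh * ckd 0 1 1 k - (3 * rp + rpc) * ckd 1 1 1 k
  + (6 * ta * ckd 3 1 1 k + (tac + 3 * tp) * ckd 2 1 1 k)
  + (- (18 * rp * rh) - 4 * phi_F * phic_F + 18 * tp * ta) * k.
Definition M1K u f : K := 2 * phi_F * phic_F *
  (4 * ckd 3 1 2 u + 8 * tp * u - (4 * rp - 2 * rpc) * f).
Definition T2K u : K := - ckd 0 2 2 (ckd 1 1 2 u) + ckd 2 1 1 (ckd 3 1 2 u)
  - (3 * rh + rhc) * ckd 0 1 2 u - (rp + rpc) * ckd 1 1 2 u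
  + ((4 * ta + tpc) * ckd 3 1 2 u + tac * ckd 2 1 2 u)
  + (- (3 * rp * rh) - rpc * rhc + 3 * Pcw - Pw + 4 * phi_F * phic_F
     - 3 * ckd 3 0 1 ta) * u + tpc * (tac * u).
Definition M2K al f h : K := - phi_F * (ckd 0 2 2 al + (3 * rp - rpc) * al)
  + 3 * half * ckd 0 0 1 ta * f + (2 * ta - tpc) * h.
Definition T3K al : K := - ckd 1 1 2 (ckd 0 2 2 al) + ckd 2 2 1 (ckd 3 2 2 al)
  - (rhc + 4 * rh) * ckd 0 2 2 al - rp * ckd 1 2 2 al
  + ((4 * ta + tpc) * ckd 3 2 2 al + tp * ckd 2 2 2 al)
  + (- (4 * rh * rp) + 2 * Pcw - 2 * phi_F * phic_F) * al + 4 * ta * tp * al.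
Definition M3K u f : K := 2 * phic_F * (2 * ckd 1 1 2 u + 4 * rh * u + (tpc + ta) * f).

End TetradEquations.

(** * The three equations modulo the ideal of negligible elements *)

Section Assembly.
Context {K K0 : comPzRingType}.
Variables (ev : {rmorphism K -> K0}) (dl : {additive K -> K0}).
Hypothesis dlM : forall x y, dl (x * y) = dl x * ev y + ev x * dl y.
Variables (D : 'I_4 -> {additive K -> K}) (D0 : 'I_4 -> {additive K0 -> K0}).
Hypothesis DM : forall i x y, D i (x * y) = D i x * y + x * D i y.
Hypothesis DC : forall i j x, D i (D j x) = D j (D i x).
Hypothesis D0M : forall i x y, D0 i (x * y) = D0 i x * y + x * D0 i y.
Hypothesis D0C : forall i j x, D0 i (D0 j x) = D0 j (D0 i x).
Hypothesis evD : forall i x, ev (D i x) = D0 i (ev x).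
Hypothesis dlD : forall i x, dl (D i x) = D0 i (dl x).
Variables (half : K) (g E F : 'M[K]_4).
Hypothesis half2 : half + half = 1.
Hypothesis gT : g^T = g.
Hypothesis FT : F^T = - F.
Hypothesis EgE : E *m g *m E^T = nullmx 2.
Local Notation w := (spin D half g E).
Local Notation ff := (ff E F).
Local Notation d := (frd D E).
Local Notation E0 := (map_mx ev E).
Local Notation d0 := (frd D0 E0).
Local Notation curv := (curv D half g E (nullmx 2) (nullmx half)).
Local Notation ricf := (ricf D half g E).
Local Notation phi := (phi_F half E F).
Local Notation phic := (phic_F half E F).
Local Notation ck := (ckd D half g E).
Variables (ii aK M Q rr cc ss iw iS iD : K0).
Let half0 := ev half.
Local Notation a := (kn_a half0 ii aK rr cc iw).
Local Notation b := (kn_b half0 ii aK rr cc iw).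
Local Notation s := (kn_s ii aK ss iw).
Local Notation ct := (kn_ct cc iw iS).
Local Notation Dl := (kn_D half0 ii aK M Q rr cc ss iw).
Local Notation cm := (kn_comm half0 ii aK M Q rr cc ss iw iS).
Local Notation nu3' := (kn_nu3 half0 ii aK M Q rr cc ss iw).
Hypothesis comm0 : forall l k j, (l, k) \in kn_pairs ->
  d0 l (E0 k j) - d0 k (E0 l j) = \sum_(t < 4) (cm l k)`_t * E0 t j.
Hypothesis commE : forall l k f, (l, k) \in kn_pairs ->
  d0 l (d0 k f) - d0 k (d0 l f) = \sum_(t < 4) (cm l k)`_t * d0 t f.
Hypothesis kn : kn_background (d0 0) (d0 1) (d0 2) (d0 3) a b s ct M Q.
Hypothesis kn_ct2 : d0 2 ct = s * ct * (a - b) - ct * ct - 4 * a * b.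
Hypothesis kn_ct3 : d0 3 ct = s * ct * (a - b) - ct * ct - 4 * a * b.

Hypothesis einN : forall i j, ev (einstein_F D half g E F i j) = 0
  /\ dl (einstein_F D half g E F i j) = 0.
Hypothesis biaN : forall k i j, ev (bianchi_F D half g E F k i j) = 0
  /\ dl (bianchi_F D half g E F k i j) = 0.
Hypothesis divN : forall j, ev (div_F D half g E F j) = 0
  /\ dl (div_F D half g E F j) = 0.

(** Algebraic form of O(eps^2). It is stable under sums and under multiplication by anything, and
    contains products of two elements that vanish in the background. *)
Definition nul k := ev k = 0 /\ dl k = 0.
Lemma nulD x y : nul x -> nul y -> nul (x + y).
Proof. by move=> [e f] [e' f']; split; [rewrite rmorphD e e' | rewrite (raddfD dl) f f']; rewrite addr0. Qed.
Lemma nulN x : nul x -> nul (- x).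
Proof. by move=> [e f]; split; [rewrite rmorphN e | rewrite (raddfN dl) f]; rewrite oppr0. Qed.
Lemma nulMl x y : nul y -> nul (x * y).
Proof.
by move=> [e f]; split; [rewrite rmorphM e mulr0 | rewrite dlM e f !mulr0 addr0].
Qed.
Lemma nulM x y : ev x = 0 -> ev y = 0 -> nul (x * y).
Proof. by move=> e f; split; [rewrite rmorphM e mul0r | rewrite dlM e f mulr0 mul0r addr0]. Qed.
Lemma nul_sum (I : Type) (r : seq I) (f : I -> K) :
  (forall i, nul (f i)) -> nul (\sum_(i <- r) f i).
Proof.
move=> h; elim: r => [|i r IH]; last by rewrite big_cons; exact: nulD.
by rewrite big_nil; split; [exact: rmorph0 | exact: raddf0].
Qed.

Lemma nul_con2 T p q : (forall i j, nul (T i j)) -> nul (con2 E T p q).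
Proof. by move=> h; apply: nul_sum => i; apply: nul_sum => j; exact: nulMl. Qed.
Lemma nul_con3 T p q r : (forall i j k, nul (T i j k)) -> nul (con3 E T p q r).
Proof.
by move=> h; apply: nul_sum => i; apply: nul_sum => j; apply: nul_sum => k; exact: nulMl.
Qed.

Let sp := ev_spinE DM evD half2 gT EgE comm0.

Let d0M l x y : d0 l (x * y) = d0 l x * y + x * d0 l y.
Proof. exact: frdM. Qed.
Let dM l x y : d l (x * y) = d l x * y + x * d l y.
Proof. exact: frdM. Qed.
Let evd l x : ev (d l x) = d0 l (ev x).
Proof. exact: ev_frd. Qed.
(** By the product rule the variation of the frame multiplies a derivative of the background value
    of [x], which is 0. *)
Let dld l x : ev x = 0 -> dl (d l x) = d0 l (dl x).
Proof.
move=> e; rewrite raddf_sum; apply: eq_bigr => i _.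
by rewrite dlM evD dlD e raddf0 mulr0 add0r /= mxE.
Qed.

Hypothesis ev_BF : ev (ff 2 1) = 0.
Hypothesis ev_BbF : ev (ff 2 0) = 0.
Hypothesis ev_BFc : ev (ff 3 1) = 0.
Hypothesis ev_BbFc : ev (ff 3 0) = 0.
Hypothesis ev_phi : ev phi = 4 * Q * b * b.
Hypothesis ev_phic : ev phic = 4 * Q * a * a.

Let nz := half * con2 E (einstein_F D half g E F) 2 1.
Let nul_z : nul nz. Proof. by apply/nulMl/nul_con2 => i j; exact: einN. Qed.
Let nul_m1 : nul (max4 D half g E F).
Proof.
rewrite (max4E DM half2 gT EgE FT) (cyc_fE DM half2 EgE F) (div_fE DM half2 EgE F).
apply: nulD; first by apply/nulMl/nul_con3 => i j k; exact: biaN.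
by apply/nulN/nul_sum => j; apply/nulMl; exact: divN.
Qed.
Let nul_m2 : nul (maxm D half g E F).
Proof.
rewrite (maxmE DM half2 gT EgE FT) (cyc_fE DM half2 EgE F) (div_fE DM half2 EgE F).
apply: nulD; first by apply/nulMl/nul_con3 => i j k; exact: biaN.
by apply/nulN/nul_sum => j; apply/nulMl; exact: divN.
Qed.

Let c12 p q l m : curv q p l m = - curv p q l m.
Proof. exact: (curv_anti12 DM half2 gT (nullmxD DM) (nullmxT half) (nullmx_inv half2) EgE). Qed.

(** These two curvature components are Ricci components, hence by the Einstein equation products of
    two components of F that vanish in the background. *)
Let R13 := half * curv 2 1 1 3.
Let R02 := half * curv 2 1 0 2.
Let nul_R13 : nul R13.
Proof.
apply: nulMl; have -> : curv 2 1 1 3 = - ricf 1 1 by rewrite (ricf_11 DM DC half2 gT EgE) opprK.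
have e := einstein_11 D half2 EgE FT.
have -> : ricf 1 1 = con2 E (einstein_F D half g E F) 1 1 + 2 * (ff 2 1 * ff 3 1).
  by rewrite e subrK.
apply/nulN/nulD; first by apply: nul_con2 => i j; exact: einN.
by apply/nulMl/nulM.
Qed.
Let nul_R02 : nul R02.
Proof.
apply: nulMl; rewrite -(ricf_22 DM DC half2 gT EgE).
have e := einstein_22 D half2 EgE FT.
have -> : ricf 2 2 = con2 E (einstein_F D half g E F) 2 2 - 2 * (ff 2 1 * ff 2 0).
  by rewrite e addrK.
apply/nulD; first by apply: nul_con2 => i j; exact: einN.
by apply/nulN/nulMl/nulM.
Qed.

Definition A_w := half * curv 1 2 1 2.
(** The Weyl component, i.e. the curvature with its Ricci part removed. [A_w] needs no correction,
    because g vanishes on all pairs formed from e_4 and m. *)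
Definition B_w := half * (curv 2 1 0 1 - ricf 2 1).
Local Notation Aw := A_w.
Local Notation Bw := B_w.
Let rc := half * ricf 2 1.
Let ph := half0 * dl (ff 2 1).

Let dhalf l : d l half = 0.
Proof.
have d1 : d l 1 = 0 by apply: (@derivation_nat _ (d l) 1); exact: dM.
have := congr1 (d l) half2; rewrite raddfD d1 => h.
by rewrite -[LHS](halfK half2) mulr_natl mulr2n h mulr0.
Qed.
Let dhM l x : d l (half * x) = half * d l x.
Proof. by rewrite dM dhalf mul0r add0r. Qed.

Let e_BD : Bw + rc = half * curv 2 1 0 1. Proof. rewrite /Bw /rc; ring. Qed.
Let e_BB : Bw - rc = half * curv 2 1 2 3.
Proof. rewrite (curv_23 DM DC half2 gT EgE) /Bw /rc; ring. Qed.
Let e_A : half * curv 2 1 1 2 = - Aw.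
Proof. rewrite (c12 1 2) /Aw; ring. Qed.
Let e_A' : Aw = - (half * curv 2 1 1 2). Proof. by rewrite e_A opprK. Qed.

Let ev_mu l x : ev (w l 2 3) = - x -> ev (- w l 2 3) = x.
Proof. by move=> e; rewrite rmorphN e opprK. Qed.

Let rcE : rc = ff 2 1 * phic + nz.
Proof.
have e := einstein_21 D half2 EgE FT.
have -> : rc = half * (con2 E (einstein_F D half g E F) 2 1 + 2 * (ff 2 1 * phic)).
  by rewrite e subrK.
by rewrite mulrDr (halfK half2) addrC.
Qed.

Let dl_ff : dl (ff 2 1) = 2 * ph.
Proof.
have h : half0 * 2 = 1 by rewrite mulr_natr mulr2n -rmorphD half2 rmorph1.
by rewrite /ph mulrA [2 * _]mulrC h mul1r.
Qed.

Let b4 : d 1 (Bw - rc) - d 3 Aw - d 2 R13 + 2 * Bw * w 3 1 2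
  + half * (curv 0 1 1 3 + curv 2 3 1 3) * w 2 1 2
  - half * (curv 0 1 2 3 + curv 2 3 2 3) * w 1 1 2 + (Bw + rc) * (w 3 1 2 - w 2 1 3)
  + R02 * w 1 1 3 - half * curv 2 1 0 3 * w 1 1 2
  - Aw * (2 * (- w 3 2 3) + 2 * w 3 1 0 + w 1 0 3) - R13 * (2 * w 2 1 0 + w 1 0 2)
  + (Bw - rc) * (- w 1 2 3 + w 1 1 0 + w 3 1 2 + w 2 1 3) = 0.
Proof.
have h := bianchi_4mb DM DC half2 gT EgE; rewrite (curv_12 DM DC half2 gT EgE) in h.
rewrite e_BD e_BB e_A' !(raddfN (d _)) /= !dhM.
apply: (eq_of_diff half h); rewrite /R13 /R02 /Bw; ring.
Qed.

Let b34 : - d 0 Aw - d 1 R02 + d 2 (Bw + rc)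
  - half * (curv 0 1 0 1 + curv 2 3 0 1) * w 2 1 2
  + half * (curv 0 1 0 2 + curv 2 3 0 2) * w 1 1 2 + 2 * Bw * w 0 1 2
  + (Bw + rc) * (- w 2 2 3 + w 2 1 0 + w 0 1 2 + w 1 0 2)
  - R02 * (2 * (- w 1 2 3) + w 2 1 3) - half * curv 2 1 0 3 * w 2 1 2
  - Aw * (2 * (- w 0 2 3) + 2 * w 0 1 0 + w 2 0 3) + R13 * w 2 0 2
  + (Bw - rc) * (w 0 1 2 - w 1 0 2) = 0.
Proof.
have h := bianchi_34m DM DC half2 gT EgE; rewrite (curv_12 DM DC half2 gT EgE) in h.
rewrite e_BD e_BB e_A' !(raddfN (d _)) /= !dhM.
apply: (eq_of_diff half h); rewrite /R13 /R02 /Bw; ring.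
Qed.

Let xi := dl (w 1 1 2).
Let sg := dl (w 2 1 2).
Let ff_dl := dl_ff.

Let R11 := ricci_ka_si DM half2 gT EgE.
Let h_ka_si := etrans R11 e_A.
Let h_ka_ta := etrans (ricci_ka_ta DM half2 gT EgE) (esym e_BD).
Let h_si_rh := etrans (ricci_si_rh DM half2 gT EgE) (esym e_BB).
Let h_rh_ta := ricci_rh_ta DM half2 gT EgE.

Let c43 f : d0 1 (d0 0 f) - d0 0 (d0 1 f) =
  nu3' * d0 1 f + 2 * s * (a + b) * d0 2 f - 2 * s * (a + b) * d0 3 f.
Proof. by rewrite commE // sum4 /kn_comm /=; ring. Qed.
Let cmb f : d0 2 (d0 3 f) - d0 3 (d0 2 f) = 2 * (a - b) * (d0 0 f + Dl * d0 1 f)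
  + (s * (b - a) - ct) * d0 3 f + (ct - s * (b - a)) * d0 2 f.
Proof. by rewrite commE // sum4 /kn_comm /=; ring. Qed.

(** Feeds the exact frame equations of the family to the linearisation lemmas, whose conclusions are
    the hypotheses of the three decoupling identities. *)
Lemma linear_system : [/\ ev Aw = 0 /\ ev Bw = 0,
  T1_kn (d0 0) (d0 1) (d0 2) (d0 3) a b s ct M Q (dl Bw) ph =
    M1_kn (d0 1) (d0 2) (d0 3) a b s ct M Q ph xi sg,
  T2_kn (d0 0) (d0 1) (d0 2) (d0 3) a b s ct M Q ph sg =
    M2_kn (d0 0) (d0 1) a b s M Q (dl Aw) (dl Bw) ph xi &
  T3_kn (d0 0) (d0 1) (d0 2) (d0 3) a b s ct M Q (dl Aw) =
    M3_kn (d0 1) (d0 2) a b s ct Q ph xi sg].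
Proof.
have [[ta tac tp tpc] [[rh rhc rp rpc] [[ka kac si sic] [[kp kpc spv spc]
  [[n3 n4 nm nb] [m3 m4 mm mb]]]]]] := sp.
have {}m3 := ev_mu m3; have {}m4 := ev_mu m4; have {}mm := ev_mu mm; have {}mb := ev_mu mb.
have [ez dz] := nul_z; have [e13 d13] := nul_R13; have [e02 d02] := nul_R02.
have [em1 dm1] := nul_m1; have [em2 dm2] := nul_m2.
have L1 := lin_D4X (d4 := d 1) (dm := d 2) (e4 := d0 1) (em := d0 2) dlM (@dld 1)
  (@dld 2) ta tpc rh rhc ka si n4 nm m4 mm h_ka_si.
have L2 := lin_D4B (d3 := d 0) (d4 := d 1) (dm := d 2) (db := d 3) (e3 := d0 0) (e4 := d0 1)
  (em := d0 2) (eb := d0 3) dlM (d0M 0) (d0M 1) (d0M 2) (d0M 3) (evd 0) (evd 1) (evd 2) (evd 3)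
  (@dld 1) (@dld 2) (@dld 3) kn kn_ct2 kn_ct3
  ta tac tp tpc rh rhc rp rpc ka kac si sic kp spv n3 n4 nm nb m3 m4 mm mb
  ev_phic ev_BF h_ka_si h_ka_ta h_rh_ta (curv_nu_mu23 DM half2 gT EgE) (curv_nu_mu13 DM half2 gT EgE)
  b4 rcE dl_ff ez dz e13 d13 e02 d02.
have L3 := lin_DmB (d3 := d 0) (d4 := d 1) (dm := d 2) (db := d 3) (e3 := d0 0) (e4 := d0 1)
  (em := d0 2) (eb := d0 3) dlM (d0M 0) (d0M 1) (d0M 2) (d0M 3) (evd 0) (evd 1) (evd 2) (evd 3)
  (@dld 0) (@dld 1) (@dld 2) kn
  ta tac tp tpc rh rhc rp rpc ka si kp kpc spv spc n3 n4 nm nb m3 m4 mm mb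
  ev_phic ev_BF h_ka_si h_ka_ta h_rh_ta (curv_nu_mu01 DM half2 gT EgE) (curv_nu_mu02 DM half2 gT EgE)
  b34 rcE dl_ff ez dz e13 d13 e02 d02.
have L4 := lin_D3X (d3 := d 0) (d4 := d 1) (dm := d 2) (db := d 3) (e3 := d0 0) (e4 := d0 1)
  (em := d0 2) (eb := d0 3) dlM (dM 1) (dM 2) (d0M 0) (d0M 1) (d0M 2) (d0M 3)
  (evd 0) (evd 1) (evd 2) (evd 3)
  (@dld 0) (@dld 1) (@dld 2) (@dld 3) kn kn_ct2 kn_ct3 c43 cmb
  ta tac tp tpc rh rhc rp rpc ka si n3 nm nb m3 m4 mb
  ev_phi ev_phic ev_BF ev_BbFc h_ka_ta h_si_rh (comm_4m DM DC half2 gT EgE)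
  (erefl (max4 D half g E F)) (erefl (maxm D half g E F)) rcE dl_ff dz em1 dm1 em2 dm2.
have EA := lin_ev_A (d4 := d 1) (dm := d 2) (e4 := d0 1) (em := d0 2) (evd 1) (evd 2)
  ta tpc rh rhc ka si n4 nm m4 mm h_ka_si.
have EB := lin_ev_B (d3 := d 0) (d4 := d 1) (e3 := d0 0) (e4 := d0 1)
  (em := d0 2) (eb := d0 3) (d0M 1) (evd 0) (evd 1) kn
  ta tac tp tpc rh ka si n3 m3 m4 ev_phic ev_BF h_ka_ta rcE ez.
have h02 : half0 + half0 = 1 by rewrite -rmorphD half2 rmorph1.
split=> //.
- exact: (T1_knE (d3 := d0 0) (d4 := d0 1) (dm := d0 2) (db := d0 3)
    (d0M 0) (d0M 1) (d0M 2) (d0M 3) kn L2 L3 L4).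
- exact: (T2_knE (d3 := d0 0) (d4 := d0 1) (dm := d0 2) (db := d0 3)
    (d0M 0) (d0M 1) (d0M 2) (d0M 3) kn h02 L3 L1 L4).
- exact: (T3_knE (d3 := d0 0) (d4 := d0 1) (dm := d0 2) (db := d0 3)
    (d0M 1) (d0M 2) kn L2 L3 L1).
Qed.

Variables (Pw Pcw : K).
Hypothesis ev_Pw : ev Pw = 32 * Q * Q * a * a * a * b - 16 * M * a * a * a.
Hypothesis ev_Pcw : ev Pcw = 32 * Q * Q * a * b * b * b - 16 * M * b * b * b.
Local Notation Fw := (frakF_K D half g E F).
Local Notation Xw := (frakX_K D half g E F).
Local Notation Ww := (frakB_K half E F Bw Pcw).
Local Notation C3 := (cder3 (d0 0) a b s M Q).
Local Notation C4 := (cder4 (d0 1) a b).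
Local Notation Cm := (cderm (d0 2) a b s ct).
Local Notation Cb := (cderb (d0 3) a b s ct).

Let wE : (ev (w 0 1 2) = 2 * s * b) * (ev (w 0 1 3) = - (2 * s * a))
  * (ev (w 1 0 3) = 2 * s * b) * (ev (w 1 0 2) = - (2 * s * a))
  * ((ev (w 3 1 2) = 2 * b) * (ev (w 2 1 3) = 2 * a) * (ev (w 2 0 3) = - (2 * Dl * b))
     * (ev (w 3 0 2) = - (2 * Dl * a)))
  * ((ev (w 1 1 2) = 0) * (ev (w 2 1 2) = 0))
  * ((ev (w 0 1 0) = nu3') * (ev (w 1 1 0) = 0) * (ev (w 2 1 0) = 2 * s * a)
     * (ev (w 3 1 0) = - (2 * s * b)))
  * ((ev (w 0 2 3) = - (Dl * (b - a))) * (ev (w 1 2 3) = - (b - a))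
     * (ev (w 2 2 3) = - (s * (b - a) - ct)) * (ev (w 3 2 3) = - (ct - s * (b - a)))).
Proof.
by have [[-> -> -> ->] [[-> -> -> ->] [[-> _ -> _] [_ [[-> -> -> ->] [-> -> -> ->]]]]]] := sp.
Qed.

Let ckE l p j k : ev (ck l p j k) = d0 l (ev k) + (ev p * ev (w l 1 0) + ev j * - ev (w l 2 3)) * ev k.
Proof. by rewrite /ckd rmorphD (rmorphM ev _ k) rmorphD (rmorphM ev p) (rmorphM ev j) rmorphN evd. Qed.
Let ck_ev l p j k : ev k = 0 -> ev (ck l p j k) = 0.
Proof. by move=> e; rewrite ckE e raddf0 mulr0 addr0. Qed.
Let ck_dl l p j k : ev k = 0 ->
  dl (ck l p j k) = d0 l (dl k) + (ev p * ev (w l 1 0) + ev j * - ev (w l 2 3)) * dl k.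
Proof.
move=> e; rewrite /ckd (raddfD dl) (dld l e) dlM e mulr0 add0r.
by rewrite rmorphD (rmorphM ev p) (rmorphM ev j) rmorphN.
Qed.
Let ck0 p j k : ev k = 0 -> dl (ck 0 p j k) = C3 (ev p) (ev j) (dl k).
Proof. by move=> e; rewrite ck_dl // !wE /cder3 /kn_nu3 /kn_D; ring. Qed.
Let ck1 p j k : ev k = 0 -> dl (ck 1 p j k) = C4 (ev p) (ev j) (dl k).
Proof. by move=> e; rewrite ck_dl // !wE /cder4; ring. Qed.
Let ck2 p j k : ev k = 0 -> dl (ck 2 p j k) = Cm (ev p) (ev j) (dl k).
Proof. by move=> e; rewrite ck_dl // !wE /cderm; ring. Qed.
Let ck3 p j k : ev k = 0 -> dl (ck 3 p j k) = Cb (ev p) (ev j) (dl k).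
Proof. by move=> e; rewrite ck_dl // !wE /cderb; ring. Qed.
Let ev1 : ev 1 = 1. Proof. exact: rmorph1. Qed.
Let ev0 : ev 0 = 0. Proof. exact: rmorph0. Qed.
Let evn n : ev n%:R = n%:R. Proof. exact: rmorph_nat. Qed.
Let evnE := (ev0, ev1, evn 2, evn 3, evn 4, evn 6, evn 8, evn 18).
Let dln n : dl n%:R = 0.
Proof.
have d1 : dl 1 = 0.
  have := dlM 1 1; rewrite mulr1 rmorph1 mulr1 mul1r => /eqP.
  by rewrite -subr_eq subrr eq_sym => /eqP.
by rewrite raddfMn d1 mul0rn.
Qed.

Let evA := let: And4 h _ _ _ := linear_system in h.1.
Let evB := let: And4 h _ _ _ := linear_system in h.2.
Let evz := (evA, evB, ev_BF, ev_phi, ev_phic, ev_Pw, ev_Pcw).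
Let morE := (rmorphD ev, rmorphN ev, rmorphM ev).
Let dlE := (raddfD dl, raddfN dl, dlM).
Let dlnE := (dln 2, dln 3, dln 4, dln 6, dln 8, dln 18).
Let h02 : half0 * 2 = 1. Proof. by rewrite mulr_natr mulr2n -rmorphD half2 rmorph1. Qed.
Let d02 l : d0 l 2 = 0.
Proof. by apply: (@derivation_nat _ (d0 l) 2); exact: d0M. Qed.

Let ckBF l p j := ck_ev l p j ev_BF.
Lemma ev_FK : ev Fw = 0.
Proof. by rewrite /frakF_K !(ckBF, evz, wE, morE); ring. Qed.
Lemma ev_XK : ev Xw = 0.
Proof. by rewrite /frakX_K !(ckBF, evz, wE, morE); ring. Qed.
Lemma ev_WK : ev Ww = 0.
Proof. by rewrite /frakB_K !(evz, morE); ring. Qed.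

Lemma dl_FK : dl Fw = 4 * Q * b * b * sg - Cm 1 1 ph - 3 * (2 * s * b) * ph.
Proof.
rewrite /frakF_K (raddfD dl) (raddfB dl) (dlM (- half)) (dlM (3 * half)) (dlM (w 0 1 2)) (dlM phi).
rewrite (ck2 _ _ ev_BF) (rmorphM ev (w 0 1 2)) !(ckBF, evz, wE, evnE) (rmorphN ev) (rmorphM ev 3) evnE -/sg -/half0.
rewrite dl_ff /cderm /= d0M d02.
apply: (eq_of_diff (- (d0 2 ph + (1 * (2 * s * a) + 1 * (s * (b - a) - ct)) * ph
  + 6 * s * b * ph)) h02); ring.
Qed.
Lemma dl_XK : dl Xw = 2 * C4 1 1 ph + 3 * (4 * b) * ph - 2 * (4 * Q * b * b) * xi.
Proof.
rewrite /frakX_K (raddfB dl) (raddfD dl) (dlM (3 * _)) (dlM (2 * phi)) (ck1 _ _ ev_BF).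
rewrite (rmorphM ev 3) (rmorphM ev 2) !(evz, wE, evnE) -/xi dl_ff /cder4 /= d0M d02; ring.
Qed.
Lemma dl_WK : dl Ww = 2 * (4 * Q * b * b) * dl Bw
  - 6 * (32 * Q * Q * a * b * b * b - 16 * M * b * b * b) * ph.
Proof.
rewrite /frakB_K (raddfB dl) (dlM (2 * phi)) (dlM (3 * _)).
rewrite (rmorphM ev 3) (rmorphM ev 2) !(evz, evnE) dl_ff; ring.
Qed.

(** Coefficients of a quantity vanishing in the background contribute only their background
    values. *)
Let dlr x y : ev y = 0 -> dl (x * y) = ev x * dl y.
Proof. by move=> e; rewrite dlM e mulr0 add0r. Qed.

Let ck0n p j k u : ev k = 0 -> dl k = u -> dl (ck 0 p%:R j%:R k) = C3 p%:R j%:R u.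
Proof. by move=> e <-; rewrite ck0 // !evn. Qed.
Let ck1n p j k u : ev k = 0 -> dl k = u -> dl (ck 1 p%:R j%:R k) = C4 p%:R j%:R u.
Proof. by move=> e <-; rewrite ck1 // !evn. Qed.
Let ck2n p j k u : ev k = 0 -> dl k = u -> dl (ck 2 p%:R j%:R k) = Cm p%:R j%:R u.
Proof. by move=> e <-; rewrite ck2 // !evn. Qed.
Let ck3n p j k u : ev k = 0 -> dl k = u -> dl (ck 3 p%:R j%:R k) = Cb p%:R j%:R u.
Proof. by move=> e <-; rewrite ck3 // !evn. Qed.

(** In the background every term has a vanishing factor. The first variation is the operator with
    background coefficients applied to the variations of frakB, frakF and frakX, which is the
    identity [T1_knE]. *)
Theorem nul_T1 : nul (T1K D half g E F Ww - M1K D half g E F Fw Xw).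
Proof.
have [_ h _ _] := linear_system; move: h.
rewrite /T1_kn /M1_kn -dl_FK -dl_XK -dl_WK /T1K /M1K => h.
have [zW zF zX] := And3 ev_WK ev_FK ev_XK.
move: zW zF zX h; move: Ww Fw Xw => W F' X zW zF zX h.
have z l p := ck_ev l p 1 zW.
(* The derivatives are generalised so that rewriting does not look inside. *)
have e1 := ck_ev 0 2 1 (z 1 1).
have d1 : dl (ck 0 2 1 (ck 1 1 1 W)) = C3 2 1 (C4 1 1 (dl W)) := ck0n 2 1 (z 1 1) (ck1n 1 1 zW erefl).
have e2 := ck_ev 3 1 2 (z 2 1).
have d2 : dl (ck 3 1 2 (ck 2 1 1 W)) = Cb 1 2 (Cm 1 1 (dl W)) := ck3n 1 2 (z 2 1) (ck2n 1 1 zW erefl).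
have e3 := ck_ev 0 1 1 zW.
have d3 : dl (ck 0 1 1 W) = C3 1 1 (dl W) := ck0n 1 1 zW erefl.
have e4 := ck_ev 1 1 1 zW.
have d4 : dl (ck 1 1 1 W) = C4 1 1 (dl W) := ck1n 1 1 zW erefl.
have e5 := ck_ev 3 1 1 zW.
have d5 : dl (ck 3 1 1 W) = Cb 1 1 (dl W) := ck3n 1 1 zW erefl.
have e6 := ck_ev 2 1 1 zW.
have d6 : dl (ck 2 1 1 W) = Cm 1 1 (dl W) := ck2n 1 1 zW erefl.
have e7 := ck_ev 3 1 2 zF.
have d7 : dl (ck 3 1 2 F') = Cb 1 2 (dl F') := ck3n 1 2 zF erefl.
move: e1 d1; move: (ck 0 2 1 (ck 1 1 1 W)) => t1 e1 d1.
move: e2 d2; move: (ck 3 1 2 (ck 2 1 1 W)) => t2 e2 d2.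
move: e3 d3; move: (ck 0 1 1 W) => t3 e3 d3.
move: e4 d4; move: (ck 1 1 1 W) => t4 e4 d4.
move: e5 d5; move: (ck 3 1 1 W) => t5 e5 d5.
move: e6 d6; move: (ck 2 1 1 W) => t6 e6 d6.
move: e7 d7; move: (ck 3 1 2 F') => t7 e7 d7.
have ez := (e1, e2, e3, e4, e5, e6, e7, zW, zF, zX, evz, wE, evnE).
split; first by rewrite !(ez, morE); ring.
rewrite (raddfB dl) !(d1, d2, dlr _ e3, dlr _ e4, dlr _ e5, dlr _ e6, dlr _ zW, raddfD dl, raddfN dl).
rewrite dlr; last by rewrite !(ez, morE); ring.
rewrite !(dlr _ e7, dlr _ zF, dlr _ zX, raddfD dl, raddfN dl).
rewrite !(d3, d4, d5, d6, d7) !(ez, morE).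
apply: (eq_of_diff 1 h); rewrite /kn_D; ring.
Qed.

(** M2 contains half the e_3 derivative of H, whose component is 2 s b, whereas [M2_kn] is written
    with s b to avoid [half]. *)
Let c3h : half0 * C3 0 1 (2 * s * b) = C3 0 1 (s * b).
Proof.
have -> : C3 0 1 (2 * s * b) = 2 * C3 0 1 (s * b).
  by rewrite -mulrA /cder3 /= (d0M 0 2) d02; ring.
by rewrite mulrA h02 mul1r.
Qed.

Theorem nul_T2 : nul (T2K D half g E F Pw Pcw Fw - M2K D half g E F Aw Xw Ww).
Proof.
have [_ _ h _] := linear_system; move: h.
rewrite /T2_kn /M2_kn -dl_FK -dl_XK -dl_WK /T2K /M2K => h.
have [zW zF zX] := And3 ev_WK ev_FK ev_XK; have zA := evA.
move: zW zF zX zA h; move: Ww Fw Xw Aw => W F' X A zW zF zX zA h.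
have e1 := ck_ev 0 2 2 (ck_ev 1 1 2 zF).
have d1 : dl (ck 0 2 2 (ck 1 1 2 F')) = C3 2 2 (C4 1 2 (dl F')) :=
  ck0n 2 2 (ck_ev 1 1 2 zF) (ck1n 1 2 zF erefl).
have e2 := ck_ev 2 1 1 (ck_ev 3 1 2 zF).
have d2 : dl (ck 2 1 1 (ck 3 1 2 F')) = Cm 1 1 (Cb 1 2 (dl F')) :=
  ck2n 1 1 (ck_ev 3 1 2 zF) (ck3n 1 2 zF erefl).
have e3 := ck_ev 0 1 2 zF.
have d3 : dl (ck 0 1 2 F') = C3 1 2 (dl F') := ck0n 1 2 zF erefl.
have e4 := ck_ev 1 1 2 zF.
have d4 : dl (ck 1 1 2 F') = C4 1 2 (dl F') := ck1n 1 2 zF erefl.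
have e5 := ck_ev 3 1 2 zF.
have d5 : dl (ck 3 1 2 F') = Cb 1 2 (dl F') := ck3n 1 2 zF erefl.
have e6 := ck_ev 2 1 2 zF.
have d6 : dl (ck 2 1 2 F') = Cm 1 2 (dl F') := ck2n 1 2 zF erefl.
have e7 := ck_ev 0 2 2 zA.
have d7 : dl (ck 0 2 2 A) = C3 2 2 (dl A) := ck0n 2 2 zA erefl.
have q1 : ev (ck 3 0 1 (w 0 1 2)) = Cb 0 1 (2 * s * b).
  by rewrite ckE !wE !evnE /cderb; ring.
have q2 : ev (ck 0 0 1 (w 0 1 2)) = C3 0 1 (2 * s * b).
  by rewrite ckE !wE !evnE /cder3 /kn_nu3 /kn_D; ring.
move: e1 d1; move: (ck 0 2 2 (ck 1 1 2 F')) => t1 e1 d1.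
move: e2 d2; move: (ck 2 1 1 (ck 3 1 2 F')) => t2 e2 d2.
move: e3 d3; move: (ck 0 1 2 F') => t3 e3 d3.
move: e4 d4; move: (ck 1 1 2 F') => t4 e4 d4.
move: e5 d5; move: (ck 3 1 2 F') => t5 e5 d5.
move: e6 d6; move: (ck 2 1 2 F') => t6 e6 d6.
move: e7 d7; move: (ck 0 2 2 A) => t7 e7 d7.
move: q1; move: (ck 3 0 1 (w 0 1 2)) => u1 q1.
move: q2; move: (ck 0 0 1 (w 0 1 2)) => u2 q2.
have ez := (e1, e2, e3, e4, e5, e6, e7, (zW, zF, zX, zA, q1, q2), evz, wE, evnE).
split; first by rewrite !(ez, morE); ring.
have zt : ev (w 0 1 3 * F') = 0 by rewrite rmorphM zF mulr0.
have zm : ev (t7 + (3 * w 2 0 3 - w 3 0 2) * A) = 0.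
  by rewrite rmorphD rmorphM e7 zA mulr0 addr0.
rewrite (raddfB dl) !(d1, d2, dlr _ zm, dlr _ zt, dlr _ e3, dlr _ e4, dlr _ e5, dlr _ e6,
  dlr _ zF, dlr _ zX, dlr _ zW, dlr _ zA, raddfD dl, raddfN dl).
rewrite !(d3, d4, d5, d6, d7) !(ez, morE) -/half0.
apply: (eq_of_diff 1 h); apply: (eq_of_diff (- (3 * dl X)) c3h); rewrite /kn_D; ring.
Qed.

Theorem nul_T3 : nul (T3K D half g E F Pcw Aw - M3K D half g E F Fw Xw).
Proof.
have [_ _ _ h] := linear_system; move: h.
rewrite /T3_kn /M3_kn -dl_FK -dl_XK /T3K /M3K => h.
have [zF zX zA] := And3 ev_FK ev_XK evA.
move: zF zX zA h; move: Fw Xw Aw => F' X A zF zX zA h.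
have e1 := ck_ev 1 1 2 (ck_ev 0 2 2 zA).
have d1 : dl (ck 1 1 2 (ck 0 2 2 A)) = C4 1 2 (C3 2 2 (dl A)) :=
  ck1n 1 2 (ck_ev 0 2 2 zA) (ck0n 2 2 zA erefl).
have e2 := ck_ev 2 2 1 (ck_ev 3 2 2 zA).
have d2 : dl (ck 2 2 1 (ck 3 2 2 A)) = Cm 2 1 (Cb 2 2 (dl A)) :=
  ck2n 2 1 (ck_ev 3 2 2 zA) (ck3n 2 2 zA erefl).
have e3 := ck_ev 0 2 2 zA.
have d3 : dl (ck 0 2 2 A) = C3 2 2 (dl A) := ck0n 2 2 zA erefl.
have e4 := ck_ev 1 2 2 zA.
have d4 : dl (ck 1 2 2 A) = C4 2 2 (dl A) := ck1n 2 2 zA erefl.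
have e5 := ck_ev 3 2 2 zA.
have d5 : dl (ck 3 2 2 A) = Cb 2 2 (dl A) := ck3n 2 2 zA erefl.
have e6 := ck_ev 2 2 2 zA.
have d6 : dl (ck 2 2 2 A) = Cm 2 2 (dl A) := ck2n 2 2 zA erefl.
have e7 := ck_ev 1 1 2 zF.
have d7 : dl (ck 1 1 2 F') = C4 1 2 (dl F') := ck1n 1 2 zF erefl.
move: e1 d1; move: (ck 1 1 2 (ck 0 2 2 A)) => t1 e1 d1.
move: e2 d2; move: (ck 2 2 1 (ck 3 2 2 A)) => t2 e2 d2.
move: e3 d3; move: (ck 0 2 2 A) => t3 e3 d3.
move: e4 d4; move: (ck 1 2 2 A) => t4 e4 d4.
move: e5 d5; move: (ck 3 2 2 A) => t5 e5 d5.
move: e6 d6; move: (ck 2 2 2 A) => t6 e6 d6.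
move: e7 d7; move: (ck 1 1 2 F') => t7 e7 d7.
have ez := (e1, e2, e3, e4, e5, e6, e7, (zF, zX, zA), evz, wE, evnE).
split; first by rewrite !(ez, morE); ring.
rewrite (raddfB dl) !(d1, d2, dlr _ e3, dlr _ e4, dlr _ e5, dlr _ e6, dlr _ zA, raddfD dl, raddfN dl).
rewrite dlr; last by rewrite !(ez, morE); ring.
rewrite !(dlr _ e7, dlr _ zF, dlr _ zX, raddfD dl, raddfN dl).
rewrite !(d3, d4, d5, d6, d7) !(ez, morE).
apply: (eq_of_diff 1 h); rewrite /kn_D; ring.
Qed.

End Assembly.

Lemma smooth_on_real {R : realType} {V : normedModType R} {O : set V}
    (Oo : open O) (f : V -> R) : smooth_on O f -> smooth_C (O := O) (fun p => (f p)%:C).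
Proof. by move=> sf; split; [exact: sf | exact: (smooth_on_cst (0 : R) Oo)]. Qed.

(** * Dictionary between ring elements and families of functions *)

Section Representation.
Context {R : realType} {e0 : R} {U : set (pt R)} (Uo : open U).
Local Notation C := R[i].
Local Notation Oo := (@slab_open R (pt R) e0 U Uo).
Local Notation KO := (sfun_of Oo).
Implicit Types (k l : KO) (f h : R -> pt R -> C) (F : R -> pt R -> R).

(* The elements of [KO] are smooth functions of the parameter and the point. *)
Definition rep k f := forall s x, `|s| < e0 -> U x -> sfun_fun k (s, x) = f s x.

Definition Dx (i : 'I_4) : {additive KO -> KO} := sder ((0, delta_mx 0 i) : R * pt R).

Lemma DxM i k l : Dx i (k * l) = Dx i k * l + k * Dx i l.
Proof. exact: sderM. Qed.
Lemma DxC i j k : Dx i (Dx j k) = Dx j (Dx i k).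
Proof. exact: sder_comm. Qed.

Lemma rep_ext k f h : (forall s x, `|s| < e0 -> U x -> f s x = h s x) ->
  rep k f -> rep k h.
Proof. by move=> e r s x ps Ux; rewrite r // e. Qed.

Lemma repD k l f h : rep k f -> rep l h -> rep (k + l) (fun s x => f s x + h s x).
Proof. by move=> a b s x ps Ux; rewrite sfun_addE ?a ?b. Qed.
Lemma repN k f : rep k f -> rep (- k) (fun s x => - f s x).
Proof. by move=> a s x ps Ux; rewrite sfun_oppE ?a. Qed.
Lemma repM k l f h : rep k f -> rep l h -> rep (k * l) (fun s x => f s x * h s x).
Proof. by move=> a b s x ps Ux; rewrite sfun_mulE ?a ?b. Qed.
Lemma rep_cst (c : C) : rep (sfun_cst Oo c) (fun _ _ => c).
Proof. by move=> s x ps Ux; rewrite sfun_cstE. Qed.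
Lemma rep_conj k f : rep k f -> rep (sconj k) (fun s x => (f s x)^*).
Proof. by move=> a s x ps Ux; rewrite sconjE ?a. Qed.
(** The way back into the ring: pointwise facts about the family, such as symmetry of the metric or
    normalisation of the frame, become ring equations. *)
Lemma rep_inj k l f : rep k f -> rep l f -> k = l.
Proof. by move=> a b; apply: sfunP => -[s x] [ps Ux]; rewrite a ?b. Qed.
Lemma rep_sum (I : Type) (r : seq I) (k : I -> KO) (f : I -> R -> pt R -> C) :
  (forall i, rep (k i) (f i)) ->
  rep (\sum_(i <- r) k i) (fun s x => \sum_(i <- r) f i s x).
Proof.
move=> a; elim: r => [|i r IH] s x ps Ux.
  by rewrite !big_nil sfun_cstE.
by rewrite !big_cons; apply: (repD (a i) IH).
Qed.

Definition repr k F := rep k (fun s x => (F s x)%:C).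

Lemma reprD k l F G : repr k F -> repr l G -> repr (k + l) (fun s x => F s x + G s x).
Proof. by move=> a b s x ps Ux; rewrite (repD a b) // -rmorphD. Qed.
Lemma reprN k F : repr k F -> repr (- k) (fun s x => - F s x).
Proof. by move=> a s x ps Ux; rewrite (repN a) // -rmorphN. Qed.
Lemma reprB k l F G : repr k F -> repr l G -> repr (k - l) (fun s x => F s x - G s x).
Proof. by move=> a b; apply: reprD => //; exact: reprN. Qed.
Lemma reprM k l F G : repr k F -> repr l G -> repr (k * l) (fun s x => F s x * G s x).
Proof. by move=> a b s x ps Ux; rewrite (repM a b) // -rmorphM. Qed.
Lemma repr_cst (c : R) : repr (sfun_cst Oo c%:C) (fun _ _ => c).
Proof. exact: rep_cst. Qed.
Lemma repr_sum (I : Type) (r : seq I) (k : I -> KO) (F : I -> R -> pt R -> R) :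
  (forall i, repr (k i) (F i)) ->
  repr (\sum_(i <- r) k i) (fun s x => \sum_(i <- r) F i s x).
Proof. by move=> a s x ps Ux; rewrite (rep_sum _ a) // rmorph_sum. Qed.

Lemma sconj_repr k F : repr k F -> sconj k = k.
Proof.
move=> a; apply: rep_inj (rep_conj a) _; apply: rep_ext a => s x _ _.
by rewrite conjc_real.
Qed.

Definition part i (f : pt R -> C) (x : pt R) : C :=
  partial i (fun y => complex.Re (f y)) x +i* partial i (fun y => complex.Im (f y)) x.

Lemma rep_part i k f : rep k f -> rep (Dx i k) (fun s x => part i (f s) x).
Proof.
move=> a s x ps Ux; rewrite sderE // /derC /part /partial -!derive_slice.
by congr (_ +i* _); apply: near_eq_derive; apply: (open_near_eq Uo Ux) => y /[!inE] Uy /=;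
  rewrite a.
Qed.

Lemma repr_partial i k F : repr k F -> repr (Dx i k) (fun s x => partial i (F s) x).
Proof.
move=> a s x ps Ux; rewrite (rep_part i a) // /part /=; congr (_ +i* _).
exact: (derive_cst (0 : R) x (delta_mx 0 i)).
Qed.

Definition lift F (sf : smooth_on (@slab R (pt R) e0 U) (fun p => F p.1 p.2)) : KO :=
  mk_sfun Oo (smooth_on_real Oo sf).

Lemma liftP F sf : repr (@lift F sf) F.
Proof. by move=> s x ps Ux; rewrite /lift mk_sfunE. Qed.

End Representation.

Lemma sum2 (K : nmodType) (F : 'I_2 -> K) : \sum_(i < 2) F i = F 0 + F 1.
Proof.
rewrite !big_ord_recl big_ord0 addr0.
by congr (F _ + F _); apply: val_inj.
Qed.

(** * Metric, frame and electromagnetic tensor of the family as matrices over the ring *)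

Section Family.
Context {R : realType} {e0 : R} {U : set (pt R)} (Uo : open U) {S : R -> spacetime R}.
Local Notation C := R[i].
Local Notation Oo := (@slab_open R (pt R) e0 U Uo).
Local Notation KO := (sfun_of Oo).
Hypothesis sf : smooth_family (@slab R (pt R) e0 U) S.
Hypothesis gTS : forall s x, `|s| < e0 -> U x -> (metric (S s) x)^T = metric (S s) x.
Hypothesis FTS : forall s x, `|s| < e0 -> U x -> (Fem (S s) x)^T = - Fem (S s) x.
Hypothesis nfS : forall s x, `|s| < e0 -> U x -> null_frame (S s) x.

Let sg i j : smooth_on (@slab R (pt R) e0 U) (fun p => metric (S p.1) p.2 i j).
Proof. by case: sf. Qed.
Let s3 i : smooth_on (@slab R (pt R) e0 U) (fun p => e3 (S p.1) p.2 0 i).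
Proof. by case: sf. Qed.
Let s4 i : smooth_on (@slab R (pt R) e0 U) (fun p => e4 (S p.1) p.2 0 i).
Proof. by case: sf. Qed.
Let sh b i : smooth_on (@slab R (pt R) e0 U) (fun p => eh (S p.1) b p.2 0 i).
Proof. by case: sf. Qed.
Let sF i j : smooth_on (@slab R (pt R) e0 U) (fun p => Fem (S p.1) p.2 i j).
Proof. by case: sf. Qed.

Definition gK : 'M[KO]_4 :=
  \matrix_(i, j) lift (F := fun s x => metric (S s) x i j) Uo (sg i j).
Definition FK : 'M[KO]_4 :=
  \matrix_(i, j) lift (F := fun s x => Fem (S s) x i j) Uo (sF i j).
Definition r3 : 'rV[KO]_4 := \row_i lift (F := fun s x => e3 (S s) x 0 i) Uo (s3 i).
Definition r4 : 'rV[KO]_4 := \row_i lift (F := fun s x => e4 (S s) x 0 i) Uo (s4 i).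
Definition rh b : 'rV[KO]_4 := \row_i lift (F := fun s x => eh (S s) b x 0 i) Uo (sh b i).

Definition ii : KO := sfun_cst Oo 'i.
Definition half : KO := sfun_cst Oo (2^-1)%:C.

Lemma half2 : half + half = 1.
Proof.
rewrite /half -rmorphD -rmorphD /= -(rmorph1 (sfun_cst Oo)).
by congr (sfun_cst Oo _%:C); rewrite -[2^-1]mul1r -splitr.
Qed.
Lemma iiE : ii * ii = -1.
Proof. by rewrite /ii -rmorphM -[RHS](rmorphN1 (sfun_cst Oo)) -expr2 sqr_i. Qed.
Lemma sconj_ii : sconj ii = - ii.
Proof. by rewrite /ii sconj_cst -rmorphN; congr (sfun_cst Oo _); apply/eqP; rewrite eq_complex /= oppr0 !eqxx. Qed.
Lemma sconj_half : sconj half = half.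
Proof. by rewrite /half sconj_cst conjc_real. Qed.
Lemma Dx_ii i : Dx Uo i ii = 0.
Proof. exact: sder_cst. Qed.

(* The null frame (e_3, e_4, e_1 + i e_2, e_1 - i e_2). *)
Definition frow (l : 'I_4) : 'rV[KO]_4 :=
  nth 0 [:: r3; r4; rh 0 + ii *: rh 1; rh 0 - ii *: rh 1] l.
Definition EK : 'M[KO]_4 := \matrix_(l, i) frow l 0 i.

Definition repv (X : 'rV[KO]_4) (Y : R -> vfield R) :=
  forall i, repr (X 0 i) (fun s x => Y s x 0 i).

Lemma repv3 : repv r3 (fun s => e3 (S s)).
Proof. by move=> i; rewrite mxE; exact: liftP. Qed.
Lemma repv4 : repv r4 (fun s => e4 (S s)).
Proof. by move=> i; rewrite mxE; exact: liftP. Qed.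
Lemma repvh b : repv (rh b) (fun s => eh (S s) b).
Proof. by move=> i; rewrite mxE; exact: liftP. Qed.
Lemma rep_g i j : repr (gK i j) (fun s x => metric (S s) x i j).
Proof. by rewrite mxE; exact: liftP. Qed.
Lemma rep_F i j : repr (FK i j) (fun s x => Fem (S s) x i j).
Proof. by rewrite mxE; exact: liftP. Qed.

Lemma gKT : gK^T = gK.
Proof.
apply/matrixP => i j; rewrite mxE; apply: rep_inj (rep_g j i) _.
apply: rep_ext (rep_g i j) => s x ps Ux; congr (_%:C).
by have /matrixP/(_ j i) := gTS ps Ux; rewrite mxE.
Qed.
Lemma FKT : FK^T = - FK.
Proof.
apply/matrixP => i j; rewrite mxE oppmxE; apply: rep_inj (rep_F j i) _.
apply: rep_ext (reprN (rep_F i j)) => s x ps Ux; congr (_%:C).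
by have /matrixP/(_ i j) := FTS ps Ux; rewrite mxE oppmxE => ->.
Qed.

Definition bilK (b : 'M[KO]_4) (u v : 'rV[KO]_4) : KO :=
  \sum_i \sum_j b i j * u 0 i * v 0 j.

Lemma bilKDl b u u' v : bilK b (u + u') v = bilK b u v + bilK b u' v.
Proof.
rewrite /bilK -big_split; apply: eq_bigr => i _; rewrite -big_split.
by apply: eq_bigr => j _; rewrite addmxE /=; ring.
Qed.
Lemma bilKDr b u v v' : bilK b u (v + v') = bilK b u v + bilK b u v'.
Proof.
rewrite /bilK -big_split; apply: eq_bigr => i _; rewrite -big_split.
by apply: eq_bigr => j _; rewrite addmxE /=; ring.
Qed.
Lemma bilKZl b c u v : bilK b (c *: u) v = c * bilK b u v.
Proof.
rewrite /bilK mulr_sumr; apply: eq_bigr => i _; rewrite mulr_sumr.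
by apply: eq_bigr => j _; rewrite mxE; ring.
Qed.
Lemma bilKZr b c u v : bilK b u (c *: v) = c * bilK b u v.
Proof.
rewrite /bilK mulr_sumr; apply: eq_bigr => i _; rewrite mulr_sumr.
by apply: eq_bigr => j _; rewrite mxE; ring.
Qed.
Lemma bilKNl b u v : bilK b (- u) v = - bilK b u v.
Proof. by rewrite -scaleN1r bilKZl mulN1r. Qed.
Lemma bilKNr b u v : bilK b u (- v) = - bilK b u v.
Proof. by rewrite -scaleN1r bilKZr mulN1r. Qed.
Definition bilKE := (bilKDl, bilKDr, bilKZl, bilKZr, bilKNl, bilKNr).

Lemma rep_bil (b : 'M[KO]_4) (B : R -> pt R -> 'M[R]_4) u v X Y :
  (forall i j, repr (b i j) (fun s x => B s x i j)) ->
  repv u X -> repv v Y ->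
  repr (bilK b u v) (fun s x => bilin (B s x) (X s x) (Y s x)).
Proof.
move=> rb ru rv; apply: repr_sum => i; apply: repr_sum => j.
apply: reprM (rv j); exact: reprM (rb i j) (ru i).
Qed.

Lemma bilK_frame b l k : (EK *m b *m EK^T) l k = bilK b (frow l) (frow k).
Proof.
rewrite -mulmxA mxE /bilK; apply: eq_bigr => i _.
rewrite [(b *m _) _ _]mxE mulr_sumr; apply: eq_bigr => j _; rewrite !mxE; ring.
Qed.

Let dotK u v X Y (c : R) : repv u X -> repv v Y ->
  (forall s x, `|s| < e0 -> U x -> gdot (S s) (X s) (Y s) x = c) ->
  bilK gK u v = sfun_cst Oo c%:C.
Proof.
move=> ru rv e; refine (rep_inj _ (repr_cst (e0 := e0) Uo c)).
by apply: rep_ext (rep_bil rep_g ru rv) => s x ps Ux; congr (_%:C); exact: e.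
Qed.

Lemma bilK_sym u v : bilK gK u v = bilK gK v u.
Proof.
rewrite /bilK exchange_big; apply: eq_bigr => i _; apply: eq_bigr => j _ /=.
by rewrite -[in LHS]gKT mxE mulrAC.
Qed.

Let cst0 : sfun_cst Oo (0 : R)%:C = 0. Proof. exact: rmorph0. Qed.
Let cst1 : sfun_cst Oo (1 : R)%:C = 1. Proof. exact: rmorph1. Qed.
Let g34 : bilK gK r3 r4 = -2.
Proof.
rewrite (dotK (c := -2) repv3 repv4); last by move=> s x ps Ux; case: (nfS ps Ux).
by rewrite !rmorphN !rmorph_nat.
Qed.
Let g33 : bilK gK r3 r3 = 0.
Proof. by rewrite (dotK (c := 0) repv3 repv3) // => s x ps Ux; case: (nfS ps Ux) => _ []. Qed.
Let g44 : bilK gK r4 r4 = 0.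
Proof. by rewrite (dotK (c := 0) repv4 repv4) // => s x ps Ux; case: (nfS ps Ux) => _ []. Qed.
Let gh3 a : bilK gK (rh a) r3 = 0.
Proof.
rewrite (dotK (c := 0) (repvh a) repv3) // => s x ps Ux.
by case: (nfS ps Ux) => _ _ /(_ a)[].
Qed.
Let gh4 a : bilK gK (rh a) r4 = 0.
Proof.
rewrite (dotK (c := 0) (repvh a) repv4) // => s x ps Ux.
by case: (nfS ps Ux) => _ _ /(_ a)[].
Qed.
Let ghh a b : bilK gK (rh a) (rh b) = (a == b)%:R.
Proof.
rewrite (dotK (c := (a == b)%:R) (repvh a) (repvh b)).
  by rewrite !rmorph_nat.
by move=> s x ps Ux; case: (nfS ps Ux) => _ _ _; exact.
Qed.

Let c3h a : bilK gK r3 (rh a) = 0. Proof. by rewrite bilK_sym gh3. Qed.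
Let c4h a : bilK gK r4 (rh a) = 0. Proof. by rewrite bilK_sym gh4. Qed.
Let c43 : bilK gK r4 r3 = -2. Proof. by rewrite bilK_sym g34. Qed.

(** The normalisation of the real frame makes m null with g(m, mb) = 2; this supplies the hypothesis
    [EgE] of the tetrad part. *)
Lemma EgK : EK *m gK *m EK^T = nullmx (2 : KO).
Proof.
apply/matrixP => l k; rewrite bilK_frame mxE.
case: l => [[|[|[|[|//]]]] ?]; case: k => [[|[|[|[|//]]]] ?]; rewrite /frow /=
  ?bilKE ?(g34, g33, g44, gh3, gh4, ghh, c3h, c4h, c43) /=; ring: iiE.
Qed.

End Family.

(** * Connection and curvature of the family as ring elements *)

Section Curvature.
Context {R : realType} {e0 : R} {U : set (pt R)} (Uo : open U) {S : R -> spacetime R}.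
Local Notation C := R[i].
Local Notation Oo := (@slab_open R (pt R) e0 U Uo).
Local Notation KO := (sfun_of Oo).
Hypothesis sf : smooth_family (@slab R (pt R) e0 U) S.
Hypothesis gTS : forall s x, `|s| < e0 -> U x -> (metric (S s) x)^T = metric (S s) x.
Hypothesis FTS : forall s x, `|s| < e0 -> U x -> (Fem (S s) x)^T = - Fem (S s) x.
Hypothesis nfS : forall s x, `|s| < e0 -> U x -> null_frame (S s) x.
Local Notation g := (gK Uo sf).
Local Notation E := (EK Uo sf).
Local Notation F := (FK Uo sf).
Local Notation frow := (frow Uo sf).
Local Notation r3 := (r3 Uo sf).
Local Notation r4 := (r4 Uo sf).
Local Notation rh := (rh Uo sf).
Local Notation ii := (@ii R e0 U Uo).
Local Notation half := (@half R e0 U Uo).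
Local Notation Dx := (@Dx R e0 U Uo).
Local Notation eta := (nullmx (2 : KO)).
Local Notation etai := (nullmx half).
Local Notation DM := (@DxM R e0 U Uo).
Local Notation DC := (@DxC R e0 U Uo).
Local Notation h2 := (half2 (e0 := e0) Uo).
Local Notation gT := (gKT Uo sf gTS).
Local Notation FT := (FKT Uo sf FTS).
Local Notation EgE := (EgK Uo sf gTS nfS).

(** At each point the ring identity for [ginv] evaluates to a right inverse of the metric matrix,
    which is therefore invertible with that inverse. *)
Lemma rep_ginv i j : repr (ginv E etai i j) (fun s x => invmx (metric (S s) x) i j).
Proof.
move=> s x ps Ux; have Ox : @slab R (pt R) e0 U (s, x) by split.
pose v := sev (Oo := Oo) Ox.
have e : map_mx v g = map_mx (real_complex R) (metric (S s) x).
  apply/matrixP => p q; rewrite !mxE /v /sev; exact: (liftP (F := fun s x => metric (S s) x p q) _ _ ps Ux).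
have := congr1 (map_mx v) (ginvP (nullmx_inv h2) EgE).
rewrite map_mxM e map_mx1 => gv.
have [u _] := mulmx1_unit gv.
transitivity (map_mx v (ginv E etai) i j); first by rewrite [RHS]mxE.
by rewrite -[map_mx v _](mulKmx u) gv mulmx1 -map_invmx mxE.
Qed.

Local Notation christ := (christ Dx half g E etai).
Local Notation riemup := (riemup Dx half g E etai).
Local Notation riem := (riem Dx half g E etai).
Local Notation ric := (ric Dx half g E etai).
Local Notation scal := (scal Dx half g E etai).
Local Notation dF := (dF Dx half g E etai F).
Local Notation spin := (spin Dx half g E).
Local Notation repg := (rep_g Uo sf).
Local Notation repF := (rep_F Uo sf).

Lemma rep_half : repr half (fun _ _ => 2^-1).
Proof. exact: repr_cst. Qed.
Lemma rep_two : repr (2 : KO) (fun _ _ => 2).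
Proof.
have -> : (2 : KO) = sfun_cst Oo (2%:R : R)%:C by rewrite !rmorph_nat.
exact: repr_cst.
Qed.

Lemma rep_christ k i j : repr (christ k i j) (fun s x => christoffel (metric (S s)) k i j x).
Proof.
apply: reprM rep_half _; apply: repr_sum => l; apply: reprM (rep_ginv k l) _.
apply: reprB; first apply: reprD; exact: repr_partial (repg _ _).
Qed.

Lemma rep_riemup k l i j :
  repr (riemup k l i j) (fun s x => riemann_up (metric (S s)) k l i j x).
Proof.
apply: reprD.
  by apply: reprB; apply: repr_partial (rep_christ _ _ _).
apply: repr_sum => m; apply: reprB; apply: reprM; exact: rep_christ.
Qed.

Lemma rep_riem k l i j : repr (riem k l i j) (fun s x => riemann (metric (S s)) k l i j x).
Proof.
apply: repr_sum => m; apply: reprM; [exact: repg | exact: rep_riemup].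
Qed.

Lemma rep_ric i j : repr (ric i j) (fun s x => ricci (metric (S s)) i j x).
Proof. by apply: repr_sum => k; exact: rep_riemup. Qed.

Lemma rep_scal : repr scal (fun s x => scalar_curvature (metric (S s)) x).
Proof.
apply: repr_sum => i; apply: repr_sum => j; apply: reprM;
  [exact: rep_ginv | exact: rep_ric].
Qed.

Definition sixth : KO := sfun_cst Oo (6^-1)%:C.

Definition weylK k l i j : KO := riem k l i j
  - half * (g k i * ric l j - g k j * ric l i + g l j * ric k i - g l i * ric k j)
  + sixth * scal * (g k i * g l j - g k j * g l i).

Lemma rep_weyl k l i j : repr (weylK k l i j) (fun s x => weyl (metric (S s)) k l i j x).
Proof.
apply: reprD.
  apply: reprB; first exact: rep_riem.
  apply: reprM rep_half _; apply: reprB; first apply: reprD; first apply: reprB;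
    exact: reprM (repg _ _) (rep_ric _ _).
apply: reprM; first exact: reprM (repr_cst _ _) rep_scal.
apply: reprB; exact: reprM (repg _ _) (repg _ _).
Qed.

Lemma rep_dF k i j : repr (dF k i j) (fun s x => covD_form (metric (S s)) (Fem (S s)) k i j x).
Proof.
apply: reprB; first apply: reprB; first exact: repr_partial (repF _ _).
  by apply: repr_sum => m; exact: reprM (rep_christ _ _ _) (repF _ _).
by apply: repr_sum => m; exact: reprM (rep_christ _ _ _) (repF _ _).
Qed.

Lemma rep_einstein i j : repr (einstein_F Dx half g E F i j)
  (fun s x => einstein_defect (metric (S s)) (Fem (S s)) i j x).
Proof.
apply: reprB; first exact: rep_ric.
apply: reprB.
  apply: reprM rep_two _; apply: repr_sum => k; apply: repr_sum => l.
  exact: reprM (reprM (rep_ginv _ _) (repF _ _)) (repF _ _).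
apply: reprM; first exact: reprM rep_half (repg _ _).
apply: repr_sum => k; apply: repr_sum => l; apply: repr_sum => m; apply: repr_sum => n.
exact: reprM (reprM (reprM (rep_ginv _ _) (rep_ginv _ _)) (repF _ _)) (repF _ _).
Qed.

Lemma rep_bianchi k i j : repr (bianchi_F Dx half g E F k i j)
  (fun s x => bianchi_defect (metric (S s)) (Fem (S s)) k i j x).
Proof. by apply: reprD; first apply: reprD; exact: rep_dF. Qed.

Lemma rep_div j : repr (div_F Dx half g E F j)
  (fun s x => divergence_defect (metric (S s)) (Fem (S s)) j x).
Proof.
apply: repr_sum => i; apply: repr_sum => k; exact: reprM (rep_ginv _ _) (rep_dF _ _ _).
Qed.

Definition tens4 (T : 'I_4 -> 'I_4 -> 'I_4 -> 'I_4 -> KO) (X Y Z V : 'rV[KO]_4) : KO :=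
  \sum_k \sum_l \sum_i \sum_j T k l i j * X 0 k * Y 0 l * Z 0 i * V 0 j.

Lemma rep_tens4 X Y Z V x y z v : repv x X -> repv y Y -> repv z Z -> repv v V ->
  repr (tens4 weylK x y z v) (fun s p => weyl_on (metric (S s)) (X s) (Y s) (Z s) (V s) p).
Proof.
move=> rx ry rz rv.
apply: repr_sum => k; apply: repr_sum => l; apply: repr_sum => i; apply: repr_sum => j.
apply: reprM (rv j); apply: reprM (rz i); apply: reprM (ry l); apply: reprM (rx k).
exact: rep_weyl.
Qed.

Lemma con4_tens4 T a b l m : con4 E T a b l m = tens4 T (frow a) (frow b) (frow l) (frow m).
Proof.
by apply: eq_bigr => k _; apply: eq_bigr => p _; apply: eq_bigr => i _;
  apply: eq_bigr => j _; rewrite !mxE.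
Qed.

Lemma tens4_lin1 T c x x' y z v : tens4 T (x + c *: x') y z v = tens4 T x y z v + c * tens4 T x' y z v.
Proof.
rewrite /tens4; do 4!(rewrite mulr_sumr -big_split; apply: eq_bigr => ? _ /=).
rewrite !mxE; ring.
Qed.
Lemma tens4_lin2 T c x x' y z v : tens4 T y (x + c *: x') z v = tens4 T y x z v + c * tens4 T y x' z v.
Proof.
rewrite /tens4; do 4!(rewrite mulr_sumr -big_split; apply: eq_bigr => ? _ /=).
rewrite !mxE; ring.
Qed.
Lemma tens4_lin4 T c x x' y z v : tens4 T y z v (x + c *: x') = tens4 T y z v x + c * tens4 T y z v x'.
Proof.
rewrite /tens4; do 4!(rewrite mulr_sumr -big_split; apply: eq_bigr => ? _ /=).
rewrite !mxE; ring.
Qed.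

Definition covDK (X Y : 'rV[KO]_4) : 'rV[KO]_4 :=
  \row_k \sum_i X 0 i * (Dx i (Y 0 k) + \sum_j christ k i j * Y 0 j).

Lemma rep_covD X Y x y : repv x X -> repv y Y ->
  repv (covDK x y) (fun s => covD (metric (S s)) (X s) (Y s)).
Proof.
move=> rx ry k; rewrite mxE.
apply: (rep_ext (f := fun s x => (\sum_i X s x 0 i *
    (partial i (fun y => Y s y 0 k) x
     + \sum_j christoffel (metric (S s)) k i j x * Y s x 0 j))%:C)).
  by move=> s p ps Up; rewrite mxE.
apply: repr_sum => i; apply: reprM (rx i) _; apply: reprD.
  exact: repr_partial (ry k).
by apply: repr_sum => j; exact: reprM (rep_christ _ _ _) (ry j).
Qed.

(** g(D_X Y, Z) for arbitrary vectors rather than frame indices: the definitions to be matched use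
    the real vectors e_1 and e_2, which are not in the null frame. *)
Definition cnn X Y Z : KO := bilK g (covDK X Y) Z.

Lemma rep_cnn X Y Z x y z : repv x X -> repv y Y -> repv z Z ->
  repr (cnn x y z) (fun s p => gdot (S s) (covD (metric (S s)) (X s) (Y s)) (Z s) p).
Proof.
by move=> rx ry rz; exact: (rep_bil (B := fun s x => metric (S s) x) repg (rep_covD rx ry) rz).
Qed.

Lemma cnn_frame X a b : cnn X (frow a) (frow b) =
  \sum_i X 0 i * frame_conn Dx half g E eta etai i a b.
Proof.
symmetry; rewrite /cnn /bilK.
under eq_bigr do rewrite (frame_connE Dx half g E (nullmx_inv h2)) -mulmxA [(_ *m (_ *m _)) _ _]mxE.
under eq_bigr do rewrite mulr_sumr; rewrite exchange_big; apply: eq_bigr => k _ /=.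
transitivity (covDK X (frow a) 0 k * (g *m E^T) k b).
  rewrite [covDK _ _ _ _]mxE mulr_suml; apply: eq_bigr => i _.
  rewrite mulrA; congr (_ * _); rewrite addmxE; congr (_ * (_ + _)).
    by rewrite [LHS]mxE [E a k]mxE.
  by rewrite mxE; apply: eq_bigr => j _; rewrite [E a j]mxE [cmx _ _ _ _ _ _ _ _]mxE mulrC.
rewrite [(_ *m _) _ _]mxE mulr_sumr; apply: eq_bigr => j _; rewrite [E^T _ _]mxE [E b j]mxE; ring.
Qed.

Lemma cnn_conn l a b : conn Dx half g E eta etai l a b = cnn (frow l) (frow a) (frow b).
Proof. by rewrite cnn_frame; apply: eq_bigr => i _; rewrite [E l i]mxE. Qed.

Lemma cnn_anti X a b : cnn X (frow a) (frow b) = - cnn X (frow b) (frow a).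
Proof.
rewrite !cnn_frame -sumrN; apply: eq_bigr => i _.
have /matrixP/(_ b a) := frame_conn_anti DM h2 gT (nullmxD DM) (nullmxT half) (nullmx_inv h2) EgE i.
by rewrite mxE => ->; rewrite oppmxE mulrN.
Qed.

Lemma cnn_spin l a b : cnn (frow l) (frow a) (frow b) = 2 * spin l a b.
Proof. by rewrite -cnn_conn; exact: (conn_spin Dx h2). Qed.

Lemma cnn_linr c X Y Z Z' : cnn X Y (Z + c *: Z') = cnn X Y Z + c * cnn X Y Z'.
Proof. by rewrite /cnn !bilKE. Qed.

Lemma cnn_linl c X X' Y Z : cnn (X + c *: X') Y Z = cnn X Y Z + c * cnn X' Y Z.
Proof.
rewrite /cnn -bilKZl -bilKDl; congr (bilK _ _ _); apply/rowP => k; rewrite !mxE.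
rewrite mulr_sumr -big_split; apply: eq_bigr => i _; rewrite !mxE /=; ring.
Qed.

Lemma cnn_linm c X Y Y' Z : (forall i, Dx i c = 0) ->
  cnn X (Y + c *: Y') Z = cnn X Y Z + c * cnn X Y' Z.
Proof.
move=> c0; rewrite /cnn -bilKZl -bilKDl; congr (bilK _ _ _); apply/rowP => k; rewrite !mxE.
rewrite mulr_sumr -big_split; apply: eq_bigr => i _; rewrite ?mxE /=.
have -> : \sum_j christ k i j * (Y + c *: Y') 0 j =
   \sum_j christ k i j * Y 0 j + c * \sum_j christ k i j * Y' 0 j.
  by rewrite mulr_sumr -big_split; apply: eq_bigr => j _; rewrite !mxE /=; ring.
rewrite raddfD DM c0 /=; ring.
Qed.

End Curvature.

(** * Horizontal tensors of s_1(C) and s_2(C) by their single component *)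

Section Spin.
Context {R : realType}.
Local Notation C := R[i].
Implicit Types (z c : C) (S : spacetime R) (x : pt R).

Lemma i2 : 'i * 'i = -1 :> C.
Proof. by rewrite -expr2 sqr_i. Qed.

(* The elements of s_1(C) and s_2(C) have a single independent component. *)
Definition sd1 z : 'rV[C]_2 := \row_a (if a == 0 then z else - ('i * z)).
Definition sd2 z : 'M[C]_2 :=
  \matrix_(a, b) (if a == b then if a == 0 then z else - z else - ('i * z)).

Lemma sd1E z : (sd1 z 0 0 = z) * (sd1 z 0 1 = - ('i * z)).
Proof. by rewrite !mxE. Qed.
Lemma sd2E z : (sd2 z 0 0 = z) * (sd2 z 0 1 = - ('i * z))
  * (sd2 z 1 0 = - ('i * z)) * (sd2 z 1 1 = - z).
Proof. by rewrite !mxE. Qed.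

Lemma row2P (T : Type) (f h : 'rV[T]_2) : f 0 0 = h 0 0 -> f 0 1 = h 0 1 -> f = h.
Proof.
move=> e0 e1; apply/rowP => -[[|[|//]] ?].
  by move: e0; congr (f 0 _ = h 0 _); exact: val_inj.
by move: e1; congr (f 0 _ = h 0 _); exact: val_inj.
Qed.

Lemma mx2P (T : Type) (f h : 'M[T]_2) : f 0 0 = h 0 0 -> f 0 1 = h 0 1 ->
  f 1 0 = h 1 0 -> f 1 1 = h 1 1 -> f = h.
Proof.
move=> e00 e01 e10 e11; apply/matrixP => -[[|[|//]] ?] [[|[|//]] ?].
- by move: e00; congr (f _ _ = h _ _); exact: val_inj.
- by move: e01; congr (f _ _ = h _ _); exact: val_inj.
- by move: e10; congr (f _ _ = h _ _); exact: val_inj.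
- by move: e11; congr (f _ _ = h _ _); exact: val_inj.
Qed.

Lemma scalemxE p q (c : C) (m : 'M[C]_(p, q)) a b : (c *: m) a b = c * m a b.
Proof. exact: mxE. Qed.
Let mE := (@addmxE C, @oppmxE C, scalemxE, sd1E, sd2E).

Lemma sd1D z c : sd1 (z + c) = sd1 z + sd1 c.
Proof. by apply: row2P; rewrite !mE; ring. Qed.
Lemma sd1N z : sd1 (- z) = - sd1 z.
Proof. by apply: row2P; rewrite !mE; ring. Qed.
Lemma sd1Z c z : sd1 (c * z) = c *: sd1 z.
Proof. by apply: row2P; rewrite !mE; ring. Qed.
Lemma sd2D z c : sd2 (z + c) = sd2 z + sd2 c.
Proof. by apply: mx2P; rewrite !mE; ring. Qed.
Lemma sd2N z : sd2 (- z) = - sd2 z.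
Proof. by apply: mx2P; rewrite !mE; ring. Qed.
Lemma sd2Z c z : sd2 (c * z) = c *: sd2 z.
Proof. by apply: mx2P; rewrite !mE; ring. Qed.

Lemma hvolE : (hvol 0 0 = 0 :> R) * (hvol 0 1 = 1 :> R) * (hvol 1 0 = -1 :> R)
  * (hvol 1 1 = 0 :> R).
Proof. by rewrite /hvol /= !(subrr, subr0, sub0r). Qed.

Lemma cplx1E (f : 'rV[R]_2) : cplx1 f = sd1 ((f 0 0)%:C + 'i * (f 0 1)%:C).
Proof.
by apply: row2P; rewrite !mE mxE sum2 !hvolE; apply/eqP; rewrite eq_complex /=;
  apply/andP; split; apply/eqP; ring.
Qed.

Lemma cplx2E (u : 'M[R]_2) : u 1 1 = - u 0 0 -> u 0 1 = u 1 0 ->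
  cplx2 u = sd2 ((u 0 0)%:C + 'i * (u 1 0)%:C).
Proof.
move=> e11 e01.
by apply: mx2P; rewrite !mE mxE sum2 !hvolE ?e11 ?e01; apply/eqP; rewrite eq_complex /=;
  apply/andP; split; apply/eqP; ring.
Qed.

Lemma calDE (V : lmodType C) (n : 'I_2 -> V) :
  (calD n 0 = n 0 + 'i *: n 1) * (calD n 1 = n 1 - 'i *: n 0).
Proof.
by rewrite /calD !sum2 !hvolE !rmorph0 !rmorphN !rmorph1 !scale0r add0r addr0 !scaleNr
  !scale1r scalerN.
Qed.
Lemma calDbarE (V : lmodType C) (n : 'I_2 -> V) :
  (calDbar n 0 = n 0 - 'i *: n 1) * (calDbar n 1 = n 1 + 'i *: n 0).
Proof.
by rewrite /calDbar !sum2 !hvolE !rmorph0 !rmorphN !rmorph1 !scale0r add0r addr0 !scaleNr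
  !scale1r scalerN opprK.
Qed.

Section FirstOrder.
Variables (S : spacetime R) (t : int) (f : pt R -> 'rV[C]_2) (x : pt R) (z0 z1 : C).
Hypothesis f0 : cnablah_1 S t f x 0 = sd1 z0.
Hypothesis f1 : cnablah_1 S t f x 1 = sd1 z1.
Let fE := (f0, f1).

(** On s_1(C) the rotation by [hvol] is multiplication by -i, so all entries reduce to the
    derivative along e_1 plus i times the one along e_2. For the conjugate operator the sign changes
    and the two equal contributions add up to a factor 2. *)
Lemma cD_hotimes_sd : cD_hotimes S t f x = sd2 (z0 + 'i * z1).
Proof.
have h (c : C) : 2^-1 * (2 * c) = c by rewrite mulrA mulVf ?mul1r ?pnatr_eq0.
rewrite -[z0 + _]h; apply: mx2P; rewrite mxE !sum2 !calDE !fE !mE /=; ring: i2.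
Qed.
Lemma cDbar_dot1_sd : cDbar_dot1 S t f x = 2 * (z0 - 'i * z1).
Proof. rewrite /cDbar_dot1 !sum2 !calDbarE !fE !mE; ring: i2. Qed.
Lemma dot_cnabla1_sd (h : 'rV[C]_2) :
  dot_cnabla1 S t h f x = sd1 (h 0 0 * z0 + h 0 1 * z1).
Proof. by rewrite /dot_cnabla1 sum2 !fE sd1D !sd1Z. Qed.
End FirstOrder.

Section SecondOrder.
Variables (S : spacetime R) (t : int) (f : pt R -> 'M[C]_2) (x : pt R) (z0 z1 : C).
Hypothesis f0 : cnablah_2 S t f x 0 = sd2 z0.
Hypothesis f1 : cnablah_2 S t f x 1 = sd2 z1.
Let fE := (f0, f1).

Lemma cDbar_dot2_sd : cDbar_dot2 S t f x = sd1 (2 * (z0 - 'i * z1)).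
Proof. by apply: row2P; rewrite mxE !sum2 !calDbarE !fE !mE; ring: i2. Qed.
Lemma dot_cnabla2_sd (h : 'rV[C]_2) :
  dot_cnabla2 S t h f x = sd2 (h 0 0 * z0 + h 0 1 * z1).
Proof. by rewrite /dot_cnabla2 sum2 !fE sd2D !sd2Z. Qed.
End SecondOrder.

Lemma hotimes_sd z c : hotimes (sd1 z) (sd1 c) = sd2 (z * c).
Proof.
have h (y : C) : 2^-1 * (2 * y) = y by rewrite mulrA mulVf ?mul1r ?pnatr_eq0.
by rewrite -[z * c]h; apply: mx2P; rewrite mxE /dot !sum2 !mE /=; ring: i2.
Qed.
Lemma cj1_sd z : (cj1 (sd1 z) 0 0 = z^*) * (cj1 (sd1 z) 0 1 = 'i * z^*).
Proof.
rewrite /cj1 ![map_mx _ _ _ _]mxE !sd1E; split=> //; case: z => zr zi.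
by apply/eqP; rewrite eq_complex /=; apply/andP; split; apply/eqP; ring.
Qed.
Lemma dot2_cj_sd z c : dot2 (cj1 (sd1 z)) (sd2 c) = sd1 (2 * (z^* * c)).
Proof. by apply: row2P; rewrite mxE !sum2 !cj1_sd !mE; ring: i2. Qed.
Lemma dot_cj_sd z c : dot (cj1 (sd1 z)) (sd1 c) = 2 * (z^* * c).
Proof. by rewrite /dot !sum2 !cj1_sd !mE; ring: i2. Qed.

(** Rotation of the horizontal frame acts on the component by i g(D_X e_1, e_2), and with twice that
    weight on two-tensors ([nabla2_sd]). *)
Lemma nabla1_sd S X (f : pt R -> 'rV[C]_2) x d h z :
  f x = sd1 z -> dirC X (fun y => f y 0 0) x = d ->
  dirC X (fun y => f y 0 1) x = - ('i * d) ->
  hconn S X 0 0 x = 0 -> hconn S X 1 1 x = 0 ->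
  hconn S X 0 1 x = h -> hconn S X 1 0 x = - h ->
  nabla1 S X f x = sd1 (d + 'i * h * z).
Proof.
move=> fz d0 d1 h00 h11 h01 h10.
by apply: row2P; rewrite mxE sum2 fz ?d0 ?d1 ?h00 ?h11 ?h01 ?h10 !mE; ring: i2.
Qed.

Lemma nabla2_sd S X (f : pt R -> 'M[C]_2) x d h z :
  f x = sd2 z -> dirC X (fun y => f y 0 0) x = d ->
  dirC X (fun y => f y 0 1) x = - ('i * d) ->
  dirC X (fun y => f y 1 0) x = - ('i * d) -> dirC X (fun y => f y 1 1) x = - d ->
  hconn S X 0 0 x = 0 -> hconn S X 1 1 x = 0 ->
  hconn S X 0 1 x = h -> hconn S X 1 0 x = - h ->
  nabla2 S X f x = sd2 (d + 2 * ('i * h) * z).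
Proof.
move=> fz d00 d01 d10 d11 h00 h11 h01 h10.
by apply: mx2P; rewrite mxE !sum2 fz ?(d00, d01, d10, d11, h00, h11, h01, h10) !mE; ring: i2.
Qed.

End Spin.

Lemma complex_sum4 (R : realType) (a b c : 'I_4 -> R) :
  \sum_i (a i)%:C * (b i +i* c i) = (\sum_i a i * b i) +i* (\sum_i a i * c i).
Proof.
by rewrite !sum4; apply/eqP; rewrite eq_complex /=; apply/andP; split; apply/eqP; ring.
Qed.

(** * Horizontal covariant derivatives on components *)

Section Operators.
Context {R : realType} {e0 : R} {U : set (pt R)} (Uo : open U) {S : R -> spacetime R}.
Local Notation C := R[i].
Local Notation Oo := (@slab_open R (pt R) e0 U Uo).
Local Notation KO := (sfun_of Oo).
Hypothesis sf : smooth_family (@slab R (pt R) e0 U) S.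
Hypothesis gTS : forall s x, `|s| < e0 -> U x -> (metric (S s) x)^T = metric (S s) x.
Hypothesis FTS : forall s x, `|s| < e0 -> U x -> (Fem (S s) x)^T = - Fem (S s) x.
Hypothesis nfS : forall s x, `|s| < e0 -> U x -> null_frame (S s) x.
Local Notation g := (gK Uo sf).
Local Notation E := (EK Uo sf).
Local Notation F := (FK Uo sf).
Local Notation frow := (frow Uo sf).
Local Notation r3 := (r3 Uo sf).
Local Notation r4 := (r4 Uo sf).
Local Notation rh := (rh Uo sf).
Local Notation ii := (@ii R e0 U Uo).
Local Notation half := (@half R e0 U Uo).
Local Notation Dx := (@Dx R e0 U Uo).
Local Notation eta := (nullmx (2 : KO)).
Local Notation etai := (nullmx half).
Local Notation DM := (@DxM R e0 U Uo).
Local Notation DC := (@DxC R e0 U Uo).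
Local Notation h2 := (half2 (e0 := e0) Uo).
Local Notation gT := (gKT Uo sf gTS).
Local Notation FT := (FKT Uo sf FTS).
Local Notation EgE := (EgK Uo sf gTS nfS).
Local Notation repv := (@repv R e0 U Uo).
Local Notation cnn := (@cnn R e0 U Uo S sf).
Local Notation w := (spin Dx half g E).
Local Notation frd := (frd Dx E).

Lemma halfD x : half * (x + x) = x.
Proof. by rewrite mulrDr -mulrDl h2 mul1r. Qed.

Lemma dbl_eq0 (x : KO) : x + x = 0 -> x = 0.
Proof. by move=> e; rewrite -[x]halfD e mulr0. Qed.

Definition dX (X : 'rV[KO]_4) (k : KO) : KO := \sum_i X 0 i * Dx i k.

Lemma frd_dX l k : frd l k = dX (frow l) k.
Proof. by apply: eq_bigr => i _; rewrite mxE. Qed.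

Lemma dX_lin c X Y k : dX (X + c *: Y) k = dX X k + c * dX Y k.
Proof.
rewrite /dX mulr_sumr -big_split; apply: eq_bigr => i _; rewrite !mxE /=; ring.
Qed.

Lemma dXZ X c k : (forall i, Dx i c = 0) -> dX X (c * k) = c * dX X k.
Proof.
by move=> c0; rewrite /dX mulr_sumr; apply: eq_bigr => i _; rewrite DM c0 mul0r add0r; ring.
Qed.

Lemma dXN X k : dX X (- k) = - dX X k.
Proof. by rewrite -sumrN; apply: eq_bigr => i _; rewrite raddfN mulrN. Qed.

Lemma rep_dirC X x k f : repv x X -> rep k f ->
  rep (dX x k) (fun s p => dirC (X s) (f s) p).
Proof.
move=> rx rf s p ps Up.
rewrite (rep_sum _ (fun i => repM (rx i) (rep_part i rf))) //.
exact: complex_sum4.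
Qed.

(* i g(D_X e_1, e_2) *)
Definition muX X : KO := ii * cnn X (rh 0) (rh 1).

Let iiE' : ii * ii = -1. Proof. exact: iiE. Qed.
Let i0 i : Dx i ii = 0. Proof. exact: Dx_ii. Qed.

Let f2E : frow 2 = rh 0 + ii *: rh 1. Proof. by []. Qed.
Let f3E : frow 3 = rh 0 + (- ii) *: rh 1. Proof. by rewrite scaleNr. Qed.
Let Ni0 i : Dx i (- ii) = 0. Proof. by rewrite raddfN i0 oppr0. Qed.

(** Antisymmetry of the connection is available in the null frame; expanding m and mb and solving
    the linear relations gives it for e_1 and e_2. *)
Let cE X : [/\ cnn X (rh 0) (rh 0) = 0, cnn X (rh 1) (rh 1) = 0 &
  cnn X (rh 1) (rh 0) = - cnn X (rh 0) (rh 1)].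
Proof.
have h a b := cnn_anti sf gTS nfS X a b.
have h22 : cnn X (frow 2) (frow 2) = 0.
  by apply: dbl_eq0; rewrite {1}h addNr.
have h33 : cnn X (frow 3) (frow 3) = 0.
  by apply: dbl_eq0; rewrite {1}h addNr.
have h23 := h 2 3.
move: h22 h33 h23; rewrite f2E f3E !(cnn_linr sf, cnn_linm sf _ _ _ _ i0, cnn_linm sf _ _ _ _ Ni0).
move: (cnn X (rh 0) (rh 0)) (cnn X (rh 1) (rh 1)) (cnn X (rh 0) (rh 1)) (cnn X (rh 1) (rh 0)).
move=> a b c d e1 e2 e3; split.
- apply: dbl_eq0; apply: dbl_eq0.
  apply: (eq_of_diff 1 e1); apply: (eq_of_diff 1 e2); apply: (eq_of_diff 1 e3).
  ring: iiE'.
- apply: dbl_eq0; apply: dbl_eq0.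
  apply: (eq_of_diff (-1) e1); apply: (eq_of_diff (-1) e2); apply: (eq_of_diff 1 e3).
  ring: iiE'.
apply/eqP; rewrite -addr_eq0; apply/eqP; apply: dbl_eq0.
apply: (eq_of_diff (- ii) e1); apply: (eq_of_diff ii e2).
ring: iiE'.
Qed.

Lemma muX_spin l : muX (frow l) = - w l 2 3.
Proof.
rewrite /muX /spin cnn_conn f2E f3E !(cnn_linr sf, cnn_linm sf _ _ _ _ i0, cnn_linm sf _ _ _ _ Ni0).
have [-> -> ->] := cE (frow l).
rewrite -[LHS]halfD; ring.
Qed.

Lemma rep_hconn X x a b : repv x X ->
  rep (cnn x (rh a) (rh b)) (fun s p => hconn (S s) (X s) a b p).
Proof. by move=> rx; exact: (rep_cnn sf gTS nfS rx (repvh Uo sf a) (repvh Uo sf b)). Qed.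

Definition rep1 (k : KO) (f : R -> pt R -> 'rV[C]_2) :=
  forall s x, `|s| < e0 -> U x -> f s x = sd1 (sfun_fun k (s, x)).
Definition rep2 (k : KO) (f : R -> pt R -> 'M[C]_2) :=
  forall s x, `|s| < e0 -> U x -> f s x = sd2 (sfun_fun k (s, x)).

Lemma rep1_nabla X x k f : repv x X -> rep1 k f ->
  rep1 (dX x k + muX x * k) (fun s p => nabla1 (S s) (X s) (f s) p).
Proof.
move=> rx rf.
have r0 : rep k (fun s p => f s p 0 0) by move=> s p ps Up; rewrite rf // sd1E.
have r1 : rep (- (ii * k)) (fun s p => f s p 0 1).
  apply: rep_ext (repN (repM (rep_cst Uo 'i) r0)) => s p ps Up.
  by rewrite rf // !sd1E.
have [c00 c11 c10] := cE x.
move=> s p ps Up; have Ox : @slab R (pt R) e0 U (s, p) by split.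
have e0' := rep_dirC rx r0 ps Up; have e1' := rep_dirC rx r1 ps Up.
have e00 := rep_hconn 0 0 rx ps Up; have e11 := rep_hconn 1 1 rx ps Up.
have e01 := rep_hconn 0 1 rx ps Up; have e10 := rep_hconn 1 0 rx ps Up.
rewrite dXN (dXZ _ _ i0) in e1'; rewrite c00 in e00; rewrite c11 in e11; rewrite c10 in e10.
have z0 : sfun_fun (0 : KO) (s, p) = 0 by exact: sfun_cstE.
rewrite (nabla1_sd (d := sfun_fun (dX x k) (s, p)) (h := sfun_fun (cnn x (rh 0) (rh 1)) (s, p))
  (z := sfun_fun k (s, p))) //.
- by rewrite /muX !(sfun_addE, sfun_mulE, sfun_cstE).
- exact: rf.
- by rewrite -e1' !(sfun_oppE, sfun_mulE, sfun_cstE).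
- by rewrite -e00.
- by rewrite -e11.
- by rewrite -e10 sfun_oppE.
Qed.

Lemma rep2_nabla X x k f : repv x X -> rep2 k f ->
  rep2 (dX x k + 2 * muX x * k) (fun s p => nabla2 (S s) (X s) (f s) p).
Proof.
move=> rx rf.
have r0 : rep k (fun s p => f s p 0 0) by move=> s p ps Up; rewrite rf // sd2E.
have r1 : rep (- (ii * k)) (fun s p => f s p 0 1).
  apply: rep_ext (repN (repM (rep_cst Uo 'i) r0)) => s p ps Up.
  by rewrite rf // !sd2E.
have r2 : rep (- (ii * k)) (fun s p => f s p 1 0).
  by apply: rep_ext r1 => s p ps Up; rewrite rf // !sd2E.
have r3 : rep (- k) (fun s p => f s p 1 1).
  by apply: rep_ext (repN r0) => s p ps Up; rewrite rf // !sd2E.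
have [c00 c11 c10] := cE x.
move=> s p ps Up; have Ox : @slab R (pt R) e0 U (s, p) by split.
have e0' := rep_dirC rx r0 ps Up; have e1' := rep_dirC rx r1 ps Up.
have e2' := rep_dirC rx r2 ps Up; have e3' := rep_dirC rx r3 ps Up.
have e00 := rep_hconn 0 0 rx ps Up; have e11 := rep_hconn 1 1 rx ps Up.
have e01 := rep_hconn 0 1 rx ps Up; have e10 := rep_hconn 1 0 rx ps Up.
rewrite dXN (dXZ _ _ i0) in e1'; rewrite dXN (dXZ _ _ i0) in e2'; rewrite dXN in e3'.
rewrite c00 in e00; rewrite c11 in e11; rewrite c10 in e10.
have z0 : sfun_fun (0 : KO) (s, p) = 0 by exact: sfun_cstE.
have z2 : sfun_fun (2 : KO) (s, p) = 2.
  have -> : (2 : KO) = sfun_cst Oo 2 by rewrite rmorph_nat.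
  exact: sfun_cstE.
rewrite (nabla2_sd (d := sfun_fun (dX x k) (s, p)) (h := sfun_fun (cnn x (rh 0) (rh 1)) (s, p))
  (z := sfun_fun k (s, p))) //.
- by rewrite /muX !(sfun_addE, sfun_mulE, sfun_cstE, z2).
- exact: rf.
- by rewrite -e1' !(sfun_oppE, sfun_mulE, sfun_cstE).
- by rewrite -e2' !(sfun_oppE, sfun_mulE, sfun_cstE).
- by rewrite -e3' sfun_oppE.
- by rewrite -e00.
- by rewrite -e11.
- by rewrite -e10 sfun_oppE.
Qed.

End Operators.

(** * Conformal derivatives and contractions on components *)

Section Quantities.
Context {R : realType} {e0 : R} {U : set (pt R)} (Uo : open U) {S : R -> spacetime R}.
Local Notation C := R[i].
Local Notation Oo := (@slab_open R (pt R) e0 U Uo).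
Local Notation KO := (sfun_of Oo).
Hypothesis sf : smooth_family (@slab R (pt R) e0 U) S.
Hypothesis gTS : forall s x, `|s| < e0 -> U x -> (metric (S s) x)^T = metric (S s) x.
Hypothesis FTS : forall s x, `|s| < e0 -> U x -> (Fem (S s) x)^T = - Fem (S s) x.
Hypothesis nfS : forall s x, `|s| < e0 -> U x -> null_frame (S s) x.
Local Notation g := (gK Uo sf).
Local Notation E := (EK Uo sf).
Local Notation F := (FK Uo sf).
Local Notation frow := (frow Uo sf).
Local Notation r3 := (r3 Uo sf).
Local Notation r4 := (r4 Uo sf).
Local Notation rh := (rh Uo sf).
Local Notation ii := (@ii R e0 U Uo).
Local Notation half := (@half R e0 U Uo).
Local Notation Dx := (@Dx R e0 U Uo).
Local Notation eta := (nullmx (2 : KO)).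
Local Notation etai := (nullmx half).
Local Notation DM := (@DxM R e0 U Uo).
Local Notation DC := (@DxC R e0 U Uo).
Local Notation h2 := (half2 (e0 := e0) Uo).
Local Notation gT := (gKT Uo sf gTS).
Local Notation FT := (FKT Uo sf FTS).
Local Notation EgE := (EgK Uo sf gTS nfS).
Local Notation repv := (@repv R e0 U Uo).
Local Notation cnn := (@cnn R e0 U Uo S sf).
Local Notation w := (spin Dx half g E).
Local Notation d := (frd Dx E).
Local Notation dX := (@dX R e0 U Uo).
Local Notation muX := (muX sf).
Local Notation rep1 := (@rep1 R e0 U Uo).
Local Notation rep2 := (@rep2 R e0 U Uo).
Local Notation nu l := (w l 1 0).
Local Notation mu l := (- w l 2 3).
Local Notation rv3 := (repv3 Uo sf).
Local Notation rv4 := (repv4 Uo sf).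
Local Notation rvh := (repvh Uo sf).

Definition ck l (p j k : KO) : KO := d l k + (p * nu l + j * mu l) * k.

Let i0 i : Dx i ii = 0. Proof. exact: Dx_ii. Qed.
Let f2E : frow 2 = rh 0 + ii *: rh 1. Proof. by []. Qed.
Let f3E : frow 3 = rh 0 + (- ii) *: rh 1. Proof. by rewrite scaleNr. Qed.

Lemma half_cnn l a b : half * cnn (frow l) (frow a) (frow b) = w l a b.
Proof. by rewrite -cnn_conn. Qed.

Lemma rep_int (t : int) : rep (t%:~R : KO) (fun _ _ => t%:~R).
Proof. by rewrite -(rmorph_int (sfun_cst Oo)); exact: rep_cst. Qed.

Lemma rep_omega : repr (nu 1) (fun s x => 2 * omega (S s) x).
Proof.
rewrite -half_cnn; apply: rep_ext (reprM (rep_half Uo) (rep_cnn sf gTS nfS rv4 rv4 rv3)).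
by move=> s x _ _; congr (_%:C); rewrite /omega; field.
Qed.

Lemma rep_omegab : repr (nu 0) (fun s x => - (2 * omegab (S s) x)).
Proof.
have -> : nu 0 = - w 0 0 1 by rewrite (spin_anti DM h2 gT EgE 0 0 1) opprK.
rewrite -half_cnn; apply: rep_ext (reprN (reprM (rep_half Uo) (rep_cnn sf gTS nfS rv3 rv3 rv4))).
by move=> s x _ _; congr (_%:C); rewrite /omegab; field.
Qed.

Definition zetaK a : KO := half * cnn (rh a) r4 r3.

Lemma rep_zeta a : repr (zetaK a) (fun s x => zeta (S s) x 0 a).
Proof.
apply: rep_ext (reprM (rep_half Uo) (rep_cnn sf gTS nfS (rvh a) rv4 rv3)).
by move=> s x _ _; rewrite mxE.
Qed.

Lemma zetaK2 : zetaK 0 + ii * zetaK 1 = nu 2.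
Proof. rewrite -half_cnn f2E (cnn_linl sf) /zetaK; ring. Qed.
Lemma zetaK3 : zetaK 0 - ii * zetaK 1 = nu 3.
Proof. rewrite -half_cnn f3E (cnn_linl sf) /zetaK; ring. Qed.

(** Conformal derivative along the real vector e_a on components of type [p] and spin [j]. [hk2] and
    [hk3] combine the two into derivatives along m and mb. *)
Definition hk a (p j k : KO) : KO :=
  dX (rh a) k + (p * zetaK a + j * muX (rh a)) * k.

Lemma hk2 p j k : hk 0 p j k + ii * hk 1 p j k = ck 2 p j k.
Proof.
rewrite /ck frd_dX -zetaK2 -(muX_spin Uo sf gTS nfS 2) f2E dX_lin /muX (cnn_linl sf) /hk /muX; ring.
Qed.
Lemma hk3 p j k : hk 0 p j k - ii * hk 1 p j k = ck 3 p j k.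
Proof.
rewrite /ck frd_dX -zetaK3 -(muX_spin Uo sf gTS nfS 3) f3E dX_lin /muX (cnn_linl sf) /hk /muX; ring.
Qed.

Lemma rep1D k l f h : rep1 k f -> rep1 l h -> rep1 (k + l) (fun s x => f s x + h s x).
Proof.
move=> a b s x ps Ux; have Ox : @slab R (pt R) e0 U (s, x) by split.
by rewrite a // b // sfun_addE // sd1D.
Qed.
Lemma rep1N k f : rep1 k f -> rep1 (- k) (fun s x => - f s x).
Proof.
move=> a s x ps Ux; have Ox : @slab R (pt R) e0 U (s, x) by split.
by rewrite a // sfun_oppE // sd1N.
Qed.
Lemma rep1Z k l z f : rep l z -> rep1 k f -> rep1 (l * k) (fun s x => z s x *: f s x).
Proof.
move=> a b s x ps Ux; have Ox : @slab R (pt R) e0 U (s, x) by split.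
by rewrite -a // b // sfun_mulE // sd1Z.
Qed.
Lemma rep1_eq k l f : k = l -> rep1 k f -> rep1 l f. Proof. by move->. Qed.
Lemma rep2D k l f h : rep2 k f -> rep2 l h -> rep2 (k + l) (fun s x => f s x + h s x).
Proof.
move=> a b s x ps Ux; have Ox : @slab R (pt R) e0 U (s, x) by split.
by rewrite a // b // sfun_addE // sd2D.
Qed.
Lemma rep2N k f : rep2 k f -> rep2 (- k) (fun s x => - f s x).
Proof.
move=> a s x ps Ux; have Ox : @slab R (pt R) e0 U (s, x) by split.
by rewrite a // sfun_oppE // sd2N.
Qed.
Lemma rep2Z k l z f : rep l z -> rep2 k f -> rep2 (l * k) (fun s x => z s x *: f s x).
Proof.
move=> a b s x ps Ux; have Ox : @slab R (pt R) e0 U (s, x) by split.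
by rewrite -a // b // sfun_mulE // sd2Z.
Qed.
Lemma rep2_eq k l f : k = l -> rep2 k f -> rep2 l f. Proof. by move->. Qed.
Lemma rep_eq k l f : k = l -> rep (e0 := e0) (Uo := Uo) k f -> rep l f. Proof. by move->. Qed.

Let rep_w3 (t : int) : rep (t%:~R * nu 0) (fun s x => - (2 * t%:~R * omegab (S s) x)%:C).
Proof.
apply: rep_ext (repM (rep_int t) rep_omegab) => s x _ _.
by rewrite -rmorphN -(rmorph_int (real_complex R)) -rmorphM; congr (_%:C); ring.
Qed.
Let rep_w4 (t : int) : rep (t%:~R * nu 1) (fun s x => (2 * t%:~R * omega (S s) x)%:C).
Proof.
apply: rep_ext (repM (rep_int t) rep_omega) => s x _ _.
by rewrite -(rmorph_int (real_complex R)) -rmorphM; congr (_%:C); ring.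
Qed.
Let rep_wh (t : int) a : rep (t%:~R * zetaK a) (fun s x => (t%:~R * zeta (S s) x 0 a)%:C).
Proof.
apply: rep_ext (repM (rep_int t) (rep_zeta a)) => s x _ _.
by rewrite -(rmorph_int (real_complex R)) -rmorphM.
Qed.

Lemma rep1_c3 t k f : rep1 k f ->
  rep1 (ck 0 t%:~R 1 k) (fun s x => cnabla3_1 (S s) t (f s) x).
Proof.
move=> rf; have h := rep1D (rep1_nabla sf gTS nfS rv3 rf) (rep1Z (rep_w3 t) rf).
move=> s x ps Ux; rewrite /cnabla3_1 -scaleNr; refine (etrans (h s x ps Ux) _).
congr (sd1 (sfun_fun _ _)).
rewrite /ck frd_dX -(muX_spin Uo sf gTS nfS 0) /frow /=; ring.
Qed.
Lemma rep2_c3 t k f : rep2 k f ->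
  rep2 (ck 0 t%:~R 2 k) (fun s x => cnabla3_2 (S s) t (f s) x).
Proof.
move=> rf; have h := rep2D (rep2_nabla sf gTS nfS rv3 rf) (rep2Z (rep_w3 t) rf).
move=> s x ps Ux; rewrite /cnabla3_2 -scaleNr; refine (etrans (h s x ps Ux) _).
congr (sd2 (sfun_fun _ _)).
rewrite /ck frd_dX -(muX_spin Uo sf gTS nfS 0) /frow /=; ring.
Qed.
Lemma rep1_c4 t k f : rep1 k f ->
  rep1 (ck 1 t%:~R 1 k) (fun s x => cnabla4_1 (S s) t (f s) x).
Proof.
move=> rf; apply: rep1_eq (rep1D (rep1_nabla sf gTS nfS rv4 rf) (rep1Z (rep_w4 t) rf)).
rewrite /ck frd_dX -(muX_spin Uo sf gTS nfS 1) /frow /=; ring.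
Qed.
Lemma rep2_c4 t k f : rep2 k f ->
  rep2 (ck 1 t%:~R 2 k) (fun s x => cnabla4_2 (S s) t (f s) x).
Proof.
move=> rf; apply: rep2_eq (rep2D (rep2_nabla sf gTS nfS rv4 rf) (rep2Z (rep_w4 t) rf)).
rewrite /ck frd_dX -(muX_spin Uo sf gTS nfS 1) /frow /=; ring.
Qed.
Lemma rep1_ch t a k f : rep1 k f ->
  rep1 (hk a t%:~R 1 k) (fun s x => cnablah_1 (S s) t (f s) x a).
Proof.
move=> rf; apply: rep1_eq (rep1D (rep1_nabla sf gTS nfS (rvh a) rf) (rep1Z (rep_wh t a) rf)).
rewrite /hk; ring.
Qed.
Lemma rep2_ch t a k f : rep2 k f ->
  rep2 (hk a t%:~R 2 k) (fun s x => cnablah_2 (S s) t (f s) x a).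
Proof.
move=> rf; apply: rep2_eq (rep2D (rep2_nabla sf gTS nfS (rvh a) rf) (rep2Z (rep_wh t a) rf)).
rewrite /hk; ring.
Qed.

Let val2 z : @slab R (pt R) e0 U z -> sfun_fun (2 : KO) z = 2.
Proof.
by move=> Oz; have -> : (2 : KO) = sfun_cst Oo 2 by [rewrite rmorph_nat]; exact: sfun_cstE.
Qed.

Lemma rep2_hotimes t k f : rep1 k f ->
  rep2 (ck 2 t%:~R 1 k) (fun s x => cD_hotimes (S s) t (f s) x).
Proof.
move=> rf s x ps Ux; have Ox : @slab R (pt R) e0 U (s, x) by split.
rewrite (cD_hotimes_sd (rep1_ch t 0 rf ps Ux) (rep1_ch t 1 rf ps Ux)) -hk2.
by rewrite !(sfun_addE, sfun_mulE, sfun_cstE).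
Qed.
Lemma rep_dbar1 t k f : rep1 k f ->
  rep (2 * ck 3 t%:~R 1 k) (fun s x => cDbar_dot1 (S s) t (f s) x).
Proof.
move=> rf s x ps Ux; have Ox : @slab R (pt R) e0 U (s, x) by split.
rewrite (cDbar_dot1_sd (rep1_ch t 0 rf ps Ux) (rep1_ch t 1 rf ps Ux)) -hk3.
by rewrite !(sfun_addE, sfun_oppE, sfun_mulE, sfun_cstE, val2).
Qed.
Lemma rep1_dbar2 t k f : rep2 k f ->
  rep1 (2 * ck 3 t%:~R 2 k) (fun s x => cDbar_dot2 (S s) t (f s) x).
Proof.
move=> rf s x ps Ux; have Ox : @slab R (pt R) e0 U (s, x) by split.
rewrite (cDbar_dot2_sd (rep2_ch t 0 rf ps Ux) (rep2_ch t 1 rf ps Ux)) -hk3.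
by rewrite !(sfun_addE, sfun_oppE, sfun_mulE, sfun_cstE, val2).
Qed.

(* A contraction with [h] whose components are [u + v] and [- i (u - v)]. *)
Lemma rep1_dot t k f u v (h : R -> pt R -> 'rV[C]_2) : rep1 k f ->
  rep (u + v) (fun s x => h s x 0 0) -> rep (- (ii * (u - v))) (fun s x => h s x 0 1) ->
  rep1 (u * ck 3 t%:~R 1 k + v * ck 2 t%:~R 1 k)
       (fun s x => dot_cnabla1 (S s) t (h s x) (f s) x).
Proof.
move=> rf h0 h1 s x ps Ux; have Ox : @slab R (pt R) e0 U (s, x) by split.
rewrite (dot_cnabla1_sd (rep1_ch t 0 rf ps Ux) (rep1_ch t 1 rf ps Ux)).
rewrite -h0 // -h1 // -!(sfun_mulE, sfun_addE) //; congr (sd1 (sfun_fun _ _)).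
rewrite -hk2 -hk3; ring: (iiE (e0 := e0) Uo).
Qed.
Lemma rep2_dot t k f u v (h : R -> pt R -> 'rV[C]_2) : rep2 k f ->
  rep (u + v) (fun s x => h s x 0 0) -> rep (- (ii * (u - v))) (fun s x => h s x 0 1) ->
  rep2 (u * ck 3 t%:~R 2 k + v * ck 2 t%:~R 2 k)
       (fun s x => dot_cnabla2 (S s) t (h s x) (f s) x).
Proof.
move=> rf h0 h1 s x ps Ux; have Ox : @slab R (pt R) e0 U (s, x) by split.
rewrite (dot_cnabla2_sd (rep2_ch t 0 rf ps Ux) (rep2_ch t 1 rf ps Ux)).
rewrite -h0 // -h1 // -!(sfun_mulE, sfun_addE) //; congr (sd2 (sfun_fun _ _)).
rewrite -hk2 -hk3; ring: (iiE (e0 := e0) Uo).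
Qed.

End Quantities.

(** * Connection coefficients as spin coefficients *)

Section Quantities.
Context {R : realType} {e0 : R} {U : set (pt R)} (Uo : open U) {S : R -> spacetime R}.
Local Notation C := R[i].
Local Notation Oo := (@slab_open R (pt R) e0 U Uo).
Local Notation KO := (sfun_of Oo).
Hypothesis sf : smooth_family (@slab R (pt R) e0 U) S.
Hypothesis gTS : forall s x, `|s| < e0 -> U x -> (metric (S s) x)^T = metric (S s) x.
Hypothesis FTS : forall s x, `|s| < e0 -> U x -> (Fem (S s) x)^T = - Fem (S s) x.
Hypothesis nfS : forall s x, `|s| < e0 -> U x -> null_frame (S s) x.
Local Notation g := (gK Uo sf).
Local Notation E := (EK Uo sf).
Local Notation F := (FK Uo sf).
Local Notation frow := (frow Uo sf).
Local Notation r3 := (r3 Uo sf).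
Local Notation r4 := (r4 Uo sf).
Local Notation rh := (rh Uo sf).
Local Notation ii := (@ii R e0 U Uo).
Local Notation half := (@half R e0 U Uo).
Local Notation Dx := (@Dx R e0 U Uo).
Local Notation eta := (nullmx (2 : KO)).
Local Notation etai := (nullmx half).
Local Notation DM := (@DxM R e0 U Uo).
Local Notation DC := (@DxC R e0 U Uo).
Local Notation h2 := (half2 (e0 := e0) Uo).
Local Notation gT := (gKT Uo sf gTS).
Local Notation FT := (FKT Uo sf FTS).
Local Notation EgE := (EgK Uo sf gTS nfS).
Local Notation repv := (@repv R e0 U Uo).
Local Notation cnn := (@cnn R e0 U Uo S sf).
Local Notation w := (spin Dx half g E).
Local Notation rep1 := (@rep1 R e0 U Uo).
Local Notation rep2 := (@rep2 R e0 U Uo).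
Local Notation rv3 := (repv3 Uo sf).
Local Notation rv4 := (repv4 Uo sf).
Local Notation rvh := (repvh Uo sf).
Local Notation curv := (curv Dx half g E eta etai).
Local Notation ricf := (ricf Dx half g E).
Local Notation scal := (scal Dx half g E etai).
Local Notation weylK := (weylK Uo sf).
Local Notation tens4 := (@tens4 R e0 U Uo).
Local Notation iiE := (iiE (e0 := e0) Uo).
Local Notation sixth := (@sixth R e0 U Uo).

Let i0 i : Dx i ii = 0. Proof. exact: Dx_ii. Qed.
Let f2E : frow 2 = rh 0 + ii *: rh 1. Proof. by []. Qed.
Let f3E : frow 3 = rh 0 + (- ii) *: rh 1. Proof. by rewrite scaleNr. Qed.

Lemma rep_cplx1 k0 k1 (f : R -> pt R -> 'rV[R]_2) :
  repr k0 (fun s x => f s x 0 0) -> repr k1 (fun s x => f s x 0 1) ->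
  rep1 (k0 + ii * k1) (fun s x => cplx1 (f s x)).
Proof.
move=> h0 h1 s x ps Ux; rewrite cplx1E; congr (sd1 _).
by rewrite (repD h0 (repM (rep_cst Uo 'i) h1) ps Ux).
Qed.

Lemma rep_cplx2 k0 k1 k2 k3 (f : R -> pt R -> 'M[R]_2) :
  repr k0 (fun s x => f s x 0 0) -> repr k1 (fun s x => f s x 0 1) ->
  repr k2 (fun s x => f s x 1 0) -> repr k3 (fun s x => f s x 1 1) ->
  k3 = - k0 -> k1 = k2 ->
  rep2 (k0 + ii * k2) (fun s x => cplx2 (f s x)).
Proof.
move=> h0 h1 h2' h3 e3 e1 s x ps Ux; rewrite cplx2E.
- by congr (sd2 _); rewrite (repD h0 (repM (rep_cst Uo 'i) h2') ps Ux).
- have := h3 s x ps Ux; rewrite e3 (reprN h0) // => h.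
  by apply/esym; have := congr1 (@complex.Re R) h.
- by have := h1 s x ps Ux; rewrite e1 h2' // => h; have := congr1 (@complex.Re R) h.
Qed.

Lemma rep1_H : rep1 (w 0 1 2) (fun s x => H (S s) x).
Proof.
apply: rep1_eq (rep_cplx1 (k0 := half * cnn r3 r4 (rh 0)) (k1 := half * cnn r3 r4 (rh 1)) _ _).
- rewrite -half_cnn f2E (cnn_linr sf) /frow /=; ring.
- by apply: rep_ext (reprM (rep_half Uo) (rep_cnn sf gTS nfS rv3 rv4 (rvh 0))) => s x _ _; rewrite mxE.
- by apply: rep_ext (reprM (rep_half Uo) (rep_cnn sf gTS nfS rv3 rv4 (rvh 1))) => s x _ _; rewrite mxE.
Qed.
Lemma rep1_Hb : rep1 (w 1 0 2) (fun s x => Hb (S s) x).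
Proof.
apply: rep1_eq (rep_cplx1 (k0 := half * cnn r4 r3 (rh 0)) (k1 := half * cnn r4 r3 (rh 1)) _ _).
- rewrite -half_cnn f2E (cnn_linr sf) /frow /=; ring.
- by apply: rep_ext (reprM (rep_half Uo) (rep_cnn sf gTS nfS rv4 rv3 (rvh 0))) => s x _ _; rewrite mxE.
- by apply: rep_ext (reprM (rep_half Uo) (rep_cnn sf gTS nfS rv4 rv3 (rvh 1))) => s x _ _; rewrite mxE.
Qed.
Lemma rep1_Xi : rep1 (w 1 1 2) (fun s x => Xi (S s) x).
Proof.
apply: rep1_eq (rep_cplx1 (k0 := half * cnn r4 r4 (rh 0)) (k1 := half * cnn r4 r4 (rh 1)) _ _).
- rewrite -half_cnn f2E (cnn_linr sf) /frow /=; ring.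
- by apply: rep_ext (reprM (rep_half Uo) (rep_cnn sf gTS nfS rv4 rv4 (rvh 0))) => s x _ _; rewrite mxE.
- by apply: rep_ext (reprM (rep_half Uo) (rep_cnn sf gTS nfS rv4 rv4 (rvh 1))) => s x _ _; rewrite mxE.
Qed.

Let rch a b : repr (cnn (rh a) r4 (rh b)) (fun s x => chi (S s) x a b).
Proof.
by apply: rep_ext (rep_cnn sf gTS nfS (rvh a) rv4 (rvh b)) => s x _ _; rewrite mxE.
Qed.
Let rchb a b : repr (cnn (rh a) r3 (rh b)) (fun s x => chib (S s) x a b).
Proof.
by apply: rep_ext (rep_cnn sf gTS nfS (rvh a) rv3 (rvh b)) => s x _ _; rewrite mxE.
Qed.

Let rep_tr (c : 'I_2 -> 'I_2 -> KO) (u : R -> pt R -> 'M[R]_2) :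
  (forall a b, repr (c a b) (fun s x => u s x a b)) ->
  rep (c 0 0 + c 1 1 - ii * (c 0 1 - c 1 0)) (fun s x => \tr (u s x) -i* atr (u s x)).
Proof.
move=> rc; apply: rep_ext (repD (reprD (rc 0 0) (rc 1 1))
  (repN (repM (rep_cst Uo 'i) (reprB (rc 0 1) (rc 1 0))))) => s x _ _.
rewrite /mxtrace /atr !sum2 !hvolE.
by apply/eqP; rewrite eq_complex /=; apply/andP; split; apply/eqP; ring.
Qed.

Let wdbl l a b : cnn (frow l) (frow a) (frow b) = 2 * w l a b.
Proof. exact: cnn_spin. Qed.

Lemma rep_trX : rep (2 * w 2 1 3) (fun s x => trX (S s) x).
Proof.
apply: rep_eq (rep_tr rch).
rewrite -wdbl f2E f3E (cnn_linr sf) !(cnn_linl sf) /frow /=; ring: iiE.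
Qed.
Lemma rep_trXb : rep (2 * w 2 0 3) (fun s x => trXb (S s) x).
Proof.
apply: rep_eq (rep_tr rchb).
rewrite -wdbl f2E f3E (cnn_linr sf) !(cnn_linl sf) /frow /=; ring: iiE.
Qed.

Lemma rep2_Xhat : rep2 (w 2 1 2) (fun s x => Xhat (S s) x).
Proof.
pose c a b := cnn (rh a) r4 (rh b).
have e a b s x : symtraceless (chi (S s) x) a b =
    2^-1 * (chi (S s) x a b + chi (S s) x b a
      - (a == b)%:R * (chi (S s) x 0 0 + chi (S s) x 1 1)).
  rewrite !mxE /mxtrace sum2; congr (_ * (_ + _ - _)); rewrite !mxE mulr_natl //.
have hc a b : repr (half * (c a b + c b a - (a == b)%:R * (c 0 0 + c 1 1)))
    (fun s x => symtraceless (chi (S s) x) a b).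
  apply: rep_ext (reprM (rep_half Uo) (reprB (reprD (rch a b) (rch b a)) (reprM
    (_ : repr (a == b)%:R (fun _ _ => (a == b)%:R)) (reprD (rch 0 0) (rch 1 1))))).
    by move=> s x _ _; rewrite e.
  by rewrite -[(a == b)%:R in X in repr X](rmorph_nat (sfun_cst Oo)) -(rmorph_nat (real_complex R)); exact: repr_cst.
apply: rep2_eq (rep_cplx2 (hc 0 0) (hc 0 1) (hc 1 0) (hc 1 1) _ _).
- rewrite -half_cnn f2E (cnn_linr sf) !(cnn_linl sf) /frow /= /c; ring: iiE.
- rewrite /=; ring.
- rewrite /=; ring.
Qed.

End Quantities.

Lemma con4_weyl (K : comPzRingType) (n : nat) (E : 'M[K]_n)
    (T : 'I_n -> 'I_n -> 'I_n -> 'I_n -> K) (g r : 'I_n -> 'I_n -> K) (h t : K) a b l m :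
  con4 E (fun k p i j => T k p i j
    - h * (g k i * r p j - g k j * r p i + g p j * r k i - g p i * r k j)
    + t * (g k i * g p j - g k j * g p i)) a b l m =
  con4 E T a b l m - h * (con2 E g a l * con2 E r b m - con2 E g a m * con2 E r b l
    + con2 E g b m * con2 E r a l - con2 E g b l * con2 E r a m)
  + t * (con2 E g a l * con2 E g b m - con2 E g a m * con2 E g b l).
Proof.
have p (u v : 'I_n -> 'I_n -> K) := con4_prod E u v a b l m.
have q (u v : 'I_n -> 'I_n -> K) : con4 E (fun k p i j => u k j * v p i) a b l m =
    con2 E u a m * con2 E v b l.
  exact: etrans (con4_34 E (fun k p i j => u k i * v p j) a b l m) (con4_prod E u v a b m l).
transitivity (con4 E (fun k p i j => T k p i j
  + (- h) * (g k i * r p j + (-1) * (g k j * r p i) + (r k i * g p j)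
    + (-1) * (r k j * g p i))
  + t * (g k i * g p j + (-1) * (g k j * g p i))) a b l m).
  apply: eq_con4 => k p' i j; ring.
rewrite !(con4D, con4Z) !p !q; ring.
Qed.

(** * Weyl components, electromagnetic components and conjugation *)

Section Quantities2.
Context {R : realType} {e0 : R} {U : set (pt R)} (Uo : open U) {S : R -> spacetime R}.
Local Notation C := R[i].
Local Notation Oo := (@slab_open R (pt R) e0 U Uo).
Local Notation KO := (sfun_of Oo).
Hypothesis sf : smooth_family (@slab R (pt R) e0 U) S.
Hypothesis gTS : forall s x, `|s| < e0 -> U x -> (metric (S s) x)^T = metric (S s) x.
Hypothesis FTS : forall s x, `|s| < e0 -> U x -> (Fem (S s) x)^T = - Fem (S s) x.
Hypothesis nfS : forall s x, `|s| < e0 -> U x -> null_frame (S s) x.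
Local Notation g := (gK Uo sf).
Local Notation E := (EK Uo sf).
Local Notation F := (FK Uo sf).
Local Notation frow := (frow Uo sf).
Local Notation r3 := (r3 Uo sf).
Local Notation r4 := (r4 Uo sf).
Local Notation rh := (rh Uo sf).
Local Notation ii := (@ii R e0 U Uo).
Local Notation half := (@half R e0 U Uo).
Local Notation Dx := (@Dx R e0 U Uo).
Local Notation eta := (nullmx (2 : KO)).
Local Notation etai := (nullmx half).
Local Notation DM := (@DxM R e0 U Uo).
Local Notation DC := (@DxC R e0 U Uo).
Local Notation h2 := (half2 (e0 := e0) Uo).
Local Notation gT := (gKT Uo sf gTS).
Local Notation FT := (FKT Uo sf FTS).
Local Notation EgE := (EgK Uo sf gTS nfS).
Local Notation repv := (@repv R e0 U Uo).
Local Notation cnn := (@cnn R e0 U Uo S sf).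
Local Notation w := (spin Dx half g E).
Local Notation rep1 := (@rep1 R e0 U Uo).
Local Notation rep2 := (@rep2 R e0 U Uo).
Local Notation rv3 := (repv3 Uo sf).
Local Notation rv4 := (repv4 Uo sf).
Local Notation rvh := (repvh Uo sf).
Local Notation curv := (curv Dx half g E eta etai).
Local Notation ricf := (ricf Dx half g E).
Local Notation scal := (scal Dx half g E etai).
Local Notation weylK := (@weylK R e0 U Uo S sf).
Local Notation tens4 := (@tens4 R e0 U Uo).
Local Notation iiE := (iiE (e0 := e0) Uo).
Local Notation sixth := (@sixth R e0 U Uo).
Local Notation dbl_eq0 := (@dbl_eq0 R e0 U Uo).
Local Notation halfD := (@halfD R e0 U Uo).

Let f2E : frow 2 = rh 0 + ii *: rh 1. Proof. by []. Qed.
Let f3E : frow 3 = rh 0 + (- ii) *: rh 1. Proof. by rewrite scaleNr. Qed.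

Let Wf a b l m := con4 E weylK a b l m.

Lemma weyl_frame a b l m : con4 E weylK a b l m = curv a b l m
  - half * (eta a l * ricf b m - eta a m * ricf b l + eta b m * ricf a l
            - eta b l * ricf a m)
  + sixth * scal * (eta a l * eta b m - eta a m * eta b l).
Proof.
rewrite (curv_riem DM DC half gT (nullmx_inv h2) EgE).
have gE p q := con2_g EgE p q.
have := con4_weyl E (riem Dx half g E etai) (fun i j => g i j) (ric Dx half g E etai)
  half (sixth * scal) a b l m.
by rewrite !gE; exact: etrans.
Qed.

Let c12 a b l m : curv b a l m = - curv a b l m.
Proof. exact: (curv_anti12 DM h2 gT (nullmxD DM) (nullmxT half) (nullmx_inv h2) EgE). Qed.
Let c12d a l m : curv a a l m = 0.
Proof. by apply: dbl_eq0; rewrite {1}c12 addNr. Qed.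

Local Notation AK := (A_w Dx half g E).
Local Notation BK := (B_w Dx half g E).
(** The Ricci and scalar parts are removed from the first curvature component, which gives rho. The
    component on (m, mb, e_3, e_4) is -4 i times the dual part of P, whence its sign and factor. *)
Definition PK := half * (half * (curv 1 0 1 0 - half * (2 * ricf 0 1 + 2 * ricf 1 0)
  - sixth * scal * 4 - curv 2 3 0 1)).

Let T a b c d' := tens4 weylK a b c d'.

Let ral a b : repr (T r4 (rh a) r4 (rh b)) (fun s x => alpha (S s) x a b).
Proof.
apply: rep_ext (rep_tens4 sf gTS nfS rv4 (rvh a) rv4 (rvh b)) => s x _ _.
by rewrite mxE.
Qed.

Lemma real_eq0 (x y : KO) : sconj x = x -> sconj y = y -> x + ii * y = 0 -> x = 0 /\ y = 0.
Proof.
move=> rx ry e; have := congr1 (fun z : KO => sconj z) e.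
rewrite /= rmorphD rmorphM rmorph0 /= rx ry sconj_ii => e'.
split; apply: dbl_eq0.
  by apply: (eq_of_diff 1 e); apply: (eq_of_diff 1 e'); ring.
by apply: (eq_of_diff (- ii) e); apply: (eq_of_diff ii e'); ring: iiE.
Qed.

(** That alpha is symmetric and traceless is the vanishing of the Weyl component on (e_4, m, e_4,
    mb), whose real and imaginary parts are separated by [real_eq0]. *)
Lemma rep2_A : rep2 AK (fun s x => A (S s) x).
Proof.
have e2 : con4 E weylK 1 2 1 2 = curv 1 2 1 2.
  rewrite weyl_frame !mxE /=; ring.
have e3 : con4 E weylK 1 2 1 3 = 0.
  rewrite weyl_frame !mxE /= (ricf_11 DM DC h2 gT EgE) (c12 1 2 1 3).
  apply: (eq_of_diff (-1) (halfD (curv 1 2 1 3))); ring.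
rewrite !con4_tens4 f2E f3E in e2 e3.
rewrite !(tens4_lin2, tens4_lin4) -!/(T _ _ _ _) in e2 e3.
have sc a b : sconj (T r4 (rh a) r4 (rh b)) = T r4 (rh a) r4 (rh b) := sconj_repr (ral a b).
have [t0 t1] : T r4 (rh 0) r4 (rh 0) + T r4 (rh 1) r4 (rh 1) = 0 /\
    T r4 (rh 1) r4 (rh 0) - T r4 (rh 0) r4 (rh 1) = 0.
  apply: real_eq0; [by rewrite rmorphD /= !sc | by rewrite rmorphB /= !sc |].
  apply: etrans e3; rewrite /frow /=; ring: iiE.
apply: rep2_eq (rep_cplx2 (ral 0 0) (ral 0 1) (ral 1 0) (ral 1 1) _ _).
- rewrite /A_w -e2 /frow /= -[LHS]halfD; congr (half * _).
  apply: (eq_of_diff 1 t0); apply: (eq_of_diff ii t1); ring: iiE.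
- by apply: (eq_of_diff 1 t0); ring.
- by apply: (eq_of_diff (-1) t1); ring.
Qed.

Lemma rep1_B : rep1 BK (fun s x => B (S s) x).
Proof.
have e : con4 E weylK 2 1 0 1 = curv 2 1 0 1 - ricf 2 1.
  rewrite weyl_frame !mxE /= -[in RHS](halfD (ricf 2 1)); ring.
have rb a : repr (half * T (rh a) r4 r3 r4) (fun s x => beta (S s) x 0 a).
  apply: rep_ext (reprM (rep_half Uo) (rep_tens4 sf gTS nfS (rvh a) rv4 rv3 rv4)) => s x _ _.
  by rewrite mxE.
apply: rep1_eq (rep_cplx1 (rb 0) (rb 1)).
rewrite /B_w -e con4_tens4 f2E tens4_lin1 /frow /= /T; ring.
Qed.

(** The Weyl components on the pairs formed from m and mb are linear in those on e_1 and e_2; the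
    relations [e1] to [e4] are solved for the latter. *)
Lemma rep_P : rep PK (fun s x => P (S s) x).
Proof.
have e0' : con4 E weylK 1 0 1 0 = curv 1 0 1 0 - half * (2 * ricf 0 1 + 2 * ricf 1 0)
    - sixth * scal * 4.
  rewrite weyl_frame !mxE /=; ring.
have e1 : con4 E weylK 2 3 0 1 = curv 2 3 0 1.
  rewrite weyl_frame !mxE /=; ring.
have e2 : con4 E weylK 3 2 0 1 = - curv 2 3 0 1.
  rewrite weyl_frame !mxE /= (c12 2 3); ring.
have e3 : con4 E weylK 2 2 0 1 = 0.
  rewrite weyl_frame !mxE /= c12d; ring.
have e4 : con4 E weylK 3 3 0 1 = 0.
  rewrite weyl_frame !mxE /= c12d; ring.
rewrite !con4_tens4 f2E ?f3E in e1 e2 e3 e4.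
rewrite con4_tens4 in e0'.
rewrite !(tens4_lin1, tens4_lin2) /frow /= -!/(T _ _ _ _) in e1 e2 e3 e4.
have r0 : repr (half * (half * T r4 r3 r4 r3)) (fun s x => rho (S s) x).
  apply: rep_ext (reprM (rep_half Uo) (reprM (rep_half Uo) (rep_tens4 sf gTS nfS rv4 rv3 rv4 rv3))) => s x _ _.
  by congr (_%:C); rewrite /rho; field.
have r1 : repr (half * T (rh 0) (rh 1) r3 r4) (fun s x => rhod (S s) x).
  exact: (reprM (rep_half Uo) (rep_tens4 sf gTS nfS (rvh 0) (rvh 1) rv3 rv4)).
have h : rep (half * (half * T r4 r3 r4 r3) + ii * (half * T (rh 0) (rh 1) r3 r4))
    (fun s x => P (S s) x).
  apply: rep_ext (repD r0 (repM (rep_cst Uo 'i) r1)) => s x _ _.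
  by rewrite /P; apply/eqP; rewrite eq_complex /=; apply/andP; split; apply/eqP; ring.
apply: rep_eq h; rewrite /PK -e0' /frow /= -/(T _ _ _ _).
transitivity (half * (half * (T r4 r3 r4 r3 + (ii * T (rh 0) (rh 1) r3 r4 + ii * T (rh 0) (rh 1) r3 r4)))).
  rewrite mulrDr halfD; ring.
congr (half * (half * _)); rewrite -[LHS]halfD -[RHS]halfD; congr (half * _).
move: (T (rh 0) (rh 0) r3 r4) (T (rh 0) (rh 1) r3 r4) (T (rh 1) (rh 0) r3 r4)
  (T (rh 1) (rh 1) r3 r4) e1 e2 e3 e4 => a b c d' e1 e2 e3 e4.
apply: (eq_of_diff (-1) e1); apply: (eq_of_diff 1 e2); apply: (eq_of_diff 1 e3);
  apply: (eq_of_diff (-1) e4).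
ring: iiE.
Qed.

Lemma bilF_anti u v : bilK F v u = - bilK F u v.
Proof.
rewrite /bilK exchange_big -sumrN; apply: eq_bigr => i _ /=; rewrite -sumrN.
apply: eq_bigr => j _.
have -> : F j i = - F i j by rewrite -[in LHS](trmxK F) mxE FT oppmxE.
ring.
Qed.

Local Notation ff := (ff E F).
Local Notation phiK := (phi_F half E F).
Local Notation phicK := (phic_F half E F).

Lemma ff_bil a b : ff a b = bilK F (frow a) (frow b).
Proof. by rewrite ffE bilK_frame. Qed.

Lemma rep1_BF : rep1 (ff 2 1) (fun s x => B_F (S s) x).
Proof.
have rb a : repr (bilK F (rh a) r4) (fun s x => beta_F (S s) x 0 a).
  apply: rep_ext (rep_bil (B := fun s x => Fem (S s) x) (rep_F Uo sf) (rvh a) rv4) => s x _ _.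
  by rewrite mxE.
apply: rep1_eq (rep_cplx1 (rb 0) (rb 1)).
by rewrite ff_bil f2E !bilKE.
Qed.

Lemma rep1_BbF : rep1 (ff 2 0) (fun s x => cplx1 (betab_F (S s) x)).
Proof.
have rb a : repr (bilK F (rh a) r3) (fun s x => betab_F (S s) x 0 a).
  apply: rep_ext (rep_bil (B := fun s x => Fem (S s) x) (rep_F Uo sf) (rvh a) rv3) => s x _ _.
  by rewrite mxE.
apply: rep1_eq (rep_cplx1 (rb 0) (rb 1)).
by rewrite ff_bil f2E !bilKE.
Qed.

Let Fd u : bilK F u u = 0.
Proof. by apply: dbl_eq0; rewrite {1}bilF_anti addNr. Qed.

Lemma rep_PF : rep phiK (fun s x => P_F (S s) x).
Proof.
have rF := rep_bil (B := fun s x => Fem (S s) x) (rep_F Uo sf).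
have h := repD (reprM (rep_half Uo) (rF _ _ _ _ rv3 rv4))
  (repM (rep_cst Uo 'i) (reprN (rF _ _ _ _ (rvh 0) (rvh 1)))).
apply: rep_eq (rep_ext _ h).
  rewrite /phi_F !ff_bil f2E f3E !bilKE !Fd (bilF_anti (rh 0) (rh 1)) /frow /= -/ii.
  rewrite -[ii * _ in LHS]halfD; ring.
move=> s x _ _; rewrite /P_F /rho_F /rhod_F /Fdot.
by apply/eqP; rewrite eq_complex /=; apply/andP; split; apply/eqP; ring.
Qed.

Local Notation cj := (@sconj R _ _ Oo).

Definition cjf (l : 'I_4) : 'I_4 := nth 0 [:: 0; 1; 3; 2] l.

Let sconj_row X x : repv x X -> map_mx cj x = x.
Proof. by move=> rx; apply/rowP => i; rewrite mxE; exact: sconj_repr (rx i). Qed.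

Lemma frow_conj l : map_mx cj (frow l) = frow (cjf l).
Proof.
case: l => [[|[|[|[|//]]]] ?]; rewrite /cjf /frow /=.
- exact: sconj_row rv3.
- exact: sconj_row rv4.
- by rewrite map_mxD map_mxZ (sconj_row (rvh 0)) (sconj_row (rvh 1)) /= sconj_ii scaleNr.
- by rewrite map_mxB map_mxZ (sconj_row (rvh 0)) (sconj_row (rvh 1)) /= sconj_ii scaleNr opprK.
Qed.

Lemma bilK_conj (b : 'M[KO]_4) u v : (forall i j, sconj (b i j) = b i j) ->
  sconj (bilK b u v) = bilK b (map_mx cj u) (map_mx cj v).
Proof.
move=> rb; rewrite rmorph_sum; apply: eq_bigr => i _.
rewrite rmorph_sum; apply: eq_bigr => j _; rewrite !rmorphM /= rb !mxE //.
Qed.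

Lemma sconj_ff a b : sconj (ff a b) = ff (cjf a) (cjf b).
Proof.
rewrite !ff_bil bilK_conj ?frow_conj // => i j; exact: sconj_repr (rep_F Uo sf i j).
Qed.

(** The metric and the original frame are real, so conjugation only exchanges m and mb. *)
Lemma sconj_spin l a b : sconj (w l a b) = w (cjf l) (cjf a) (cjf b).
Proof.
rewrite -!half_cnn rmorphM /= sconj_half /cnn bilK_conj ?frow_conj; last first.
  by move=> i j; exact: sconj_repr (rep_g Uo sf i j).
congr (half * bilK _ _ _); rewrite -!frow_conj; apply/rowP => k; rewrite !mxE.
rewrite rmorph_sum; apply: eq_bigr => i _.
rewrite rmorphM rmorphD rmorph_sum /= !mxE -sder_conj; congr (_ * (_ + _)).
apply: eq_bigr => j _; rewrite rmorphM /= !mxE; congr (_ * _).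
exact: sconj_repr (rep_christ Uo sf gTS nfS k i j).
Qed.

Lemma sconj_phi : sconj phiK = phicK.
Proof.
rewrite /phi_F rmorphM rmorphD /= sconj_half !sconj_ff /cjf /=.
by rewrite (ff_bil 3 2) bilF_anti -ff_bil.
Qed.

End Quantities2.

(** * O(eps^2) means vanishing value and first derivative at parameter 0 *)

Section Neglected.
Context {R : realType}.
Implicit Types (f df ddf : R -> R).

(** A bound k h^2 forces the value at 0 to vanish and bounds the difference quotient by k |h|. *)
Lemma neglected_flat f c : is_derive (0 : R) 1 f c -> neglected f -> f 0 = 0 /\ c = 0.
Proof.
move=> df /eqO_exP[k k0 fk].
have f0 : f 0 = 0.
  have := nbhs_singleton fk; rewrite expr0n /= normr0 mulr0 normr_le0 => /eqP; exact.
split=> //; case: df => df dfc.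
have h1 : (fun h : R => h^-1 *: (f (h *: (1 : R) + 0) - f 0)) @ 0^' --> c.
  by rewrite -dfc; exact: df.
apply: (cvg_unique _ h1) => //.
apply/cvgrPdist_le => e e0; near=> h.
rewrite sub0r normrN addr0 [h *: 1]mulr1 f0 subr0 normrM normfV.
have h0 : h != 0 by near: h; exact: nbhs_dnbhs_neq.
have fh : `|f h| <= k * `|h ^+ 2|.
  by near: h; exact: nbhs_dnbhs fk.
have he : `|h| <= e / k.
  near: h; apply: nbhs_dnbhs; apply/nbhs_ballP; exists (e / k) => /=; first exact: divr_gt0.
  by move=> z; rewrite /ball /= sub0r normrN => /ltW.
rewrite mulrC ler_pdivrMr ?normr_gt0 //.
apply: (le_trans fh); rewrite normrX expr2 mulrA ler_wpM2r // mulrC.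
by rewrite -ler_pdivlMr.
Unshelve. all: by end_near. Qed.

Lemma mvt0 f df (r s : R) : (forall t : R, `|t| < r -> is_derive t 1 f (df t)) -> `|s| < r ->
  exists2 t, `|t| <= `|s| & f s - f 0 = df t * s.
Proof.
move=> D sr.
have [s0|s0] := leP 0 s.
  have [t||t] := @MVT_segment _ f df 0 s s0.
  - rewrite in_itv /= => /andP[t0 ts]; apply: D; rewrite gtr0_norm //.
    by apply: lt_trans ts _; rewrite -(ger0_norm s0).
  - apply: derivable_within_continuous => t; rewrite in_itv /= => /andP[t0 ts].
    have [] // := D t _; rewrite ger0_norm //.
    by apply: le_lt_trans ts _; rewrite -(ger0_norm s0).
  rewrite in_itv /= subr0 => /andP[t0 ts] e.
  by exists t => //; rewrite !ger0_norm.
have [t||t] := @MVT_segment _ f df s 0 (ltW s0).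
- rewrite in_itv /= => /andP[t0 ts]; apply: D; rewrite ltr0_norm //.
  by rewrite (ltr0_norm s0) in sr; apply: le_lt_trans sr; rewrite lerN2 ltW.
- apply: derivable_within_continuous => t; rewrite in_itv /= => /andP[t0 ts].
  have [] // := D t _; rewrite ler0_norm //.
  by rewrite (ltr0_norm s0) in sr; apply: le_lt_trans sr; rewrite lerN2.
rewrite in_itv /= sub0r => /andP[t0 ts] e.
exists t; first by rewrite !ler0_norm ?lerN2 // ltW.
by rewrite -opprB e mulrN opprK.
Qed.

(** Two applications of the mean value theorem; near 0 the second derivative is bounded by its value
    there plus 1, by continuity. *)
Lemma flat_neglected f df ddf (r : R) : 0 < r ->
  (forall t : R, `|t| < r -> is_derive t 1 f (df t)) ->
  (forall t : R, `|t| < r -> is_derive t 1 df (ddf t)) ->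
  {for 0, continuous ddf} -> f 0 = 0 -> df 0 = 0 -> neglected f.
Proof.
move=> r0 D1 D2 cd f0 df0; apply/eqO_exP.
have k0 : 0 < `|ddf 0| + 1 by rewrite ltr_wpDl.
exists (`|ddf 0| + 1) => //.
have /nbhs_ballP[d /= d0 dP] : \forall t \near (0 : R), `|ddf t| <= `|ddf 0| + 1.
  move/cvgrPdist_le : cd => /(_ 1 ltr01); apply: filterS => t h.
  have -> : ddf t = ddf 0 - (ddf 0 - ddf t) by rewrite subKr.
  by apply: le_trans (ler_normB _ _) _; rewrite lerD2l.
apply/nbhs_ballP; exists (Num.min d r) => /=; first by rewrite lt_min d0.
move=> s; rewrite /ball /= sub0r normrN lt_min => /andP[sd sr].
have [t ts] := mvt0 D1 sr; rewrite f0 subr0 => ->.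
have tr : `|t| < r by exact: le_lt_trans sr.
have [u ut] := mvt0 D2 tr; rewrite df0 subr0 => ->.
rewrite normrX expr2 !normrM -!mulrA.
apply: ler_pM => //; last by rewrite ler_wpM2r.
- by apply: dP; rewrite /ball /= sub0r normrN; apply: le_lt_trans ut _; exact: le_lt_trans sd.
Qed.

End Neglected.

Section NeglectedRing.
Context {R : realType} {V : normedModType R} {e0 : R} {U : set V}.
Hypotheses (e00 : 0 < e0) (Uo : open U).
Local Notation Oo := (@slab_open R V e0 U Uo).
Local Notation KO := (sfun_of Oo).
Local Notation Re := (@complex.Re R).
Local Notation Im := (@complex.Im R).
Local Notation dt := (@sder R _ _ Oo ((1, 0) : R * V)).
Implicit Types (k : KO) (x : V).

Let line (f : R * V -> R) x (s : R) : smooth_on (@slab R V e0 U) f -> U x -> `|s| < e0 ->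
  is_derive s 1 (fun s => f (s, x)) ('D_((1, 0) : R * V) f (s, x)).
Proof.
move=> sf Ux se.
have e t : ((0, x) : R * V) + t *: ((1, 0) : R * V) = (t, x).
  congr (_, _); first by rewrite /= add0r [t *: 1]mulr1.
  by rewrite /= scaler0 addr0.
have -> : (fun s => f (s, x)) = (fun s => f ((0, x) + s *: (1, 0))).
  by apply/funext => t; rewrite e.
have d : derivable f (((0, x) : R * V) + s *: ((1, 0) : R * V)) ((1, 0) : R * V).
  by rewrite e; have [_] := sf [::] (s, x) (conj se Ux); exact.
by have := is_derive_line d; rewrite e.
Qed.

Lemma is_derive_Re k x (s : R) : U x -> `|s| < e0 ->
  is_derive s 1 (fun s => Re (sfun_fun k (s, x))) (Re (sfun_fun (dt k) (s, x))).
Proof.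
move=> Ux se; rewrite sderE //; exact: (line (sfun_smooth k).1.1 Ux se).
Qed.
Lemma is_derive_Im k x (s : R) : U x -> `|s| < e0 ->
  is_derive s 1 (fun s => Im (sfun_fun k (s, x))) (Im (sfun_fun (dt k) (s, x))).
Proof.
move=> Ux se; rewrite sderE //; exact: (line (sfun_smooth k).1.2 Ux se).
Qed.

Lemma neglected_ev_delta k :
  (forall x, U x -> neglected (fun s => Re (sfun_fun k (s, x))) /\
                    neglected (fun s => Im (sfun_fun k (s, x)))) ->
  ev e00 k = 0 /\ delta e00 k = 0.
Proof.
move=> nk; split; apply: sfunP => x Ux.
  have e0' : `|0 : R| < e0 by rewrite normr0.
  have [r0 _] := neglected_flat (is_derive_Re k Ux e0') (nk x Ux).1.
  have [i0 _] := neglected_flat (is_derive_Im k Ux e0') (nk x Ux).2.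
  by rewrite evE // sfun_cstE //; case: (sfun_fun k (0, x)) r0 i0 => a b /= -> ->.
have e0' : `|0 : R| < e0 by rewrite normr0.
have [_ r0] := neglected_flat (is_derive_Re k Ux e0') (nk x Ux).1.
have [_ i0] := neglected_flat (is_derive_Im k Ux e0') (nk x Ux).2.
by rewrite evE // sfun_cstE //; case: (sfun_fun (dt k) (0, x)) r0 i0 => a b /= -> ->.
Qed.

Let slice_cont (f : R * V -> R) x : smooth_on (@slab R V e0 U) f -> U x ->
  {for 0, continuous (fun s => f (s, x))}.
Proof.
move=> sf Ux; have e0' : `|0 : R| < e0 by rewrite normr0.
have [d _] := line sf Ux e0'.
exact/differentiable_continuous/derivable1_diffP.
Qed.

Lemma ev_delta_neglected k x : U x -> ev e00 k = 0 -> delta e00 k = 0 ->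
  neglected (fun s => Re (sfun_fun k (s, x))) /\ neglected (fun s => Im (sfun_fun k (s, x))).
Proof.
move=> Ux ek dk.
have {}ek : sfun_fun k (0, x) = 0 by rewrite -(evE e00) // ek sfun_cstE.
have {}dk : sfun_fun (dt k) (0, x) = 0 by rewrite -(evE e00) // -/(delta _ k) dk sfun_cstE.
have e0' : 0 < e0 := e00.
split.
  refine (@flat_neglected R (fun s => Re (sfun_fun k (s, x)))
    (fun s => Re (sfun_fun (dt k) (s, x))) (fun s => Re (sfun_fun (dt (dt k)) (s, x))) e0 e0'
    (fun t => @is_derive_Re k x t Ux) (fun t => @is_derive_Re (dt k) x t Ux)
    (slice_cont (sfun_smooth (dt (dt k))).1.1 Ux) _ _).
    by rewrite ek.
  by rewrite dk.
refine (@flat_neglected R (fun s => Im (sfun_fun k (s, x)))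
  (fun s => Im (sfun_fun (dt k) (s, x))) (fun s => Im (sfun_fun (dt (dt k)) (s, x))) e0 e0'
  (fun t => @is_derive_Im k x t Ux) (fun t => @is_derive_Im (dt k) x t Ux)
  (slice_cont (sfun_smooth (dt (dt k))).1.2 Ux) _ _).
  by rewrite ek.
by rewrite dk.
Qed.

End NeglectedRing.

(** * Smoothness and derivatives of functions of one coordinate *)

Section CoordinateFunctions.
Context {R : realType} {O : set (pt R)} (Oo : open O) (j : 'I_4).
Implicit Types (phi : R -> R) (x v : pt R).

Lemma is_derive_coord phi dphi x v : is_derive (x 0 j) 1 phi dphi ->
  is_derive x v (fun y : pt R => phi (y 0 j)) (v 0 j * dphi).
Proof.
move=> dp.
have d1 : is_derive (0 : R) 1 (fun h : R => x 0 j + h * v 0 j) (v 0 j).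
  have -> : (fun h : R => x 0 j + h * v 0 j) = cst (x 0 j) + (id * cst (v 0 j)).
    by apply/funext.
  by apply: is_derive_eq; rewrite scaler0 !add0r [_ *: 1]mulr1.
have d2 : is_derive ((fun h : R => x 0 j + h * v 0 j) 0) 1 phi dphi.
  by rewrite /= mul0r addr0.
have [d dE] := is_derive1_comp (f := phi) (g := fun h : R => x 0 j + h * v 0 j) (x := 0) d2 d1.
have e : (fun h : R => h^-1 *: (((fun y : pt R => phi (y 0 j)) \o shift x) (h *: v) - phi (x 0 j)))
  = (fun h : R => h^-1 *: (((phi \o (fun h : R => x 0 j + h * v 0 j)) \o shift 0) (h *: 1)
      - (phi \o (fun h : R => x 0 j + h * v 0 j)) 0)).
  apply/funext => h /=; rewrite addr0 mul0r addr0 [h *: 1]mulr1; congr (_ *: (phi _ - _)).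
  by rewrite !mxE addrC.
split; first by rewrite /derivable e.
by rewrite /derive e; rewrite [RHS]mulrC; exact: dE.
Qed.

(** Suffices for the identity, cosine and sine: a class of one-variable functions closed under
    derivatives up to a scalar, which may be 0 and so covers constants. *)
Lemma smooth_on_coord (Phi : (R -> R) -> Prop) phi :
  (forall f, Phi f -> exists c h, Phi h /\ forall t : R, is_derive t 1 f (c * h t)) ->
  Phi phi -> smooth_on O (fun x : pt R => phi (x 0 j)).
Proof.
move=> HPhi Pphi.
apply: (@smooth_on_class _ _ O (fun F => exists c f, Phi f /\
  F = (fun x : pt R => c * f (x 0 j)))) => //; last first.
  by exists 1, phi; split=> //; apply/funext => x; rewrite mul1r.
move=> _ [c [f [Pf ->]]]; have [c' [h [Ph fh]]] := HPhi f Pf.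
have D x v : is_derive x v (fun x : pt R => c * f (x 0 j)) (c * (v 0 j * (c' * h (x 0 j)))).
  exact: is_deriveZ (is_derive_coord v (fh (x 0 j))).
split=> [x Ox|v].
  split; last by move=> v; case: (D x v).
  have cf : {for x 0 j, continuous f}.
    apply: differentiable_continuous; apply/derivable1_diffP.
    by case: (fh (x 0 j)).
  apply: continuousM; first exact: cst_continuous.
  apply: (@continuous_comp _ _ _ (fun y : pt R => y 0 j) f); last exact: cf.
  exact: coord_continuous.
exists (fun x => c * (v 0 j * c') * h (x 0 j)).
  by exists (c * (v 0 j * c')), h.
by move=> x _; have [_ ->] := D x v; rewrite !mulrA.
Qed.

Lemma smooth_on_coord_id : smooth_on O (fun x : pt R => x 0 j).
Proof.
apply: (@smooth_on_coord (fun f => f = id \/ f = cst 1) id); last by left.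
move=> f [] ->; [exists 1|exists 0]; exists (cst 1); split; try by right.
  by move=> t; rewrite mul1r; exact: is_derive_id.
by move=> t; rewrite mul0r; exact: is_derive_cst.
Qed.

Let trig (f : R -> R) : f = cos \/ f = sin ->
  exists c (h : R -> R), (h = cos \/ h = sin) /\ forall t : R, is_derive t 1 f (c * h t).
Proof.
case=> ->; [exists (-1), sin | exists 1, cos]; split; try by [left|right].
  by move=> t; rewrite mulN1r; exact: is_derive_cos.
by move=> t; rewrite mul1r; exact: is_derive_sin.
Qed.

Lemma smooth_on_coord_cos : smooth_on O (fun x : pt R => cos (x 0 j)).
Proof. by apply: smooth_on_coord trig _; left. Qed.
Lemma smooth_on_coord_sin : smooth_on O (fun x : pt R => sin (x 0 j)).
Proof. by apply: smooth_on_coord trig _; right. Qed.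

End CoordinateFunctions.

Section RealFunctions.
Context {R : realType} {U : set (pt R)} (Uo : open U).
Local Notation C := R[i].
Local Notation KU := (sfun_of Uo).
Implicit Types (k l : KU) (F G : pt R -> R).

Definition reprU k F := forall x, U x -> sfun_fun k x = (F x)%:C.

Lemma reprU_D k l F G : reprU k F -> reprU l G -> reprU (k + l) (fun x => F x + G x).
Proof. by move=> a b x Ux; rewrite sfun_addE // a // b // -rmorphD. Qed.
Lemma reprU_N k F : reprU k F -> reprU (- k) (fun x => - F x).
Proof. by move=> a x Ux; rewrite sfun_oppE // a // -rmorphN. Qed.
Lemma reprU_B k l F G : reprU k F -> reprU l G -> reprU (k - l) (fun x => F x - G x).
Proof. by move=> a b; apply: reprU_D => //; exact: reprU_N. Qed.
Lemma reprU_M k l F G : reprU k F -> reprU l G -> reprU (k * l) (fun x => F x * G x).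
Proof. by move=> a b x Ux; rewrite sfun_mulE // a // b // -rmorphM. Qed.
Lemma reprU_cst (c : R) : reprU (sfun_cst Uo c%:C) (fun _ => c).
Proof. by move=> x Ux; rewrite sfun_cstE. Qed.
Lemma reprU_nat n : reprU n%:R (fun _ => n%:R).
Proof.
have -> : n%:R = sfun_cst Uo (n%:R : R)%:C by rewrite !rmorph_nat.
exact: reprU_cst.
Qed.
Lemma reprU_eq k l F G : reprU k F -> reprU l G -> (forall x, U x -> F x = G x) -> k = l.
Proof. by move=> a b e; apply: sfunP => x Ux; rewrite a // b // e. Qed.
Lemma sconj_reprU k F : reprU k F -> sconj k = k.
Proof.
by move=> a; apply: sfunP => x Ux; rewrite sconjE // a // conjc_real.
Qed.

Lemma reprU_coord k j (phi dphi : R -> R) i : reprU k (fun x => phi (x 0 j)) ->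
  (forall t : R, is_derive t 1 phi (dphi t)) ->
  reprU (sder (delta_mx 0 i) k) (fun x => (i == j)%:R * dphi (x 0 j)).
Proof.
move=> rk dp x Ux; rewrite sderE //.
have e : {in U, sfun_fun k =1 fun y : pt R => (phi (y 0 j))%:C}.
  by move=> y /[!inE] Uy; exact: rk.
rewrite (derC_eq Uo (delta_mx 0 i) Ux e) /derC.
have [_ d] := is_derive_coord (delta_mx 0 i) (dp (x 0 j)).
have -> : (@complex.Re R) \o (fun y : pt R => (phi (y 0 j))%:C) = (fun y : pt R => phi (y 0 j)).
  by apply/funext.
have -> : (@complex.Im R) \o (fun y : pt R => (phi (y 0 j))%:C) = cst 0.
  by apply/funext.
by rewrite d derive_cst mxE eqxx /= eq_sym.
Qed.

End RealFunctions.

Lemma row4E (R : realType) (c0 c1 c2 c3 : R) :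
  (row4 c0 c1 c2 c3 0 0 = c0) * (row4 c0 c1 c2 c3 0 1 = c1)
  * (row4 c0 c1 c2 c3 0 2 = c2) * (row4 c0 c1 c2 c3 0 3 = c3).
Proof. by rewrite !mxE. Qed.

(** * The Kerr-Newman generators as smooth functions *)

Section Background.
Context {R : realType} {e0 : R} {U : set (pt R)} (Uo : open U) {S : R -> spacetime R}.
Local Notation C := R[i].
Local Notation Oo := (@slab_open R (pt R) e0 U Uo).
Local Notation KO := (sfun_of Oo).
Hypothesis sf : smooth_family (@slab R (pt R) e0 U) S.
Hypothesis gTS : forall s x, `|s| < e0 -> U x -> (metric (S s) x)^T = metric (S s) x.
Hypothesis FTS : forall s x, `|s| < e0 -> U x -> (Fem (S s) x)^T = - Fem (S s) x.
Hypothesis nfS : forall s x, `|s| < e0 -> U x -> null_frame (S s) x.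
Local Notation g := (gK Uo sf).
Local Notation E := (EK Uo sf).
Local Notation F := (FK Uo sf).
Local Notation frow := (frow Uo sf).
Local Notation r3 := (r3 Uo sf).
Local Notation r4 := (r4 Uo sf).
Local Notation rh := (rh Uo sf).
Local Notation ii := (@ii R e0 U Uo).
Local Notation half := (@half R e0 U Uo).
Local Notation Dx := (@Dx R e0 U Uo).
Local Notation eta := (nullmx (2 : KO)).
Local Notation etai := (nullmx half).
Local Notation DM := (@DxM R e0 U Uo).
Local Notation DC := (@DxC R e0 U Uo).
Local Notation h2 := (half2 (e0 := e0) Uo).
Local Notation gT := (gKT Uo sf gTS).
Local Notation FT := (FKT Uo sf FTS).
Local Notation EgE := (EgK Uo sf gTS nfS).
Variables (M a Q : R).
Hypothesis e00 : 0 < e0.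
Hypothesis Udom : U `<=` kn_domain M a Q.
Hypothesis bk : forall x, U x -> is_kerr_newman M a Q (S 0) x.
Local Notation KU := (sfun_of Uo).
Local Notation ev := (@ev R (pt R) e0 U e00 Uo).
Local Notation cstU c := (sfun_cst Uo c).
Local Notation reprU := (@reprU R U Uo).
Local Notation reprU_eq := (@reprU_eq R U Uo).
Local Notation cstr c := (@reprU_cst R U Uo c).
Local Notation natr n := (@reprU_nat R U Uo n).

Definition rrU : KU := mk_sfun Uo (smooth_on_real Uo (smooth_on_coord_id Uo 1)).
Definition ccU : KU := mk_sfun Uo (smooth_on_real Uo (smooth_on_coord_cos Uo 2)).
Definition ssU : KU := mk_sfun Uo (smooth_on_real Uo (smooth_on_coord_sin Uo 2)).
Definition aU : KU := cstU a%:C.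
Definition MU : KU := cstU M%:C.
Definition QU : KU := cstU Q%:C.
Definition iiU : KU := cstU 'i.
(** 1/|q|, and below 1/sin(theta) and 1/Delta, are extracted from the frame components at parameter
    0. These are smooth by hypothesis, so no smoothness of roots or inverses has to be shown. *)
Definition iwU : KU := ev (rh 0 0 2).
(** The phi component of e_2 is 1/(|q| sin(theta)); it is multiplied by |q|^2/|q|. *)
Definition iSU : KU := ev (rh 1 0 3) * iwU * (rrU * rrU + aU * aU * ccU * ccU).
(** The combination of components of e_4 equals (r^2 + a^2 - a^2 sin(theta)^2)/Delta =
    |q|^2/Delta. *)
Definition iDU : KU := (ev (r4 0 0) - aU * ssU * ssU * ev (r4 0 3)) * (iwU * iwU).

Lemma rep_rrU : reprU rrU (fun x => x 0 1).
Proof. by move=> x Ux; rewrite mk_sfunE. Qed.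
Lemma rep_ccU : reprU ccU (fun x => cos (x 0 2)).
Proof. by move=> x Ux; rewrite mk_sfunE. Qed.
Lemma rep_ssU : reprU ssU (fun x => sin (x 0 2)).
Proof. by move=> x Ux; rewrite mk_sfunE. Qed.

Let rev (k : KO) F' : repr k F' -> reprU (ev k) (fun x => F' 0 x).
Proof. by move=> rk x Ux; rewrite evE // rk // normr0. Qed.

Let r3E i : reprU (ev (r3 0 i)) (fun x => kn_e3 M a Q x 0 i).
Proof.
move=> x Ux; rewrite (rev (repv3 Uo sf i)) //.
by case: (bk Ux) => _ [-> _].
Qed.
Let r4E i : reprU (ev (r4 0 i)) (fun x => kn_e4 M a Q x 0 i).
Proof.
move=> x Ux; rewrite (rev (repv4 Uo sf i)) //.
by case: (bk Ux) => _ [_ ->].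
Qed.
Let rh0E i : reprU (ev (rh 0 0 i)) (fun x => kn_e1 a x 0 i).
Proof.
move=> x Ux; rewrite (rev (repvh Uo sf 0 i)) //.
by case: (bk Ux) => _ _ [-> _].
Qed.
Let rh1E i : reprU (ev (rh 1 0 i)) (fun x => kn_e2 a x 0 i).
Proof.
move=> x Ux; rewrite (rev (repvh Uo sf 1 i)) //.
by case: (bk Ux) => _ _ [_ ->].
Qed.

Lemma kn_regular x : U x -> let w := kn_absq a x in let r := x 0 1 in let t := x 0 2 in
  [/\ w != 0, w * w = r * r + a * a * cos t * cos t, sin t != 0,
    sin t * sin t = 1 - cos t * cos t & kn_Delta M a Q x != 0].
Proof.
move=> Ux w r t; have [/andP[t0 tp] D0 q0] := Udom Ux.
have q2 : kn_q2 a x = r * r + a * a * cos t * cos t.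
  by rewrite /kn_q2 -/r -/t; ring.
have q2p : 0 <= kn_q2 a x by rewrite addr_ge0 ?sqr_ge0 // mulr_ge0 // sqr_ge0.
have ww : w * w = kn_q2 a x by rewrite -expr2 sqr_sqrtr.
split=> //.
- by apply: contra_neq q0 => w0; rewrite -ww w0 mul0r.
- by rewrite ww.
- by rewrite gt_eqF // sin_gt0_pi // t0.
- by have := cos2Dsin2 t; rewrite !expr2 => <-; ring.
Qed.

Lemma rep_iwU : reprU iwU (fun x => (kn_absq a x)^-1).
Proof. by move=> x Ux; rewrite rh0E // row4E. Qed.

Let rq : reprU (rrU * rrU + aU * aU * ccU * ccU)
  (fun x => x 0 1 * x 0 1 + a * a * cos (x 0 2) * cos (x 0 2)).
Proof.
apply: reprU_D; first exact: reprU_M rep_rrU rep_rrU.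
exact: reprU_M (reprU_M (reprU_M (cstr a) (cstr a)) rep_ccU) rep_ccU.
Qed.

Lemma rep_iSU : reprU iSU (fun x => (sin (x 0 2))^-1).
Proof.
move=> x Ux; rewrite (reprU_M (reprU_M (rh1E 3) rep_iwU) rq) //; congr (_%:C).
have [w0 <- s0 _ _] := kn_regular Ux; rewrite row4E; field.
by rewrite w0 s0.
Qed.

Lemma rep_iDU : reprU iDU (fun x => (kn_Delta M a Q x)^-1).
Proof.
move=> x Ux; rewrite (reprU_M (reprU_B (r4E 0) (reprU_M (reprU_M (reprU_M (cstr a) rep_ssU) rep_ssU)
  (r4E 3))) (reprU_M rep_iwU rep_iwU)) //; congr (_%:C).
have [w0 ww s0 ss D0] := kn_regular Ux; rewrite !row4E.
have e : x 0 1 ^+ 2 + a ^+ 2 = kn_absq a x * kn_absq a x + a * a * (sin (x 0 2) * sin (x 0 2)).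
  by rewrite ww ss; ring.
rewrite e; field.
by rewrite w0 D0.
Qed.

Lemma kn_rrD i : sder (delta_mx 0 i) rrU = (i == 1)%:R.
Proof.
apply: reprU_eq (reprU_coord i rep_rrU (fun t => is_derive_id t 1)) (natr _) _ => x _.
by rewrite mulr1.
Qed.
Lemma kn_ccD i : sder (delta_mx 0 i) ccU = - ((i == 2)%:R * ssU).
Proof.
apply: reprU_eq (reprU_coord i rep_ccU (fun t => is_derive_cos t))
  (reprU_N (reprU_M (natr _) rep_ssU)) _ => x _.
by rewrite mulrN.
Qed.
Lemma kn_ssD i : sder (delta_mx 0 i) ssU = (i == 2)%:R * ccU.
Proof.
exact: reprU_eq (reprU_coord i rep_ssU (fun t => is_derive_sin t))
  (reprU_M (natr _) rep_ccU) (fun _ _ => erefl).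
Qed.

Let one : reprU (1 : KU) (fun _ => 1).
Proof. exact: (cstr 1). Qed.

Lemma kn_iwE : iwU * iwU * (rrU * rrU + aU * aU * ccU * ccU) = 1.
Proof.
apply: reprU_eq (reprU_M (reprU_M rep_iwU rep_iwU) rq) one _ => x Ux.
by have [w0 <- _ _ _] := kn_regular Ux; field.
Qed.
Lemma kn_sscc : ssU * ssU + ccU * ccU = 1.
Proof.
apply: reprU_eq (reprU_D (reprU_M rep_ssU rep_ssU) (reprU_M rep_ccU rep_ccU)) one _ => x Ux.
by have [_ _ _ -> _] := kn_regular Ux; ring.
Qed.
Lemma kn_iSE : iSU * ssU = 1.
Proof.
apply: reprU_eq (reprU_M rep_iSU rep_ssU) one _ => x Ux.
by have [_ _ s0 _ _] := kn_regular Ux; rewrite mulVf.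
Qed.

Let rD : reprU (rrU * rrU - 2 * MU * rrU + aU * aU + QU * QU) (kn_Delta M a Q).
Proof.
have h := reprU_D (reprU_D (reprU_B (reprU_M rep_rrU rep_rrU)
  (reprU_M (reprU_M (natr 2) (cstr M)) rep_rrU)) (reprU_M (cstr a) (cstr a)))
  (reprU_M (cstr Q) (cstr Q)).
by move=> x Ux; rewrite h //; congr (_%:C); rewrite /kn_Delta; ring.
Qed.

Lemma kn_iDE : iDU * (rrU * rrU - 2 * MU * rrU + aU * aU + QU * QU) = 1.
Proof.
apply: reprU_eq (reprU_M rep_iDU rD) one _ => x Ux.
by have [_ _ _ _ D0] := kn_regular Ux; rewrite mulVf.
Qed.

Local Notation E0 := (map_mx ev E).
Let X := rrU * rrU + aU * aU.
Let rX : reprU X (fun x => x 0 1 * x 0 1 + a * a).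
Proof. exact: reprU_D (reprU_M rep_rrU rep_rrU) (reprU_M (cstr a) (cstr a)). Qed.
Let rw2 := reprU_M rep_iwU rep_iwU.
Let zero : reprU (0 : KU) (fun _ => 0).
Proof. exact: (cstr 0). Qed.

Local Notation halfU := (ev half).
Lemma halfU2 : halfU + halfU = 1.
Proof. by rewrite -rmorphD h2 rmorph1. Qed.
Lemma iiUE : iiU * iiU = -1.
Proof. by rewrite /iiU -rmorphM -[RHS](rmorphN1 (sfun_cst Uo)) -expr2 sqr_i. Qed.

Lemma kn_E0 : [/\ E0 0 0 = X * (iwU * iwU),
  E0 0 1 = - kn_D halfU iiU aU MU QU rrU ccU ssU iwU,
  E0 0 2 = 0 & E0 0 3 = aU * (iwU * iwU)].
Proof.
rewrite -(kn_DE MU QU halfU2 iiUE kn_iwE kn_sscc).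
have e i : E0 0 i = ev (r3 0 i) by rewrite mxE [E 0 i]mxE.
split; rewrite e.
- apply: reprU_eq (r3E 0) (reprU_M rX rw2) _ => x Ux.
  have [w0 ww _ _ _] := kn_regular Ux; rewrite row4E.
  have -> : kn_q2 a x = kn_absq a x * kn_absq a x by rewrite ww /kn_q2; ring.
  by field.
- apply: reprU_eq (r3E 1) (reprU_N (reprU_M rw2 rD)) _ => x Ux.
  have [w0 ww _ _ _] := kn_regular Ux; rewrite row4E.
  have -> : kn_q2 a x = kn_absq a x * kn_absq a x by rewrite ww /kn_q2; ring.
  by field.
- by apply: reprU_eq (r3E 2) zero _ => x Ux; rewrite row4E.
- apply: reprU_eq (r3E 3) (reprU_M (cstr a) rw2) _ => x Ux.
  have [w0 ww _ _ _] := kn_regular Ux; rewrite row4E.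
  have -> : kn_q2 a x = kn_absq a x * kn_absq a x by rewrite ww /kn_q2; ring.
  by field.
Qed.

Lemma kn_E1 : [/\ E0 1 0 = X * iDU, E0 1 1 = 1, E0 1 2 = 0 & E0 1 3 = aU * iDU].
Proof.
have e i : E0 1 i = ev (r4 0 i) by rewrite mxE [E 1 i]mxE.
split; rewrite e.
- by apply: reprU_eq (r4E 0) (reprU_M rX rep_iDU) _ => x Ux; rewrite row4E !expr2.
- by apply: reprU_eq (r4E 1) one _ => x Ux; rewrite row4E.
- by apply: reprU_eq (r4E 2) zero _ => x Ux; rewrite row4E.
- by apply: reprU_eq (r4E 3) (reprU_M (cstr a) rep_iDU) _ => x Ux; rewrite row4E.
Qed.

Let h0E : (ev (rh 0 0 0) = 0) * (ev (rh 0 0 1) = 0) * (ev (rh 0 0 2) = iwU)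
  * (ev (rh 0 0 3) = 0).
Proof.
do !split.
- by apply: reprU_eq (rh0E 0) zero _ => x Ux; rewrite row4E.
- by apply: reprU_eq (rh0E 1) zero _ => x Ux; rewrite row4E.
- by apply: reprU_eq (rh0E 3) zero _ => x Ux; rewrite row4E.
Qed.
Let h1E : (ev (rh 1 0 0) = aU * ssU * iwU) * (ev (rh 1 0 1) = 0) * (ev (rh 1 0 2) = 0)
  * (ev (rh 1 0 3) = iwU * iSU).
Proof.
do !split.
- by apply: reprU_eq (rh1E 0) (reprU_M (reprU_M (cstr a) rep_ssU) rep_iwU) _ => x Ux; rewrite row4E.
- by apply: reprU_eq (rh1E 1) zero _ => x Ux; rewrite row4E.
- by apply: reprU_eq (rh1E 2) zero _ => x Ux; rewrite row4E.
- apply: reprU_eq (rh1E 3) (reprU_M rep_iwU rep_iSU) _ => x Ux; rewrite row4E.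
  by rewrite invfM.
Qed.

Let evii : ev ii = iiU.
Proof. exact: ev_cst. Qed.

Lemma kn_E2 : [/\ E0 2 0 = kn_s iiU aU ssU iwU, E0 2 1 = 0, E0 2 2 = iwU
  & E0 2 3 = iiU * iwU * iSU].
Proof.
have e i : E0 2 i = ev (rh 0 0 i) + iiU * ev (rh 1 0 i).
  rewrite mxE [E 2 i]mxE /frow /= addmxE [(ii *: rh 1) 0 i]mxE rmorphD rmorphM /=.
  by rewrite -evii.
by split; rewrite e h0E h1E /kn_s; ring.
Qed.
Lemma kn_E3 : [/\ E0 3 0 = - kn_s iiU aU ssU iwU, E0 3 1 = 0, E0 3 2 = iwU
  & E0 3 3 = - (iiU * iwU * iSU)].
Proof.
have e i : E0 3 i = ev (rh 0 0 i) - iiU * ev (rh 1 0 i).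
  rewrite mxE [E 3 i]mxE /frow /= addmxE oppmxE [(ii *: rh 1) 0 i]mxE rmorphB rmorphM /=.
  by rewrite -evii.
by split; rewrite e h0E h1E /kn_s; ring.
Qed.

End Background.

(** * Normalising the numerical coefficients of the operators *)

Section Identities.
Context {K : comPzRingType} (half : K) (h21 : half * 2 = 1).
Implicit Types (k l m ta tac tp tpc rh rhc rp rpc ph phc pw pwc : K).

(** Stated over an abstract ring with derivatives as variables, so that [ring] meets only atoms. The
    single relation [h21] clears the halves coming from the fractions of the definitions. *)
Fact id_T1 k ta tac tp rh rp rpc ph phc t1 t2 t3 t4 t5 t6 :
  - t1 + t2 - 3 * (2 * rh) * t3 - (3 * half * (2 * rp) + 1 * half * (2 * rpc)) * t4
  + ((6 * ta + 0 + 3 * 0) * t5 + (6 * 0 + tac + 3 * tp) * t6)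
  + (- (9 * half) * (2 * rp) * (2 * rh) - 4 * ph * phc + 9 * (2 * (tp * ta))) * k
  = - t1 + t2 - 6 * rh * t3 - (3 * rp + rpc) * t4
    + (6 * ta * t5 + (tac + 3 * tp) * t6)
    + (- (18 * rp * rh) - 4 * ph * phc + 18 * tp * ta) * k.
Proof.
by apply: (eq_of_diff (- (3 * rp + rpc) * t4 - 18 * rp * rh * k) h21); ring.
Qed.

Fact id_T2 k ta tac tpc rh rhc rp rpc ph phc pw pwc t1 t2 t3 t4 t5 t6 t7 :
  - t1 + t2 - (3 * half * (2 * rh) + 1 * half * (2 * rhc)) * t3
  - 1 * half * (2 * rp + 2 * rpc) * t4
  + ((4 * ta + 0 + tpc) * t5 + (4 * 0 + tac + 0) * t6)
  + (- (3 * (half * half)) * (2 * rp) * (2 * rh)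
     - 1 * (half * half) * (2 * rpc) * (2 * rhc) + 3 * pwc - pw + 4 * ph * phc
     - 3 * half * (2 * t7)) * k + half * (tpc * (2 * (tac * k)))
  = - t1 + t2 - (3 * rh + rhc) * t3 - (rp + rpc) * t4
    + ((4 * ta + tpc) * t5 + tac * t6)
    + (- (3 * rp * rh) - rpc * rhc + 3 * pwc - pw + 4 * ph * phc - 3 * t7) * k
    + tpc * (tac * k).
Proof.
by apply: (eq_of_diff (- ((3 * rh + rhc) * t3) - (rp + rpc) * t4
  - (3 * rp * rh + rpc * rhc) * k * (half * 2 + 1) - 3 * t7 * k + tpc * (tac * k)) h21); ring.
Qed.

Fact id_T3 k ta tp tpc rh rhc rp ph phc pwc t1 t2 t3 t4 t5 t6 :
  - t1 + t2 - (1 * half * (2 * rhc) + 2 * (2 * rh)) * t3 - 1 * half * (2 * rp) * t4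
  + ((4 * ta + tpc + 0) * t5 + (4 * 0 + 0 + tp) * t6)
  + (- (2 * rh) * (2 * rp) + 2 * pwc - 2 * ph * phc) * k + 2 * (ta * (2 * (tp * k)))
  = - t1 + t2 - (rhc + 4 * rh) * t3 - rp * t4 + ((4 * ta + tpc) * t5 + tp * t6)
    + (- (4 * rh * rp) + 2 * pwc - 2 * ph * phc) * k + 4 * ta * tp * k.
Proof. by apply: (eq_of_diff (- (rhc * t3) - rp * t4) h21); ring. Qed.

Fact id_M2 k l m ta tpc rp rpc ph t1 t2 :
  - ph * (t1 + 1 * half * (3 * (2 * rp) - 2 * rpc) * k) + 3 * half * t2 * l
  + (2 * ta - tpc) * m
  = - ph * (t1 + (3 * rp - rpc) * k) + 3 * half * t2 * l + (2 * ta - tpc) * m.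
Proof. by apply: (eq_of_diff (- (ph * (3 * rp - rpc) * k)) h21); ring. Qed.

Fact half_quarter (n : nat) : n%:R * (half * half) * 4 = n%:R :> K.
Proof.
have -> : n%:R * (half * half) * 4 = n%:R * (half * 2) * (half * 2) by ring.
by rewrite h21 !mulr1.
Qed.
End Identities.

Fact id_M1 (K : comPzRingType) (k f t tp rp rpc ph phc : K) :
  2 * ph * phc * (2 * (2 * t) + 4 * (2 * (tp * k)) - (2 * (2 * rp) - 2 * rpc) * f)
  = 2 * ph * phc * (4 * t + 8 * tp * k - (4 * rp - 2 * rpc) * f).
Proof. by ring. Qed.
Fact id_M3 (K : comPzRingType) (k f t ta tpc rh phc : K) :
  2 * phc * (2 * t + 2 * (2 * rh) * k + (tpc + ta) * f)
  = 2 * phc * (2 * t + 4 * rh * k + (tpc + ta) * f).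
Proof. by ring. Qed.

(** * The gauge-invariant quantities and full operators on components *)

Section Operators.
Context {R : realType} {e0 : R} {U : set (pt R)} (Uo : open U) {S : R -> spacetime R}.
Local Notation C := R[i].
Local Notation Oo := (@slab_open R (pt R) e0 U Uo).
Local Notation KO := (sfun_of Oo).
Hypothesis sf : smooth_family (@slab R (pt R) e0 U) S.
Hypothesis gTS : forall s x, `|s| < e0 -> U x -> (metric (S s) x)^T = metric (S s) x.
Hypothesis FTS : forall s x, `|s| < e0 -> U x -> (Fem (S s) x)^T = - Fem (S s) x.
Hypothesis nfS : forall s x, `|s| < e0 -> U x -> null_frame (S s) x.
Local Notation g := (gK Uo sf).
Local Notation E := (EK Uo sf).
Local Notation F := (FK Uo sf).
Local Notation frow := (frow Uo sf).
Local Notation r3 := (r3 Uo sf).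
Local Notation r4 := (r4 Uo sf).
Local Notation rh := (rh Uo sf).
Local Notation ii := (@ii R e0 U Uo).
Local Notation half := (@half R e0 U Uo).
Local Notation Dx := (@Dx R e0 U Uo).
Local Notation eta := (nullmx (2 : KO)).
Local Notation etai := (nullmx half).
Local Notation DM := (@DxM R e0 U Uo).
Local Notation DC := (@DxC R e0 U Uo).
Local Notation h2 := (half2 (e0 := e0) Uo).
Local Notation gT := (gKT Uo sf gTS).
Local Notation FT := (FKT Uo sf FTS).
Local Notation EgE := (EgK Uo sf gTS nfS).
Local Notation w := (spin Dx half g E).
Local Notation ff := (ff E F).
Local Notation rep := (@rep R e0 U Uo).
Local Notation rep1 := (@rep1 R e0 U Uo).
Local Notation rep2 := (@rep2 R e0 U Uo).
Local Notation ck := (ckd Dx half g E).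
Local Notation phi := (phi_F half E F).
Local Notation phic := (phic_F half E F).
Local Notation cj := (@sconj R _ _ Oo).
Local Notation PKf := (PK Uo sf).

Let h2K x : half * (2 * x) = x.
Proof. by rewrite mulr_natl mulr2n halfD. Qed.

Lemma rep_nat n : rep (n%:R : KO) (fun _ _ => n%:R).
Proof. by rewrite -(rmorph_nat (sfun_cst Oo)); exact: rep_cst. Qed.
Lemma rep_halfC : rep half (fun _ _ => 2^-1).
Proof.
by apply: rep_ext (rep_half Uo) => s x _ _; rewrite fmorphV rmorph_nat.
Qed.
Lemma rep_nhalf n : rep (n%:R * half) (fun _ _ => n%:R / 2).
Proof. exact: repM (rep_nat n) rep_halfC. Qed.

Lemma rep_trXc : rep (2 * w 3 1 2) (fun s x => (trX (S s) x)^*).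
Proof.
apply: rep_eq (rep_conj (rep_trX Uo sf gTS nfS)).
by rewrite rmorphM rmorph_nat /= (sconj_spin Uo sf gTS nfS).
Qed.
Lemma rep_trXbc : rep (2 * w 3 0 2) (fun s x => (trXb (S s) x)^*).
Proof.
apply: rep_eq (rep_conj (rep_trXb Uo sf gTS nfS)).
by rewrite rmorphM rmorph_nat /= (sconj_spin Uo sf gTS nfS).
Qed.
Lemma rep_PFc : rep phic (fun s x => (P_F (S s) x)^*).
Proof. by apply: rep_eq (rep_conj (rep_PF Uo sf FTS)); exact: sconj_phi. Qed.
Lemma rep_Pc : rep (sconj PKf) (fun s x => (P (S s) x)^*).
Proof. exact: rep_conj (rep_P Uo sf gTS nfS). Qed.

Let rH := rep1_H Uo sf gTS nfS.
Let rHb := rep1_Hb Uo sf gTS nfS.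
Let rBF := rep1_BF Uo sf.

Lemma rep2_hot k l (f h : R -> pt R -> 'rV[C]_2) : rep1 k f -> rep1 l h ->
  rep2 (k * l) (fun s x => hotimes (f s x) (h s x)).
Proof.
move=> a b s x ps Ux; have Ox : @slab R (pt R) e0 U (s, x) by split.
by rewrite a // b // hotimes_sd sfun_mulE.
Qed.
Let val2 z : @slab R (pt R) e0 U z -> sfun_fun (2 : KO) z = 2.
Proof.
by move=> Oz; have -> : (2 : KO) = sfun_cst Oo 2 by [rewrite rmorph_nat]; exact: sfun_cstE.
Qed.
Lemma rep1_dot2cj k l f u : rep1 k f -> rep2 l u ->
  rep1 (2 * (sconj k * l)) (fun s x => dot2 (cj1 (f s x)) (u s x)).
Proof.
move=> a b s x ps Ux; have Ox : @slab R (pt R) e0 U (s, x) by split.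
by rewrite a // b // dot2_cj_sd !(sfun_mulE, sconjE, val2).
Qed.
Lemma rep_dotcj k l f h : rep1 k f -> rep1 l h ->
  rep (2 * (sconj k * l)) (fun s x => dot (cj1 (f s x)) (h s x)).
Proof.
move=> a b s x ps Ux; have Ox : @slab R (pt R) e0 U (s, x) by split.
by rewrite a // b // dot_cj_sd !(sfun_mulE, sconjE, val2).
Qed.

(** A complex horizontal vector split into its part in s_1(C), with component [u], and its part in
    the conjugate space, with component [v]. Contraction with the gradient is then [u] times the mb
    derivative plus [v] times the m derivative. *)
Definition reph (u v : KO) (h : R -> pt R -> 'rV[C]_2) :=
  rep (u + v) (fun s x => h s x 0 0) /\ rep (- (ii * (u - v))) (fun s x => h s x 0 1).

Lemma reph1 k f : rep1 k f -> reph k 0 f.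
Proof.
move=> a; rewrite /reph addr0 subr0; split.
  by move=> s x ps Ux; rewrite a // sd1E.
move=> s x ps Ux; have Ox : @slab R (pt R) e0 U (s, x) by split.
by rewrite a // sd1E !(sfun_oppE, sfun_mulE, sfun_cstE).
Qed.
Lemma reph_cj k f : rep1 k f -> reph 0 (sconj k) (fun s x => cj1 (f s x)).
Proof.
move=> a; rewrite /reph add0r sub0r mulrN opprK; split.
  move=> s x ps Ux; have Ox : @slab R (pt R) e0 U (s, x) by split.
  by rewrite a // cj1_sd sconjE.
move=> s x ps Ux; have Ox : @slab R (pt R) e0 U (s, x) by split.
by rewrite a // cj1_sd !(sconjE, sfun_mulE, sfun_cstE).
Qed.
Lemma rephD u v h u' v' h' : reph u v h -> reph u' v' h' ->
  reph (u + u') (v + v') (fun s x => h s x + h' s x).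
Proof.
move=> [a b] [a' b']; split.
  apply: rep_eq (rep_ext _ (repD a a')); first by ring.
  by move=> s x ps Ux; rewrite addmxE.
apply: rep_eq (rep_ext _ (repD b b')); first by ring.
by move=> s x ps Ux; rewrite addmxE.
Qed.
Lemma rephZ n u v h : reph u v h ->
  reph (n%:R * u) (n%:R * v) (fun s x => n%:R *: h s x).
Proof.
move=> [a b]; split.
  apply: rep_eq (rep_ext _ (repM (rep_nat n) a)); first by ring.
  by move=> s x ps Ux; rewrite scalemxE.
apply: rep_eq (rep_ext _ (repM (rep_nat n) b)); first by ring.
by move=> s x ps Ux; rewrite scalemxE.
Qed.

Let conjH : sconj (w 0 1 2) = w 0 1 3. Proof. exact: (sconj_spin Uo sf gTS nfS). Qed.
Let conjHb : sconj (w 1 0 2) = w 1 0 3. Proof. exact: (sconj_spin Uo sf gTS nfS). Qed.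

Lemma rep1_ck3 (t : int) k f : rep1 k f ->
  rep1 (ck 0 t%:~R 1 k) (fun s x => cnabla3_1 (S s) t (f s) x).
Proof. exact: (rep1_c3 sf gTS nfS). Qed.
Lemma rep1_ck4 (t : int) k f : rep1 k f ->
  rep1 (ck 1 t%:~R 1 k) (fun s x => cnabla4_1 (S s) t (f s) x).
Proof. exact: (rep1_c4 sf gTS nfS). Qed.
Lemma rep2_ck3 (t : int) k f : rep2 k f ->
  rep2 (ck 0 t%:~R 2 k) (fun s x => cnabla3_2 (S s) t (f s) x).
Proof. exact: (rep2_c3 sf gTS nfS). Qed.
Lemma rep2_ck4 (t : int) k f : rep2 k f ->
  rep2 (ck 1 t%:~R 2 k) (fun s x => cnabla4_2 (S s) t (f s) x).
Proof. exact: (rep2_c4 sf gTS nfS). Qed.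
Lemma rep2_ckm (t : int) k f : rep1 k f ->
  rep2 (ck 2 t%:~R 1 k) (fun s x => cD_hotimes (S s) t (f s) x).
Proof. exact: (rep2_hotimes sf gTS nfS). Qed.
Lemma rep1_ckb (t : int) k f : rep2 k f ->
  rep1 (2 * ck 3 t%:~R 2 k) (fun s x => cDbar_dot2 (S s) t (f s) x).
Proof. exact: (rep1_dbar2 sf gTS nfS). Qed.
Lemma rep_ckb (t : int) k f : rep1 k f ->
  rep (2 * ck 3 t%:~R 1 k) (fun s x => cDbar_dot1 (S s) t (f s) x).
Proof. exact: (rep_dbar1 sf gTS nfS). Qed.
Lemma rep1_ckdot (t : int) k f u v h : rep1 k f -> reph u v h ->
  rep1 (u * ck 3 t%:~R 1 k + v * ck 2 t%:~R 1 k)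
       (fun s x => dot_cnabla1 (S s) t (h s x) (f s) x).
Proof. by move=> a [b c]; exact: (rep1_dot sf gTS nfS). Qed.
Lemma rep2_ckdot (t : int) k f u v h : rep2 k f -> reph u v h ->
  rep2 (u * ck 3 t%:~R 2 k + v * ck 2 t%:~R 2 k)
       (fun s x => dot_cnabla2 (S s) t (h s x) (f s) x).
Proof. by move=> a [b c]; exact: (rep2_dot sf gTS nfS). Qed.

Lemma rep2_frakF : rep2 (frakF_K Dx half g E F) (fun s x => frakF (S s) x).
Proof.
exact: (rep2D (rep2D (rep2Z (repN rep_halfC) (rep2_ckm 1 rBF))
  (rep2N (rep2Z (rep_nhalf 3) (rep2_hot rH rBF))))
  (rep2Z (rep_PF Uo sf FTS) (rep2_Xhat Uo sf gTS nfS))).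
Qed.
Lemma rep1_frakX : rep1 (frakX_K Dx half g E F) (fun s x => frakX (S s) x).
Proof.
apply: rep1_eq (rep1D (rep1D (rep1_ck4 1 rBF) (rep1Z (repM (rep_nhalf 3) rep_trXc) rBF))
  (rep1N (rep1Z (repM (rep_nat 2) (rep_PF Uo sf FTS)) (rep1_Xi Uo sf gTS nfS)))).
rewrite /frakX_K; congr (_ + _ * _ - _).
by rewrite -mulrA h2K.
Qed.
Lemma rep1_frakB : rep1 (frakB_K half E F (B_w Dx half g E) (sconj PKf)) (fun s x => frakB (S s) x).
Proof.
exact: (rep1D (rep1Z (repM (rep_nat 2) (rep_PF Uo sf FTS)) (rep1_B Uo sf gTS nfS))
  (rep1N (rep1Z (repM (rep_nat 3) rep_Pc) rBF))).
Qed.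

Let rPF := rep_PF Uo sf FTS.
Let rP := rep_P Uo sf gTS nfS.
Let rX := rep_trX Uo sf gTS nfS.
Let rXb := rep_trXb Uo sf gTS nfS.
Let rhf n := rep_nhalf n.
Let rn n := rep_nat n.
Let h21 : half * 2 = 1. Proof. by rewrite mulr_natr mulr2n h2. Qed.
Let cstC (n m : nat) k : k * m%:R = n%:R -> m%:R != 0 :> C -> rep k (fun _ _ => n%:R / m%:R).
Proof.
move=> e m0 s x ps Ux; have Ox : @slab R (pt R) e0 U (s, x) by split.
have nE p : sfun_fun (p%:R : KO) (s, x) = p%:R := rep_nat p ps Ux.
have : sfun_fun (k * m%:R) (s, x) = n%:R by rewrite e nE.
by rewrite sfun_mulE // nE => <-; rewrite mulfK.
Qed.
Let n0 (m : nat) : (m.+1)%:R != 0 :> C. Proof. by rewrite pnatr_eq0. Qed.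

Lemma rep1_T1 k f : rep1 k f ->
  rep1 (T1K Dx half g E F k) (fun s x => T1 (S s) (f s) x).
Proof.
move=> rf.
have d4f := rep1_ck4 1 rf; have d3f := rep1_ck3 1 rf; have dmf := rep2_ckm 1 rf.
have rh6 := rephD (rephD (rephZ 6 (reph1 rH)) (reph_cj rH)) (rephZ 3 (reph_cj rHb)).
have r92 : rep (9 * half) (fun _ _ => 9 / 2) := rhf 9.
have r32 : rep (3 * half) (fun _ _ => 3 / 2) := rhf 3.
have r12 : rep (1 * half) (fun _ _ => 1 / 2) := rhf 1.
have C0 := repD (repD (repM (repM (repN r92) rXb) rep_trXc)
  (repN (repM (repM (rn 4) rPF) rep_PFc))) (repM (rn 9) (rep_dotcj rHb rH)).
have h := rep1D (rep1D (rep1D (rep1D (rep1D (rep1N (rep1_ck3 2 d4f))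
    (rep1Z rep_halfC (rep1_ckb 1 dmf)))
    (rep1N (rep1Z (repM (rn 3) rep_trXc) d3f)))
    (rep1N (rep1Z (repD (repM r32 rXb) (repM r12 rep_trXbc)) d4f)))
    (rep1_ckdot 1 rf rh6)) (rep1Z C0 rf).
apply: rep1_eq h; rewrite conjH conjHb /T1K.
have e2 : (2 : int)%:~R = 2 :> KO by [].
have e1 : (1 : int)%:~R = 1 :> KO by [].
rewrite !e2 !e1 h2K.
exact: (id_T1 h21).
Qed.

Lemma rep2_T2 k u : rep2 k u ->
  rep2 (T2K Dx half g E F PKf (sconj PKf) k) (fun s x => T2 (S s) (u s) x).
Proof.
move=> ru.
have d4u := rep2_ck4 1 ru; have d3u := rep2_ck3 1 ru; have dbu := rep1_ckb 1 ru.
have rh4 := rephD (rephD (rephZ 4 (reph1 rH)) (reph_cj rH)) (reph1 rHb).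
have r32 : rep (3 * half) (fun _ _ => 3 / 2) := rhf 3.
have r12 : rep (1 * half) (fun _ _ => 1 / 2) := rhf 1.
have r34 : rep (3 * (half * half)) (fun _ _ => 3 / 4) := cstC (half_quarter h21 3) (n0 3).
have r14 : rep (1 * (half * half)) (fun _ _ => 1 / 4) := cstC (half_quarter h21 1) (n0 3).
have C0 := repD (repD (repD (repD (repD (repM (repM (repN r34) rXb) rep_trXc)
  (repN (repM (repM r14 rep_trXbc) rX))) (repM (rn 3) rep_Pc)) (repN rP))
  (repM (repM (rn 4) rPF) rep_PFc)) (repN (repM r32 (rep_ckb 0 rH))).
have h := rep2D (rep2D (rep2D (rep2D (rep2D (rep2D (rep2N (rep2_ck3 2 d4u))
    (rep2Z rep_halfC (rep2_ckm 1 dbu)))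
    (rep2N (rep2Z (repD (repM r32 rep_trXc) (repM r12 rX)) d3u)))
    (rep2N (rep2Z (repM r12 (repD rXb rep_trXbc)) d4u)))
    (rep2_ckdot 1 ru rh4)) (rep2Z C0 ru))
    (rep2Z rep_halfC (rep2_hot rHb (rep1_dot2cj rH ru))).
apply: rep2_eq h; rewrite conjH /T2K.
have e2 : (2 : int)%:~R = 2 :> KO by [].
have e1 : (1 : int)%:~R = 1 :> KO by [].
have e0' : (0 : int)%:~R = 0 :> KO by [].
have d2 (x : KO) : ck 2 1 1 (2 * x) = 2 * ck 2 1 1 x.
  by rewrite /ckd (frdM DM) (@derivation_nat _ (frd Dx E 2) 2 (frdM DM E 2)); ring.
rewrite !e2 !e1 !e0' d2 h2K.
exact: (id_T2 h21).
Qed.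

Lemma rep2_T3 k u : rep2 k u ->
  rep2 (T3K Dx half g E F (sconj PKf) k) (fun s x => T3 (S s) (u s) x).
Proof.
move=> ru.
have d4u := rep2_ck4 2 ru; have d3u := rep2_ck3 2 ru; have dbu := rep1_ckb 2 ru.
have rh4 := rephD (rephD (rephZ 4 (reph1 rH)) (reph1 rHb)) (reph_cj rHb).
have r12 : rep (1 * half) (fun _ _ => 1 / 2) := rhf 1.
have C0 := repD (repD (repM (repN rep_trXc) rXb) (repM (rn 2) rep_Pc))
  (repN (repM (repM (rn 2) rPF) rep_PFc)).
have h := rep2D (rep2D (rep2D (rep2D (rep2D (rep2D (rep2N (rep2_ck4 1 d3u))
    (rep2Z rep_halfC (rep2_ckm 2 dbu)))
    (rep2N (rep2Z (repD (repM r12 rX) (repM (rn 2) rep_trXc)) d3u)))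
    (rep2N (rep2Z (repM r12 rXb) d4u)))
    (rep2_ckdot 2 ru rh4)) (rep2Z C0 ru))
    (rep2Z (rn 2) (rep2_hot rH (rep1_dot2cj rHb ru))).
apply: rep2_eq h; rewrite conjHb /T3K.
have e2 : (2 : int)%:~R = 2 :> KO by [].
have e1 : (1 : int)%:~R = 1 :> KO by [].
have d2 (x : KO) : ck 2 2 1 (2 * x) = 2 * ck 2 2 1 x.
  by rewrite /ckd (frdM DM) (@derivation_nat _ (frd Dx E 2) 2 (frdM DM E 2)); ring.
rewrite !e2 !e1 d2 h2K.
exact: (id_T3 h21).
Qed.

Lemma rep1_M1 k l u f : rep2 k u -> rep1 l f ->
  rep1 (M1K Dx half g E F k l) (fun s x => M1 (S s) (u s) (f s) x).
Proof.
move=> ru rf.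
have h := rep1Z (repM (repM (rn 2) rPF) rep_PFc) (rep1D (rep1D
  (rep1Z (rn 2) (rep1_ckb 1 ru)) (rep1Z (rn 4) (rep1_dot2cj rHb ru)))
  (rep1N (rep1Z (repD (repM (rn 2) rXb) (repN rep_trXbc)) rf))).
apply: rep1_eq h; rewrite conjHb /M1K.
have e1 : (1 : int)%:~R = 1 :> KO by [].
rewrite !e1; exact: id_M1.
Qed.

Lemma rep2_M2 k l m u f h : rep2 k u -> rep1 l f -> rep1 m h ->
  rep2 (M2K Dx half g E F k l m) (fun s x => M2 (S s) (u s) (f s) (h s) x).
Proof.
move=> ru rf rh'.
have r32 : rep (3 * half) (fun _ _ => 3 / 2) := rhf 3.
have r12 : rep (1 * half) (fun _ _ => 1 / 2) := rhf 1.
have h' := rep2D (rep2D (rep2Z (repN rPF) (rep2D (rep2_ck3 2 ru)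
    (rep2Z (repM r12 (repD (repM (rn 3) rXb) (repN rep_trXbc))) ru)))
  (rep2_hot (rep1Z r32 (rep1_ck3 0 rH)) rf))
  (rep2_hot (rep1D (rep1Z (rn 2) rH) (rep1N rHb)) rh').
apply: rep2_eq h'; rewrite /M2K.
have e2 : (2 : int)%:~R = 2 :> KO by [].
have e0' : (0 : int)%:~R = 0 :> KO by [].
rewrite !e2 !e0'.
exact: (id_M2 h21).
Qed.

Lemma rep2_M3 k l u f : rep2 k u -> rep1 l f ->
  rep2 (M3K Dx half g E F k l) (fun s x => M3 (S s) (u s) (f s) x).
Proof.
move=> ru rf.
have h := rep2Z (repM (rn 2) rep_PFc) (rep2D (rep2D
  (rep2Z (rn 2) (rep2_ck4 1 ru)) (rep2Z (repM (rn 2) rep_trXc) ru))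
  (rep2_hot (rep1D rHb rH) rf)).
apply: rep2_eq h; rewrite /M3K.
have e1 : (1 : int)%:~R = 1 :> KO by [].
rewrite !e1; exact: id_M3.
Qed.

End Operators.

Lemma neglected_near {R : realType} (r : R) (f h : R -> R) : 0 < r ->
  (forall s, `|s| < r -> f s = h s) -> neglected f -> neglected h.
Proof.
move=> r0 e /eqO_exP[k k0 fk]; apply/eqO_exP; exists k => //.
near=> s; rewrite -e; last first.
  by near: s; apply/nbhs_ballP; exists r => //= z; rewrite /ball /= sub0r normrN.
by near: s.
Unshelve. all: by end_near. Qed.

Lemma neglected0 {R : realType} : neglected (fun _ : R => 0 : R).
Proof.
by apply/eqO_exP; exists 1 => //; near=> s; rewrite normr0 mul1r.
Unshelve. all: by end_near. Qed.

Fact kn_half_inv (F' : numFieldType) (z zc : F') : z != 0 -> zc != 0 ->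
  (2^-1 * zc * (z * zc)^-1 = (2 * z)^-1) * (2^-1 * z * (z * zc)^-1 = (2 * zc)^-1).
Proof. by move=> z0 zc0; split; field; rewrite z0 zc0. Qed.
Fact kn_inv_sqr (F' : numFieldType) (z q : F') : z != 0 ->
  q / z ^+ 2 = 4 * q * (2 * z)^-1 * (2 * z)^-1.
Proof. by move=> z0; field; rewrite z0. Qed.

Fact rmorph_PK (K K0 : comPzRingType) (f : {rmorphism K -> K0}) (h c d r1 r2 s6 sc : K) :
  f (h * (h * (c - h * (2 * r1 + 2 * r2) - s6 * sc * 4 - d))) =
  f h * (f h * (f c - f h * (2 * f r1 + 2 * f r2) - f s6 * f sc * 4 - f d)).
Proof. by rewrite !(rmorph_nat, rmorphM, rmorphB, rmorphD). Qed.

(** * Background values for the family and return to tensors *)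

Section Transfer.
Context {R : realType} {e0 : R} {U : set (pt R)} (Uo : open U) {S : R -> spacetime R}.
Local Notation C := R[i].
Local Notation Oo := (@slab_open R (pt R) e0 U Uo).
Local Notation KO := (sfun_of Oo).
Hypothesis sf : smooth_family (@slab R (pt R) e0 U) S.
Hypothesis gTS : forall s x, `|s| < e0 -> U x -> (metric (S s) x)^T = metric (S s) x.
Hypothesis FTS : forall s x, `|s| < e0 -> U x -> (Fem (S s) x)^T = - Fem (S s) x.
Hypothesis nfS : forall s x, `|s| < e0 -> U x -> null_frame (S s) x.
Local Notation g := (gK Uo sf).
Local Notation E := (EK Uo sf).
Local Notation F := (FK Uo sf).
Local Notation frow := (frow Uo sf).
Local Notation r3 := (r3 Uo sf).
Local Notation r4 := (r4 Uo sf).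
Local Notation rh := (rh Uo sf).
Local Notation ii := (@ii R e0 U Uo).
Local Notation half := (@half R e0 U Uo).
Local Notation Dx := (@Dx R e0 U Uo).
Local Notation eta := (nullmx (2 : KO)).
Local Notation etai := (nullmx half).
Local Notation DM := (@DxM R e0 U Uo).
Local Notation DC := (@DxC R e0 U Uo).
Local Notation h2 := (half2 (e0 := e0) Uo).
Local Notation gT := (gKT Uo sf gTS).
Local Notation FT := (FKT Uo sf FTS).
Local Notation EgE := (EgK Uo sf gTS nfS).
Variables (M a Q : R).
Hypothesis e00 : 0 < e0.
Hypothesis Udom : U `<=` kn_domain M a Q.
Hypothesis bk : forall x, U x -> is_kerr_newman M a Q (S 0) x.
Local Notation KU := (sfun_of Uo).
Local Notation ev := (@ev R (pt R) e0 U e00 Uo).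
Local Notation cstU c := (sfun_cst Uo c).
Local Notation dlt := (@delta R (pt R) e0 U e00 Uo).
Local Notation w := (spin Dx half g E).
Local Notation ff := (ff E F).
Local Notation rep := (@rep R e0 U Uo).
Local Notation repr := (@repr R e0 U Uo).
Local Notation rep1 := (@rep1 R e0 U Uo).
Local Notation rep2 := (@rep2 R e0 U Uo).
Local Notation phi := (phi_F half E F).
Local Notation phic := (phic_F half E F).
Local Notation PKf := (PK Uo sf).
Local Notation nul := (nul ev dlt).

Lemma nul_repr k f : repr k f -> (forall x, U x -> neglected (fun s => f s x)) -> nul k.
Proof.
move=> rk nf; apply: neglected_ev_delta => x Ux; split.
  by apply: neglected_near e00 _ (nf x Ux) => s ps; rewrite rk.
by apply: neglected_near e00 _ neglected0 => s ps; rewrite rk.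
Qed.

Lemma neglected_rep k f x : rep k f -> nul k -> U x ->
  neglected (fun s => complex.Re (f s x)) /\ neglected (fun s => complex.Im (f s x)).
Proof.
move=> rk [e d] Ux; have [nr ni] := ev_delta_neglected Ux e d; split.
  by apply: neglected_near e00 _ nr => s ps; rewrite rk.
by apply: neglected_near e00 _ ni => s ps; rewrite rk.
Qed.

Let nulii k : nul k -> nul (- (ii * k)).
Proof.
by move=> [e d]; split; [rewrite rmorphN rmorphM e | rewrite raddfN /= deltaM e d mulr0 add0r];
  rewrite mulr0 oppr0.
Qed.
Let nulN k : nul k -> nul (- k).
Proof. by move=> [e d]; split; [rewrite rmorphN e | rewrite raddfN /= d]; rewrite oppr0. Qed.

(** Each entry is the single component up to a constant factor, so negligibility of the difference
    of components suffices. *)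
Lemma rep1_eq_mod k l f h x : rep1 k f -> rep1 l h -> nul (k - l) -> U x ->
  eq_mod_quadratic (fun s => f s x) (fun s => h s x).
Proof.
move=> rf rh n Ux i j; rewrite ord1.
have v s y (ps : `|s| < e0) (Uy : U y) :
    sfun_fun (k - l) (s, y) = sfun_fun k (s, y) - sfun_fun l (s, y).
  by have Oy : @slab R (pt R) e0 U (s, y) by []; rewrite sfun_addE // sfun_oppE.
case: j => [[|[|//]]] jP.
  have -> : Ordinal jP = 0 by apply/val_inj.
  apply: (neglected_rep (k := k - l) (f := fun s x => f s x 0 0 - h s x 0 0)) => // s y ps Uy.
  by rewrite v // rf // rh // !sd1E.
have -> : Ordinal jP = 1 by apply/val_inj.
apply: (neglected_rep (k := - (ii * (k - l))) (f := fun s x => f s x 0 1 - h s x 0 1)) => //.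
  move=> s y ps Uy; have Oy : @slab R (pt R) e0 U (s, y) by [].
  rewrite sfun_oppE // sfun_mulE // v // sfun_cstE // rf // rh // !sd1E.
  by rewrite mulrBr opprB addrC opprK.
exact: nulii.
Qed.

Lemma rep2_eq_mod k l f h x : rep2 k f -> rep2 l h -> nul (k - l) -> U x ->
  eq_mod_quadratic (fun s => f s x) (fun s => h s x).
Proof.
move=> rf rh n Ux.
have v s y (ps : `|s| < e0) (Uy : U y) :
    sfun_fun (k - l) (s, y) = sfun_fun k (s, y) - sfun_fun l (s, y).
  by have Oy : @slab R (pt R) e0 U (s, y) by []; rewrite sfun_addE // sfun_oppE.
have off i j : i != j -> neglected (fun s => complex.Re (f s x i j - h s x i j)) /\
    neglected (fun s => complex.Im (f s x i j - h s x i j)).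
  move=> ij.
  apply: (neglected_rep (k := - (ii * (k - l))) (f := fun s x => f s x i j - h s x i j)) => //.
    move=> s y ps Uy; have Oy : @slab R (pt R) e0 U (s, y) by [].
    rewrite sfun_oppE // sfun_mulE // v // sfun_cstE // rf // rh // !mxE (negPf ij).
    by rewrite mulrBr opprB addrC opprK.
  exact: nulii.
move=> i j; have [<-{j}|ij] := eqVneq i j; last exact: off.
have [i0|i0] := eqVneq i 0.
  apply: (neglected_rep (k := k - l) (f := fun s x => f s x i i - h s x i i)) => // s y ps Uy.
  by rewrite v // rf // rh // !mxE eqxx i0 eqxx.
apply: (neglected_rep (k := - (k - l)) (f := fun s x => f s x i i - h s x i i)) => //.
  move=> s y ps Uy; have Oy : @slab R (pt R) e0 U (s, y) by [].
  rewrite sfun_oppE // v // rf // rh // !mxE eqxx (negPf i0).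
  by rewrite opprB addrC opprK.
exact: nulN.
Qed.

Local Notation aF := (kn_a (ev half) (iiU Uo) (aU Uo a) (rrU Uo) (ccU Uo) (iwU Uo sf e00)).
Local Notation bF := (kn_b (ev half) (iiU Uo) (aU Uo a) (rrU Uo) (ccU Uo) (iwU Uo sf e00)).

Let q x := kn_q a x.
Let qval x : U x -> q x * (q x)^* = (kn_absq a x * kn_absq a x)%:C.
Proof.
move=> Ux; have [_ -> _ _ _] := kn_regular Udom Ux.
by apply/eqP; rewrite eq_complex /=; apply/andP; split; apply/eqP; ring.
Qed.
Let q0 x : U x -> q x != 0 /\ (q x)^* != 0.
Proof.
move=> Ux; have [w0 _ _ _ _] := kn_regular Udom Ux.
have : q x * (q x)^* != 0.
  by rewrite qval // -(rmorph0 (real_complex R)) (inj_eq (@complexI R)) mulf_neq0.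
by rewrite mulf_eq0 negb_or => /andP.
Qed.
Let qE x : q x = (x 0 1)%:C + 'i * a%:C * (cos (x 0 2))%:C.
Proof. by apply/eqP; rewrite eq_complex /=; apply/andP; split; apply/eqP; ring. Qed.
Let qcE x : (q x)^* = (x 0 1)%:C - 'i * a%:C * (cos (x 0 2))%:C.
Proof. by apply/eqP; rewrite eq_complex /=; apply/andP; split; apply/eqP; ring. Qed.
Let evhalf x : U x -> sfun_fun (ev half) x = 2^-1.
Proof. by move=> Ux; rewrite evE // rep_halfC // normr0. Qed.
Let iw2 x : U x -> sfun_fun (iwU Uo sf e00 * iwU Uo sf e00) x = (q x * (q x)^*)^-1.
Proof.
move=> Ux; rewrite qval // sfun_mulE // (rep_iwU Uo sf e00 bk) //.
by rewrite -rmorphM -invfM fmorphV.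
Qed.
Let aval x : U x -> sfun_fun aF x = (2 * q x)^-1.
Proof.
move=> Ux; rewrite /kn_a sfun_mulE // iw2 // sfun_mulE // evhalf //.
have -> : sfun_fun (rrU Uo - iiU Uo * aU Uo a * ccU Uo) x = (q x)^*.
  by rewrite sfun_addE // sfun_oppE // !sfun_mulE // !sfun_cstE // rep_rrU // rep_ccU //.
by have [z0 zc0] := q0 Ux; rewrite (kn_half_inv z0 zc0).
Qed.
Let bval x : U x -> sfun_fun bF x = (2 * (q x)^*)^-1.
Proof.
move=> Ux; rewrite /kn_b sfun_mulE // iw2 // sfun_mulE // evhalf //.
have -> : sfun_fun (rrU Uo + iiU Uo * aU Uo a * ccU Uo) x = q x.
  by rewrite sfun_addE // !sfun_mulE // !sfun_cstE // rep_rrU // rep_ccU //.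
by have [z0 zc0] := q0 Ux; rewrite (kn_half_inv z0 zc0).
Qed.
Let natval n x : U x -> sfun_fun (n%:R : KU) x = n%:R.
Proof. by move=> Ux; rewrite (reprU_nat Uo n Ux) rmorph_nat. Qed.
Let qcK x : ((q x)^*)^* = q x.
Proof. exact: conjcK. Qed.

Lemma sconj_kn_a : sconj aF = bF.
Proof.
apply: sfunP => x Ux; rewrite sconjE // aval // bval //.
by rewrite fmorphV rmorphM rmorph_nat.
Qed.
Lemma sconj_kn_b : sconj bF = aF.
Proof. by rewrite -sconj_kn_a sconjK. Qed.

Lemma ev_phi_kn : ev phi = 4 * QU Uo Q * bF * bF.
Proof.
apply: sfunP => x Ux; rewrite evE // (rep_PF Uo sf FTS) ?normr0 //.
have [_ _ _ _ ->] := bk Ux.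
move: (bval Ux); move: bF => b' bE.
rewrite !sfun_mulE // bE natval // sfun_cstE // -/(q x).
by have [_ z0] := q0 Ux; exact: kn_inv_sqr.
Qed.
Lemma ev_phic_kn : ev phic = 4 * QU Uo Q * aF * aF.
Proof.
rewrite -(sconj_phi Uo sf FTS) ev_conj ev_phi_kn.
move: sconj_kn_b; move: aF bF => a' b' eb.
by rewrite 3!rmorphM rmorph_nat /= eb sconj_cst conjc_real.
Qed.

Let cplx10 : cplx1 (0 : 'rV[R]_2) = 0.
Proof.
apply/rowP => i; rewrite !mxE big1 // => j _.
by rewrite mxE mulr0.
Qed.
Let ev_rep1 k f : rep1 k f -> (forall x, U x -> f 0 x = 0) -> ev k = 0.
Proof.
move=> rk f0; apply: sfunP => x Ux; rewrite evE // sfun_cstE //.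
have e : f 0 x = sd1 (sfun_fun k (0, x)) by apply: rk => //; rewrite normr0.
by have := congr1 (fun v : 'rV[C]_2 => v 0 0) e; rewrite f0 // sd1E mxE => <-.
Qed.
Lemma ev_BF_kn : ev (ff 2 1) = 0.
Proof.
apply: ev_rep1 (rep1_BF Uo sf) _ => x Ux.
by have [_ _ _ [e _] _] := bk Ux; rewrite /B_F e cplx10.
Qed.
Lemma ev_BbF_kn : ev (ff 2 0) = 0.
Proof.
apply: ev_rep1 (rep1_BbF Uo sf) _ => x Ux.
by have [_ _ _ [_ e] _] := bk Ux; rewrite e cplx10.
Qed.
Lemma ev_BFc_kn : ev (ff 3 1) = 0.
Proof.
have -> : ff 3 1 = sconj (ff 2 1) by rewrite sconj_ff.
by rewrite ev_conj ev_BF_kn rmorph0.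
Qed.
Lemma ev_BbFc_kn : ev (ff 3 0) = 0.
Proof.
have -> : ff 3 0 = sconj (ff 2 0) by rewrite sconj_ff.
by rewrite ev_conj ev_BbF_kn rmorph0.
Qed.

Let D0 (i : 'I_4) : {additive KU -> KU} := sder (delta_mx 0 i : pt R).
Let D0M i (x y : KU) : D0 i (x * y) = D0 i x * y + x * D0 i y.
Proof. exact: sderM. Qed.
Let D0C i j (x : KU) : D0 i (D0 j x) = D0 j (D0 i x).
Proof. exact: sder_comm. Qed.
Let evD i (x : KO) : ev (Dx i x) = D0 i (ev x).
Proof. exact: ev_der. Qed.
Let dlD i (x : KO) : dlt (Dx i x) = D0 i (dlt x).
Proof. exact: delta_der. Qed.
Let dlM (x y : KO) : dlt (x * y) = dlt x * ev y + ev x * dlt y.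
Proof. exact: deltaM. Qed.
Let cstD i : [/\ D0 i (iiU Uo) = 0, D0 i (aU Uo a) = 0, D0 i (MU Uo M) = 0 & D0 i (QU Uo Q) = 0].
Proof. by split; exact: sder_cst. Qed.

Let comm0 := kn_frame_comm D0M (halfU2 Uo e00) (iiUE Uo) cstD (kn_rrD Uo) (kn_ccD Uo) (kn_ssD Uo)
  (kn_iwE Uo sf e00 Udom bk) (kn_sscc Uo Udom) (kn_iSE Uo sf e00 Udom bk) (kn_iDE Uo sf e00 Udom bk)
  (kn_E0 Uo sf e00 Udom bk) (kn_E1 Uo sf e00 Udom bk) (kn_E2 Uo sf e00 Udom bk)
  (kn_E3 Uo sf e00 Udom bk).
Let commE := kn_commE D0M D0C (halfU2 Uo e00) (iiUE Uo) cstD (kn_rrD Uo) (kn_ccD Uo) (kn_ssD Uo)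
  (kn_iwE Uo sf e00 Udom bk) (kn_sscc Uo Udom) (kn_iSE Uo sf e00 Udom bk) (kn_iDE Uo sf e00 Udom bk)
  (kn_E0 Uo sf e00 Udom bk) (kn_E1 Uo sf e00 Udom bk) (kn_E2 Uo sf e00 Udom bk)
  (kn_E3 Uo sf e00 Udom bk).
Let knt := kn_table D0M D0C (halfU2 Uo e00) (iiUE Uo) cstD (kn_rrD Uo) (kn_ccD Uo) (kn_ssD Uo)
  (kn_iwE Uo sf e00 Udom bk) (kn_sscc Uo Udom) (kn_iSE Uo sf e00 Udom bk) (kn_iDE Uo sf e00 Udom bk)
  (kn_E0 Uo sf e00 Udom bk) (kn_E1 Uo sf e00 Udom bk) (kn_E2 Uo sf e00 Udom bk)
  (kn_E3 Uo sf e00 Udom bk).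
Let knct := kn_ct_deriv D0M (halfU2 Uo e00) (iiUE Uo) cstD (kn_rrD Uo) (kn_ccD Uo) (kn_ssD Uo)
  (kn_iwE Uo sf e00 Udom bk) (kn_sscc Uo Udom) (kn_iSE Uo sf e00 Udom bk) (kn_iDE Uo sf e00 Udom bk)
  (kn_E0 Uo sf e00 Udom bk) (kn_E1 Uo sf e00 Udom bk) (kn_E2 Uo sf e00 Udom bk)
  (kn_E3 Uo sf e00 Udom bk).

Let c_em := ev_curv_em DM D0M evD h2 gT EgE comm0 knt.
Let c_01 := ev_ricf01 DM DC D0M evD h2 gT EgE comm0 knt.
Let c_10 := ev_ricf10 DM DC D0M evD h2 gT EgE comm0 knt.
Let c_s := ev_scal DM DC D0M evD h2 gT EgE comm0 knt knct.1 knct.2.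

(** The Ricci terms subtracted in forming the Weyl component add up to 64 Y and cancel the excess of
    [ev_curv_em]; the scalar curvature is 0. *)
Let peeling (h c d r1 r2 s6 sc X Y : KU) : h + h = 1 -> c - d = 4 * X + 64 * Y -> r1 = 32 * Y ->
  r2 = 32 * Y -> sc = 0 ->
  h * (h * (c - h * (2 * r1 + 2 * r2) - s6 * sc * 4 - d)) = X.
Proof.
move=> hh cd -> -> ->.
have h2' : h * 2 = 1 by rewrite mulr_natr mulr2n.
have -> : c = d + (4 * X + 64 * Y) by rewrite -cd; ring.
have -> : h * (h * (d + (4 * X + 64 * Y) - h * (2 * (32 * Y) + 2 * (32 * Y)) - s6 * 0 * 4 - d))
  = (h * 2) * (h * 2) * X + 64 * h * h * Y * (1 - h * 2) by ring.
by rewrite h2'; ring.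
Qed.

Lemma ev_P_kn : ev PKf = 32 * QU Uo Q * QU Uo Q * aF * aF * aF * bF - 16 * MU Uo M * aF * aF * aF.
Proof.
rewrite (rmorph_PK ev); move: c_em c_01 c_10; move: aF bF => a' b' e1 e2 e3.
apply: (@peeling _ _ _ _ _ _ _ _ (QU Uo Q * QU Uo Q * a' * a' * b' * b') (halfU2 Uo e00) _ _ _ c_s).
- by rewrite e1 !mulrA.
- by rewrite e2 !mulrA.
- by rewrite e3 !mulrA.
Qed.
Lemma ev_Pc_kn : ev (sconj PKf) =
  32 * QU Uo Q * QU Uo Q * aF * bF * bF * bF - 16 * MU Uo M * bF * bF * bF.
Proof.
rewrite ev_conj ev_P_kn; move: sconj_kn_a sconj_kn_b; move: aF bF => a' b' ea eb.
rewrite rmorphB 10!rmorphM !rmorph_nat /= ea eb !sconj_cst !conjc_real; ring.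
Qed.

Hypothesis einS : forall x i j, U x -> neglected (fun s =>
  einstein_defect (metric (S s)) (Fem (S s)) i j x).
Hypothesis biaS : forall x k i j, U x -> neglected (fun s =>
  bianchi_defect (metric (S s)) (Fem (S s)) k i j x).
Hypothesis divS : forall x j, U x -> neglected (fun s =>
  divergence_defect (metric (S s)) (Fem (S s)) j x).
Let einN i j := nul_repr (rep_einstein Uo sf gTS nfS i j) (fun x Ux => einS i j Ux).
Let biaN k i j := nul_repr (rep_bianchi Uo sf gTS nfS k i j) (fun x Ux => biaS k i j Ux).
Let divN j := nul_repr (rep_div Uo sf gTS nfS j) (fun x Ux => divS j Ux).

Let n1 := nul_T1 dlM DM DC D0M evD dlD h2 gT FT EgE comm0 commE knt knct.1 knct.2 einN biaN divN
  ev_BF_kn ev_BbF_kn ev_BFc_kn ev_BbFc_kn ev_phi_kn ev_phic_kn ev_P_kn ev_Pc_kn.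
Let n2 := nul_T2 dlM DM DC D0M evD dlD h2 gT FT EgE comm0 commE knt knct.1 knct.2 einN biaN divN
  ev_BF_kn ev_BbF_kn ev_BFc_kn ev_BbFc_kn ev_phi_kn ev_phic_kn ev_P_kn ev_Pc_kn.
Let n3 := nul_T3 dlM DM DC D0M evD dlD h2 gT FT EgE comm0 commE knt knct.1 knct.2 einN biaN divN
  ev_BF_kn ev_BbF_kn ev_BFc_kn ev_BbFc_kn ev_phi_kn ev_phic_kn ev_P_kn ev_Pc_kn.
Let rF := rep2_frakF Uo sf gTS FTS nfS.
Let rX := rep1_frakX Uo sf gTS FTS nfS.
Let rB := rep1_frakB Uo sf gTS FTS nfS.
Let rA := rep2_A Uo sf gTS nfS.

Lemma T1_mod x : U x -> eq_mod_quadratic (fun s => T1 (S s) (frakB (S s)) x)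
  (fun s => M1 (S s) (frakF (S s)) (frakX (S s)) x).
Proof.
move=> Ux.
have h := rep1_T1 sf gTS FTS nfS rB.
have m := rep1_M1 sf gTS FTS nfS rF rX.
have n := rep1_eq_mod h m n1 Ux.
exact: n.
Qed.
Lemma T2_mod x : U x -> eq_mod_quadratic (fun s => T2 (S s) (frakF (S s)) x)
  (fun s => M2 (S s) (A (S s)) (frakX (S s)) (frakB (S s)) x).
Proof.
move=> Ux.
have h := rep2_T2 sf gTS FTS nfS rF.
have m := rep2_M2 sf gTS FTS nfS rA rX rB.
have n := rep2_eq_mod h m n2 Ux.
exact: n.
Qed.
Lemma T3_mod x : U x -> eq_mod_quadratic (fun s => T3 (S s) (A (S s)) x)
  (fun s => M3 (S s) (frakF (S s)) (frakX (S s)) x).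
Proof.
move=> Ux.
have h := rep2_T3 sf gTS FTS nfS rA.
have m := rep2_M3 sf gTS FTS nfS rF rX.
have n := rep2_eq_mod h m n3 Ux.
exact: n.
Qed.

End Transfer.

Theorem theorem6p1 (R : realType) (M a Q : R) (U : set (pt R)) (eps0 : R)
    (S : R -> spacetime R) :
  Num.sqrt (a ^+ 2 + Q ^+ 2) < M ->
  open U -> U `<=` kn_domain M a Q -> 0 < eps0 ->
  linear_perturbation M a Q U eps0 S ->
  forall x : pt R, U x ->
  [/\ eq_mod_quadratic
        (fun eps => T1 (S eps) (frakB (S eps)) x)
        (fun eps => M1 (S eps) (frakF (S eps)) (frakX (S eps)) x),
      eq_mod_quadratic
        (fun eps => T2 (S eps) (frakF (S eps)) x)
        (fun eps => M2 (S eps) (A (S eps)) (frakX (S eps)) (frakB (S eps)) x) &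
      eq_mod_quadratic
        (fun eps => T3 (S eps) (A (S eps)) x)
        (fun eps => M3 (S eps) (frakF (S eps)) (frakX (S eps)) x)].
Proof.
move=> _ Uo Udom e00 [sf bk nf ein md] x Ux.
have gTS s y : `|s| < eps0 -> U y -> (metric (S s) y)^T = metric (S s) y.
  by move=> ps Uy; have [] := nf s y ps Uy.
have FTS s y : `|s| < eps0 -> U y -> (Fem (S s) y)^T = - Fem (S s) y.
  by move=> ps Uy; have [] := nf s y ps Uy.
have nfS s y : `|s| < eps0 -> U y -> null_frame (S s) y.
  by move=> ps Uy; have [] := nf s y ps Uy.
have bia y k i j (Uy : U y) := (md y Uy).1 k i j.
have dv y j (Uy : U y) := (md y Uy).2 j.
split.
- exact: (T1_mod Uo sf gTS FTS nfS e00 Udom bk ein bia dv).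
- exact: (T2_mod Uo sf gTS FTS nfS e00 Udom bk ein bia dv).
- exact: (T3_mod Uo sf gTS FTS nfS e00 Udom bk ein bia dv).
Qed.
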